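(* Let $\mathfrak g$ be a classical simple Lie superalgebra over $\mathbb C$, let $\mathfrak b=\mathfrak t\oplus\mathfrak u$ be the parabolic subalgebra of $\mathfrak g$ defined in the context, and let $\mathfrak f$ be the detecting subalgebra. Then: (a) $\operatorname{H}^{\bullet}(\mathfrak f,\mathfrak f_{\bar 0},\mathbb C)\cong S^{\bullet}(\mathfrak f_{\bar 1}^* )$. (b) The restriction map $$\operatorname{H}^{\bullet}(\mathfrak b,\mathfrak b_{\bar 0},\mathbb C)\longrightarrow\operatorname{H}^{\bullet}(\mathfrak f,\mathfrak f_{\bar 0},\mathbb C)^{T_{\bar 0}}$$ is an isomorphism. Moreover, $\operatorname{H}^{\bullet}(\mathfrak f,\mathfrak f_{\bar 0},\mathbb C)^{T_{\bar 0}}\cong\operatorname{H}^{\bullet}(\mathfrak t,\mathfrak t_{\bar 0},\mathbb C)$.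
   Context: Algebras. Classical simple Lie superalgebras are here: $\mathfrak{gl}(m|n)$, $\mathfrak{sl}(m|n)$ ($m\neq n$), $\mathfrak{sl}(n|n)$, $\mathfrak{psl}(n|n)$, $\mathfrak{osp}(2m+1|2n)$, $\mathfrak{osp}(2m|2n)$, $D(2,1,\alpha)$, $G(3)$, $F(4)$, $\mathfrak q(n)$ (even and odd parts both $\mathfrak{gl}_n$), $\mathfrak{psq}(n)$ (the simple subquotient of $\mathfrak q(n)$), and type $P(n)$: $\mathfrak p(n)$ (matrices $\begin{pmatrix}A&B\\ C&-A^t\end{pmatrix}$, $A\in\mathfrak{sl}_n$, $B$ symmetric, $C$ skew-symmetric, $n\geq 2$) and its enlargement $\widetilde{\mathfrak p}(n)$ ($A\in\mathfrak{gl}_n$). $G_{\bar 0}$ is the connected reductive group with $\operatorname{Lie}G_{\bar 0}=\mathfrak g_{\bar 0}$ acting on $\mathfrak g_{\bar 1}$. The parabolic $\mathfrak b$. Fix a Cartan subalgebra $\mathfrak t_{\bar 0}=\operatorname{Lie}T_{\bar 0}$ of $\mathfrak g_{\bar 0}$ ($T_{\bar 0}$ a maximal torus of $G_{\bar 0}$) and let $\mathfrak b_{\bar 0}\supseteq\mathfrak t_{\bar 0}$ be the negative Borel subalgebra of $\mathfrak g_{\bar 0}$, with nilradical $\mathfrak u_{\bar 0}$. Use the standard weights $\epsilon_i,\delta_j$ (simple roots $\epsilon_i-\epsilon_{i+1}$, $\delta_i-\delta_{i+1}$, together with $\epsilon_m$ for $\mathfrak{so}_{2m+1}$, $\epsilon_{m-1}+\epsilon_m$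 for $\mathfrak{so}_{2m}$, $2\delta_n$ for $\mathfrak{sp}_{2n}$). For $D(2,1,\alpha)$: $\mathfrak g_{\bar 0}=\mathfrak{sl}_2^{3}$, $\mathfrak g_{\bar 1}=V\boxtimes V\boxtimes V$; for $G(3)$: $\mathfrak g_{\bar 0}=G_2\times\mathfrak{sl}_2$, $\mathfrak g_{\bar 1}=L(\omega_1)\boxtimes V$ ($\dim L(\omega_1)=7$); for $F(4)$: $\mathfrak g_{\bar 0}=\mathfrak{so}_7\times\mathfrak{sl}_2$, $\mathfrak g_{\bar 1}=L(\omega_3)\boxtimes V$ (spin); $V$ is the natural $\mathfrak{sl}_2$-module with weights $\pm\epsilon$. Let $\mathfrak f_{\bar 1}$ and $\mathfrak u_{\bar 1}$ be spanned by the odd root vectors with roots in $\Phi_{\mathfrak f_{\bar 1}}$ and $\Phi_{\bar 1}^-$ respectively (all admissible indices): - $\mathfrak{gl},\mathfrak{sl},\mathfrak{psl}$ types: $\Phi_{\mathfrak f_{\bar 1}}=\{\pm(\epsilon_i-\delta_i):1\le i\le\min(m,n)\}$, $\Phi^-_{\bar 1}=\{-\epsilon_i+\delta_j,\,-\delta_i+\epsilon_j: i<j\}$. - $\mathfrak{osp}(2m|2n)$: same $\Phi_{\mathfrak f_{\bar 1}}$; $\Phi^-_{\bar 1}=\{-\epsilon_i+\delta_j,-\delta_i+\epsilon_j:i<j\}\cup\{-\epsilon_k-\delta_\ell:\text{all }k,\ell\}$. - $\mathfrak{osp}(2m+1|2n)$: same $\Phi_{\mathfrak f_{\bar 1}}$;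 $\Phi^-_{\bar 1}$ as for $\mathfrak{osp}(2m|2n)$ together with $\{-\delta_t:1\le t\le n\}$. - $\mathfrak q(n),\mathfrak{psq}(n)$: $\mathfrak f_{\bar 1}$ is the odd part of the Cartan subalgebra (odd diagonal matrices), $\Phi^-_{\bar 1}=\{-\epsilon_i+\epsilon_j:i<j\}$. - $D(2,1,\alpha)$: $\Phi_{\mathfrak f_{\bar 1}}=\{\pm(\epsilon,-\epsilon,\epsilon)\}$, $\Phi^-_{\bar 1}=\{(-\epsilon,-\epsilon,-\epsilon),(-\epsilon,-\epsilon,\epsilon),(\epsilon,-\epsilon,-\epsilon)\}$. - $G(3)$: $\Phi_{\mathfrak f_{\bar 1}}=\{\pm(\omega_1,-\epsilon)\}$, $\Phi^-_{\bar 1}=\{(\mu,-\epsilon):\mu\text{ a weight of }L(\omega_1),\ \mu\ne\omega_1\}$. - $F(4)$: $\Phi_{\mathfrak f_{\bar 1}}=\{\pm(\omega_3,-\epsilon)\}$, $\Phi^-_{\bar 1}=\{(\mu,-\epsilon):\mu\text{ a weight of }L(\omega_3),\ \mu\neq\omega_3\}$. - type $P(n)$: the odd roots are $\epsilon_i+\epsilon_j$ ($i\le j$) and $-\epsilon_i-\epsilon_j$ ($i<j$); $\Phi_{\mathfrak f_{\bar 1}}=\{\pm(\epsilon_{1+j}+\epsilon_{2l-j}):0\le j\le l-1\}$ if $n=2l$, and $\{\pm(\epsilon_{1+j}+\epsilon_{2l+1-j}):0\le j\le l-1\}\cup\{2\epsilon_{l+1}\}$ if $n=2l+1$; $\Phi^-_{\bar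 1}=\{\epsilon_i+\epsilon_j:i+j>n+1\}\cup\{-\epsilon_i-\epsilon_j:i<j,\ i+j<n+1\}$. Put $\mathfrak f_{\bar 0}=[\mathfrak f_{\bar 1},\mathfrak f_{\bar 1}]\subseteq\mathfrak t_{\bar 0}$, $\mathfrak f=\mathfrak f_{\bar 0}\oplus\mathfrak f_{\bar 1}$ (the detecting subalgebra), $\mathfrak t=\mathfrak t_{\bar 0}\oplus\mathfrak f_{\bar 1}$, $\mathfrak u=\mathfrak u_{\bar 0}\oplus\mathfrak u_{\bar 1}$, $\mathfrak b=\mathfrak t\oplus\mathfrak u$. $\operatorname{H}^\bullet(\mathfrak a,\mathfrak a_{\bar 0},\mathbb C)$ denotes relative Lie superalgebra cohomology of the pair $(\mathfrak a,\mathfrak a_{\bar 0})$. *)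

(* Defs.v *)
From mathcomp Require Import all_boot all_order all_algebra.
From mathcomp Require Import functions mpoly.

Set Implicit Arguments.
Unset Strict Implicit.
Unset Printing Implicit Defensive.

Import GRing.Theory.
Local Open Scope ring_scope.

(* A Lie superalgebra is presented inside an ambient vector space: the        *)
(* superalgebra itself is spart false (+) spart true (even and odd parts),    *)
(* and sbr is only meaningful there.  A subsuperalgebra is thus the same      *)
(* ambient space and bracket with smaller even and odd parts.                 *)
Record superalgebra (K : fieldType) := SuperAlgebra {
  ambient : vectType K;
  sbr : ambient -> ambient -> ambient;
  spart : bool -> {vspace ambient} }.

Section Superalgebra.
Variables (K : fieldType) (L : superalgebra K).

Definition total : {vspace ambient L} := (spart L false + spart L true)%VS.

Definition subalgebra (a0 a1 : {vspace ambient L}) : superalgebra K :=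
  SuperAlgebra (@sbr K L) (fun b => if b then a1 else a0).

Definition bracket_space (U W : {vspace ambient L}) : {vspace ambient L} :=
  <<[seq sbr x y | x <- vbasis U, y <- vbasis W]>>%VS.

Definition root_space (t0 : {vspace ambient L}) (b : bool)
    (lam : ambient L -> K) : {vspace ambient L} :=
  (spart L b :&:
   \bigcap_(h <- vbasis t0)
      lker (linfun (fun x => sbr h x - lam h *: x)%R))%VS.

Definition elt := subvs_of total.

Definition ebr (x y : elt) : elt := vsproj total (sbr (vsval x) (vsval y)).

(* A p-cochain with trivial coefficients is a function on the sequences of    *)
(* length p, extended by 0 to all other sequences.                            *)
Definition cochain := seq elt -> K^o.

Definition homogeneous (s : seq elt) (e : seq bool) :=
  all2 (fun x b => vsval x \in spart L b) s e.

Definition multilinear (f : cochain) := forall a (x y : elt) s1 s2,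
  f (s1 ++ (a *: x + y) :: s2) = a * f (s1 ++ x :: s2) + f (s1 ++ y :: s2).

Definition super_alternating (f : cochain) := forall (a b : bool) (x y : elt) s1 s2,
  vsval x \in spart L a -> vsval y \in spart L b ->
  f (s1 ++ x :: y :: s2) = - (-1) ^+ (a && b) * f (s1 ++ y :: x :: s2).

(* C^p(L, L_0) = Hom_(L_0)(Lambda_s^p (L / L_0), K) *)
Record relative_cochain (p : nat) (f : cochain) : Prop := RelativeCochain {
  rc_degree : forall s, size s != p -> f s = 0;
  rc_multilinear : multilinear f;
  rc_alternating : super_alternating f;
  rc_basic : forall (x : elt) s1 s2,
    vsval x \in spart L false -> f (s1 ++ x :: s2) = 0;
  rc_invariant : forall (h : elt) s, vsval h \in spart L false ->
    \sum_(i < size s) f (set_nth 0 s i (ebr h s`_i)) = 0 }.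

(* Koszul sign exponent of the pair i < j for arguments of parities e *)
Definition koszul (e : seq bool) (i j : nat) : nat :=
  (i + j + nth false e i * nth false e j
   + nth false e i * count id (take i e) + nth false e j * count id (take j e))%N.

Definition omit2 (s : seq elt) (i j : nat) : seq elt :=
  take i s ++ drop i.+1 (take j s) ++ drop j.+1 s.

(* The value of df on homogeneous arguments s of parities e; the terms of the *)
(* general formula involving the action on the coefficients are zero.         *)
Definition differential (f : cochain) (s : seq elt) (e : seq bool) : K :=
  \sum_(j < size s) \sum_(i < j)
    (-1) ^+ koszul e i j * f (ebr s`_i s`_j :: omit2 s i j).

Definition cocycle (p : nat) (f : cochain) : Prop :=
  relative_cochain p f /\
  forall s e, homogeneous s e -> differential f s e = 0.

Definition coboundary (p : nat) (f : cochain) : Prop :=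
  if p is q.+1 then
    exists2 g, relative_cochain q g &
      forall s e, homogeneous s e -> f s = differential g s e
  else f = 0.

(* The product of relative cochains, as a sum over shuffles.  It only sees    *)
(* the arguments modulo the even part, i.e. as odd vectors, so that all the   *)
(* Koszul signs of the shuffles are +1.                                       *)
Definition cup (f g : cochain) : cochain := fun s =>
  \sum_(u : (size s).-tuple bool) f (mask u s) * g (mask (map negb u) s).

Definition cochain1 : cochain := fun s => (s == [::])%:R.

End Superalgebra.

Definition pullback (K : fieldType) (L L' : superalgebra K)
    (u : elt L' -> elt L) (f : cochain L) : cochain L' :=
  fun s => f (map u s).

(* For a0' <= a0 and a1' <= a1 this is the inclusion of subsuperalgebras. *)
Definition inclusion (K : fieldType) (L : superalgebra K)
    (a0' a1' a0 a1 : {vspace ambient L})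
    (x : elt (subalgebra a0' a1')) : elt (subalgebra a0 a1) :=
  vsproj _ (vsval x).

(* The restriction to a subsuperalgebra of a map of the ambient space that    *)
(* stabilises it.                                                             *)
Definition induced (K : fieldType) (L : superalgebra K)
    (phi : ambient L -> ambient L) (x : elt L) : elt L :=
  vsproj _ (phi (vsval x)).

(* A graded K-algebra presented as a subquotient: its component of degree p   *)
(* is ga_deg p modulo ga_null p.                                              *)
Record graded_algebra (K : fieldType) := GradedAlgebra {
  ga_sort : lmodType K;
  ga_deg : nat -> ga_sort -> Prop;
  ga_null : nat -> ga_sort -> Prop;
  ga_one : ga_sort;
  ga_mul : ga_sort -> ga_sort -> ga_sort }.

Record graded_iso (K : fieldType) (A B : graded_algebra K)
    (phi : nat -> ga_sort A -> ga_sort B) : Prop := GradedIso {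
  gi_deg : forall p x, ga_deg p x -> ga_deg p (phi p x);
  gi_linear : forall p a x y, ga_deg p x -> ga_deg p y ->
    ga_null p (phi p (a *: x + y) - (a *: phi p x + phi p y));
  gi_one : ga_null 0 (phi 0%N (ga_one A) - ga_one B);
  gi_mul : forall p q x y, ga_deg p x -> ga_deg q y ->
    ga_null (p + q)%N (phi (p + q)%N (ga_mul x y) - ga_mul (phi p x) (phi q y));
  gi_null : forall p x, ga_deg p x -> (ga_null p (phi p x) <-> ga_null p x);
  gi_onto : forall p y, ga_deg p y ->
    exists2 x, ga_deg p x & ga_null p (phi p x - y) }.

Definition graded_isomorphic (K : fieldType) (A B : graded_algebra K) : Prop :=
  exists phi, @graded_iso K A B phi.

Definition cohomology (K : fieldType) (L : superalgebra K) : graded_algebra K :=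
  @GradedAlgebra K (cochain L) (@cocycle K L) (@coboundary K L)
    (@cochain1 K L) (@cup K L).

(* T is a group of automorphisms of the ambient space that stabilises L. *)
Definition invariant_cohomology (K : fieldType) (L : superalgebra K)
    (T : (ambient L -> ambient L) -> Prop) : graded_algebra K :=
  @GradedAlgebra K (cochain L)
    (fun p f => cocycle p f /\
       forall phi, T phi -> coboundary p (pullback (induced phi) f - f))
    (@coboundary K L) (@cochain1 K L) (@cup K L).

Arguments invariant_cohomology {K} L T.

(* S^*(V^* ) for V of dimension n, as the polynomial ring on a basis of V^* *)
Definition sym_dual (K : fieldType) (n : nat) : graded_algebra K :=
  @GradedAlgebra K {mpoly K[n]}
    (fun p x => x \is p.-homog) (fun _ x => x = 0) 1 *%R.

(* cu0 is the nilradical of the negative Borel subalgebra of the even part    *)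
(* containing the Cartan subalgebra ct0, cf1 and cu1 are the odd parts of f   *)
(* and u, and ctorus is the group of transformations by which the maximal     *)
(* torus T_0 of G_0 acts.                                                     *)
Record classical_datum (K : fieldType) := ClassicalDatum {
  calg : superalgebra K;
  ct0 : {vspace ambient calg};
  cu0 : {vspace ambient calg};
  cf1 : {vspace ambient calg};
  cu1 : {vspace ambient calg};
  ctorus : (ambient calg -> ambient calg) -> Prop }.

Arguments ctorus {K} c phi.

Definition kernel (K : fieldType) (U W : vectType K) (f : U -> W) : {vspace U} :=
  lker (linfun f).

Section BlockMatrices.
Variables (K : fieldType) (m n : nat).
Notation V := 'M[K]_(m + n).

Definition even_block (X : V) : V := block_mx (ulsubmx X) 0 0 (drsubmx X).
Definition odd_block (X : V) : V := block_mx 0 (ursubmx X) (dlsubmx X) 0.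

(* XY - YX, except that it is XY + YX when X and Y are both odd *)
Definition supercommutator (X Y : V) : V :=
  X *m Y - Y *m X + 2 *: (odd_block Y *m odd_block X).

Definition block_superalgebra (b : V -> V -> V) (E O : {vspace V}) :=
  @SuperAlgebra K V b
    (fun p => if p then O :&: kernel even_block else E :&: kernel odd_block)%VS.

Definition entry (N : nat) (i : 'I_N) (h : 'M[K]_N) : K := h i i.

Definition eps (i : 'I_m) : V -> K := @entry (m + n) (lshift n i).
Definition del (j : 'I_n) : V -> K := @entry (m + n) (rshift m j).

End BlockMatrices.

Definition diagonal_space (K : fieldType) (N : nat) : {vspace 'M[K]_N} :=
  kernel (fun X : 'M[K]_N => X - diag_mx (\row_i X i i)).

Definition diagonal_torus (K : fieldType) (N : nat) (P : 'rV[K]_N -> Prop)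
    (phi : 'M[K]_N -> 'M[K]_N) : Prop :=
  exists d : 'rV[K]_N, [/\ forall i, d 0 i != 0, P d &
    forall X, phi X = diag_mx d *m X *m invmx (diag_mx d)].

(* The scalar matrices are to be factored out in psl and psq; the quotient is *)
(* realised on the complementary subspace of the trace zero matrices.         *)
Definition modulo_scalars (K : fieldType) (N : nat) (X : 'M[K]_N) : 'M[K]_N :=
  X - (\tr X / N%:R)%:M.

Section TypeA.
Variables (K : fieldType) (m n : nat).
Variables (b : 'M[K]_(m + n) -> 'M[K]_(m + n) -> 'M[K]_(m + n)).
Variables (E : {vspace 'M[K]_(m + n)}) (P : 'rV[K]_(m + n) -> Prop).

Let g := block_superalgebra b E fullv.
Let t0 : {vspace 'M[K]_(m + n)} := (spart g false :&: diagonal_space K (m + n))%VS.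
Local Notation g0_ lam := (@root_space K g t0 false lam%R).
Local Notation g1_ lam := (@root_space K g t0 true lam%R).
Let e (i : 'I_m) : 'M[K]_(m + n) -> K := eps i.
Let d (j : 'I_n) : 'M[K]_(m + n) -> K := del j.

Definition typeA : classical_datum K := @ClassicalDatum K g t0
  (\sum_(i < m) \sum_(j < m | (i < j)%N) g0_ (- e i + e j) +
   \sum_(i < n) \sum_(j < n | (i < j)%N) g0_ (- d i + d j))%VS
  (\sum_(i < m) \sum_(j < n | (i == j :> nat)%N)
     (g1_ (e i - d j) + g1_ (- (e i - d j))))%VS
  (\sum_(i < m) \sum_(j < n | (i < j)%N) g1_ (- e i + d j) +
   \sum_(i < n) \sum_(j < m | (i < j)%N) g1_ (- d i + e j))%VS
  (diagonal_torus P).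

End TypeA.

Section Linear.
Variables (K : fieldType) (m n : nat).
Notation V := 'M[K]_(m + n).

Definition gl_datum : classical_datum K :=
  typeA (@supercommutator K m n) fullv (fun _ => True).

Definition sl_datum : classical_datum K :=
  typeA (@supercommutator K m n)
    (kernel (fun X : V => \tr (ulsubmx X) - \tr (drsubmx X) : K^o))
    (fun d => \prod_(i < m) lsubmx d 0 i = \prod_(j < n) rsubmx d 0 j).

End Linear.

(* Here G_0 = SL_n x SL_n. *)
Definition psl_datum (K : fieldType) (n : nat) : classical_datum K :=
  typeA (fun X Y : 'M[K]_(n + n) => modulo_scalars (supercommutator X Y))
    (kernel (fun X : 'M[K]_(n + n) => \tr (ulsubmx X) : K^o) :&:
     kernel (fun X : 'M[K]_(n + n) => \tr (drsubmx X) : K^o))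
    (fun d => \prod_(i < n) lsubmx d 0 i = 1 /\ \prod_(j < n) rsubmx d 0 j = 1).

Section Orthosymplectic.
Variables (K : fieldType) (m n : nat) (s : bool).
Notation M := (m + m + s)%N.
Notation V := 'M[K]_(M + (n + n)).

(* The forms are chosen so that the Cartan subalgebra of osp(2m + s | 2n) is  *)
(* diagonal.                                                                  *)
Definition sym_form : 'M[K]_M :=
  block_mx (block_mx 0 1%:M 1%:M 0) 0 0 1%:M.
Definition alt_form : 'M[K]_(n + n) := block_mx 0 1%:M (- 1%:M) 0.

Definition osp : superalgebra K :=
  block_superalgebra (@supercommutator K M (n + n))
    (kernel (fun X : V =>
       (ulsubmx X)^T *m sym_form + sym_form *m ulsubmx X) :&:
     kernel (fun X : V =>
       (drsubmx X)^T *m alt_form + alt_form *m drsubmx X))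
    (kernel (fun X : V =>
       (dlsubmx X)^T *m alt_form + sym_form *m ursubmx X)).

Let t0 : {vspace V} := (spart osp false :&: diagonal_space K (M + (n + n)))%VS.
Local Notation g0_ lam := (@root_space K osp t0 false lam%R).
Local Notation g1_ lam := (@root_space K osp t0 true lam%R).
Let e (i : 'I_m) : V -> K := eps (lshift s (lshift m i)).
Let d (j : 'I_n) : V -> K := del (lshift n j).

Definition osp_torus (x : 'rV[K]_(M + (n + n))) : Prop :=
  exists (a : 'rV[K]_m) (c : 'rV[K]_n),
    x = row_mx (row_mx (row_mx a (map_mx GRing.inv a)) (const_mx 1))
               (row_mx c (map_mx GRing.inv c)).

Definition osp_datum : classical_datum K := @ClassicalDatum K osp t0
  (\sum_(i < m) \sum_(j < m | (i < j)%N)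
      (g0_ (- e i + e j) + g0_ (- e i - e j)) +
   \sum_(i < m | s) g0_ (- e i) +
   \sum_(i < n) \sum_(j < n | (i < j)%N)
      (g0_ (- d i + d j) + g0_ (- d i - d j)) +
   \sum_(i < n) g0_ (- (d i *+ 2)))%VS
  (\sum_(i < m) \sum_(j < n | (i == j :> nat)%N)
     (g1_ (e i - d j) + g1_ (- (e i - d j))))%VS
  (\sum_(i < m) \sum_(j < n | (i < j)%N) g1_ (- e i + d j) +
   \sum_(i < n) \sum_(j < m | (i < j)%N) g1_ (- d i + e j) +
   \sum_(i < m) \sum_(j < n) g1_ (- e i - d j) +
   \sum_(j < n | s) g1_ (- d j))%VS
  (diagonal_torus osp_torus).

End Orthosymplectic.

Section TypeQ.
Variables (K : fieldType) (n : nat).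
Notation V := 'M[K]_(n + n).
Variables (b : V -> V -> V) (E O : {vspace V}) (P : 'rV[K]_(n + n) -> Prop).

Let g := block_superalgebra b
  (E :&: kernel (fun X : V => ulsubmx X - drsubmx X))
  (O :&: kernel (fun X : V => ursubmx X - dlsubmx X)).
Let t0 : {vspace V} := (spart g false :&: diagonal_space K (n + n))%VS.
Local Notation g0_ lam := (@root_space K g t0 false lam%R).
Local Notation g1_ lam := (@root_space K g t0 true lam%R).
Let e (i : 'I_n) : V -> K := eps i.

Definition typeQ : classical_datum K := @ClassicalDatum K g t0
  (\sum_(i < n) \sum_(j < n | (i < j)%N) g0_ (- e i + e j))%VS
  (spart g true :&:
   kernel (fun X : V => ursubmx X - diag_mx (\row_i ursubmx X i i)))%VS
  (\sum_(i < n) \sum_(j < n | (i < j)%N) g1_ (- e i + e j))%VS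
  (diagonal_torus (fun d => lsubmx d = rsubmx d /\ P d)).

End TypeQ.

Definition q_datum (K : fieldType) (n : nat) : classical_datum K :=
  typeQ (@supercommutator K n n) fullv fullv (fun _ => True).

(* psq(n) is the quotient by the scalars of the subalgebra of q(n) on which   *)
(* the odd block is traceless; G_0 = SL_n.                                    *)
Definition psq_datum (K : fieldType) (n : nat) : classical_datum K :=
  typeQ (fun X Y : 'M[K]_(n + n) => modulo_scalars (supercommutator X Y))
    (kernel (fun X : 'M[K]_(n + n) => \tr (ulsubmx X) : K^o))
    (kernel (fun X : 'M[K]_(n + n) => \tr (ursubmx X) : K^o))
    (fun d => \prod_(i < n) lsubmx d 0 i = 1).

Section TypeP.
Variables (K : fieldType) (n : nat).
Notation V := 'M[K]_(n + n).
Variables (E : {vspace V}) (P : 'rV[K]_n -> Prop).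

Let g := block_superalgebra (@supercommutator K n n)
  (E :&: kernel (fun X : V => drsubmx X + (ulsubmx X)^T))
  (kernel (fun X : V => (ursubmx X)^T - ursubmx X) :&:
   kernel (fun X : V => (dlsubmx X)^T + dlsubmx X)).
Let t0 : {vspace V} := (spart g false :&: diagonal_space K (n + n))%VS.
Local Notation g0_ lam := (@root_space K g t0 false lam%R).
Local Notation g1_ lam := (@root_space K g t0 true lam%R).
Let e (i : 'I_n) : V -> K := eps i.

(* The indices start at 0, so that i + j = n + 1 becomes i + j + 1 = n. *)
Definition typeP : classical_datum K := @ClassicalDatum K g t0
  (\sum_(i < n) \sum_(j < n | (i < j)%N) g0_ (- e i + e j))%VS
  (\sum_(i < n) \sum_(j < n | ((i < j) && ((i + j).+1 == n))%N)
     (g1_ (e i + e j) + g1_ (- (e i + e j))) +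
   \sum_(i < n | ((i + i).+1 == n)%N) g1_ (e i *+ 2))%VS
  (\sum_(i < n) \sum_(j < n | ((i <= j) && (n < (i + j).+1))%N) g1_ (e i + e j) +
   \sum_(i < n) \sum_(j < n | ((i < j) && ((i + j).+1 < n))%N) g1_ (- e i - e j))%VS
  (diagonal_torus (fun d => exists2 a, d = row_mx a (map_mx GRing.inv a) & P a)).

End TypeP.

Definition p_datum (K : fieldType) (n : nat) : classical_datum K :=
  typeP (kernel (fun X : 'M[K]_(n + n) => \tr (ulsubmx X) : K^o))
    (fun a : 'rV_n => \prod_(i < n) a 0 i = 1).

Definition ptilde_datum (K : fieldType) (n : nat) : classical_datum K :=
  @typeP K n fullv (fun _ => True).

(* The symplectic form of V = K^2.  For the symmetric matrix P = sum P_ab     *)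
(* e_a e_b in S^2 V, the matrix P *m symp2 is the corresponding element of    *)
(* sl_2 = sp(V).                                                              *)
Definition symp2 (K : fieldType) : 'M[K]_2 :=
  \matrix_(i, j) ((i < j)%:R - (j < i)%:R).

Section D21.
Variables (K : fieldType) (alpha : K).

(* sl_2^3 (+) V (x) V (x) V, a tensor being given by its coordinates on the   *)
(* basis e_(s 0) (x) e_(s 1) (x) e_(s 2).                                     *)
Notation I := {ffun 'I_3 -> 'I_2}.
Notation T := {ffun I -> K^o}.
Notation V := ({ffun 'I_3 -> 'M[K]_2} * T)%type.

Definition reset (s : I) (k : 'I_3) (c : 'I_2) : I :=
  [ffun l => if l == k then c else s l].

Definition tensor_act (A : {ffun 'I_3 -> 'M[K]_2}) (x : T) : T :=
  [ffun s : I => \sum_(k < 3) \sum_(c < 2) A k (s k) c * x (reset s k c)].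

(* Contraction of x and y by the symplectic form on the factors l != k *)
Definition contract (k : 'I_3) (x y : T) : 'M[K]_2 := \matrix_(a, b)
  \sum_(s : I | s k == a) \sum_(r : I | r k == b)
     (\prod_(l < 3 | l != k) symp2 K (s l) (r l)) * x s * y r.

(* Three scalars with sum 0, on which the bracket depends up to a factor *)
Definition sigma (k : 'I_3) : K := nth 0 [:: - (1 + alpha); 1; alpha] k.

Definition D21_bracket (X Y : V) : V :=
  ([ffun k => X.1 k *m Y.1 k - Y.1 k *m X.1 k +
      sigma k *: ((contract k X.2 Y.2 + (contract k X.2 Y.2)^T) *m symp2 K)],
   tensor_act X.1 Y.2 - tensor_act Y.1 X.2).

Definition D21 : superalgebra K := @SuperAlgebra K V D21_bracket
  (fun p => if p then kernel (fun X : V => X.1) else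
    kernel (fun X : V => X.2) :&:
    kernel (fun X : V => [ffun k => \tr (X.1 k) : K^o]))%VS.

Let t0 : {vspace V} := (spart D21 false :&:
  kernel (fun X : V => [ffun k => X.1 k - diag_mx (\row_i X.1 k i i)]))%VS.
Local Notation g0_ lam := (@root_space K D21 t0 false lam%R).
Local Notation g1_ lam := (@root_space K D21 t0 true lam%R).
Let e (k : nat) : V -> K := fun h => h.1 (inord k) 0 0.

Definition D21_torus (phi : V -> V) : Prop :=
  exists a : 'I_3 -> K, (forall k, a k != 0) /\
    let d k := \row_(i < 2) (if i == 0 then a k else (a k)^-1) in
    forall X, phi X = ([ffun k => diag_mx (d k) *m X.1 k *m invmx (diag_mx (d k))],
                       [ffun s : I => (\prod_k d k 0 (s k)) * X.2 s]).

Definition D21_datum : classical_datum K := @ClassicalDatum K D21 t0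
  (\sum_(k < 3) g0_ (- (e k *+ 2)))%VS
  (g1_ (e 0 - e 1 + e 2) + g1_ (- (e 0 - e 1 + e 2)))%VS
  (g1_ (- e 0 - e 1 - e 2) + g1_ (- e 0 - e 1 + e 2) +
   g1_ (e 0 - e 1 - e 2))%VS
  D21_torus.

End D21.

(* A Lie superalgebra (s x sl_2) (+) (W (x) V) with W = K^N, V = K^2,         *)
(* s <= gl(W) and W (x) V identified with 'M_(N, 2).  The odd bracket is      *)
(*   [x (x) u, y (x) v] = psi(u, v) D(x, y) + <x, y> (u v + v u)              *)
(* where psi is the symplectic form of V, D : Lambda^2 W -> s is equivariant  *)
(* and <x, y> = x^T F y is an invariant symmetric form.                       *)
Section Exceptional.
Variables (K : fieldType) (N : nat).
Notation V := ('M[K]_N * 'M[K]_2 * 'M[K]_(N, 2))%type.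
Variables (s : {vspace 'M[K]_N}) (D : 'cV[K]_N -> 'cV[K]_N -> 'M[K]_N).
Variables (F : 'M[K]_N) (P : 'rV[K]_N -> Prop).

Definition exc_bracket (X Y : V) : V :=
  let G := X.2^T *m F *m Y.2 in
  (X.1.1 *m Y.1.1 - Y.1.1 *m X.1.1
     + (D (col 0 X.2) (col 1 Y.2) - D (col 1 X.2) (col 0 Y.2)),
   X.1.2 *m Y.1.2 - Y.1.2 *m X.1.2 + (G + G^T) *m symp2 K,
   X.1.1 *m Y.2 + Y.2 *m X.1.2^T - (Y.1.1 *m X.2 + X.2 *m Y.1.2^T)).

Definition exc_even (s1 : {vspace 'M[K]_N}) (s2 : {vspace 'M[K]_2}) : {vspace V} :=
  (linfun (fun A : 'M[K]_N => (A, 0, 0) : V) @: s1 +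
   linfun (fun B : 'M[K]_2 => (0, B, 0) : V) @: s2)%VS.

Definition exc : superalgebra K := @SuperAlgebra K V exc_bracket
  (fun p => if p then kernel (fun X : V => X.1)
            else exc_even s (kernel (fun B : 'M[K]_2 => \tr B : K^o))).

Definition exc_t0 : {vspace V} :=
  exc_even (s :&: diagonal_space K N)
           (kernel (fun B : 'M[K]_2 => \tr B : K^o) :&: diagonal_space K 2).

Definition exc_root := @root_space K exc exc_t0.

(* The weights of W, and the weight of the first basis vector of V *)
Definition exc_mu (i : 'I_N) : V -> K := fun h => h.1.1 i i.
Definition exc_eps : V -> K := fun h => h.1.2 0 0.

Definition exc_torus (phi : V -> V) : Prop :=
  exists (d : 'rV[K]_N) (a : K), [/\ forall i, d 0 i != 0, P d, a != 0 &
    let r := diag_mx (\row_(i < 2) (if i == 0 then a else a^-1)) in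
    forall X, phi X = (diag_mx d *m X.1.1 *m invmx (diag_mx d),
                       r *m X.1.2 *m invmx r, diag_mx d *m X.2 *m r)].

End Exceptional.

Section G3.
Variable K : fieldType.

(* W = imaginary split octonions = K (+) K^3 (+) (K^3)^*, in Zorn's vector    *)
(* matrix form.                                                               *)
Notation W := 'cV[K]_(1 + (3 + 3)).

Definition oz (u : W) : K := u 0 0.
Definition ox (u : W) : 'cV[K]_3 := usubmx (dsubmx u).
Definition oy (u : W) : 'cV[K]_3 := dsubmx (dsubmx u).
Definition dot3 (x y : 'cV[K]_3) : K := \sum_i x i 0 * y i 0.
Definition cross3 (x y : 'cV[K]_3) : 'cV[K]_3 :=
  \col_i (x (i + 1) 0 * y (i + 2) 0 - x (i + 2) 0 * y (i + 1) 0).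

(* The product of imaginary octonions is uv = <u, v> 1 + octo_cross u v. *)
Definition octo_cross (u v : W) : W := col_mx
  (((dot3 (ox u) (oy v) - dot3 (oy u) (ox v)) / 2)%:M)
  (col_mx (oz u *: ox v - oz v *: ox u - cross3 (oy u) (oy v))
          (oz v *: oy u - oz u *: oy v + cross3 (ox u) (ox v))).

Definition octo_dot (u v : W) : K :=
  oz u * oz v + (dot3 (ox u) (oy v) + dot3 (oy u) (ox v)) / 2.

(* The derivation [L_u, L_v] + [L_u, R_v] + [R_u, R_v] of the octonions *)
Definition octo_der (u v : W) : 'M[K]_(1 + (3 + 3)) := \matrix_(i, j)
  (let w := delta_mx j 0 in
   octo_cross u (octo_cross v w) - octo_cross v (octo_cross u w)
     + 3 *: (octo_dot v w *: u - octo_dot u w *: v)) i 0.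

(* The Lie algebra of derivations of the octonions, acting on W *)
Definition G2 : {vspace 'M[K]_(1 + (3 + 3))} :=
  (\bigcap_(i < 7) \bigcap_(j < 7)
    kernel (fun A : 'M[K]_(1 + (3 + 3)) =>
      let u : W := delta_mx i 0 in let v : W := delta_mx j 0 in
      A *m octo_cross u v - octo_cross (A *m u) v - octo_cross u (A *m v))%R)%VS.

Definition G3_form : 'M[K]_(1 + (3 + 3)) :=
  \matrix_(i, j) (4 * octo_dot (delta_mx i 0) (delta_mx j 0)).

Definition G2_torus (d : 'rV[K]_(1 + (3 + 3))) : Prop :=
  exists2 a : 'rV[K]_3, \prod_i a 0 i = 1 &
    d = row_mx (const_mx 1) (row_mx a (map_mx GRing.inv a)).

Let rs := @exc_root K 7 G2 octo_der G3_form.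
Local Notation g0_ lam := (rs false lam%R).
Local Notation g1_ lam := (rs true lam%R).
Let mu (i : 'I_7) := @exc_mu K 7 i.
Let e (k : nat) := mu (inord k.+1).
Let c := @exc_eps K 7.

(* The weights of W are 0, e_0, e_1, e_2 and their opposites, with            *)
(* e_0 + e_1 + e_2 = 0.  The simple roots of G_2 are - e_1 and e_1 - e_2, and *)
(* the highest weight of W is omega_1 = e_0 = mu 1.                           *)
Definition G3_datum : classical_datum K := @ClassicalDatum K
  (exc G2 octo_der G3_form) (exc_t0 G2)
  (g0_ (- e 0) + g0_ (e 1) + g0_ (e 2) +
   g0_ (- e 0 + e 1) + g0_ (- e 0 + e 2) + g0_ (- e 1 + e 2) +
   g0_ (- (c *+ 2)))%VS
  (g1_ (e 0 - c) + g1_ (- (e 0 - c)))%VS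
  (\sum_(i < 7 | (i != 1)%R) g1_ (mu i - c))%VS
  (exc_torus G2_torus).

End G3.

Section F4.
Variable K : fieldType.

Definition bit (k i : nat) : bool := odd (i %/ 2 ^ k).

(* The gamma matrices of the split quadratic space K^7, by creation and       *)
(* annihilation operators on the exterior algebra of K^3 (the basis being     *)
(* indexed by subsets of {0,1,2} in binary): for k < 3,                       *)
(* gamma k = a_k + a_k^* and gamma (k + 3) = +/-(a_k - a_k^* ), while gamma 6 *)
(* is the parity operator; their squares are given by gamma_sign.             *)
Definition gamma (k : 'I_7) : 'M[K]_8 := \matrix_(i, j)
  if (k == 6 :> nat)%N then (i == j)%:R * (-1) ^+ (bit 0 j + bit 1 j + bit 2 j)%N
  else let l := (k %% 3)%N in
    [forall r : 'I_3, bit r i == bit r j (+) (r == l :> nat)]%:R *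
    (-1) ^+ ((\sum_(r < l) bit r j) + ((3 <= k) && bit l j))%N.

Definition gamma_sign (k : 'I_7) : K := if (3 <= k < 6)%N then -1 else 1.

(* so_7 acting on its spin module *)
Definition spin7 : {vspace 'M[K]_8} :=
  (\sum_(i < 7) \sum_(j < 7 | (i < j)%N) <[gamma i *m gamma j]>)%VS.

(* The invariant symmetric form of the spin module *)
Definition spin_form : 'M[K]_8 :=
  gamma (inord 3) *m gamma (inord 4) *m gamma (inord 5).

Definition spin_der (x y : 'cV[K]_8) : 'M[K]_8 :=
  \sum_(i < 7) \sum_(j < 7 | (i < j)%N)
    (gamma_sign i * gamma_sign j * (x^T *m spin_form *m gamma i *m gamma j *m y) 0 0)
    *: (gamma i *m gamma j).

(* The torus of Spin_7 is {(t, r) | r^2 = t_0 t_1 t_2}, where r is the        *)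
(* character omega_3.                                                         *)
Definition spin_torus (d : 'rV[K]_8) : Prop :=
  exists (t : 'I_3 -> K) (r : K), r ^+ 2 = \prod_k t k /\
    forall i : 'I_8, d 0 i = r / \prod_(k < 3 | bit k i) t k.

Let rs := @exc_root K 8 spin7 spin_der (3 *: spin_form).
Local Notation g0_ lam := (rs false lam%R).
Local Notation g1_ lam := (rs true lam%R).
Let mu (i : 'I_8) := @exc_mu K 8 i.
Let e (k : nat) := mu 0 - mu (inord (2 ^ k)).
Let c := @exc_eps K 8.

(* mu i = omega_3 - (the sum of the e_k with bit k i), with                   *)
(* omega_3 = mu 0 = (e_0 + e_1 + e_2) / 2                                     *)
Definition F4_datum : classical_datum K := @ClassicalDatum K
  (exc spin7 spin_der (3 *: spin_form)) (exc_t0 spin7)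
  (\sum_(k < 3) g0_ (- e k) +
   \sum_(i < 3) \sum_(j < 3 | (i < j)%N)
      (g0_ (- e i + e j) + g0_ (- e i - e j)) +
   g0_ (- (c *+ 2)))%VS
  (g1_ (mu 0 - c) + g1_ (- (mu 0 - c)))%VS
  (\sum_(i < 8 | (i != 0)%R) g1_ (mu i - c))%VS
  (exc_torus spin_torus).

End F4.

Inductive classical_type (K : Type) :=
  | GL of nat & nat | SL of nat & nat | PSL of nat
  | OSPodd of nat & nat | OSPeven of nat & nat
  | D21type of K | G3type | F4type
  | Qtype of nat | PSQtype of nat | Ptype of nat | Ptildetype of nat.

Arguments G3type {K}.
Arguments F4type {K}.

Definition admissible (K : fieldType) (X : classical_type K) : bool :=
  match X with
  | GL m n | SL m n => (0 < m)%N && (0 < n)%N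
  | PSL n | Qtype n | PSQtype n => (0 < n)%N
  | OSPodd _ n => (0 < n)%N
  | OSPeven m n => (0 < m)%N && (0 < n)%N
  | D21type alpha => (alpha != 0) && (alpha != -1)
  | G3type | F4type => true
  | Ptype n | Ptildetype n => (1 < n)%N
  end.

Definition classical (K : fieldType) (X : classical_type K) : classical_datum K :=
  match X with
  | GL m n => gl_datum K m n
  | SL m n => sl_datum K m n
  | PSL n => psl_datum K n
  | OSPodd m n => osp_datum K m n true
  | OSPeven m n => osp_datum K m n false
  | D21type alpha => D21_datum alpha
  | G3type => G3_datum K
  | F4type => F4_datum K
  | Qtype n => q_datum K n
  | PSQtype n => psq_datum K n
  | Ptype n => p_datum K n
  | Ptildetype n => ptilde_datum K n
  end.

Section Subalgebras.
Variables (K : fieldType) (g : classical_datum K).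

Definition cf0 : {vspace ambient (calg g)} := bracket_space (cf1 g) (cf1 g).
Definition cb0 : {vspace ambient (calg g)} := (ct0 g + cu0 g)%VS.
Definition cb1 : {vspace ambient (calg g)} := (cf1 g + cu1 g)%VS.

Definition f_alg := subalgebra cf0 (cf1 g).
Definition t_alg := subalgebra (ct0 g) (cf1 g).
Definition b_alg := subalgebra cb0 cb1.

Definition restriction_b_f (p : nat) (f : cochain b_alg) : cochain f_alg :=
  pullback (@inclusion K (calg g) cf0 (cf1 g) cb0 cb1) f.

End Subalgebras.

Arguments restriction_b_f {K} g p f.

(* Main.v *)
(* The Cartan subalgebra t_0 contains an element H with integral eigenvalues   *)
(* which vanish on f_1 and are negative on u_0 and u_1, and [f_1, f_1] lies in *)
(* t_0 and kills f_1.  For each pair in the statement, the odd elements        *)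
(* bracket into the even part, so that the differential vanishes on relative   *)
(* cochains and the cohomology is the algebra of invariant polynomials on the  *)
(* odd part.  As f_0 acts trivially on f_1, this proves (a).  An H-invariant   *)
(* polynomial on f_1 + u_1 only involves f_1, and a polynomial on f_1 extended *)
(* by 0 along u_1 is b_0-invariant as soon as it is t_0-invariant; finally     *)
(* t_0 and T_0 act on f_1 through the same integral weights, so that they have *)
(* the same invariants.                                                        *)
(*   The existence of H and the description of the root spaces are checked in  *)
(* coordinates in which t_0 is diagonal: H gives a level to each coordinate,   *)
(* the bracket is additive on levels, and f_1, u_0, u_1 are the subspaces of   *)
(* the vectors supported in level 0, resp. in negative levels.                 *)
From HB Require Import structures.
Require Import Defs.
From mathcomp Require Import all_boot all_order all_algebra.
From mathcomp Require Import boolp functions mpoly.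
From mathcomp Require Import reals complex.
From mathcomp Require Import zify ring.

Set Implicit Arguments.
Unset Strict Implicit.
Unset Printing Implicit Defensive.

Import Order.TTheory GRing.Theory Num.Theory.
Local Open Scope ring_scope.

(** * Relative cochains as symmetric polynomials *)

(** Let (a, a_0) be one of the pairs (f, f_0), (t, t_0), (b, b_0). A relative cochain vanishes on
    even arguments, and two odd elements bracket into a_0. Hence in the differential a bracket of
    two odd arguments contributes nothing, while a single even argument contributes exactly the sum
    that a_0-invariance makes zero: the differential vanishes on relative cochains
    ([differential_eq0]). Multilinear coboundaries are then zero ([coboundary_multilinear]), so
    cohomology is the algebra of relative cochains itself, that is, of a_0-invariant symmetric
    multilinear forms on a_1, and everything becomes a statement about invariant polynomials.

    For f, the even part f_0 lies in t_0 and kills f_1, so invariance is automatic. Restricting a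
    form of degree N to the diagonal and dividing by N! gives a polynomial; this normalisation turns
    the shuffle product into the product of polynomials ([sympoly_cup]), and polarization is the
    inverse map ([sympoly_polar]). Together they give [cohomology_sym].

    For b, some H in t_0 kills f_1 and has negative integral eigenvalues on u_1. Evaluated on
    eigenvectors, an H-invariant cochain is 0 as soon as one argument lies in u_1, so restriction to
    f is injective. Conversely a cochain on f is extended through the projection onto f_1 along b_0
    + u_1. As u_0 maps b_1 into u_1, the extension is b_0-invariant once the given cochain is
    t_0-invariant ([f_proj_br], [extend_relative]). The same projection compares f with t. Finally
    T_0 and t_0 have the same invariants ([torus_invariant]): on weight vectors both conditions say
    that the cochain vanishes unless the weights add up to 0.

    All this only uses the facts gathered in [triangular], which are then checked type by type. The
    tool is a family of coordinate functions diagonalising t_0, each with an integral level, the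
    value of its weight at H ([coordinates]). Root spaces become support conditions
    ([root_space_gr], [gr_root_space]), the subspaces f_1, u_0, u_1 become parts of level 0 or of
    negative level, and the bracket adds levels; [coordinates_triangular] concludes. In the matrix
    families the levels come from the indices. G(3) and F(4) share one scheme, where the form on W
    is normalised against the map D; in D(2,1,alpha) the equality [[f_1, f_1], f_1] = 0 is the
    relation between the three structure constants. *)

Section SymmetricPolynomial.
Variables (K : fieldType) (L : superalgebra K) (n : nat) (e : 'I_n -> elt L).
Hypothesis charK : forall k, k.+1%:R != 0 :> K.
Implicit Types f g : cochain L.

(* The polynomial function x |-> f (x, ..., x) / N! in the coordinates along e *)
Fixpoint sympoly N f : {mpoly K[n]} :=
  if N is N'.+1 then N%:R^-1 *: \sum_i 'X_i * sympoly N' (fun s => f (e i :: s))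
  else (f [::] : K)%:MP.

Lemma mderiv_sum I (r : seq I) (F : I -> {mpoly K[n]}) j :
  (\sum_(i <- r) F i)^`M(j) = \sum_(i <- r) (F i)^`M(j).
Proof. exact: (raddf_sum (mderiv j)). Qed.

Lemma sympolyS N f :
  sympoly N.+1 f = N.+1%:R^-1 *: \sum_i 'X_i * sympoly N (fun s => f (e i :: s)).
Proof. by []. Qed.

Lemma sympolyS' N f :
  N.+1%:R *: sympoly N.+1 f = \sum_i 'X_i * sympoly N (fun s => f (e i :: s)).
Proof. by rewrite sympolyS scalerA mulfV ?charK // scale1r. Qed.

Lemma mderivX1 i j : ('X_i : {mpoly K[n]})^`M(j) = (i == j)%:R.
Proof.
rewrite mderivX mnm1E; case: eqP => [->|_]; last by rewrite scale0r.
rewrite scale1r; have -> : (U_(j) - U_(j) = 0 :> 'X_{1..n})%MM.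
  by apply/mnmP=> k; rewrite mnmBE subnn mnm0E.
by rewrite mpolyX0.
Qed.

Lemma eq_sympoly N f g :
  (forall s, size s = N -> f s = g s) -> sympoly N f = sympoly N g.
Proof.
elim: N f g => [|N IH] f g fg /=; first by rewrite fg.
congr (_ *: _); apply: eq_bigr => i _.
by rewrite (IH _ (fun s => g (e i :: s))) // => s hs; rewrite fg //= hs.
Qed.

Lemma sympoly_linear N a f g :
  sympoly N (fun s => a * f s + g s) = a *: sympoly N f + sympoly N g.
Proof.
elim: N f g => [|N IH] f g /=; first by rewrite -mul_mpolyC -mpolyCM -mpolyCD.
rewrite scalerA mulrC -scalerA -scalerDr; congr (_ *: _).
rewrite scaler_sumr -big_split /=; by apply: eq_bigr => i _; rewrite IH mulrDr scalerAr.
Qed.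

Lemma sympoly0 N f : (forall s, size s = N -> f s = 0) -> sympoly N f = 0.
Proof.
elim: N f => [|N IH] f f0 /=; first by rewrite f0 // mpolyC0.
rewrite big1 ?scaler0 // => i _.
by rewrite IH ?mulr0 // => s hs; apply: f0; rewrite /= hs.
Qed.

Lemma sympolyD N f g :
  sympoly N (fun s => f s + g s) = sympoly N f + sympoly N g.
Proof.
rewrite -[sympoly N f]scale1r -sympoly_linear.
by apply: eq_sympoly => s _; rewrite mul1r.
Qed.

Lemma sympoly_homog N f : sympoly N f \is N.-homog.
Proof.
elim: N f => [|N IH] f /=.
  by rewrite -[_%:MP]mulr1 mul_mpolyC rpredZ // dhomog1.
rewrite rpredZ // rpred_sum // => i _.
by rewrite -[N.+1]add1n dhomogM // dhomogX /= mdeg1.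
Qed.

(** The first bit of the mask decides which factor receives the first argument. Contraction with a
    vector is thus a derivation of the cup product, which drives the induction of [sympoly_cup]. *)
Lemma cup_cons f g x s :
  cup f g (x :: s) = cup (fun s => f (x :: s)) g s + cup f (fun s => g (x :: s)) s.
Proof.
rewrite /cup /= (reindex (fun p : bool * (size s).-tuple bool => [tuple of p.1 :: p.2])) /=.
  rewrite -(pair_bigA _ (fun b (u : (size s).-tuple bool) =>
     f (mask (b :: u) (x :: s)) * g (mask (map negb (b :: u)) (x :: s)))) /=.
  by rewrite big_bool.
exists (fun u : (size s).+1.-tuple bool => (thead u, [tuple of behead u])) => [[b u] _|u _] /=.
  by apply/eqP; rewrite xpair_eqE theadE eqxx -val_eqE /= eqxx.
by rewrite -tuple_eta.
Qed.

Lemma cup_nil f g : cup f g [::] = f [::] * g [::].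
Proof.
by rewrite /cup /= (big_pred1 [tuple]) //= => u; apply/esym/eqP/tuple0.
Qed.

(** Induction through the Leibniz rule [cup_cons]. After clearing the factor 1/(N+1), the two halves
    contribute the term of bidegree (a, N+1-a) with coefficients a and N+1-a, which add up to N+1.
    The division by N! in [sympoly] is what absorbs the binomial coefficients. *)
Lemma sympoly_cup N f g :
  sympoly N (cup f g) = \sum_(a < N.+1) sympoly a f * sympoly (N - a) g.
Proof.
elim: N f g => [|N IH] f g /=; first by rewrite big_ord1 /= cup_nil mpolyCM.
have split i : sympoly N (fun s => cup f g (e i :: s)) =
    sympoly N (cup (fun s => f (e i :: s)) g) + sympoly N (cup f (fun s => g (e i :: s))).
  by rewrite -sympolyD; apply: eq_sympoly => s _; rewrite cup_cons.
under eq_bigr do rewrite split !IH mulrDr.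
apply: (canLR (scalerK _)); first exact: charK.
rewrite big_split /=.
under eq_bigr do rewrite mulr_sumr.
rewrite exchange_big /=.
under eq_bigr => a _.
  under eq_bigr do rewrite mulrA.
  rewrite -mulr_suml -sympolyS' -scalerAl.
  over.
under [X in _ + X]eq_bigr do rewrite mulr_sumr.
rewrite [X in _ + X]exchange_big /=.
under [X in _ + X]eq_bigr => a _.
  under eq_bigr do rewrite mulrCA.
  rewrite -mulr_sumr -sympolyS' -scalerAr.
  over.
(* Both sums are extended to all [a] up to N+1; the boundary term added to each has coefficient
   0. *)
have -> : \sum_(a < N.+1) a.+1%:R *: (sympoly a.+1 f * sympoly (N - a) g) =
          \sum_(a < N.+2) (nat_of_ord a)%:R *: (sympoly a f * sympoly (N.+1 - a) g).
  by rewrite [RHS]big_ord_recl /= scale0r add0r; apply: eq_bigr => a _.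
have -> : \sum_(a < N.+1) (N - a).+1%:R *: (sympoly a f * sympoly (N - a).+1 g) =
          \sum_(a < N.+2) (N.+1 - a)%:R *: (sympoly a f * sympoly (N.+1 - a) g).
  rewrite [RHS]big_ord_recr /= subnn scale0r addr0; apply: eq_bigr => a _.
  by rewrite subSn // -ltnS.
rewrite -big_split scaler_sumr; apply: eq_bigr => a _ /=.
by rewrite -scalerDl -natrD subnKC // -ltnS.
Qed.

Arguments sympoly : simpl never.

(** In the derivative of the recursion the variable contributes one copy of the right-hand side and,
    by induction, the remaining factors contribute N copies; these cancel 1/(N+1). Symmetry brings
    the argument [e j] to the front. *)
Lemma mderiv_sympoly N f j :
  (forall i k s1 s2, f (s1 ++ e i :: e k :: s2) = f (s1 ++ e k :: e i :: s2)) ->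
  (sympoly N.+1 f)^`M(j) = sympoly N (fun s => f (e j :: s)).
Proof.
elim: N f => [|N IH] f sym.
  rewrite sympolyS invr1 scale1r mderiv_sum (bigD1 j) //= big1 => [|i /negPf ij].
    by rewrite mulrC mderiv_mulC mderivX1 eqxx mulr1 addr0.
  by rewrite mulrC mderiv_mulC mderivX1 ij mulr0.
have key i : (sympoly N.+1 (fun s => f (e i :: s)))^`M(j)
    = sympoly N (fun s => f (e j :: e i :: s)).
  rewrite IH; last by move=> i' k s1 s2; rewrite -!cat_cons sym.
  by apply: eq_sympoly => s _; rewrite -[_ :: _]/([::] ++ e i :: e j :: s) sym.
rewrite sympolyS mderivZ mderiv_sum.
under eq_bigr do rewrite mderivM.
rewrite big_split /=; under [X in _ + X]eq_bigr do rewrite key.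
rewrite -(sympolyS' _ (fun s => f (e j :: s))).
have -> : \sum_i ('X_i)^`M(j) * sympoly N.+1 (fun s => f (e i :: s)) =
    sympoly N.+1 (fun s => f (e j :: s)).
  rewrite (bigD1 j) //= big1 => [|i /negPf ij].
    by rewrite mderivX1 eqxx mul1r addr0.
  by rewrite mderivX1 ij mul0r.
rewrite -[X in X + _]scale1r -scalerDl nat1r scalerA.
by rewrite mulVf ?charK // scale1r.
Qed.

(** Each derivative strips one argument off [f], so the polynomial determines the values of a
    symmetric cochain on the vectors [e i]. This is the source of injectivity. *)
Lemma mcoeff_sympoly N f (t : seq 'I_n) :
  (forall i k s1 s2, f (s1 ++ e i :: e k :: s2) = f (s1 ++ e k :: e i :: s2)) ->
  size t = N ->
  (foldl (fun P i => mderiv i P) (sympoly N f) t)@_0 = f (map e t).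
Proof.
elim: t N f => [|j t IH] [|N] f sym //= ht.
  by rewrite mcoeffC eqxx mulr1.
case: ht => ht; rewrite mderiv_sympoly // IH // => i k s1 s2.
by rewrite -!cat_cons sym.
Qed.

(** Euler's identity has the same shape as the recursion defining [sympoly], which is how it enters
    the proof of [sympoly_polar]. *)
Lemma euler_mpoly N (P : {mpoly K[n]}) :
  P \is N.-homog -> \sum_i 'X_i * P^`M(i) = N%:R *: P.
Proof.
move=> /dhomogP hP; rewrite {1 2}[P]mpolyE.
under eq_bigr => i _ do rewrite mderiv_sum mulr_sumr /=.
rewrite exchange_big scaler_sumr; apply: eq_big_seq => m /hP /= <-.
rewrite mdegE natr_sum scaler_suml; apply: eq_bigr => i _.
rewrite mderivZ mderivX -!mul_mpolyC.
have [mi0|mi0] := posnP (m i); first by rewrite mi0 mpolyC0 !mul0r !mulr0.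
rewrite [LHS]mulrCA [RHS]mulrCA [X in _ * X = _]mulrCA -mpolyXD.
congr (_ * (_ * 'X_[_])).
by apply/mnmP => k; rewrite mnmDE mnmBE mnm1E; case: eqP => [<-|_] /=; lia.
Qed.

End SymmetricPolynomial.

(** * Polarization of homogeneous polynomials *)

Section Polarization.
Variables (K : fieldType) (L : superalgebra K) (n : nat) (e : 'I_n -> elt L).
Hypothesis charK : forall k, k.+1%:R != 0 :> K.
Variable q : 'I_n -> {linear elt L -> K^o}.
Hypothesis q_dual : forall i j, q i (e j) = (i == j)%:R.

Definition dirderiv (P : {mpoly K[n]}) (x : elt L) : {mpoly K[n]} :=
  \sum_i (q i x : K) *: P^`M(i).

Implicit Types P Q : {mpoly K[n]}.

(** The complete polarization: the iterated directional derivative along the arguments, evaluated at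
    0. On the diagonal it is N! times [P] for [P] homogeneous of degree N, which matches the
    division by N! in [sympoly]. *)
Definition polar (P : {mpoly K[n]}) : cochain L := fun s => (foldl dirderiv P s)@_0.

Lemma dirderiv_linearl x a P Q :
  dirderiv (a *: P + Q) x = a *: dirderiv P x + dirderiv Q x.
Proof.
rewrite /dirderiv scaler_sumr -big_split; apply: eq_bigr => i _ /=.
by rewrite mderivD mderivZ scalerDr scalerA mulrC -scalerA.
Qed.

Lemma dirderiv_linearr P a x y :
  dirderiv P (a *: x + y) = a *: dirderiv P x + dirderiv P y.
Proof.
rewrite /dirderiv scaler_sumr -big_split; apply: eq_bigr => i _ /=.
by rewrite linearP scalerDl scalerA.
Qed.

Lemma foldl_dirderiv_linear s a P Q :
  foldl dirderiv (a *: P + Q) s = a *: foldl dirderiv P s + foldl dirderiv Q s.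
Proof. by elim: s P Q => //= x s IH P Q; rewrite dirderiv_linearl IH. Qed.

Lemma dirderivC P x y : dirderiv (dirderiv P x) y = dirderiv (dirderiv P y) x.
Proof.
rewrite /dirderiv.
under eq_bigr => i _.
  rewrite mderiv_sum scaler_sumr; under eq_bigr do rewrite mderivZ scalerA mderiv_comm mulrC.
  over.
rewrite exchange_big /=; apply: eq_bigr => i _.
rewrite mderiv_sum scaler_sumr; apply: eq_bigr => j _.
by rewrite mderivZ scalerA.
Qed.

Lemma polar_multilinear P : multilinear (polar P).
Proof.
move=> a x y s1 s2; rewrite /polar !foldl_cat /= dirderiv_linearr.
by rewrite foldl_dirderiv_linear mcoeffD mcoeffZ.
Qed.

Lemma polar_sym P x y s1 s2 : polar P (s1 ++ x :: y :: s2) = polar P (s1 ++ y :: x :: s2).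
Proof. by rewrite /polar !foldl_cat /= dirderivC. Qed.

Lemma mderiv_homog N (P : {mpoly K[n]}) i : P \is N.+1.-homog -> P^`M(i) \is N.-homog.
Proof.
move=> /dhomogP hP; apply/dhomogP => m; rewrite mcoeff_msupp mcoeff_deriv => nz.
have /hP : (m + U_(i))%MM \in msupp P.
  by rewrite mcoeff_msupp; apply: contraNneq nz => ->; rewrite mul0rn.
by rewrite /= mdegD mdeg1 addn1 => -[].
Qed.

Lemma dirderiv_homog N P x : P \is N.+1.-homog -> dirderiv P x \is N.-homog.
Proof. by move=> hP; rewrite rpred_sum // => i _; rewrite rpredZ // mderiv_homog. Qed.

Lemma homog0P (P : {mpoly K[n]}) : P \is 0.-homog -> P = (P@_0)%:MP.
Proof.
move=> /dhomogP hP; apply/mpolyP => m; rewrite mcoeffC.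
have [->|m0] := eqVneq m 0%MM; first by rewrite mulr1.
rewrite mulr0; apply/eqP; rewrite -[_ == 0]negbK -mcoeff_msupp.
by apply: contra m0 => /hP /eqP; rewrite mdeg_eq0.
Qed.

Lemma polar_degree N P s : P \is N.-homog -> size s != N -> polar P s = 0.
Proof.
elim: s N P => [|x s IH] [|N] P hP //=.
- move=> _; rewrite /polar /=; apply/eqP; rewrite -[_ == 0]negbK -mcoeff_msupp.
  by move/dhomogP: hP => hP; apply/negP => /hP; rewrite /= mdeg0.
- move=> _; rewrite /polar /= (homog0P hP) /dirderiv big1; last by move=> i _; rewrite mderivC scaler0.
  have -> : foldl dirderiv 0 s = 0; last by rewrite mcoeff0.
  by elim: s {IH} => //= y s IH; rewrite -[RHS]IH /dirderiv big1 // => i _; rewrite mderiv0 scaler0.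
- by move=> hs; apply: (IH N) => //; apply: dirderiv_homog.
Qed.

Lemma sympoly_polar N P : P \is N.-homog -> sympoly e N (polar P) = P.
Proof.
elim: N P => [|N IH] P hP; first by rewrite [RHS]homog0P.
apply: (scalerI (charK N)); rewrite sympolyS' // -euler_mpoly //.
apply: eq_bigr => i _; rewrite -[in RHS](IH _ (mderiv_homog i hP)); congr (_ * _).
apply: eq_sympoly => s _; rewrite /polar /=; congr (foldl _ _ _)@_ _.
rewrite /dirderiv (bigD1 i) //= q_dual eqxx scale1r big1 ?addr0 // => j /negPf ji.
by rewrite q_dual ji scale0r.
Qed.

End Polarization.

(** The set [Q] (homogeneous vectors, weight vectors, eigenvectors) is usually not closed under
    addition, hence explicit finite combinations. By [multilinear_ext] identities between
    multilinear functions need only be tested on such vectors. *)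
Definition spanned (K : fieldType) (V : lmodType K) (A Q : V -> Prop) :=
  forall x, A x -> exists2 r : seq (K * V),
    x = \sum_(y <- r) y.1 *: y.2 & forall y, y \in r -> Q y.2.

Section Cochains.
Variables (K : fieldType) (L : superalgebra K).
Implicit Types (f g : cochain L) (x y h : elt L) (s : seq (elt L)).

Lemma multilinear0 f s1 s2 : multilinear f -> f (s1 ++ 0 :: s2) = 0.
Proof.
move=> mf; have := mf 1 0 0 s1 s2; rewrite scaler0 addr0 mul1r.
by move/eqP; rewrite -subr_eq subrr => /eqP.
Qed.

Lemma multilinearZ f a x s1 s2 :
  multilinear f -> f (s1 ++ a *: x :: s2) = a * f (s1 ++ x :: s2).
Proof. by move=> mf; rewrite -[a *: x]addr0 mf multilinear0 // addr0. Qed.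

Lemma multilinearD f x y s1 s2 :
  multilinear f -> f (s1 ++ x + y :: s2) = f (s1 ++ x :: s2) + f (s1 ++ y :: s2).
Proof. by move=> mf; rewrite -[x]scale1r mf mul1r scale1r. Qed.

Lemma multilinear_sum f (r : seq (K * elt L)) s1 s2 : multilinear f ->
  f (s1 ++ \sum_(y <- r) y.1 *: y.2 :: s2) = \sum_(y <- r) y.1 * f (s1 ++ y.2 :: s2).
Proof.
move=> mf; elim: r => [|x r IH]; first by rewrite !big_nil multilinear0.
by rewrite !big_cons multilinearD // multilinearZ // IH.
Qed.

Lemma multilinear_cons f x : multilinear f -> multilinear (fun s => f (x :: s)).
Proof. by move=> mf a y z s1 s2; rewrite -!cat_cons mf. Qed.

Lemma multilinear_ext (Q : elt L -> Prop) f g :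
    spanned (fun=> True) Q ->
    multilinear f -> multilinear g ->
    (forall s, (forall x, x \in s -> Q x) -> f s = g s) -> f =1 g.
Proof.
move=> spanQ mf mg fg s.
suff: forall s2 s1, (forall x, x \in s1 -> Q x) -> f (s1 ++ s2) = g (s1 ++ s2).
  by move/(_ s [::]); apply.
elim=> [|x s2 IH] s1 Qs1; first by rewrite cats0 fg.
have [r -> Qr] := spanQ x I; rewrite !multilinear_sum //.
apply: eq_big_seq => y /Qr Qy; congr (_ * _); rewrite -!cat_rcons IH // => z.
by rewrite mem_rcons inE => /orP[/eqP->|/Qs1].
Qed.

(* The derivation extending D, on forms *)
Definition dact (D : elt L -> elt L) f s : K :=
  \sum_(i < size s) f (set_nth 0 s i (D s`_i)).

Lemma dact_cons D f x s :
  dact D f (x :: s) = f (D x :: s) + dact D (fun s => f (x :: s)) s.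
Proof. by rewrite /dact /= big_ord_recl. Qed.

Lemma eq_dact D f g s : f =1 g -> dact D f s = dact D g s.
Proof. by move=> fg; apply: eq_bigr => i _; rewrite fg. Qed.

Lemma dact_linear D a f g s :
  dact D (fun s => a * f s + g s) s = a * dact D f s + dact D g s.
Proof. by rewrite /dact big_split mulr_sumr. Qed.

Lemma dact_multilinear (D : {linear elt L -> elt L}) f :
  multilinear f -> multilinear (dact D f).
Proof.
move=> mf a x y s1; elim: s1 f mf => [|z s1 IH] f mf s2 /=.
  rewrite !dact_cons linearP -[_ :: s2]cat0s mf /=.
  rewrite (eq_dact _ (g := fun s => a * f (x :: s) + f (y :: s))) => [|s].
    by rewrite dact_linear; ring.
  by rewrite -[_ :: s]cat0s mf.
rewrite !dact_cons (IH _ (multilinear_cons _ mf)) -!cat_cons mf; ring.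
Qed.

End Cochains.

(** * The differential vanishes on relative cochains *)

Record parity_graded (K : fieldType) (L : superalgebra K) : Prop := ParityGraded {
  pg_cap : (spart L false :&: spart L true)%VS = 0%VS;
  pg_linl : forall z, linear (fun x => @sbr K L x z);
  pg_linr : forall z, linear (@sbr K L z);
  pg_sbr : forall a b x y,
    x \in spart L a -> y \in spart L b -> sbr x y \in spart L (a (+) b);
  pg_skew : forall x y,
    x \in spart L false -> y \in spart L true -> sbr y x = - sbr x y }.

(** Here [k] will be the position of the only even argument: pairs avoiding it contribute nothing to
    the differential, and what is left are the partners before it and those after it. *)
Lemma sum_pairs_through (V : zmodType) (T : nat -> nat -> V) k m :
  (forall i j, (i < j < k.+1 + m)%N -> i != k -> j != k -> T i j = 0) ->
  \sum_(0 <= j < k.+1 + m) \sum_(0 <= i < j) T i j =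
  \sum_(0 <= i < k) T i k + \sum_(0 <= l < m) T k (k.+1 + l)%N.
Proof.
elim: m => [|m IH] T0.
  rewrite addn0 big_nat_recr //= [X in X + _]big_nat big1 ?add0r ?big_nil ?addr0 //.
  by move=> j /= jk; rewrite big_nat big1 // => i /= ij; apply: T0; lia.
have {}IH := IH (fun i j ijk => T0 i j ltac:(lia)).
rewrite addnS big_nat_recr //= IH [in RHS]big_nat_recr //= addrA; congr (_ + _).
rewrite big_mkord (bigD1 (Ordinal (leq_addr m k.+1 : k < k.+1 + m)%N)) //= big1 ?addr0 // => i.
by rewrite -val_eqE /= => ik; apply: T0 => //; have := ltn_ord i; lia.
Qed.

Section RelativeCochains.
Variables (K : fieldType) (L : superalgebra K).
Hypothesis gL : parity_graded L.
Implicit Types (f g : cochain L) (x y h : elt L) (s : seq (elt L)).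

Lemma mem_total b (x : ambient L) : x \in spart L b -> x \in Defs.total L.
Proof. by case: b => xL; [apply: (subvP (addvSr _ _))|apply: (subvP (addvSl _ _))]. Qed.

Lemma vsval_ebr a b x y : vsval x \in spart L a -> vsval y \in spart L b ->
  vsval (ebr x y) = sbr (vsval x) (vsval y).
Proof. by move=> xa yb; rewrite vsprojK // (mem_total (pg_sbr gL xa yb)). Qed.

Lemma ebr_parity a b x y : vsval x \in spart L a -> vsval y \in spart L b ->
  vsval (ebr x y) \in spart L (a (+) b).
Proof. by move=> xa yb; rewrite (vsval_ebr xa yb) (pg_sbr gL). Qed.

Lemma ebr_linear z : linear (@ebr K L z).
Proof. by move=> a x y; rewrite /ebr linearP (pg_linr gL) linearP. Qed.

Lemma elt_split x : exists x0 x1 : elt L,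
  [/\ x = x0 + x1, vsval x0 \in spart L false & vsval x1 \in spart L true].
Proof.
have /memv_addP[u u0 [v v1 xuv]] := valP x.
exists (vsproj _ u), (vsproj _ v); rewrite !vsprojK ?(mem_total u0) ?(mem_total v1) //.
by split=> //; apply: val_inj; rewrite /= !vsprojK ?(mem_total u0) ?(mem_total v1).
Qed.

Lemma relative_even p f x s : relative_cochain p f ->
  x \in s -> vsval x \in spart L false -> f s = 0.
Proof. by move=> rf; case/splitPr => s1 s2 /(rc_basic rf). Qed.

Lemma relative_swap p f a b x y s1 s2 : relative_cochain p f ->
  vsval x \in spart L a -> vsval y \in spart L b ->
  f (s1 ++ x :: y :: s2) = f (s1 ++ y :: x :: s2).
Proof.
move=> rf xa yb; case: a xa => xa; last first.
  by rewrite !(relative_even (x := x) rf) // mem_cat !inE eqxx ?orbT.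
case: b yb => yb; last first.
  by rewrite !(relative_even (x := y) rf) // mem_cat !inE eqxx ?orbT.
by rewrite (rc_alternating rf _ _ xa yb) /= expr1 opprK mul1r.
Qed.

Definition ishom x := (vsval x \in spart L false) || (vsval x \in spart L true).

Lemma ishomP x : reflect (exists b, vsval x \in spart L b) (ishom x).
Proof.
by apply: (iffP orP) => [[]|[[]]] xb; [exists false|exists true|right|left].
Qed.

Lemma relative_front p f y s1 s2 : relative_cochain p f ->
  ishom y -> all ishom s1 -> f (s1 ++ y :: s2) = f (y :: s1 ++ s2).
Proof.
move=> rf hy; elim/last_ind: s1 s2 => [|s1 x IH] s2 //; rewrite all_rcons => /andP[hx hs].
have /ishomP[a xa] := hx; have /ishomP[b yb] := hy.
by rewrite !cat_rcons (relative_swap _ _ rf xa yb) IH.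
Qed.

Lemma homogeneousP s e : homogeneous s e ->
  size e = size s /\ forall i, (i < size s)%N -> vsval s`_i \in spart L (nth false e i).
Proof.
rewrite /homogeneous all2E => /andP[/eqP szE /(all_nthP (0, false)) H]; split=> // i hi.
by have := H i; rewrite size_zip -szE minnn nth_zip //=; apply.
Qed.

Lemma mem_omit2 s i j k : (i < j)%N -> (k < size s)%N -> k != i -> k != j ->
  s`_k \in omit2 s i j.
Proof.
move=> ij ks ki kj; rewrite /omit2 !mem_cat.
have [k_i|i_k] := ltnP k i.
  by rewrite -(nth_take 0 k_i s) mem_nth // size_take; case: ifP.
have [k_j|j_k] := ltnP k j.
  apply/orP; right; apply/orP; left.
  have -> : s`_k = (drop i.+1 (take j s))`_(k - i.+1).
    by rewrite nth_drop nth_take ?subnKC //; lia.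
  apply: mem_nth; have -> : size (drop i.+1 (take j s)) = (minn j (size s) - i.+1)%N.
    by rewrite size_drop size_take.
  lia.
have -> : s`_k = (drop j.+1 s)`_(k - j.+1) by rewrite nth_drop subnKC; [|lia].
rewrite (mem_nth _ (s := drop j.+1 s)) ?orbT //.
have -> : size (drop j.+1 s) = (size s - j.+1)%N by rewrite size_drop.
lia.
Qed.

(** A term vanishes if the two bracketed arguments have equal parity, since the bracket is then
    even, or if an even argument stays outside the bracket. This covers the cases of no even
    argument and of at least two. When exactly one argument is even, the terms through it all carry
    the same sign and add up to the invariance sum of that argument. *)
Lemma differential_eq0 p f s e :
  relative_cochain p f -> homogeneous s e -> differential f s e = 0.
Proof.
move=> rf hse; have [sze hs] := homogeneousP hse.
pose T i j : K := (-1) ^+ koszul e i j * f (ebr s`_i s`_j :: omit2 s i j).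
have diffE : differential f s e = \sum_(0 <= j < size s) \sum_(0 <= i < j) T i j.
  by rewrite big_mkord; apply: eq_bigr => j _; rewrite big_mkord.
have TA i j : (i < j < size s)%N -> nth false e i = nth false e j -> T i j = 0.
  move=> ijs eij; rewrite /T (relative_even (x := ebr s`_i s`_j) rf) ?mulr0 ?mem_head //.
  have -> : false = nth false e i (+) nth false e j by rewrite eij addbb.
  by apply: ebr_parity; apply: hs; lia.
have TB i j k : (i < j < size s)%N -> (k < size s)%N -> k != i -> k != j ->
    nth false e k = false -> T i j = 0.
  move=> ijs ks ki kj ek; rewrite /T (relative_even (x := s`_k) rf) ?mulr0 //.
    by rewrite inE mem_omit2 ?orbT //; lia.
  by rewrite -ek hs.
have sum0 : (forall i j, (i < j < size s)%N -> T i j = 0) -> differential f s e = 0.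
  move=> T0; rewrite diffE big_nat big1 // => j /= js.
  by rewrite big_nat big1 // => i /= ij; apply: T0; lia.
have [/allP e1|] := boolP (all id e).
  apply: sum0 => i j ijs; apply: TA => //.
  by rewrite [LHS]e1 ?[RHS]e1 // mem_nth // sze; lia.
rewrite -has_predC => /(has_nthP false)[k ke /negbTE ek]; rewrite sze in ke.
(* With two even positions [k] and [l], a pair either leaves one of them outside the bracket or is
   the pair [k], [l] itself, whose bracket is even. *)
have [/existsP[l /andP[lk /negbTE el]]|] :=
    boolP [exists l : 'I_(size s), (l != k :> nat) && ~~ nth false e l].
  apply: sum0 => i j ijs.
  have [ki|ki] := eqVneq k i; have [kj|kj] := eqVneq k j; try lia; last exact: (TB _ _ k).
    have [lj|lj] := eqVneq (l : nat) j; last by apply: (TB _ _ l) => //; rewrite -ki.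
    by apply: TA => //; rewrite -ki -lj el.
  have [li|li] := eqVneq (l : nat) i; last by apply: (TB _ _ l) => //; rewrite -kj.
  by apply: TA => //; rewrite -kj -li el.
rewrite negb_exists => /forallP e1'.
have e1 l : (l < size s)%N -> l != k -> nth false e l.
  by move=> ls lk; have := e1' (Ordinal ls); rewrite /= lk negbK.
(* Only [k] is even, so the number of odd arguments before [l] is [l], minus one if [k] comes
   earlier. *)
have count_e l : (l <= size s)%N -> count id (take l e) = (l - (k < l))%N.
  elim: l => [|l IH] ls; first by rewrite take0.
  rewrite (take_nth false) ?sze // -cats1 count_cat IH /=; last exact: ltnW.
  have [->|lk] := eqVneq l k; first by rewrite ek ltnn ltnS leqnn; lia.
  rewrite e1 //; have -> : (k < l.+1)%N = (k < l)%N by lia.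
  by case: ltnP => /=; lia.
pose s1 := take k s; pose s2 := drop k.+1 s; pose h := s`_k.
have sE : s = s1 ++ h :: s2 by rewrite -drop_nth // cat_take_drop.
have sz1 : size s1 = k by rewrite size_takel // ltnW.
have szs : size s = (k.+1 + size s2)%N by rewrite sE size_cat /= sz1 addnS.
have h0 : vsval h \in spart L false by rewrite -ek hs.
have hom1 : all ishom s1.
  apply/(all_nthP 0) => i; rewrite sz1 => ik; rewrite nth_take //; apply/ishomP.
  by exists (nth false e i); apply: hs; lia.
have hom2 i : (i < size s2)%N -> vsval s2`_i \in spart L true.
  by move=> i2; rewrite nth_drop -(e1 (k.+1 + i)%N) ?hs //; lia.
have hom2' : all ishom s2.
  by apply/(all_nthP 0) => i i2; apply/ishomP; exists true; apply: hom2.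
have odd1 i : (i < k)%N -> vsval s1`_i \in spart L true.
  by move=> ik; rewrite nth_take // -(e1 i) ?hs //; lia.
pose r := s1 ++ s2.
have homr : all ishom r by rewrite all_cat hom1.
pose F i := f (set_nth 0 r i (ebr h r`_i)).
(* The bracket moves from the front to position [i]; relative cochains are symmetric on homogeneous
   arguments, so no sign appears. *)
have FE i : (i < size r)%N -> f (ebr h r`_i :: take i r ++ drop i.+1 r) = F i.
  move=> ir; rewrite /F set_nthE ir -(relative_front _ rf) //.
    have /allP/(_ _ (mem_nth 0 ir))/ishomP[b rb] := homr.
    by apply/ishomP; exists (false (+) b); apply: ebr_parity.
  by apply/allP => x /mem_take/(allP homr).
have szr : size r = (k + size s2)%N by rewrite size_cat sz1.
(* The Koszul exponent is 2i + k; the extra sign comes from exchanging the entries of the bracket so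
   that [h] acts from the left. *)
have TL i : (i < k)%N -> T i k = - (-1) ^+ k * F i.
  move=> ik; rewrite -FE; last by lia.
  rewrite /r nth_cat sz1 ik take_cat sz1 ik drop_cat sz1.
  have -> : (if (i.+1 < k)%N then drop i.+1 s1 ++ s2 else drop (i.+1 - k) s2) = drop i.+1 s1 ++ s2.
    case: ltnP => // k_i; have -> : k = i.+1 by lia.
    by rewrite subnn drop0 drop_oversize // sz1.
  rewrite /T /koszul ek (e1 i) ?count_e ?(ltnW ik) //; try lia.
  have -> : (i + k + true * false + true * (i - (k < i)) + false * (k - (k < k)) = i.*2 + k)%N.
    by rewrite ltnNge (ltnW ik) /=; lia.
  rewrite exprD -mul2n exprM sqrrN !expr1n mul1r mulNr -mulrN; congr (_ * _).
  have -> : ebr s`_i s`_k = (-1) *: ebr h s1`_i.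
    apply: val_inj; rewrite scaleN1r /= nth_take //.
    have s_i : vsval s`_i \in spart L true by rewrite -(nth_take _ ik) odd1.
    by rewrite (vsval_ebr s_i h0) (vsval_ebr h0 s_i) (pg_skew gL).
  have -> : omit2 s i k = take i s1 ++ drop i.+1 s1 ++ s2.
    by rewrite /omit2 /s1 take_takel // ltnW.
  by rewrite -[_ :: _]cat0s multilinearZ ?mulN1r //; apply: rc_multilinear rf.
(* Here [h] already stands on the left and the exponent is 2(k + l) + k + 1, so the sign agrees with
   the one found for the partners before [k]. *)
have TR l : (l < size s2)%N -> T k (k.+1 + l)%N = - (-1) ^+ k * F (k + l)%N.
  move=> l2; rewrite -FE; last by lia.
  rewrite /r nth_cat sz1 ltnNge leq_addr /= addKn take_cat sz1 ltnNge leq_addr /= addKn.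
  rewrite drop_cat sz1 ltnNge -addnS leq_addr /= addKn.
  rewrite /T /koszul ek (e1 (k.+1 + l)%N) ?count_e //; try lia.
  have -> : (k + (k.+1 + l) + false * true + false * (k - (k < k)) +
      true * (k.+1 + l - (k < k.+1 + l)) = (k + l).*2 + k.+1)%N.
    have -> : (k < k.+1 + l)%N by lia.
    by rewrite /=; lia.
  rewrite exprD -mul2n exprM sqrrN !expr1n mul1r exprS mulN1r; congr (_ * f (_ :: _)).
    by rewrite nth_drop.
  rewrite /omit2 -catA addnC -take_drop addnC -addnS drop_drop; congr (_ ++ (_ ++ drop _ _)).
  by rewrite addnC.
rewrite diffE szs sum_pairs_through => [|i j ijs ik jk]; last first.
  by apply: (TB _ _ k) => //; rewrite ?szs 1?eq_sym //; lia.
rewrite [X in X + _]big_nat (eq_bigr _ (fun i ik => TL i ik)) -big_nat.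
rewrite [X in _ + X]big_nat (eq_bigr _ (fun i ik => TR i ik)) -big_nat.
rewrite -!mulr_sumr -mulrDr.
have -> : \sum_(0 <= i < k) F i + \sum_(0 <= l < size s2) F (k + l)%N = 0; last by rewrite mulr0.
rewrite -[RHS](rc_invariant rf r h0).
transitivity (\sum_(0 <= i < size r) F i); last by rewrite big_mkord.
rewrite szr [RHS](big_cat_nat (n := k)) ?leq_addr //=; congr (_ + _).
rewrite [RHS](_ : _ = \sum_(0 + k <= i < k + size s2) F i); last by rewrite add0n.
rewrite big_addn addKn; apply: eq_bigr => i _; by rewrite addnC.
Qed.

End RelativeCochains.

(** * Cohomology classes are relative cochains *)

Section Cohomology.
Variables (K : fieldType) (L : superalgebra K).
Hypothesis gL : parity_graded L.
Implicit Types (f g : cochain L) (x y h : elt L) (s : seq (elt L)).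

Lemma elt_ext x y : vsval x = vsval y -> x = y.
Proof. exact: val_inj. Qed.

Lemma cochain0_relative p : relative_cochain p (0 : cochain L).
Proof.
split=> //=; first by move=> a x y s1 s2; rewrite mulr0 addr0.
- by move=> a b x y s1 s2 _ _; rewrite mulr0.
- by move=> h s _; rewrite big1.
Qed.

Lemma coboundary0 p : coboundary p (0 : cochain L).
Proof.
case: p => //= p; exists 0; first exact: cochain0_relative.
by move=> s e hs; rewrite (differential_eq0 gL (cochain0_relative p) hs).
Qed.

Lemma coboundary_homogeneous p f s e : coboundary p f -> homogeneous s e -> f s = 0.
Proof.
case: p => [->|p [g rg fg] hs] //.
by rewrite (fg _ _ hs) (differential_eq0 gL rg hs).
Qed.

Lemma all_ishom_homogeneous s : all (ishom (L := L)) s -> exists e, homogeneous s e.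
Proof.
elim: s => [|x s IH] /=; first by exists [::].
by case/andP => /ishomP[b xb] /IH[e se]; exists (b :: e); rewrite /homogeneous /= xb.
Qed.

Lemma spanned_ishom : spanned (fun _ : elt L => True) (fun x => ishom x).
Proof.
move=> x _; have [x0 [x1 [-> h0 h1]]] := elt_split x.
exists [:: (1, x0); (1, x1)]; first by rewrite !big_cons big_nil !scale1r addr0.
by move=> y; rewrite !inE => /orP[]/eqP->; rewrite /ishom ?h0 ?h1 ?orbT.
Qed.

(** A coboundary is only prescribed on homogeneous arguments, where it is 0 by [differential_eq0];
    multilinearity carries this to all arguments. Equality in cohomology is therefore equality of
    multilinear cochains. *)
Lemma coboundary_multilinear p f : multilinear f -> coboundary p f -> f = 0.
Proof.
move=> mf cf; apply/funext; apply: (multilinear_ext spanned_ishom) => //.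
  by move=> a x y s1 s2; rewrite mulr0 addr0.
move=> s hs; have /all_ishom_homogeneous[e se] : all (ishom (L := L)) s by apply/allP.
exact: coboundary_homogeneous cf se.
Qed.

Lemma cocycleE p f : cocycle p f <-> relative_cochain p f.
Proof.
split=> [[]//|rf]; split=> // s e hs; exact: (differential_eq0 gL rf hs).
Qed.

Lemma elt_spanned (A Q : ambient L -> Prop) :
    (forall v, v \in spart L true -> A v) -> spanned A (fun v => v \in spart L true /\ Q v) ->
  spanned (fun _ : elt L => True)
    (fun x => vsval x \in spart L false \/ vsval x \in spart L true /\ Q (vsval x)).
Proof.
move=> subA spanQ x _; have [x0 [x1 [-> h0 h1]]] := elt_split x.
have [r xr Qr] := spanQ _ (subA _ h1).
exists ((1, x0) :: [seq (w.1, vsproj _ w.2) | w <- r]) => [|y].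
  rewrite big_cons scale1r big_map; congr (_ + _); apply: elt_ext.
  rewrite linear_sum {1}xr; apply: eq_big_seq => y /Qr[yL _].
  by rewrite /= vsprojK // (mem_total yL).
rewrite inE => /orP[/eqP->|/mapP[z /Qr[zL Qz] ->]]; first by left.
by right; rewrite /= vsprojK // (mem_total zL).
Qed.

(** Used when a projection after an inclusion is the identity on odd vectors but not on even ones:
    on relative cochains it still induces the identity. *)
Lemma relative_mod_even p f (u : elt L -> elt L) s : relative_cochain p f ->
  (forall x, vsval (u x - x) \in spart L false) -> f (map u s) = f s.
Proof.
move=> rf hu; suff: forall s1, f (s1 ++ map u s) = f (s1 ++ s) by move/(_ [::]).
elim: s => [|x s IH] s1 //=.
rewrite -[u x](subrK x) multilinearD; last exact: rc_multilinear rf.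
by rewrite (rc_basic rf) // add0r -!cat_rcons IH.
Qed.

Lemma dact_eigen f (D : elt L -> elt L) (l : seq (elt L * K)) :
  multilinear f -> (forall w, w \in l -> D w.1 = w.2 *: w.1) ->
  dact D f (map fst l) = (\sum_(w <- l) w.2) * f (map fst l).
Proof.
elim: l f => [|w l IH] f mf Dl; first by rewrite big_nil mul0r /dact big_ord0.
rewrite /= dact_cons big_cons mulrDl IH ?Dl ?mem_head //; last 2 first.
- exact: multilinear_cons.
- by move=> z zl; apply: Dl; rewrite inE zl orbT.
by rewrite -[_ :: map _ _]cat0s multilinearZ.
Qed.

End Cohomology.

(** * Isomorphisms induced by linear maps *)

Section Pullback.
Variables (K : fieldType) (L L' : superalgebra K).
Hypotheses (gL : parity_graded L) (gL' : parity_graded L').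
Variable u : {linear elt L' -> elt L}.
Implicit Types (f g : cochain L) (s : seq (elt L')).

Lemma pullback_multilinear f : multilinear f -> multilinear (pullback u f).
Proof. by move=> mf a x y s1 s2; rewrite /pullback !map_cat /= linearP mf. Qed.

Lemma cup_map f g s : cup f g (map u s) = cup (pullback u f) (pullback u g) s.
Proof.
elim: s f g => [|x s IH] f g; first by rewrite !cup_nil.
by rewrite /= !cup_cons !IH.
Qed.

Lemma dact_pullback (D : elt L -> elt L) (D' : elt L' -> elt L') f s :
  (forall x, u (D' x) = D (u x)) -> dact D' (pullback u f) s = dact D f (map u s).
Proof.
move=> uD; elim: s f => [|x s IH] f; first by rewrite /dact !big_ord0.
rewrite /= !dact_cons -(IH (fun w => f (u x :: w))); congr (_ + _).
by rewrite /pullback /= uD.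
Qed.

Lemma pullback_relative p f : relative_cochain p f ->
    (forall b x, vsval x \in spart L' b -> vsval (u x) \in spart L b) ->
    (forall h s, vsval h \in spart L' false -> dact (ebr h) (pullback u f) s = 0) ->
  relative_cochain p (pullback u f).
Proof.
move=> rf hu inv_f; split=> //.
- by move=> s hs; rewrite /pullback (rc_degree rf) // size_map.
- exact/pullback_multilinear/(rc_multilinear rf).
- by move=> a b x y s1 s2 /hu xa /hu yb; rewrite /pullback !map_cat /= (rc_alternating rf _ _ xa yb).
- by move=> x s1 s2 /hu x0; rewrite /pullback map_cat /= (rc_basic rf).
Qed.

(** Multilinear coboundaries being zero, the map on cohomology is the pullback of cochains itself,
    and units and products are respected on the nose. Only injectivity and surjectivity remain; [dA]
    and [dB] stand for cocycles or for cocycles with invariant class. *)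
Lemma pullback_graded_iso (dA : nat -> cochain L -> Prop) (dB : nat -> cochain L' -> Prop) :
    (forall p f, dA p f -> relative_cochain p f) ->
    (forall p f, dA p f -> dB p (pullback u f)) ->
    (forall p f, dA p f -> pullback u f =1 (fun=> 0) -> f =1 (fun=> 0)) ->
    (forall p (f' : cochain L'), dB p f' -> exists2 g, dA p g & pullback u g =1 f') ->
  @graded_iso K
    (GradedAlgebra dA (@coboundary K L) (@cochain1 K L) (@cup K L))
    (GradedAlgebra dB (@coboundary K L') (@cochain1 K L') (@cup K L'))
    (fun _ => pullback u).
Proof.
move=> relA AB inj onto; split=> //=.
- move=> p a x y _ _; have -> : pullback u (a *: x + y) - (a *: pullback u x + pullback u y) = 0.
    by apply/funext => s; apply: subrr.
  exact: coboundary0.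
- by apply/funext => -[|x s]; apply: subrr.
- move=> p q x y _ _; have -> : pullback u (cup x y) = cup (pullback u x) (pullback u y).
    by apply/funext => s; apply: cup_map.
  by rewrite subrr; apply: coboundary0.
- move=> p f Af; have mf := rc_multilinear (relA _ _ Af); split=> [cf|cf].
    have uf0 := coboundary_multilinear gL' (pullback_multilinear mf) cf.
    have -> : f = 0; last exact: coboundary0.
    by apply/funext; apply: inj Af _ => s; rewrite uf0.
  have -> : pullback u f = 0; last exact: coboundary0.
  by rewrite (coboundary_multilinear gL mf cf); apply/funext.
- move=> p f' /onto[g Ag /funext <-]; exists g => //.
  by rewrite subrr; apply: coboundary0.
Qed.

End Pullback.

(** * Cohomology when the even part acts trivially *)

Section CentralEvenPart.
Variables (K : fieldType) (L : superalgebra K).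
Hypothesis charK : forall k, k.+1%:R != 0 :> K.
Hypothesis gL : parity_graded L.
Hypothesis even_central : forall b x y,
  x \in spart L false -> y \in spart L b -> sbr x y = 0.

Let V1 : {vspace ambient L} := spart L true.
Let n := \dim V1.

Lemma ebr_even h x : vsval h \in spart L false -> ebr h x = 0.
Proof.
move=> h0; have [x0 [x1 [-> xe xo]]] := elt_split x.
apply: elt_ext; rewrite -[x0]scale1r (ebr_linear gL) scale1r linearD /=.
by rewrite (vsval_ebr gL h0 xe) (vsval_ebr gL h0 xo) (even_central h0 xe) (even_central h0 xo) addr0.
Qed.

Definition odd_basis (i : 'I_n) : elt L := vsproj _ (vbasis V1)`_i.

Lemma capLR : (V1 :&: spart L false)%VS = 0%VS.
Proof. by rewrite capvC (pg_cap gL). Qed.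

(** The coordinate is taken after projecting to the odd part, so that polarized polynomials in these
    coordinates vanish on even arguments. *)
Definition odd_coord (i : 'I_n) (x : elt L) : K^o :=
  coord (vbasis V1) i (daddv_pi V1 (spart L false) (vsval x)).

Lemma odd_coord_linear i : linear (odd_coord i).
Proof. by move=> a x y; rewrite /odd_coord !linearP. Qed.

HB.instance Definition _ i := GRing.isLinear.Build K (elt L) K^o _ (odd_coord i) (odd_coord_linear i).

Lemma odd_basis_odd i : vsval (odd_basis i) \in V1.
Proof.
have Xi : (vbasis V1)`_i \in V1 by apply: vbasis_mem; rewrite mem_nth ?size_tuple.
by rewrite vsprojK // (mem_total Xi).
Qed.

Lemma odd_coord_even i x : vsval x \in spart L false -> odd_coord i x = 0.
Proof.
move=> x0; rewrite /odd_coord; have := @daddv_pi_add _ _ V1 (spart L false) (vsval x) capLR.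
rewrite (daddv_pi_id _ x0) ?(pg_cap gL) // => /(_ (subvP (addvSr _ _) _ x0)).
by move/eqP; rewrite -subr_eq0 addrK => /eqP->; rewrite linear0.
Qed.

Lemma odd_coord_basis i j : odd_coord i (odd_basis j) = (i == j)%:R.
Proof.
rewrite /odd_coord daddv_pi_id ?capLR ?odd_basis_odd // vsprojK; last first.
  by apply: (mem_total (b := true)); rewrite vbasis_mem // mem_nth ?size_tuple.
by rewrite coord_free ?(basis_free (vbasisP _)) // eq_sym.
Qed.

Lemma odd_coordE x : vsval x \in V1 -> x = \sum_i (odd_coord i x : K) *: odd_basis i.
Proof.
move=> x1; apply: elt_ext; rewrite linear_sum [LHS](coord_vbasis x1).
apply: eq_bigr => i _; rewrite linearZ /odd_coord daddv_pi_id ?capLR //= vsprojK //.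
by apply: (mem_total (b := true)); rewrite vbasis_mem // mem_nth ?size_tuple.
Qed.

Lemma odd_basis_spanned : spanned (fun _ : elt L => True)
  (fun x => vsval x \in spart L false \/ exists i, x = odd_basis i).
Proof.
move=> x _; have [x0 [x1 [-> xe xo]]] := elt_split x.
exists ((1, x0) :: [seq (odd_coord i x1 : K, odd_basis i) | i <- enum 'I_n]).
  by rewrite big_cons scale1r big_map {1}(odd_coordE xo) big_enum.
move=> y; rewrite inE => /orP[/eqP->|/mapP[i _ ->]]; first by left.
by right; exists i.
Qed.

Lemma relative_basis_swap p f : relative_cochain p f -> forall i k s1 s2,
  f (s1 ++ odd_basis i :: odd_basis k :: s2) = f (s1 ++ odd_basis k :: odd_basis i :: s2).
Proof. by move=> rf i k s1 s2; apply: (relative_swap _ _ rf); apply: odd_basis_odd. Qed.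

(** A relative cochain is determined by its values on the odd basis vectors, and [mcoeff_sympoly]
    reads these off the polynomial. *)
Lemma sympoly_eq0 p f : relative_cochain p f -> sympoly odd_basis p f = 0 -> f = 0.
Proof.
move=> rf f0; apply/funext; apply: (multilinear_ext odd_basis_spanned).
- exact: rc_multilinear rf.
- by move=> a x y s1 s2; rewrite mulr0 addr0.
move=> s hs; have [/hasP[x xs x0]|] := boolP (has (fun x => vsval x \in spart L false) s).
  exact: (relative_even rf xs x0).
rewrite -all_predC => /allP s1.
have [t ->] : exists t, s = map odd_basis t.
  elim: s hs s1 => [|x s IH] hs s1; first by exists [::].
  have [|t ->] := IH (fun y ys => hs y (mem_behead (s := x :: s) ys)).
    by move=> y ys; apply: s1; rewrite inE ys orbT.
  have [x0|[i ->]] := hs x (mem_head _ _); last by exists (i :: t).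
  by have := s1 x (mem_head _ _); rewrite /= x0.
have [szt|szt] := eqVneq (size t) p; last by rewrite (rc_degree rf) ?size_map.
rewrite -(mcoeff_sympoly charK (relative_basis_swap rf) szt) f0.
have -> : foldl (fun P i => mderiv i P) 0 t = 0 :> {mpoly K[n]}; last by rewrite mcoeff0.
by elim: t {szt} => //= i t IH; rewrite mderiv0.
Qed.

Lemma polar_relative p (P : {mpoly K[n]}) :
  P \is p.-homog -> relative_cochain p (polar odd_coord P).
Proof.
move=> hP; have ml := polar_multilinear odd_coord P.
have ev x s1 s2 : vsval x \in spart L false -> polar odd_coord P (s1 ++ x :: s2) = 0.
  move=> x0; rewrite /polar foldl_cat /=.
  have -> Q : dirderiv odd_coord Q x = 0.
    by rewrite /dirderiv big1 // => i _ /=; rewrite odd_coord_even // scale0r.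
  by elim: s2 => [|y s2 IH] /=; rewrite ?mcoeff0 // /dirderiv big1 // => i _; rewrite mderiv0 scaler0.
split=> //.
- by move=> s; apply: polar_degree.
- move=> a b x y s1 s2 xa yb; case: a xa => xa; last first.
    by rewrite ev // -cat_rcons ev ?mulr0.
  case: b yb => yb; last by rewrite -cat_rcons !ev ?mulr0.
  by rewrite polar_sym /= expr1 opprK mul1r.
- move=> h s h0; rewrite big1 // => i _; rewrite (ebr_even _ h0) set_nthE ltn_ord.
  exact: multilinear0.
Qed.

Lemma cohomology_sym : graded_isomorphic (cohomology L) (sym_dual K n).
Proof.
exists (fun p f => sympoly odd_basis p f); split=> /=.
- by move=> p f _; apply: sympoly_homog.
- by move=> p a x y _ _; rewrite -sympoly_linear subrr.
- by rewrite /cochain1 eqxx subrr.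
- move=> p q x y [rx _] [ry _]; rewrite sympoly_cup //.
  have pq : (p < (p + q).+1)%N by rewrite ltnS leq_addr.
  rewrite (bigD1 (Ordinal pq)) //= addKn big1 ?addr0 ?subrr // => i.
  rewrite -val_eqE /= => ip; rewrite sympoly0 ?mul0r // => s si.
  by rewrite (rc_degree rx) // si.
- move=> p f [rf _]; split=> [f0|cf].
    by rewrite (sympoly_eq0 rf f0); apply: coboundary0.
  rewrite (coboundary_multilinear gL (rc_multilinear rf) cf).
  exact: sympoly0.
- move=> p P hP; exists (polar odd_coord P).
    exact/(cocycleE gL)/polar_relative.
  by rewrite sympoly_polar ?subrr // => i j; apply: odd_coord_basis.
Qed.

End CentralEvenPart.

Lemma linfun_linear (K : fieldType) (U W : vectType K) (f : U -> W) x :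
  linear f -> linfun f x = f x.
Proof.
move=> lf; pose F := GRing.isLinear.Build K U W _ f lf.
by pose fF : {linear U -> W} := HB.pack f F; rewrite (_ : f = fF) // lfunE.
Qed.

Lemma memv_kernel (K : fieldType) (U W : vectType K) (f : U -> W) x :
  linear f -> (x \in kernel f) = (f x == 0).
Proof. by move=> lf; rewrite memv_ker linfun_linear. Qed.

(* P y a means that y is a weight vector of weight a for both the Cartan      *)
(* subalgebra and the torus, which have the same parametrisation by k         *)
(* coordinates, additively and multiplicatively.                              *)
Record torus_weights (K : fieldType) (g : classical_datum K) (k : nat)
    (P : ambient (calg g) -> {ffun 'I_k -> int} -> Prop) : Prop := TorusWeights {
  tw_span : spanned (fun v => v \in cf1 g) (fun v => v \in cf1 g /\ exists a, P v a);
  tw_cartan : forall h, h \in ct0 g -> exists y : 'I_k -> K,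
    forall v a, P v a -> sbr h v = (\sum_j (a j)%:~R * y j) *: v;
  tw_cartan_onto : forall y : 'I_k -> K, exists2 h, h \in ct0 g &
    forall v a, P v a -> sbr h v = (\sum_j (a j)%:~R * y j) *: v;
  tw_torus : forall phi, ctorus g phi -> exists2 z : 'I_k -> K, (forall j, z j != 0) &
    forall v a, P v a -> phi v = (\prod_j z j ^ a j) *: v;
  tw_torus_onto : forall z : 'I_k -> K, (forall j, z j != 0) ->
    exists2 phi, ctorus g phi & forall v a, P v a -> phi v = (\prod_j z j ^ a j) *: v }.

(** The facts about a type on which the cohomological argument rests. In [tr_fff] the even part of f
    acts trivially on f_1; in [tr_grading] the eigenvalues of H are minus successors, so that a
    nonempty sum of them is nonzero in characteristic zero. *)
Record triangular (K : fieldType) (g : classical_datum K) : Prop := Triangular {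
  tr_b : parity_graded (b_alg g);
  tr_cap : (cf1 g :&: cu1 g)%VS = 0%VS;
  tr_tt : forall h h', h \in ct0 g -> h' \in ct0 g -> sbr h h' = 0;
  tr_tf : forall h x, h \in ct0 g -> x \in cf1 g -> sbr h x \in cf1 g;
  tr_tu : forall h x, h \in ct0 g -> x \in cu1 g -> sbr h x \in cu1 g;
  tr_ub : forall h x, h \in cu0 g -> x \in cb1 g -> sbr h x \in cu1 g;
  tr_ff : forall x y, x \in cf1 g -> y \in cf1 g -> sbr x y \in ct0 g;
  tr_fff : forall x y z, x \in cf1 g -> y \in cf1 g -> z \in cf1 g ->
    sbr (sbr x y) z = 0;
  tr_grading : exists2 H, H \in ct0 g & (forall x, x \in cf1 g -> sbr H x = 0) /\
    spanned (fun v => v \in cu1 g)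
      (fun v => v \in cu1 g /\ exists n, sbr H v = - n.+1%:R *: v);
  tr_torus_linear : forall phi, ctorus g phi -> linear phi;
  tr_torus_cartan : forall phi h, ctorus g phi -> h \in ct0 g -> phi h = h;
  tr_weights : exists k P, @torus_weights K g k P }.

(** A positive power of 2 minus 1 is a positive integer, hence nonzero in [K]. So 2 is a torus
    parameter of infinite order, able to detect an integral exponent. *)
Lemma expr2z_eq1 (K : fieldType) (a : int) :
  (forall k, k.+1%:R != 0 :> K) -> (2 : K) ^ a = 1 -> a = 0.
Proof.
move=> charK; have pow n : (2 : K) ^+ n = 1 -> n = 0%N.
  case: n => // n /eqP; rewrite -subr_eq0 -natrX.
  have -> : (2 ^ n.+1 = (2 ^ n.+1).-2.+2)%N.
    by have := expn_gt0 2 n; rewrite expnS; lia.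
  by rewrite -natr1 addrK (negPf (charK _)).
case: a => n /=; first by move=> /pow->.
by move=> /(congr1 (@GRing.inv K)); rewrite invr1 NegzE -exprnN invrK => /pow.
Qed.

(** * Triangular decompositions *)

Section Triangular.
Variables (K : fieldType) (g : classical_datum K).
Hypothesis charK : forall k, k.+1%:R != 0 :> K.
Hypothesis trg : triangular g.

Let V := ambient (calg g).
Let br : V -> V -> V := @sbr K (calg g).

Lemma intr_eq0_char (a : int) : a%:~R = 0 :> K -> a = 0.
Proof.
case: a => [[|n]|n] //.
  by move=> /eqP; rewrite -pmulrn (negPf (charK n)).
by move=> /eqP; rewrite NegzE mulrNz oppr_eq0 -pmulrn (negPf (charK n)).
Qed.

Lemma br_linear_r z : linear (br z). Proof. exact: pg_linr (tr_b trg) z. Qed.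
Lemma br_linear_l z : linear (br^~ z). Proof. exact: pg_linl (tr_b trg) z. Qed.
Lemma br0r z : br z 0 = 0.
Proof. by have := br_linear_r z (-1) 0 0; rewrite scaler0 addr0 scaleN1r addNr. Qed.
Lemma br0l z : br 0 z = 0.
Proof. by have := br_linear_l z (-1) 0 0; rewrite scaler0 addr0 scaleN1r addNr. Qed.
Lemma brDr z x y : br z (x + y) = br z x + br z y.
Proof. by have := br_linear_r z 1 x y; rewrite !scale1r. Qed.
Lemma brDl z x y : br (x + y) z = br x z + br y z.
Proof. by have := br_linear_l z 1 x y; rewrite !scale1r. Qed.
Lemma brZr z a x : br z (a *: x) = a *: br z x.
Proof. by have := br_linear_r z a x 0; rewrite !addr0 br0r addr0. Qed.
Lemma brZl z a x : br (a *: x) z = a *: br x z.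
Proof. by have := br_linear_l z a x 0; rewrite !addr0 br0l addr0. Qed.

Lemma br_span (A B C : {vspace V}) :
    (forall x y, x \in A -> y \in B -> br x y \in C) -> (bracket_space A B <= C)%VS.
Proof.
move=> ABC; apply/span_subvP => v /allpairsP[[x y] [/= xA yB ->]].
by apply: ABC; apply: vbasis_mem.
Qed.

Lemma f0_sub_t0 : (cf0 g <= ct0 g)%VS.
Proof. exact: br_span (tr_ff trg). Qed.

Lemma f0_br x y : x \in cf1 g -> y \in cf1 g -> br x y \in cf0 g.
Proof.
move=> xf yf; rewrite (coord_vbasis xf) (coord_vbasis yf).
have sum_l (I : Type) (r : seq I) (F : I -> V) z : br (\sum_(i <- r) F i) z = \sum_(i <- r) br (F i) z.
  by apply: (big_morph (br^~ z) (brDl z) (br0l z)).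
have sum_r (I : Type) (r : seq I) (F : I -> V) z : br z (\sum_(i <- r) F i) = \sum_(i <- r) br z (F i).
  by apply: (big_morph (br z) (brDr z) (br0r z)).
rewrite sum_l memv_suml // => i _; rewrite sum_r memv_suml // => j _.
rewrite brZl brZr !memvZ //; apply: memv_span; apply/allpairsP.
exists ((vbasis (cf1 g))`_i, (vbasis (cf1 g))`_j); split=> //=; apply: mem_nth; by rewrite size_tuple.
Qed.

Lemma f0_central h x : h \in cf0 g -> x \in cf1 g -> br h x = 0.
Proof.
move=> hf xf; suff: h \in kernel (br^~ x) by rewrite (memv_kernel _ (br_linear_l x)) => /eqP.
apply: subvP hf; apply: br_span => y z yf zf.
by rewrite (memv_kernel _ (br_linear_l x)); apply/eqP/(tr_fff trg).
Qed.

Lemma t0_sub_b0 : (ct0 g <= cb0 g)%VS. Proof. exact: addvSl. Qed.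
Lemma f1_sub_b1 : (cf1 g <= cb1 g)%VS. Proof. exact: addvSl. Qed.
Lemma f0_sub_b0 : (cf0 g <= cb0 g)%VS. Proof. exact: subv_trans f0_sub_t0 t0_sub_b0. Qed.

Lemma parity_graded_sub (a0 a1 : {vspace V}) : (a0 <= cb0 g)%VS -> (a1 <= cb1 g)%VS ->
    (forall x y, x \in a0 -> y \in a0 -> br x y \in a0) ->
    (forall x y, x \in a0 -> y \in a1 -> br x y \in a1) ->
    (forall x y, x \in a1 -> y \in a1 -> br x y \in a0) ->
  parity_graded (subalgebra a0 a1).
Proof.
move=> /subvP sub0 /subvP sub1 a00 a01 a11; split.
- apply/eqP; rewrite -subv0 -(pg_cap (tr_b trg)) capvS //; exact/subvP.
- exact: pg_linl (tr_b trg).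
- exact: pg_linr (tr_b trg).
- case=> [] [] x y /= xa yb; [exact: a11| |exact: a01|exact: a00].
  have -> : sbr x y = - sbr y x := pg_skew (tr_b trg) (sub0 _ yb) (sub1 _ xa).
  by rewrite rpredN; apply: a01.
- by move=> x y /sub0 x0 /sub1 y1; apply: pg_skew (tr_b trg) _ _ x0 y1.
Qed.

Lemma parity_graded_f : parity_graded (f_alg g).
Proof.
apply: parity_graded_sub; [exact: f0_sub_b0|exact: f1_sub_b1| | |exact: f0_br].
- move=> x y xf yf; rewrite [br _ _](tr_tt trg) ?mem0v //; exact: (subvP f0_sub_t0).
- by move=> x y xf yf; rewrite f0_central ?mem0v.
Qed.

Lemma parity_graded_t : parity_graded (t_alg g).
Proof.
apply: parity_graded_sub; [exact: t0_sub_b0|exact: f1_sub_b1| |exact: (tr_tf trg)|exact: (tr_ff trg)].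
by move=> x y xf yf; rewrite [br _ _](tr_tt trg) ?mem0v.
Qed.

Let pgf := parity_graded_f.
Let pgt := parity_graded_t.
Let pgb := tr_b trg.

Lemma f_central b x y :
  x \in spart (f_alg g) false -> y \in spart (f_alg g) b -> @sbr K (f_alg g) x y = 0.
Proof.
move=> xf; case: b => yf; first exact: f0_central.
by apply: (tr_tt trg); apply: (subvP f0_sub_t0).
Qed.

Definition tact (h : V) (x : elt (f_alg g)) : elt (f_alg g) := vsproj _ (br h (vsval x)).

Lemma tact_linear h : linear (tact h).
Proof. by move=> a x y; rewrite /tact linearP br_linear_r linearP. Qed.

HB.instance Definition _ h := GRing.isLinear.Build K _ _ _ (tact h) (tact_linear h).

Definition weighted k (P : V -> {ffun 'I_k -> int} -> Prop) (x : elt (f_alg g)) a :=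
  vsval x \in cf0 g /\ a = 0 \/ vsval x \in cf1 g /\ P (vsval x) a.

Lemma exists_weights k (P : V -> {ffun 'I_k -> int} -> Prop) s :
    (forall x, x \in s -> exists a, weighted P x a) ->
  exists2 l, s = map fst l & forall w, w \in l -> weighted P w.1 w.2.
Proof.
elim: s => [|x s IH] hs; first by exists [::].
have [|l -> hl] := IH; first by move=> y ys; apply: hs; rewrite inE ys orbT.
have [a xa] := hs x (mem_head _ _); exists ((x, a) :: l) => // w.
by rewrite inE => /orP[/eqP->|/hl].
Qed.

(** On weight vectors with total weight c, an element of t_0 multiplies the value of [F] by the sum
    of the c_j y_j, and an element of the torus multiplies it by the product of the z_j ^ c_j.
    Either invariance forces c = 0 wherever the value is nonzero, and this in turn gives the other
    invariance. Weight vectors span, so multilinearity finishes. *)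
Lemma torus_invariant p (F : cochain (f_alg g)) : relative_cochain p F ->
  (forall phi, ctorus g phi -> forall s, F (map (@induced K (f_alg g) phi) s) = F s) <->
  (forall h, h \in ct0 g -> forall s, dact (tact h) F s = 0).
Proof.
move=> rF; have mF := rc_multilinear rF; have [k [P twP]] := tr_weights trg.
have spW : spanned (fun _ : elt (f_alg g) => True) (fun x => exists a, weighted P x a).
  move=> x _; have [r xr hr] := @elt_spanned _ (f_alg g) _ _ (fun v vf => vf) (tw_span twP) x I.
  exists r => // y /hr[y0|[y1 [a Pa]]]; first by exists 0; left.
  by exists a; right.
have tact_w h (y : 'I_k -> K) : h \in ct0 g ->
    (forall v a, P v a -> sbr h v = (\sum_j (a j)%:~R * y j) *: v) ->
    forall x a, weighted P x a -> tact h x = (\sum_j (a j)%:~R * y j) *: x.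
  move=> ht hP x a [[x0 ->]|[x1 Pa]].
    rewrite big1 => [|j _]; last by rewrite ffunE mul0r.
    by rewrite scale0r /tact [br _ _](tr_tt trg) ?linear0 //; apply: subvP x0; apply: f0_sub_t0.
  by rewrite /tact [br _ _](hP _ _ Pa) linearZ /= vsvalK.
have ind_w phi (z : 'I_k -> K) : ctorus g phi -> (forall j, z j != 0) ->
    (forall v a, P v a -> phi v = (\prod_j z j ^ a j) *: v) ->
    forall x a, weighted P x a -> @induced K (f_alg g) phi x = (\prod_j z j ^ a j) *: x.
  move=> tphi z0 phiP x a [[x0 ->]|[x1 Pa]].
    rewrite big1 => [|j _]; last by rewrite ffunE expr0z.
    by rewrite scale1r /induced (tr_torus_cartan trg) ?vsvalK //; apply: subvP x0; apply: f0_sub_t0.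
  by rewrite /induced (phiP _ _ Pa) linearZ /= vsvalK.
have dactE h y (l : seq (elt (f_alg g) * {ffun 'I_k -> int})) :
    (forall w, w \in l -> weighted P w.1 w.2) ->
    (forall x a, weighted P x a -> tact h x = (\sum_j (a j)%:~R * y j) *: x) ->
    dact (tact h) F (map fst l) = (\sum_j (\sum_(w <- l) w.2 j)%:~R * y j) * F (map fst l).
  move=> hl hw; pose l' := map (fun w : _ * {ffun 'I_k -> int} => (w.1, \sum_j (w.2 j)%:~R * y j : K)) l.
  have -> : map fst l = map fst l' by rewrite -map_comp; apply: eq_map.
  rewrite dact_eigen //; last by move=> w /mapP[w' /hl ? ->]; apply: hw.
  rewrite big_map exchange_big /=; congr (_ * _); apply: eq_bigr => j _.
  by rewrite -mulr_suml rmorph_sum.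
have indE phi z (l : seq (elt (f_alg g) * {ffun 'I_k -> int})) : (forall j, z j != 0) ->
    (forall w, w \in l -> weighted P w.1 w.2) ->
    (forall x a, weighted P x a -> @induced K (f_alg g) phi x = (\prod_j z j ^ a j) *: x) ->
    F (map (@induced K (f_alg g) phi) (map fst l)) =
    (\prod_j z j ^ (\sum_(w <- l) w.2 j)) * F (map fst l).
  move=> z0 hl hw; transitivity ((\prod_(w <- l) \prod_j z j ^ w.2 j) * F (map fst l)).
    have : forall s1, F (s1 ++ map (@induced K (f_alg g) phi) (map fst l)) =
        (\prod_(w <- l) \prod_j z j ^ w.2 j) * F (s1 ++ map fst l); last by move/(_ [::]).
    elim: l hl => [|w l IH] hl s1 /=; first by rewrite big_nil mul1r.
    rewrite big_cons (hw _ _ (hl _ (mem_head _ _))) multilinearZ // -cat_rcons IH ?cat_rcons ?mulrA //.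
    by move=> w' wl; apply: hl; rewrite inE wl orbT.
  rewrite exchange_big; congr (_ * _); apply: eq_bigr => j _ /=.
  elim: l {hl hw} => [|w l IH]; first by rewrite !big_nil expr0z.
  by rewrite !big_cons IH expfzDr.
split=> [invF h ht|invF phi tphi].
  have dl := dact_multilinear (tact h : {linear _ -> _}) mF.
  apply: (multilinear_ext spW dl (g := fun=> 0)).
    by move=> a x y s1 s2; rewrite mulr0 addr0.
  move=> s /exists_weights[l -> hl]; have [y hy] := tw_cartan twP ht.
  rewrite (dactE _ y) //; last exact: tact_w.
  have [->|Fl] := eqVneq (F (map fst l)) 0; first by rewrite mulr0.
  rewrite big1 ?mul0r // => j _; suff -> : \sum_(w <- l) w.2 j = 0 by rewrite mul0r.
  (* The torus element with parameter 2 at [j] and 1 elsewhere isolates the [j]-th component of the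
     total weight. *)
  have z0 (i : 'I_k) : (if i == j then 2 else 1 : K) != 0.
    by case: ifP => _; [exact: charK 1|exact: oner_neq0].
  have [phi tphi hphi] := tw_torus_onto twP z0.
  have := invF _ tphi (map fst l); rewrite (indE _ _ _ z0 hl (ind_w _ _ tphi z0 hphi)).
  move/(congr1 (fun c => c / F (map fst l))); rewrite mulfK // divff //.
  have -> : \prod_i (if i == j then 2 else 1 : K) ^ (\sum_(w <- l) w.2 i)
      = 2 ^ (\sum_(w <- l) w.2 j).
    by rewrite (bigD1 j) //= eqxx [X in _ * X]big1 ?mulr1 // => i /negPf->; rewrite exp1rz.
  exact: expr2z_eq1.
have ml : multilinear (fun s => F (map (@induced K (f_alg g) phi) s)).
  move=> a x y s1 s2; rewrite !map_cat /=.
  have -> : @induced K (f_alg g) phi (a *: x + y) = a *: @induced K (f_alg g) phi x + @induced K (f_alg g) phi y.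
    by rewrite /induced linearP (tr_torus_linear trg tphi) linearP.
  by rewrite mF.
apply: (multilinear_ext spW ml mF) => s /exists_weights[l -> hl].
have [z z0 hz] := tw_torus twP tphi.
rewrite (indE _ _ _ z0 hl (ind_w _ _ tphi z0 hz)).
have [->|Fl] := eqVneq (F (map fst l)) 0; first by rewrite mulr0.
rewrite big1 ?mul1r // => j _; suff -> : \sum_(w <- l) w.2 j = 0 by rewrite expr0z.
(* The additive counterpart: the element of t_0 whose parameter is the [j]-th unit vector. *)
have [h ht hy] := tw_cartan_onto twP (fun i => (i == j)%:R).
have := invF _ ht (map fst l); rewrite (dactE _ _ _ hl (tact_w _ _ ht hy)).
move/eqP; rewrite mulf_eq0 (negPf Fl) orbF.
have -> : \sum_i (\sum_(w <- l) w.2 i)%:~R * (i == j)%:R = (\sum_(w <- l) w.2 j)%:~R :> K.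
  by rewrite (bigD1 j) //= eqxx mulr1 [X in _ + X]big1 ?addr0 // => i /negPf ->; rewrite mulr0.
by move/eqP/intr_eq0_char.
Qed.

End Triangular.

(** * Comparing b, t and f through the projection onto f_1 *)

Section TriangularCohomology.
Variables (K : fieldType) (g : classical_datum K).
Hypothesis charK : forall k, k.+1%:R != 0 :> K.
Hypothesis trg : triangular g.

Let V := ambient (calg g).
Let br : V -> V -> V := @sbr K (calg g).
Let pgf := parity_graded_f trg.
Let pgt := parity_graded_t trg.
Let pgb := tr_b trg.

(** All of b_0 is killed, f_0 included, so this is not a retraction of b onto f; relative cochains
    do not see the difference. *)
Definition f1_proj : 'End(V) := daddv_pi (cf1 g) (cb0 g + cu1 g).

Lemma cap_f1 : (cf1 g :&: (cb0 g + cu1 g))%VS = 0%VS.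
Proof.
apply/eqP; rewrite -subv0; apply/subvP => x; rewrite memv_cap memv0 => /andP[xf].
case/memv_addP => b b0 [u uu xE].
have b1 : b \in cb1 g.
  rewrite (_ : b = x - u); last by rewrite xE addrK.
  by rewrite rpredB ?(subvP (addvSl _ _) _ xf) ?(subvP (addvSr _ _) _ uu).
have /eqP b00 : b == 0 by rewrite -memv0 -(pg_cap pgb) memv_cap b0.
by rewrite -memv0 -(tr_cap trg) memv_cap xf xE b00 add0r.
Qed.

Lemma f1_proj_id x : x \in cf1 g -> f1_proj x = x.
Proof. exact: daddv_pi_id cap_f1. Qed.

Lemma f1_proj_mem x : f1_proj x \in cf1 g.
Proof. exact: memv_pi. Qed.

Lemma f1_proj_eq0 x : x \in (cb0 g + cu1 g)%VS -> f1_proj x = 0.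
Proof.
move=> xu; have := daddv_pi_add cap_f1 (subvP (addvSr _ _) _ xu).
rewrite [X in _ + X]daddv_pi_id 1?capvC ?cap_f1 // => /eqP.
by rewrite -subr_eq0 addrK => /eqP.
Qed.

Lemma f1_proj_b0 x : x \in cb0 g -> f1_proj x = 0.
Proof. by move=> /(subvP (addvSl _ (cu1 g)))/f1_proj_eq0. Qed.

Lemma f1_proj_u1 x : x \in cu1 g -> f1_proj x = 0.
Proof. by move=> /(subvP (addvSr (cb0 g) _))/f1_proj_eq0. Qed.

Section Projection.
Variables a0 a1 : {vspace V}.
Definition f_proj (x : elt (subalgebra a0 a1)) : elt (f_alg g) :=
  vsproj _ (f1_proj (vsval x)).

Lemma f_proj_linear : linear f_proj.
Proof. by move=> a x y; rewrite /f_proj !linearP. Qed.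

HB.instance Definition _ := GRing.isLinear.Build K _ _ _ f_proj f_proj_linear.

Lemma vsval_f_proj x : vsval (f_proj x) = f1_proj (vsval x).
Proof. by rewrite vsprojK // (mem_total (L := f_alg g) (b := true)) // f1_proj_mem. Qed.

Variables c0 c1 : {vspace V}.
Definition incl := @inclusion K (calg g) c0 c1 a0 a1.

Lemma incl_linear : linear incl.
Proof. by move=> a x y; rewrite /incl /inclusion !linearP. Qed.

HB.instance Definition _ := GRing.isLinear.Build K _ _ _ incl incl_linear.

Lemma vsval_incl x : (c0 <= a0)%VS -> (c1 <= a1)%VS -> vsval (incl x) = vsval x.
Proof. by move=> c0a0 c1a1; rewrite vsprojK //; apply: subvP (valP x); apply: addvS. Qed.

End Projection.

Arguments f_proj {a0 a1} x.

(** Only invariance under f_0 is at stake, and f_0 is central in f. *)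
Lemma restrict_relative (a0 a1 : {vspace V}) p (F : cochain (subalgebra a0 a1)) :
    parity_graded (subalgebra a0 a1) -> (cf0 g <= a0)%VS -> (cf1 g <= a1)%VS ->
    relative_cochain p F ->
  relative_cochain p (pullback (@incl a0 a1 (cf0 g) (cf1 g)) F).
Proof.
move=> pga f0a f1a rF; apply: (pullback_relative rF).
  by case=> x /= xb; rewrite vsval_incl //; [apply: subvP xb|apply: subvP xb].
move=> h s h0; rewrite /dact big1 // => i _.
rewrite (ebr_even pgf (f_central trg)) // set_nthE ltn_ord; apply: multilinear0.
exact/pullback_multilinear/(rc_multilinear rF).
Qed.

Lemma vsval_tact h x : h \in ct0 g -> vsval (tact h x : elt (f_alg g)) = br h (vsval x).
Proof.
move=> ht; rewrite vsprojK //; have /memv_addP[x0 x0f [x1 x1f ->]] := valP x.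
rewrite (brDr trg) [X in X + _](tr_tt trg) //; last exact: (subvP (f0_sub_t0 trg) _ x0f).
by rewrite add0r (mem_total (L := f_alg g) (b := true)) //; apply: (tr_tf trg).
Qed.

(* u_0 maps f_1 + u_1 into u_1, so the projection only sees the action of t_0 *)
Lemma f_proj_br (a0 a1 : {vspace V}) (h ht hu : V) (x : elt (subalgebra a0 a1)) :
    (a0 <= cb0 g)%VS -> (a1 <= cb1 g)%VS -> parity_graded (subalgebra a0 a1) ->
    ht + hu \in a0 -> ht \in ct0 g -> hu \in cu0 g ->
  f_proj (@ebr K (subalgebra a0 a1) (vsproj _ (ht + hu)) x) = tact ht (f_proj x).
Proof.
move=> a0b a1b pga ha htt huu; apply: elt_ext; rewrite vsval_tact // !vsval_f_proj.
have [x0 [x1 [-> xe xo]]] := elt_split x.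
have hE : vsval (vsproj (Defs.total (subalgebra a0 a1)) (ht + hu)) = ht + hu.
  by rewrite vsprojK // (mem_total (L := subalgebra a0 a1) (b := false)).
have he : vsval (vsproj (Defs.total (subalgebra a0 a1)) (ht + hu)) \in spart (subalgebra a0 a1) false.
  by rewrite hE.
have -> : @ebr K (subalgebra a0 a1) (vsproj _ (ht + hu)) (x0 + x1) =
    @ebr K (subalgebra a0 a1) (vsproj _ (ht + hu)) x0 + @ebr K (subalgebra a0 a1) (vsproj _ (ht + hu)) x1.
  by rewrite -[x0 in LHS]scale1r (ebr_linear pga) scale1r.
set e0 := ebr _ x0; set e1 := ebr _ x1; rewrite !linearD /= /e0 /e1 {e0 e1}.
rewrite (vsval_ebr pga he xe) (vsval_ebr pga he xo) hE.
rewrite (f1_proj_b0 (subvP a0b _ xe)) add0r.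
rewrite f1_proj_b0 ?add0r; last first.
  have hb : ht + hu \in spart (b_alg g) false by apply: subvP ha.
  have xb : vsval x0 \in spart (b_alg g) false by apply: subvP xe.
  exact: (pg_sbr pgb hb xb).
have /memv_addP[y yf [u uu ->]] := subvP a1b _ xo.
rewrite [LHS](_ : _ = f1_proj (br ht y + br ht u + br hu (y + u))); last first.
  by rewrite -(brDr trg) -(brDl trg).
rewrite !linearD /= [f1_proj (br ht u)]f1_proj_u1 ?(tr_tu trg) //.
rewrite [f1_proj (br hu _)]f1_proj_u1 ?(tr_ub trg) //; last first.
  by rewrite memv_add.
by rewrite !addr0 (f1_proj_u1 uu) addr0 (f1_proj_id yf) f1_proj_id // (tr_tf trg).
Qed.

(** By [f_proj_br] the projection turns the action of an element of b_0 into that of its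
    t_0-component, so the t_0-invariance of [F] is inherited. *)
Lemma extend_relative (a0 a1 : {vspace V}) p (F : cochain (f_alg g)) :
    (a0 <= cb0 g)%VS -> (a1 <= cb1 g)%VS -> parity_graded (subalgebra a0 a1) ->
    relative_cochain p F -> (forall h, h \in ct0 g -> forall s, dact (tact h) F s = 0) ->
  relative_cochain p (pullback (@f_proj a0 a1) F).
Proof.
move=> a0b a1b pga rF invF; apply: (pullback_relative rF).
  case=> x /= xb; rewrite vsval_f_proj; first exact: f1_proj_mem.
  by rewrite f1_proj_b0 ?mem0v //; apply: subvP xb.
move=> h s /= h0; have /memv_addP[ht htt [hu huu hE]] := subvP a0b _ h0.
rewrite (dact_pullback (D := tact ht)) ?invF // => x.
have -> : h = vsproj (Defs.total (subalgebra a0 a1)) (ht + hu) by rewrite -hE vsvalK.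
by apply: f_proj_br => //; rewrite -hE.
Qed.

Definition invariant_f p (F : cochain (f_alg g)) :=
  cocycle p F /\ forall phi, ctorus g phi ->
    coboundary p (pullback (@induced K (f_alg g) phi) F - F).

(** Invariance of the class is invariance of the cochain, because the difference is a multilinear
    coboundary; [torus_invariant] then replaces the torus by t_0. *)
Lemma invariant_fE p F : invariant_f p F <->
  relative_cochain p F /\ forall h, h \in ct0 g -> forall s, dact (tact h) F s = 0.
Proof.
split=> [[cF iF]|[rF /(torus_invariant charK trg rF) iF]].
  have rF := (cocycleE pgf _ _).1 cF; split=> //.
  apply/(torus_invariant charK trg rF) => phi tphi s.
  have mF := rc_multilinear rF.
  have ml : multilinear (pullback (@induced K (f_alg g) phi) F - F).
    move=> a x y s1 s2.
    have indD : @induced K (f_alg g) phi (a *: x + y) =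
        a *: @induced K (f_alg g) phi x + @induced K (f_alg g) phi y.
      by rewrite /induced linearP (tr_torus_linear trg tphi) linearP.
    change (F (map (@induced K (f_alg g) phi) (s1 ++ (a *: x + y) :: s2))
        - F (s1 ++ (a *: x + y) :: s2) =
      a * (F (map (@induced K (f_alg g) phi) (s1 ++ x :: s2)) - F (s1 ++ x :: s2)) +
      (F (map (@induced K (f_alg g) phi) (s1 ++ y :: s2)) - F (s1 ++ y :: s2))).
    by rewrite !map_cat /= indD !mF; ring.
  have := congr1 (fun f : cochain (f_alg g) => f s) (coboundary_multilinear pgf ml (iF _ tphi)).
  by move/eqP; rewrite subr_eq0 => /eqP.
split=> [|phi tphi]; first exact/(cocycleE pgf).
have -> : pullback (@induced K (f_alg g) phi) F - F = 0; last exact: coboundary0.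
by apply/funext => s; apply/eqP; rewrite subr_eq0; apply/eqP/iF.
Qed.

Lemma f_proj_incl (a0 a1 : {vspace V}) x : (cf0 g <= a0)%VS -> (cf1 g <= a1)%VS ->
  (a0 <= cb0 g)%VS ->
  vsval (f_proj (@incl a0 a1 (cf0 g) (cf1 g) x) - x) \in spart (f_alg g) false.
Proof.
move=> f0a f1a a0b; rewrite linearB /= vsval_f_proj vsval_incl //.
have /memv_addP[x0 x0f [x1 x1f ->]] := valP x.
rewrite linearD /= f1_proj_b0 ?f1_proj_id ?add0r //; last first.
  exact: (subvP (f0_sub_b0 trg) _ x0f).
by rewrite opprD addrCA subrr addr0 rpredN.
Qed.

Theorem triangular_sym : graded_isomorphic (cohomology (f_alg g)) (sym_dual K (\dim (cf1 g))).
Proof. exact: (cohomology_sym charK pgf (f_central trg)). Qed.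

Theorem triangular_restriction :
  graded_iso (A := cohomology (b_alg g)) (B := invariant_cohomology (f_alg g) (ctorus g))
    (restriction_b_f g).
Proof.
pose u : {linear _ -> _} := @incl (cb0 g) (cb1 g) (cf0 g) (cf1 g).
have f0b := f0_sub_b0 trg; have f1b := f1_sub_b1 g.
apply: (@pullback_graded_iso K (b_alg g) (f_alg g) pgb pgf u (@cocycle K (b_alg g)) invariant_f).
- by move=> p f /(cocycleE pgb).
(* The restriction is t_0-invariant because t_0 lies in b_0 and the inclusion commutes with its
   action. *)
- move=> p F /(cocycleE pgb) rF; apply/invariant_fE.
  have rF' : relative_cochain p (pullback u F) by exact: restrict_relative.
  split=> // h ht s.
  have hb : h \in cb0 g by apply: (subvP (t0_sub_b0 g) _ ht).
  have hE : vsval (vsproj (Defs.total (b_alg g)) h) = h.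
    by rewrite vsprojK // (mem_total (L := b_alg g) (b := false)).
  rewrite (dact_pullback (D := @ebr K (b_alg g) (vsproj _ h))).
    by apply: (rc_invariant rF); rewrite hE.
  move=> x; apply: elt_ext; rewrite vsval_incl // vsval_tact //.
  rewrite vsprojK vsval_incl // hE //.
  have /memv_addP[x0 x0f [x1 x1f ->]] := valP x.
  rewrite (brDr trg) [X in X + _](tr_tt trg) //; last exact: (subvP (f0_sub_t0 trg) _ x0f).
  rewrite add0r (mem_total (L := b_alg g) (b := true)) //.
  exact: (subvP f1b _ (tr_tf trg ht x1f)).
(* Injectivity: it suffices to evaluate [F] on even vectors, on vectors of f_1 and on eigenvectors
   of H in u_1. If all arguments lie in f_1 the value is one of the restriction; otherwise the
   eigenvalues of H have a nonzero sum and invariance under H kills the value. *)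
- move=> p F /(cocycleE pgb) rF F0; have [H Ht [Hf spu]] := tr_grading trg.
  have Hb : H \in cb0 g by apply: (subvP (t0_sub_b0 g) _ Ht).
  have HE : vsval (vsproj (Defs.total (b_alg g)) H) = H.
    by rewrite vsprojK // (mem_total (L := b_alg g) (b := false)).
  have spb : spanned (fun v => v \in cb1 g) (fun v => v \in cb1 g /\
      (v \in cf1 g \/ exists n, br H v = - n.+1%:R *: v)).
    move=> v /memv_addP[y yf [z zu ->]]; have [r zr hr] := spu _ zu.
    exists ((1, y) :: r) => [|w]; first by rewrite big_cons scale1r zr.
    rewrite inE => /orP[/eqP->|/hr[wu hw]].
      by split; [apply: (subvP f1b _ yf)|left].
    by split; [apply: (subvP (addvSr _ _) _ wu)|right].
  have mF := rc_multilinear rF.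
  apply: (multilinear_ext (elt_spanned (L := b_alg g) (fun v vb => vb) spb) mF).
    by move=> a x y s1 s2; rewrite mulr0 addr0.
  move=> s hs; have [/hasP[x xs x0]|] := boolP (has (fun x => vsval x \in spart (b_alg g) false) s).
    exact: (relative_even rF xs x0).
  rewrite -all_predC => /allP s1.
  have [/allP sf|] := boolP (all (fun x => vsval x \in cf1 g) s).
    have -> : s = map u (map f_proj s).
      rewrite -map_comp -[LHS]map_id; apply/eq_in_map => x /sf xf /=.
      apply: elt_ext; rewrite [RHS]vsval_incl // vsval_f_proj f1_proj_id //.
    exact: F0.
  move=> /allPn[x0 x0s x0f].
  (* Each argument is paired with the opposite of its eigenvalue, a natural number that may be 0
     only on f_1. *)
  have [l [sl hl]] : exists l : seq (elt (b_alg g) * nat), s = map fst l /\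
      forall w, w \in l -> sbr H (vsval w.1) = - w.2%:R *: vsval w.1 /\
        (vsval w.1 \in cf1 g \/ w.2 != 0%N).
    elim: s {x0s x0f} hs s1 => [|x s IH] hs s1; first by exists [::].
    have [l [-> hl]] := IH (fun y ys => hs y (mem_behead (s := x :: s) ys))
      (fun y ys => s1 y (mem_behead (s := x :: s) ys)).
    have [] := hs x (mem_head _ _); first by move=> xe; have := s1 x (mem_head _ _); rewrite /= xe.
    case=> _ [xf|[n xn]].
      exists ((x, 0%N) :: l); split=> // w; rewrite inE => /orP[/eqP->|/hl//].
      by split; [rewrite oppr0 scale0r /= [LHS]Hf|left].
    exists ((x, n.+1) :: l); split=> // w; rewrite inE => /orP[/eqP->|/hl//].
    by split=> //; right.
  pose l' := map (fun w : _ * nat => (w.1, - w.2%:R : K)) l.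
  have sl' : s = map fst l' by rewrite sl -map_comp; apply: eq_map.
  have := rc_invariant rF s (_ : vsval (vsproj (Defs.total (b_alg g)) H) \in _).
  rewrite HE => /(_ Hb); rewrite -/(dact _ _ _) sl' dact_eigen //; last first.
    move=> _ /mapP[w wl ->] /=; apply: elt_ext; have [wE _] := hl _ wl.
    have w1 : vsval w.1 \in spart (b_alg g) true.
      have [|xe|[]//] := hs w.1; first by rewrite sl map_f.
      by have := s1 w.1; rewrite sl map_f //= xe => /(_ isT).
    by rewrite (vsval_ebr pgb (a := false) _ w1) ?HE // linearZ /= -wE.
  move/eqP; rewrite mulf_eq0 => /orP[|/eqP//].
  rewrite big_map -(big_map snd xpredT (fun n => - n%:R)) sumrN oppr_eq0 -natr_sum.
  have : (0 < \sum_(n <- map snd l) n)%N; last first.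
    by case: (\sum_(n <- map snd l) n)%N => // n _; rewrite (negPf (charK n)).
  move: x0s; rewrite sl => /mapP[w wl x0E]; have [_ [wf|w2]] := hl _ wl.
    by rewrite x0E wf in x0f.
  by rewrite big_map lt0n sum_nat_seq_neq0; apply/hasP; exists w.
(* Surjectivity: the extension by zero along u_1 restricts to the given cochain. *)
- move=> p F /invariant_fE[rF iF]; exists (pullback f_proj F).
    by apply/(cocycleE pgb); apply: extend_relative.
  move=> s; rewrite /pullback -map_comp; apply: (relative_mod_even _ rF) => x.
  exact: f_proj_incl.
Qed.

(** The isomorphism is the pullback along the projection of t onto f_1, with restriction from t to f
    as inverse: relative cochains on t are precisely the t_0-invariant forms on f_1. *)
Theorem triangular_invariant :
  graded_isomorphic (invariant_cohomology (f_alg g) (ctorus g)) (cohomology (t_alg g)).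
Proof.
have t0b := t0_sub_b0 g; have f1b := f1_sub_b1 g; have f0t := f0_sub_t0 trg.
exists (fun _ => pullback (@f_proj (ct0 g) (cf1 g))).
apply: (@pullback_graded_iso K (f_alg g) (t_alg g) pgf pgt f_proj invariant_f (@cocycle K (t_alg g))).
- by move=> p f /invariant_fE[].
- by move=> p F /invariant_fE[rF iF]; apply/(cocycleE pgt); apply: extend_relative.
- move=> p F /invariant_fE[rF iF] F0 s.
  rewrite -(relative_mod_even (u := f_proj \o @incl (ct0 g) (cf1 g) (cf0 g) (cf1 g)) s rF).
    by rewrite map_comp; apply: F0.
  by move=> x; apply: f_proj_incl.
- move=> p F /(cocycleE pgt) rF.
  pose u : {linear _ -> _} := @incl (ct0 g) (cf1 g) (cf0 g) (cf1 g).
  exists (pullback u F).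
    apply/invariant_fE; split; first exact: restrict_relative.
    move=> h ht s.
    have hE : vsval (vsproj (Defs.total (t_alg g)) h) = h.
      by rewrite vsprojK // (mem_total (L := t_alg g) (b := false)).
    rewrite (dact_pullback (D := @ebr K (t_alg g) (vsproj _ h))).
      by apply: (rc_invariant rF); rewrite hE.
    move=> x; apply: elt_ext; rewrite vsval_incl // vsval_tact //.
    rewrite vsprojK vsval_incl // hE //.
    have /memv_addP[x0 x0f [x1 x1f ->]] := valP x.
    rewrite (brDr trg) [X in X + _](tr_tt trg) //; last exact: (subvP f0t _ x0f).
    rewrite add0r (mem_total (L := t_alg g) (b := true)) //.
    exact: (tr_tf trg ht x1f).
  move=> s; rewrite /pullback -map_comp; apply: (relative_mod_even _ rF) => x.
  rewrite linearB /= vsval_incl // vsval_f_proj.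
  have /memv_addP[x0 x0t [x1 x1f ->]] := valP x.
  rewrite linearD /= f1_proj_b0 ?f1_proj_id ?add0r //; last exact: (subvP t0b _ x0t).
  by rewrite opprD addrCA subrr addr0 rpredN.
Qed.

End TriangularCohomology.

(** * Coordinates diagonalising the Cartan subalgebra *)

Section Isotypic.
Variables (K : fieldType) (V : vectType K) (I : finType) (c : I -> V -> K).
Hypothesis c_linear : forall p, linear (c p : V -> K^o).
Hypothesis c_sep : forall x, (forall p, c p x = 0) -> x = 0.
Variables (hs : seq V) (act : V -> V -> V) (lam : I -> V -> K) (S : {vspace V}).
Hypothesis S_act : forall h x, h \in hs -> x \in S ->
  act h x \in S /\ forall p, c p (act h x) = lam p h * c p x.

Definition isotypic y := forall p q, c p y != 0 -> c q y != 0 ->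
  {in hs, forall h, lam p h = lam q h}.

Lemma coordD p x y : c p (x + y) = c p x + c p y.
Proof. by have := c_linear p 1 x y; rewrite !scale1r. Qed.

Lemma coord0 p : c p 0 = 0.
Proof. by have := c_linear p (-1) 0 0; rewrite scaler0 addr0 scaleN1r addNr. Qed.

Lemma coordZ p a x : c p (a *: x) = a * c p x.
Proof. by have := c_linear p a x 0; rewrite !addr0 coord0 addr0. Qed.

Lemma coord_sum p (J : Type) (r : seq J) (F : J -> V) :
  c p (\sum_(i <- r) F i) = \sum_(i <- r) c p (F i).
Proof. exact: (big_morph (c p) (coordD p) (coord0 p)). Qed.

Lemma coord_inj x y : (forall p, c p x = c p y) -> x = y.
Proof.
move=> xy; apply/eqP; rewrite -subr_eq0; apply/eqP/c_sep => p.
by rewrite coordD -scaleN1r coordZ xy mulN1r subrr.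
Qed.

Let w p := [seq lam p h | h <- hs].

Lemma w_neq p q : w p != w q -> exists2 h, h \in hs & lam p h != lam q h.
Proof.
move=> pq; have /allPn[h hhs pqh] : ~~ all (fun h => lam p h == lam q h) hs.
  by apply: contra pq => /allP eqh; apply/eqP/eq_in_map => h /eqh/eqP.
by exists h.
Qed.

(* Lagrange interpolation: the factors (act h - lam q h) / (lam p h - lam q h) *)
(* kill the position q and fix those with the same weight as p.               *)
Lemma component x p : x \in S -> exists2 y, y \in S &
  forall q, c q y = if w q == w p then c q x else 0.
Proof.
move=> xS; suff [y yS yE] : exists2 y, y \in S & forall q, [/\
    w q = w p -> c q y = c q x, c q x = 0 -> c q y = 0 &
    q \in enum I -> w q != w p -> c q y = 0].
  exists y => // q; have [y1 _ y2] := yE q; have [/y1//|qp] := eqVneq.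
  by apply: y2 => //; rewrite mem_enum.
elim: (enum I) => [|r l [y yS IH]]; first by exists x.
have [rp|/w_neq[h hhs hrp]] := eqVneq (w r) (w p).
  exists y => // q; have [y1 y2 y3] := IH q; split=> //.
  by rewrite inE => /orP[/eqP->|]; [rewrite rp eqxx|exact: y3].
have [ayS ay] := S_act hhs yS.
exists ((lam p h - lam r h)^-1 *: (act h y - lam r h *: y)).
  by rewrite rpredZ // rpredB // rpredZ.
move=> q; have [y1 y2 y3] := IH q.
have -> : c q ((lam p h - lam r h)^-1 *: (act h y - lam r h *: y)) =
    (lam p h - lam r h)^-1 * ((lam q h - lam r h) * c q y).
  by rewrite coordZ coordD -scaleNr coordZ ay mulNr mulrBl.
split=> [qp|/y2->|]; last first.
- rewrite inE => /orP[/eqP-> _|ql qp]; first by rewrite subrr mul0r mulr0.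
  by rewrite y3 ?mulr0.
- by rewrite !mulr0.
have /eq_in_map -> // := qp.
by rewrite mulrA mulVf ?mul1r ?y1 // subr_eq0 eq_sym.
Qed.

(** Induction on a list containing all weights of the support: [component] splits off an isotypic
    part inside [S], and the remainder no longer meets that weight. *)
Lemma isotypic_spanned : spanned (fun x => x \in S) (fun y => y \in S /\ isotypic y).
Proof.
move=> x xS; have : forall q, c q x != 0 -> w q \in [seq w p | p <- enum I].
  by move=> q _; rewrite map_f // mem_enum.
elim: [seq _ | _ <- _] x xS => [|u us IH] x xS supp.
  exists [::] => //; rewrite big_nil; apply: c_sep => p; apply/eqP.
  by rewrite -[_ == 0]negbK; apply/negP => /supp.
have [/mapP[p _ uE]|uI] := boolP (u \in [seq w p | p <- enum I]); last first.
  apply: IH => // q /[dup] qx /supp; rewrite inE => /orP[/eqP qu|//].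
  by rewrite -qu map_f ?mem_enum in uI.
have [y yS yE] := component p xS; have [|q|r xE hr] := IH (x - y); first exact: rpredB.
  rewrite coordD -scaleN1r coordZ mulN1r yE -uE.
  case: (eqVneq (w q) u) => [_|qu]; first by rewrite subrr eqxx.
  by rewrite subr0 => /supp; rewrite inE (negPf qu).
exists ((1, y) :: r) => [|z]; first by rewrite big_cons scale1r -xE addrC subrK.
rewrite inE => /orP[/eqP->|/hr//]; split=> // q q'; rewrite !yE.
case: (eqVneq (w q) _) => [qp|_]; last by rewrite eqxx.
case: (eqVneq (w q') _) => [q'p|_]; last by rewrite eqxx.
by move=> _ _; apply/eq_in_map; rewrite -/(w q) qp.
Qed.

End Isotypic.

(** * Subspaces cut out by levels *)

Section GradedSpace.
Variables (K : fieldType) (L : superalgebra K) (I : finType).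
Variables (c : I -> ambient L -> K) (lev : I -> int).

(** A support condition inside [spart L b], because that space need not be spanned by coordinate
    vectors: in osp, for instance, several matrix entries are tied together. *)
Definition grspace b (Z : pred int) : {vspace ambient L} :=
  (spart L b :&: \bigcap_(p | ~~ Z (lev p)) kernel (c p : ambient L -> K^o))%VS.

Hypothesis c_linear : forall p, linear (c p : ambient L -> K^o).

Lemma grspaceP b (Z : pred int) x : reflect
  (x \in spart L b /\ forall p, c p x != 0 -> Z (lev p)) (x \in grspace b Z).
Proof.
rewrite memv_cap; apply: (iffP andP) => [[xb xZ]|[xb xZ]]; split=> //.
  move=> p; apply: contraNT => Zp; rewrite -(memv_kernel _ (c_linear p)).
  by move: xZ; rewrite !memvE => /subv_bigcapP/(_ p Zp).
rewrite memvE; apply/subv_bigcapP => p Zp; rewrite -memvE memv_kernel //.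
by rewrite -[_ == 0]negbK; apply: contra Zp => /xZ.
Qed.

End GradedSpace.

(* Coordinates c p on the ambient space, in which the Cartan subalgebra acts  *)
(* diagonally, with weights lam p taking integral values lev p at some H.     *)
Record coordinates (K : fieldType) (g : classical_datum K) (I : finType)
    (c : I -> ambient (calg g) -> K) (par : I -> bool) (lev : I -> int)
    (lam : I -> ambient (calg g) -> K) : Prop := Coordinates {
  co_linear : forall p, linear (c p : ambient (calg g) -> K^o);
  co_sep : forall x, (forall p, c p x = 0) -> x = 0;
  co_par : forall b x p, x \in spart (calg g) b -> c p x != 0 -> par p = b;
  co_linl : forall z, linear (fun x => @sbr K (calg g) x z);
  co_linr : forall z, linear (@sbr K (calg g) z);
  co_skew : forall x y, x \in spart (calg g) false -> y \in spart (calg g) true ->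
    sbr y x = - sbr x y;
  co_act : forall b h x, h \in ct0 g -> x \in spart (calg g) b ->
    sbr h x \in spart (calg g) b /\ forall p, c p (sbr h x) = lam p h * c p x;
  co_H : exists2 H, H \in ct0 g & forall p, lam p H = (lev p)%:~R;
  co_lam0 : forall p h, ~~ par p -> lev p = 0 -> h \in ct0 g -> lam p h = 0;
  co_lam_linear : forall p, linear (lam p : ambient (calg g) -> K^o);
  co_t0 : ct0 g = grspace c lev false (fun n => n == 0);
  co_u0 : cu0 g = grspace c lev false (fun n => n < 0);
  co_f1 : cf1 g = grspace c lev true (fun n => n == 0);
  co_u1 : cu1 g = grspace c lev true (fun n => n < 0);
  co_br : forall a b x y,
    x \in grspace c lev a (fun n => n <= 0) -> y \in grspace c lev b (fun n => n <= 0) ->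
    sbr x y \in grspace c lev (a (+) b) (fun n => n <= 0);
  co_brN : forall x y,
    x \in grspace c lev false (fun n => n < 0) -> y \in grspace c lev true (fun n => n <= 0) ->
    sbr x y \in grspace c lev true (fun n => n < 0);
  co_br0 : forall x y, x \in cf1 g -> y \in cf1 g -> sbr x y \in ct0 g;
  co_fff : forall x y z, x \in cf1 g -> y \in cf1 g -> z \in cf1 g -> sbr (sbr x y) z = 0;
  co_torus_linear : forall phi, ctorus g phi -> linear phi;
  co_torus_cartan : forall phi h, ctorus g phi -> h \in ct0 g -> phi h = h;
  co_torus_supp : forall phi x p, ctorus g phi -> c p x = 0 -> c p (phi x) = 0;
  co_weights : exists k (A : I -> {ffun 'I_k -> int}), [/\
    forall h, h \in ct0 g -> exists y : 'I_k -> K,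
      forall p, par p -> lev p = 0 -> lam p h = \sum_j (A p j)%:~R * y j,
    forall y : 'I_k -> K, exists2 h, h \in ct0 g &
      forall p, par p -> lev p = 0 -> lam p h = \sum_j (A p j)%:~R * y j,
    forall phi, ctorus g phi -> exists2 z : 'I_k -> K, (forall j, z j != 0) &
      forall p x, par p -> lev p = 0 -> c p (phi x) = (\prod_j z j ^ A p j) * c p x &
    forall z : 'I_k -> K, (forall j, z j != 0) -> exists2 phi, ctorus g phi &
      forall p x, par p -> lev p = 0 -> c p (phi x) = (\prod_j z j ^ A p j) * c p x] }.

Section CoordinatesTriangular.
Variables (K : fieldType) (g : classical_datum K) (I : finType).
Variables (c : I -> ambient (calg g) -> K) (par : I -> bool) (lev : I -> int).
Variable (lam : I -> ambient (calg g) -> K).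
Hypothesis charK : forall k, k.+1%:R != 0 :> K.
Hypothesis cog : coordinates c par lev lam.

Let c_lin := co_linear cog.
Let c_sep := co_sep cog.
Let mem := grspaceP lev c_lin.
Local Notation gr := (grspace c lev).

Lemma gr_act b Z h x : h \in ct0 g -> x \in gr b Z ->
  sbr h x \in gr b Z /\ forall p, c p (sbr h x) = lam p h * c p x.
Proof.
move=> ht /mem[xb xZ]; have [hx hc] := co_act cog ht xb; split=> //.
by apply/mem; split=> // p; rewrite hc mulf_eq0 negb_or => /andP[_ /xZ].
Qed.

Lemma gr_sub b (Z Z' : pred int) : (forall n, Z n -> Z' n) -> (gr b Z <= gr b Z')%VS.
Proof. by move=> ZZ'; apply/subvP => x /mem[xb xZ]; apply/mem; split=> // p /xZ/ZZ'. Qed.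

Lemma cap_parity : (spart (calg g) false :&: spart (calg g) true)%VS = 0%VS.
Proof.
apply/eqP; rewrite -subv0; apply/subvP => x; rewrite memv_cap => /andP[x0 x1].
rewrite memv0; apply/eqP/c_sep => p; apply/eqP; rewrite -[_ == 0]negbK; apply/negP => px.
by have := co_par cog x1 px; rewrite (co_par cog x0 px).
Qed.

(** Decompose into vectors isotypic for H. On such a vector all nonzero coordinates have the same
    level, since integers embed in [K], so it lies in one of the two summands. *)
Lemma gr_le0 b : gr b (fun n => n <= 0) =
  (gr b (fun n => n == 0)%R + gr b (fun n => n < 0)%R)%VS.
Proof.
apply/eqP; rewrite eqEsubv; apply/andP; split; last first.
  by rewrite subv_add !gr_sub // => n; rewrite [_ <= _]le_eqVlt => ->; rewrite ?orbT.
apply/subvP => x xS; have [H Ht HE] := co_H cog.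
have actS h y : h \in [:: H] -> y \in gr b (fun n => n <= 0) ->
    sbr h y \in gr b (fun n => n <= 0) /\ forall p, c p (sbr h y) = lam p h * c p y.
  by rewrite inE => /eqP->; apply: gr_act.
have [r -> hr] := isotypic_spanned c_lin c_sep actS xS.
rewrite big_seq memv_suml // => y /hr[/mem[yb yS] iso]; rewrite memvZ //.
have [/existsP[p /andP[py p0]]|] := boolP [exists p, (c p y.2 != 0) && (lev p == 0)].
  apply: (subvP (addvSl _ _)); apply/mem; split=> // q qy.
  have := iso _ _ py qy H (mem_head _ _); rewrite !HE => /eqP.
  by rewrite -subr_eq0 -rmorphB => /eqP/(intr_eq0_char charK)/eqP; rewrite (eqP p0) sub0r oppr_eq0.
rewrite negb_exists => /forallP neg; apply: (subvP (addvSr _ _)); apply/mem; split=> // q qy.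
by have := neg q; rewrite qy /= lt_neqAle => ->; apply: yS.
Qed.

Lemma b0E : cb0 g = gr false (fun n => n <= 0).
Proof. by rewrite gr_le0 /cb0 (co_t0 cog) (co_u0 cog). Qed.

Lemma b1E : cb1 g = gr true (fun n => n <= 0).
Proof. by rewrite gr_le0 /cb1 (co_f1 cog) (co_u1 cog). Qed.

(** The bracket relations follow from additivity of levels, H provides the grading of u_1, and the
    weight vectors of f_1 come from its decomposition into t_0-isotypic vectors. *)
Lemma coordinates_triangular : triangular g.
Proof.
have t0P h : h \in ct0 g -> h \in spart (calg g) false /\ forall p, c p h != 0 -> lev p = 0.
  by rewrite (co_t0 cog) => /mem[h0 hl]; split=> // p /hl/eqP.
split.
- split=> /=.
  + apply/eqP; rewrite -subv0 -cap_parity capvS // ?b0E ?b1E; apply/subvP => x /mem[] //.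
  + exact: (co_linl cog).
  + exact: (co_linr cog).
  + move=> a b x y xa yb.
    have E d : (if d then cb1 g else cb0 g) = gr d (fun n => n <= 0).
      by case: d; rewrite ?b0E ?b1E.
    by rewrite E (co_br cog) // -E.
  + move=> x y; rewrite b0E b1E => /mem[x0 _] /mem[y1 _]; exact: (co_skew cog).
- apply/eqP; rewrite -subv0 (co_f1 cog) (co_u1 cog); apply/subvP => x.
  rewrite memv_cap => /andP[/mem[_ x0] /mem[_ xN]]; rewrite memv0; apply/eqP/c_sep => p.
  apply/eqP; rewrite -[_ == 0]negbK; apply/negP => px.
  by have := xN _ px; rewrite (eqP (x0 _ px)).
- move=> h h' ht h't; apply: c_sep => p.
  have [_ ->] := co_act cog ht (t0P _ h't).1.
  have [->|ph'] := eqVneq (c p h') 0; first by rewrite mulr0.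
  have [h'0 /(_ _ ph') p0] := t0P _ h't.
  by rewrite (co_lam0 cog) ?mul0r // (co_par cog h'0 ph').
- by move=> h x ht; rewrite (co_f1 cog) => /(gr_act ht)[].
- by move=> h x ht; rewrite (co_u1 cog) => /(gr_act ht)[].
- by move=> h x; rewrite (co_u0 cog) (co_u1 cog) b1E; apply: (co_brN cog).
- exact: (co_br0 cog).
- exact: (co_fff cog).
- have [H Ht HE] := co_H cog; exists H => //; split.
    move=> x; rewrite (co_f1 cog) => /(gr_act Ht)[/mem[_ xl] xE]; apply: c_sep => p.
    have [->|] := eqVneq (c p (sbr H x)) 0 => // /[dup] /xl/eqP p0.
    by rewrite xE HE p0 mul0r eqxx.
  move=> x; rewrite (co_u1 cog) => xu.
  have actS h y : h \in [:: H] -> y \in gr true (fun n => n < 0) ->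
      sbr h y \in gr true (fun n => n < 0) /\ forall p, c p (sbr h y) = lam p h * c p y.
    by rewrite inE => /eqP->; apply: gr_act.
  have [r xE hr] := isotypic_spanned c_lin c_sep actS xu; exists r => // y /hr[yu iso].
  split=> //; have [/mem[yb yl]] := (yu, gr_act Ht yu) => -[_ yE].
  have [/existsP[p py]|] := boolP [exists p, c p y.2 != 0]; last first.
    rewrite negb_exists => /forallP y0; exists 0%N; apply: (coord_inj c_lin c_sep) => p.
    by rewrite coordZ // yE (eqP (negbNE (y0 p))) !mulr0.
  have := yl _ py; case lpE : (lev p) => [n|n] // _; exists n.
  apply: (coord_inj c_lin c_sep) => q; rewrite coordZ // yE.
  have [->|qy] := eqVneq (c q y.2) 0; first by rewrite !mulr0.
  by rewrite -(iso _ _ py qy H (mem_head _ _)) HE lpE NegzE mulrNz.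
- exact: (co_torus_linear cog).
- exact: (co_torus_cartan cog).
have [k [A [A1 A2 A3 A4]]] := co_weights cog.
(* Weight vectors are the vectors of f_1 all of whose nonzero coordinates have exponent [a]. *)
pose P v (a : {ffun 'I_k -> int}) := v \in cf1 g /\ forall p, c p v != 0 -> A p = a.
have f1P x p : x \in cf1 g -> c p x != 0 -> par p /\ lev p = 0.
  by rewrite (co_f1 cog) => /mem[x1 x0] px; rewrite (co_par cog x1 px) (eqP (x0 _ px)).
have cartanP h (y : 'I_k -> K) : h \in ct0 g ->
    (forall p, par p -> lev p = 0 -> lam p h = \sum_j (A p j)%:~R * y j) ->
    forall v a, P v a -> sbr h v = (\sum_j (a j)%:~R * y j) *: v.
  move=> ht hy v a [vf va]; apply: (coord_inj c_lin c_sep) => p.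
  rewrite coordZ // (gr_act (b := true) (Z := fun n => n == 0) ht _).2 -?(co_f1 cog) //.
  have [->|pv] := eqVneq (c p v) 0; first by rewrite !mulr0.
  by have [pp pl] := f1P _ _ vf pv; rewrite hy // (va _ pv).
have torusP phi (z : 'I_k -> K) : ctorus g phi ->
    (forall p x, par p -> lev p = 0 -> c p (phi x) = (\prod_j z j ^ A p j) * c p x) ->
    forall v a, P v a -> phi v = (\prod_j z j ^ a j) *: v.
  move=> tphi hz v a [vf va]; apply: (coord_inj c_lin c_sep) => p; rewrite coordZ //.
  have [pv|pv] := eqVneq (c p v) 0; first by rewrite pv mulr0 (co_torus_supp cog).
  by have [pp pl] := f1P _ _ vf pv; rewrite hz // (va _ pv).
exists k, P; split.
- move=> x xf; have actS h y : h \in vbasis (ct0 g) -> y \in cf1 g ->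
      sbr h y \in cf1 g /\ forall p, c p (sbr h y) = lam p h * c p y.
    by move=> /vbasis_mem ht; rewrite (co_f1 cog); apply: gr_act.
  have [r xE hr] := isotypic_spanned c_lin c_sep actS xf; exists r => // y /hr[yf iso].
  split=> //; have [/existsP[p py]|] := boolP [exists p, c p y.2 != 0]; last first.
    rewrite negb_exists => /forallP y0; exists 0; split=> // p.
    by move=> /(negP (y0 p)).
  (* An isotypic vector has a single exponent: the element of t_0 with parameter the unit vector at
     [j] isolates component [j], and an integer is determined by its image in [K]. *)
  exists (A p); split=> // q qy; apply/ffunP => j.
  have [h ht hE] := A2 (fun i => (i == j)%:R).
  have lamE : lam p h = lam q h.
    rewrite (coord_vbasis ht) -[lam p _]/(lam p _ : K^o).
    have lin_sum u (J : Type) (s : seq J) (F : J -> ambient (calg g)) :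
        lam u (\sum_(i <- s) F i) = \sum_(i <- s) lam u (F i).
      exact: (coord_sum (co_lam_linear cog)).
    rewrite !lin_sum; apply: eq_bigr => i _.
    rewrite !(coordZ (co_lam_linear cog)); congr (_ * _).
    by apply: iso => //; rewrite mem_nth // size_tuple.
  have single u : \sum_i (A u i)%:~R * (i == j)%:R = (A u j)%:~R :> K.
    by rewrite (bigD1 j) //= eqxx mulr1 [X in _ + X]big1 ?addr0 // => i /negPf->; rewrite mulr0.
  have [pp pl] := f1P _ _ yf py; have [qp ql] := f1P _ _ yf qy.
  move: lamE; rewrite !hE // !single => /eqP.
  by rewrite -subr_eq0 -rmorphB => /eqP/(intr_eq0_char charK)/eqP; rewrite subr_eq0 => /eqP.
- by move=> h ht; have [y hy] := A1 _ ht; exists y; apply: cartanP.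
- by move=> y; have [h ht hy] := A2 y; exists h => //; apply: cartanP.
- by move=> phi tphi; have [z z0 hz] := A3 _ tphi; exists z => //; apply: torusP.
- by move=> z /A4[phi tphi hz]; exists phi => //; apply: torusP.
Qed.

End CoordinatesTriangular.

(** * Root spaces in coordinates *)

Lemma memv_bigcap_seq (K : fieldType) (V : vectType K) (T : Type) (s : seq T)
    (F : T -> {vspace V}) x :
  (x \in (\bigcap_(h <- s) F h)%VS) = all (fun h => x \in F h) s.
Proof.
elim: s => [|h s IH]; first by rewrite big_nil memvf.
by rewrite big_cons memv_cap IH.
Qed.

Section RootSpaces.
Variables (K : fieldType) (L : superalgebra K) (t0 : {vspace ambient L}) (I : finType).
Variables (c : I -> ambient L -> K) (par : I -> bool) (lev : I -> int).
Variable (lam : I -> ambient L -> K).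
Hypothesis charK : forall k, k.+1%:R != 0 :> K.
Hypothesis c_linear : forall p, linear (c p : ambient L -> K^o).
Hypothesis c_sep : forall x, (forall p, c p x = 0) -> x = 0.
Hypothesis c_par : forall b x p, x \in spart L b -> c p x != 0 -> par p = b.
Hypothesis sbr_linl : forall z, linear (fun x => @sbr K L x z).
Hypothesis sbr_linr : forall z, linear (@sbr K L z).
Hypothesis act : forall b h x, h \in t0 -> x \in spart L b ->
  sbr h x \in spart L b /\ forall p, c p (sbr h x) = lam p h * c p x.
Hypothesis t0_H : exists2 H, H \in t0 & forall p, lam p H = (lev p)%:~R.
Hypothesis lam_linear : forall p, linear (lam p : ambient L -> K^o).
Local Notation gr := (grspace c lev).

Lemma root_spaceP b (lm : ambient L -> K) x : reflect
  (x \in spart L b /\ forall h, h \in vbasis t0 -> sbr h x = lm h *: x)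
  (x \in root_space t0 b lm).
Proof.
have lin h : linear (fun x => @sbr K L h x - lm h *: x).
  move=> a y z; rewrite sbr_linr scalerDr scalerBr !scalerA [lm h * a]mulrC.
  by rewrite opprD addrACA.
rewrite memv_cap memv_bigcap_seq; apply: (iffP andP) => -[xb xh]; split=> //.
  by move=> h /(allP xh); rewrite memv_ker linfun_linear // subr_eq0 => /eqP.
by apply/allP => h /xh hx; rewrite memv_ker linfun_linear // hx subrr.
Qed.

(** H acts on the root space by the scalar [lev p], and on each coordinate by its own level; so a
    nonzero coordinate has level [lev p]. *)
Lemma root_space_gr b lm p (Z : pred int) :
    {in t0, forall h, lm h = lam p h} -> Z (lev p) ->
  (root_space t0 b lm <= gr b Z)%VS.
Proof.
move=> lmE Zp; apply/subvP => x /root_spaceP[xb xh]; apply/grspaceP => //; split=> // q qx.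
have [H Ht HE] := t0_H.
have HxE : sbr H x = lam p H *: x.
  rewrite (coord_vbasis Ht).
  have sum_l (J : Type) (s : seq J) (F : J -> ambient L) :
      @sbr K L (\sum_(i <- s) F i) x = \sum_(i <- s) sbr (F i) x.
    apply: (big_morph (fun z => @sbr K L z x)).
      by move=> y z; have := sbr_linl x 1 y z; rewrite !scale1r.
    by have := sbr_linl x (-1) 0 0; rewrite scaler0 addr0 scaleN1r addNr.
  have sbrZ a y : @sbr K L (a *: y) x = a *: sbr y x.
    have := sbr_linl x a y 0; rewrite !addr0 => ->.
    by have := sum_l _ [::] (fun _ : bool => 0); rewrite !big_nil => ->; rewrite addr0.
  rewrite sum_l (coord_sum lam_linear) scaler_suml; apply: eq_bigr => i _.
  have hi : (vbasis t0)`_i \in vbasis t0 by rewrite mem_nth // size_tuple.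
  by rewrite sbrZ xh // lmE ?vbasis_mem // (coordZ lam_linear) scalerA.
have := (act Ht xb).2 q; rewrite HxE (coordZ c_linear) => /(mulIf qx) /eqP.
rewrite !HE -subr_eq0 -rmorphB => /eqP/(intr_eq0_char charK)/eqP.
by rewrite subr_eq0 => /eqP <-.
Qed.

(** A t_0-isotypic vector lies in the root space of the weight of any of its nonzero coordinates.
    The condition that the coordinate be nonzero on some vector discards positions that vanish
    identically, such as those of weight -2 epsilon_i in the orthogonal block. *)
Lemma gr_root_space b (Z : pred int) U :
    (forall p, par p = b -> Z (lev p) -> (exists2 x, x \in spart L b & c p x != 0) ->
      exists lm, {in t0, forall h, lm h = lam p h} /\ (root_space t0 b lm <= U)%VS) ->
  (gr b Z <= U)%VS.
Proof.
move=> hU; apply/subvP => x xS.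
have actS h y : h \in vbasis t0 -> y \in gr b Z ->
    sbr h y \in gr b Z /\ forall p, c p (sbr h y) = lam p h * c p y.
  move=> /vbasis_mem ht /(grspaceP _ c_linear)[yb yZ]; have [hb hc] := act ht yb.
  split=> //; apply/grspaceP => //; split=> // p; rewrite hc mulf_eq0 negb_or.
  by case/andP => _ /yZ.
have [r -> hr] := isotypic_spanned c_linear c_sep actS xS.
rewrite big_seq memv_suml // => y /hr[/(grspaceP _ c_linear)[yb yZ] iso]; rewrite memvZ //.
have [/existsP[p py]|] := boolP [exists p, c p y.2 != 0]; last first.
  rewrite negb_exists => /forallP y0.
  by rewrite (_ : y.2 = 0) ?mem0v //; apply: c_sep => p; apply/eqP/negbNE/y0.
have [|lm [lmE /subvP]] := hU p (c_par yb py) (yZ _ py); first by exists y.2.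
apply; apply/root_spaceP; split=> // h hv; apply: (coord_inj c_linear c_sep) => q.
rewrite (act (vbasis_mem hv) yb).2 (coordZ c_linear) lmE ?vbasis_mem //.
have [->|qy] := eqVneq (c q y.2) 0; first by rewrite !mulr0.
by rewrite (iso _ _ py qy h hv).
Qed.

End RootSpaces.

(** * Matrix superalgebras *)

Section BlockEntries.
Variables (K : fieldType) (m n : nat).
Notation V := 'M[K]_(m + n).

Definition in_dr (i : 'I_(m + n)) : bool := (m <= i)%N.

Lemma in_dr_lshift i : in_dr (lshift n i) = false.
Proof. by rewrite /in_dr /= leqNgt ltn_ord. Qed.

Lemma in_dr_rshift i : in_dr (rshift m i) = true.
Proof. by rewrite /in_dr /= leq_addr. Qed.

Lemma odd_blockE (X : V) i j : odd_block X i j = if in_dr i (+) in_dr j then X i j else 0.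
Proof.
case: (split_ordP i) => i' ->; case: (split_ordP j) => j' ->;
by rewrite /odd_block ?(block_mxEul, block_mxEur, block_mxEdl, block_mxEdr)
  ?in_dr_lshift ?in_dr_rshift !mxE.
Qed.

Lemma even_blockE (X : V) i j : even_block X i j = if in_dr i (+) in_dr j then 0 else X i j.
Proof.
case: (split_ordP i) => i' ->; case: (split_ordP j) => j' ->;
by rewrite /even_block ?(block_mxEul, block_mxEur, block_mxEdl, block_mxEdr)
  ?in_dr_lshift ?in_dr_rshift !mxE.
Qed.

Lemma odd_block_linear : linear (@odd_block K m n).
Proof.
by move=> a X Y; rewrite /odd_block scale_block_mx add_block_mx; congr block_mx; apply/matrixP => i j; rewrite !mxE ?mulr0 ?addr0.
Qed.

Lemma even_block_linear : linear (@even_block K m n).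
Proof.
by move=> a X Y; rewrite /even_block scale_block_mx add_block_mx; congr block_mx; apply/matrixP => i j; rewrite !mxE ?mulr0 ?addr0.
Qed.

Lemma block_superalgebraP (b : V -> V -> V) (E O : {vspace V}) p (X : V) : reflect
  (X \in (if p then O else E) /\ forall i j, X i j != 0 -> in_dr i (+) in_dr j = p)
  (X \in spart (block_superalgebra b E O) p).
Proof.
rewrite /=; case: p; rewrite memv_cap memv_kernel;
  try exact: even_block_linear; try exact: odd_block_linear;
  apply: (iffP andP) => [[XE /eqP/matrixP X0]|[XE X0]]; split=> //.
- by move=> i j; have := X0 i j; rewrite even_blockE mxE; case: (_ (+) _) => // ->; rewrite eqxx.
- apply/eqP/matrixP => i j; rewrite even_blockE mxE; case: ifP => // ij.
  by apply/eqP; rewrite -[_ == 0]negbK; apply/negP => /X0; rewrite ij.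
- by move=> i j; have := X0 i j; rewrite odd_blockE mxE; case: (_ (+) _) => // ->; rewrite eqxx.
- apply/eqP/matrixP => i j; rewrite odd_blockE mxE; case: ifP => // ij.
  by apply/eqP; rewrite -[_ == 0]negbK; apply/negP => /X0; rewrite ij.
Qed.

Lemma diagonal_spaceP N (X : 'M[K]_N) : reflect
  (forall i j, X i j != 0 -> i = j) (X \in diagonal_space K N).
Proof.
rewrite memv_kernel; last first.
  by move=> a Y Z; apply/matrixP => i j; rewrite !mxE mulrnDl -mulrnAr; ring.
apply: (iffP eqP) => [/matrixP X0 i j|X0].
  have := X0 i j; rewrite !mxE; case: (eqVneq i j) => // _.
  by rewrite mulr0n subr0 => ->; rewrite eqxx.
apply/matrixP => i j; rewrite !mxE; case: (eqVneq i j) => [->|ij]; first by rewrite subrr.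
rewrite subr0; apply/eqP; rewrite -[_ == 0]negbK; apply: contra ij => /X0->//.
Qed.

End BlockEntries.

Lemma diag_mxM (K : fieldType) N p (h : 'M[K]_N) (X : 'M[K]_(N, p)) i j :
  (forall k l, h k l != 0 -> k = l) -> (h *m X) i j = h i i * X i j.
Proof.
move=> hd; rewrite mxE (bigD1 i) //= big1 ?addr0 // => k ki.
have [->|/hd ik] := eqVneq (h i k) 0; first by rewrite mul0r.
by rewrite ik eqxx in ki.
Qed.

Lemma mx_diagM (K : fieldType) p N (h : 'M[K]_N) (X : 'M[K]_(p, N)) i j :
  (forall k l, h k l != 0 -> k = l) -> (X *m h) i j = X i j * h j j.
Proof.
move=> hd; rewrite mxE (bigD1 j) //= big1 ?addr0 // => k kj.
have [->|/hd jk] := eqVneq (h k j) 0; first by rewrite mulr0.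
by rewrite jk eqxx in kj.
Qed.

Lemma diag_conj (K : fieldType) N (d : 'rV[K]_N) (X : 'M[K]_N) i j :
  (forall k, d 0 k != 0) -> (diag_mx d *m X *m invmx (diag_mx d)) i j = d 0 i / d 0 j * X i j.
Proof.
move=> d0; have -> : invmx (diag_mx d) = diag_mx (\row_k (d 0 k)^-1).
  have dd : diag_mx d *m diag_mx (\row_k (d 0 k)^-1) = 1%:M.
    by apply/matrixP => k l; rewrite mul_diag_mx !mxE; case: eqP => [->|]; rewrite ?mulfV ?mulr0.
  have [ud _] := mulmx1_unit dd.
  by rewrite -[RHS](mulKmx ud) dd mulmx1.
rewrite mul_mx_diag mul_diag_mx !mxE; ring.
Qed.

Lemma mulmx_neq0 (K : fieldType) p1 p2 p3 (X : 'M[K]_(p1, p2)) (Y : 'M[K]_(p2, p3)) i j : (X *m Y) i j != 0 -> exists k, X i k != 0 /\ Y k j != 0.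
Proof.
move=> XY; have [/existsP[k /andP[? ?]]|] := boolP [exists k, (X i k != 0) && (Y k j != 0)].
  by exists k.
rewrite negb_exists => /forallP XY0; move: XY; rewrite mxE big1 ?eqxx // => k _; apply/eqP.
by have := XY0 k; rewrite mulf_eq0 negb_and !negbK.
Qed.

Lemma addr_neq0 (K : fieldType) (x y : K) : x + y != 0 -> x != 0 \/ y != 0.
Proof. by have [->|] := eqVneq x 0; [rewrite add0r; right|left]. Qed.

(** * Matrix superalgebras graded by levels of indices *)

Section MatrixData.
Variables (K : fieldType) (m n : nat).
Notation V := 'M[K]_(m + n).
Variables (b : V -> V -> V) (E O : {vspace V}) (lv : 'I_(m + n) -> int).
Notation L := (block_superalgebra b E O).
Notation t0 := (spart L false :&: diagonal_space K (m + n))%VS.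
Hypothesis charK : forall k, k.+1%:R != 0 :> K.

(** Here [lv] gives a level to each basis vector of the natural module and an entry (i, j) has level
    [lv i - lv j]. On odd pairs the bracket may differ from XY + YX by a scalar matrix, which covers
    psl and psq; H is prescribed through differences of levels because scalar shifts are free. *)
Record matrix_algebra : Prop := MatrixAlgebra {
  ma_linl : forall Z, linear (fun X => b X Z);
  ma_linr : forall Z, linear (b Z);
  ma_even : forall X Y, X \in spart L false -> b X Y = X *m Y - Y *m X;
  ma_odd : forall X Y, X \in spart L true -> Y \in spart L true ->
    exists a, b X Y = X *m Y + Y *m X + a%:M;
  ma_skew : forall X Y, X \in spart L true -> Y \in spart L false -> b X Y = - b Y X;
  ma_closed : forall p q X Y, X \in spart L p -> Y \in spart L q -> b X Y \in spart L (p (+) q);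
  ma_inj : forall i j, in_dr i = in_dr j -> lv i = lv j -> i = j;
  ma_H : exists2 H, H \in t0 & forall i j, H i i - H j j = (lv i - lv j)%:~R }.

Definition mx_coord (p : 'I_(m + n) * 'I_(m + n)) (X : V) : K := X p.1 p.2.
Definition mx_par (p : 'I_(m + n) * 'I_(m + n)) := in_dr p.1 (+) in_dr p.2.
Definition mx_lev (p : 'I_(m + n) * 'I_(m + n)) := lv p.1 - lv p.2.
Definition mx_weight (p : 'I_(m + n) * 'I_(m + n)) (h : V) : K := h p.1 p.1 - h p.2 p.2.
Notation gr := (@grspace K L _ mx_coord mx_lev).

Hypothesis ma : matrix_algebra.

Lemma mx_coord_linear p : linear (mx_coord p : V -> K^o).
Proof. by move=> a X Y; rewrite /mx_coord !mxE. Qed.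

Lemma mx_weight_linear p : linear (mx_weight p : V -> K^o).
Proof. by move=> a X Y; rewrite /mx_weight !mxE /GRing.scale /=; ring. Qed.

Lemma mx_coord_sep (X : V) : (forall p, mx_coord p X = 0) -> X = 0.
Proof. by move=> X0; apply/matrixP => i j; rewrite [RHS]mxE; apply: (X0 (i, j)). Qed.

Lemma mx_grP p (Z : pred int) (X : V) : reflect
  (X \in spart L p /\ forall i j, X i j != 0 -> Z (lv i - lv j)) (X \in gr p Z).
Proof.
apply: (iffP (@grspaceP K L _ mx_coord mx_lev mx_coord_linear p Z X)) => -[Xp XZ]; split=> //.
  by move=> i j; apply: (XZ (i, j)).
by move=> [i j]; apply: XZ.
Qed.

Lemma mx_coord_par p (X : ambient L) (ij : 'I_(m + n) * 'I_(m + n)) :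
  X \in spart L p -> mx_coord ij X != 0 -> mx_par ij = p.
Proof. by move=> /block_superalgebraP[_ XE] /XE. Qed.

Lemma mx_t0P (h : V) : h \in t0 -> h \in spart L false /\ forall i j, h i j != 0 -> i = j.
Proof. by rewrite memv_cap => /andP[h0 /diagonal_spaceP]. Qed.

Lemma mx_act p (h X : ambient L) : h \in t0 -> X \in spart L p ->
  sbr h X \in spart L p /\ forall ij, mx_coord ij (sbr h X) = mx_weight ij h * mx_coord ij X.
Proof.
move=> /mx_t0P[h0 hd] Xp; split; first exact: (ma_closed ma h0 Xp).
move=> [i j]; rewrite /mx_coord /mx_weight /= (ma_even ma _ h0) !mxE.
have := diag_mxM X i j hd; have := mx_diagM X i j hd; rewrite !mxE => -> ->; ring.
Qed.

Lemma mx_t0_H : exists2 H : ambient L, H \in t0 & forall p, mx_weight p H = (mx_lev p)%:~R.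
Proof. by have [H Ht HE] := ma_H ma; exists H => // -[i j]; apply: HE. Qed.

Lemma mx_root_gr p (lm : V -> K) i j (Z : pred int) :
    {in t0, forall h : V, lm h = h i i - h j j} -> Z (lv i - lv j) ->
  (@root_space K L t0 p lm <= gr p Z)%VS.
Proof.
move=> lmE Zij; apply: (@root_space_gr K L t0 _ mx_coord mx_lev mx_weight _ _ _ _ _ _ _ p lm (i, j)) => //.
- exact: mx_coord_linear.
- exact: ma_linl ma.
- exact: ma_linr ma.
- exact: mx_act.
- exact: mx_t0_H.
- exact: mx_weight_linear.
Qed.

Lemma mx_gr_root p (Z : pred int) (U : {vspace V}) :
    (forall i j, in_dr i (+) in_dr j = p -> Z (lv i - lv j) ->
      (exists2 X, X \in spart L p & X i j != 0) ->
      exists lm : V -> K, {in t0, forall h : V, lm h = h i i - h j j} /\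
        (@root_space K L t0 p lm <= U)%VS) ->
  (gr p Z <= U)%VS.
Proof.
move=> hU; apply: (@gr_root_space K L t0 _ mx_coord mx_par mx_lev mx_weight).
- exact: mx_coord_linear.
- exact: mx_coord_sep.
- exact: mx_coord_par.
- exact: ma_linr ma.
- exact: mx_act.
- by move=> [i j]; apply: hU.
Qed.

Lemma mx_gr_t0 : t0 = gr false (fun n => n == 0).
Proof.
apply/eqP; rewrite eqEsubv; apply/andP; split; apply/subvP => X.
  move=> /mx_t0P[X0 Xd]; apply/mx_grP; split=> // i j /Xd ->.
  by rewrite subrr.
move=> /mx_grP[X0 Xl]; rewrite memv_cap X0; apply/diagonal_spaceP => i j Xij.
apply: (ma_inj ma); last by apply/eqP; rewrite -subr_eq0; apply: Xl.
by have := mx_coord_par (ij := (i, j)) X0 Xij; rewrite /mx_par /=; case: in_dr; case: in_dr.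
Qed.

(** Levels add along a path i, k, j of a matrix product. The scalar correction sits on the diagonal,
    at level 0, whence the extra condition on [Z] for two odd arguments. *)
Lemma mx_br_lev p q (X Y : V) (Z : pred int) :
    X \in spart L p -> Y \in spart L q ->
    (forall i j k, X i k != 0 -> Y k j != 0 -> Z (lv i - lv j)) ->
    (forall i j k, Y i k != 0 -> X k j != 0 -> Z (lv i - lv j)) ->
    (p && q -> Z 0) ->
  forall ij, mx_coord ij (b X Y) != 0 -> Z (mx_lev ij).
Proof.
move=> Xp Yq XY YX Z0 [i j]; rewrite /mx_coord /mx_lev /=.
have comm : X *m Y - Y *m X = b X Y \/ - (Y *m X - X *m Y) = b X Y ->
    b X Y i j != 0 -> Z (lv i - lv j).
  rewrite opprB => h; have <- : X *m Y - Y *m X = b X Y by case: h.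
  rewrite !mxE => /addr_neq0[]; first by have := @mulmx_neq0 _ _ _ _ X Y i j; rewrite mxE => h1 /h1[k [? ?]]; apply: (XY _ _ k).
  rewrite oppr_eq0; have := @mulmx_neq0 _ _ _ _ Y X i j; rewrite mxE => h1 /h1[k [? ?]]; exact: (YX _ _ k).
case: p Xp Z0 => Xp; last by move=> _; apply: comm; left; rewrite (ma_even ma _ Xp).
case: q Yq => Yq Z0; last by apply: comm; right; rewrite (ma_skew ma Xp Yq) (ma_even ma _ Yq).
have [a ->] := ma_odd ma Xp Yq.
rewrite !mxE => /addr_neq0[/addr_neq0[]|].
- by have := @mulmx_neq0 _ _ _ _ X Y i j; rewrite mxE => h1 /h1[k [? ?]]; apply: (XY _ _ k).
- by have := @mulmx_neq0 _ _ _ _ Y X i j; rewrite mxE => h1 /h1[k [? ?]]; apply: (YX _ _ k).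
case: (eqVneq i j) => [-> _|_]; first by rewrite subrr Z0.
by rewrite mulr0n eqxx.
Qed.

End MatrixData.

Section MatrixTriangular.
Variables (K : fieldType) (m n : nat).
Notation V := 'M[K]_(m + n).
Variables (b : V -> V -> V) (E O : {vspace V}) (lv : 'I_(m + n) -> int).
Notation L := (block_superalgebra b E O).
Notation t0 := (spart L false :&: diagonal_space K (m + n))%VS.
Notation gr := (@grspace K L _ (@mx_coord K m n) (mx_lev lv)).
Hypothesis charK : forall k, k.+1%:R != 0 :> K.
Variables (u0 f1 u1 : {vspace V}) (P : 'rV[K]_(m + n) -> Prop).
Notation g := (@ClassicalDatum K L t0 u0 f1 u1 (diagonal_torus P)).

(** One integral matrix [A] describes the diagonal entries additively for t_0 and multiplicatively
    for the torus, in both directions. *)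
Definition torus_param k (A : 'I_(m + n) -> {ffun 'I_k -> int}) : Prop := [/\
  forall h : V, h \in t0 -> exists y : 'I_k -> K, forall i, h i i = \sum_j (A i j)%:~R * y j,
  forall y : 'I_k -> K, diag_mx (\row_i \sum_j (A i j)%:~R * y j) \in E,
  forall d : 'rV[K]_(m + n), (forall i, d 0 i != 0) -> P d -> exists2 z : 'I_k -> K, (forall j, z j != 0) &
    forall i, d 0 i = \prod_j z j ^ A i j &
  forall z : 'I_k -> K, (forall j, z j != 0) -> P (\row_i \prod_j z j ^ A i j)].

Hypothesis ma : matrix_algebra b E O lv.
Hypothesis u0E : u0 = gr false (fun n => n < 0).
Hypothesis f1E : f1 = gr true (fun n => n == 0).
Hypothesis u1E : u1 = gr true (fun n => n < 0).

Let mem := mx_grP b E O lv.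

Lemma mx_br p q X Y (Z Z1 Z2 : pred int) :
    X \in gr p Z1 -> Y \in gr q Z2 -> (forall x y, Z1 x -> Z2 y -> Z (x + y)) ->
    (p && q -> Z 0) ->
  b X Y \in gr (p (+) q) Z.
Proof.
move=> /mem[Xp XZ] /mem[Yq YZ] ZZ Z0; apply/mem; split; first exact: (ma_closed ma Xp Yq).
move=> i0 j0; suff H : forall ij, mx_coord ij (b X Y) != 0 -> Z (mx_lev lv ij) by apply: (H (i0, j0)).
apply: (mx_br_lev ma Xp Yq) => // i j k ik kj.
  have -> : lv i - lv j = (lv i - lv k) + (lv k - lv j) by ring.
  by apply: ZZ; [apply: XZ|apply: YZ].
have -> : lv i - lv j = (lv k - lv j) + (lv i - lv k) by ring.
by apply: ZZ; [apply: XZ|apply: YZ].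
Qed.

Lemma mx_f1 X : X \in f1 -> X \in spart L true /\
  forall i j, X i j != 0 -> in_dr i != in_dr j /\ lv i = lv j.
Proof.
rewrite f1E => /mem[X1 Xl]; split=> // i j Xij; split.
  by have /block_superalgebraP[_ /(_ _ _ Xij)] := X1; case: in_dr; case: in_dr.
by apply/eqP; rewrite -subr_eq0; apply: Xl.
Qed.

(** The bracket of [X] and [Y] is diagonal, so it multiplies the entry (i, j) of [Z] by a difference
    of diagonal entries. A nonzero entry of f_1 joins indices of equal level in opposite blocks, and
    every index has at most one such partner; hence the entries of XY + YX at partners i and j
    consist of the same two products. *)
Lemma mx_fff X Y Z : X \in f1 -> Y \in f1 -> Z \in f1 -> b (b X Y) Z = 0.
Proof.
move=> /[dup] Xf /mx_f1[X1 Xl] /[dup] Yf /mx_f1[Y1 Yl] /[dup] Zf /mx_f1[Z1 Zl].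
have XY0 : b X Y \in gr false (fun n => n == 0).
  move: Xf Yf; rewrite f1E -[false]/(true (+) true) => Xf Yf.
  by apply: (mx_br Xf Yf) => // x y /eqP-> /eqP->; rewrite addr0.
have [XYg0 XYd] : b X Y \in spart L false /\ forall i j, b X Y i j != 0 -> i = j.
  by apply: mx_t0P; rewrite (mx_gr_t0 ma).
apply/matrixP => i j; rewrite [RHS]mxE (ma_even ma _ XYg0) !mxE.
have := diag_mxM Z i j XYd; have := mx_diagM Z i j XYd; rewrite !mxE => -> ->.
have [->|Zij] := eqVneq (Z i j) 0; first by rewrite mulr0 mul0r subrr.
suff -> : b X Y i i = b X Y j j by rewrite mulrC subrr.
have [pij lij] := Zl _ _ Zij; have [a ->] := ma_odd ma X1 Y1.
have single (A B : V) k l : (forall i j, A i j != 0 -> in_dr i != in_dr j /\ lv i = lv j) ->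
    in_dr k != in_dr l -> lv k = lv l -> \sum_q A k q * B q k = A k l * B l k :> K.
  move=> Al pkl lkl; rewrite (bigD1 l) //= big1 ?addr0 // => q ql.
  have [->|/Al[pkq lkq]] := eqVneq (A k q) 0; first by rewrite mul0r.
  suff ql' : q = l by rewrite ql' eqxx in ql.
  apply: (ma_inj ma); last by rewrite -lkl.
  by move: pkl pkq; case: in_dr; case: in_dr; case: in_dr.
rewrite !mxE !(single _ _ i j) //.
by rewrite !(single _ _ j i) ?(eq_sym (in_dr j)) // !eqxx; ring.
Qed.

Lemma matrix_coordinates k (A : 'I_(m + n) -> {ffun 'I_k -> int}) :
  torus_param A -> coordinates (g := g) (@mx_coord K m n) (@mx_par m n) (mx_lev lv) (@mx_weight K m n).
Proof.
move=> [A1 A2 A3 A4]; split=> /=.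
- exact: mx_coord_linear.
- exact: mx_coord_sep.
- exact: mx_coord_par.
- exact: ma_linl ma.
- exact: ma_linr ma.
- by move=> X Y X0 Y1; apply: (ma_skew ma).
- exact: mx_act ma.
- exact: mx_t0_H ma.
- move=> [i j] h; rewrite /mx_par /mx_lev /mx_weight /= => /negPf pij /eqP lij ht.
  suff -> : i = j by rewrite subrr.
  by apply: (ma_inj ma); [move: pij; case: in_dr; case: in_dr|apply/eqP; rewrite -subr_eq0].
- exact: mx_weight_linear.
- exact: mx_gr_t0 ma.
- exact: u0E.
- exact: f1E.
- exact: u1E.
- move=> p q X Y Xp Yq; apply: (mx_br Xp Yq) => // x y x0 y0; lia.
- by move=> X Y Xp Yq; rewrite -[true]/(false (+) true); apply: (mx_br Xp Yq) => // x y x0 y0; lia.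
- move=> X Y; rewrite f1E => Xf Yf; rewrite (mx_gr_t0 ma) -[false]/(true (+) true).
  by apply: (mx_br Xf Yf) => // x y /eqP-> /eqP->; rewrite addr0.
- exact: mx_fff.
- move=> phi [d [_ _ phiE]] a X Y; rewrite !phiE.
  by rewrite mulmxDr mulmxDl -scalemxAr -scalemxAl.
- move=> phi h [d [d0 _ phiE]] ht; have [_ hd] := @mx_t0P K m n b E O h ht; apply/matrixP => i j; rewrite phiE diag_conj //.
  by have [->|/hd->] := eqVneq (h i j) 0; rewrite ?mulr0 // mulfV // mul1r.
- by move=> phi X [i j] [d [d0 _ phiE]]; rewrite /mx_coord /= phiE diag_conj // => ->; rewrite mulr0.
have wE (y : 'I_k -> K) (ij : 'I_(m + n) * 'I_(m + n)) :
    \sum_l (A ij.1 l)%:~R * y l - \sum_l (A ij.2 l)%:~R * y l =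
    \sum_l ((A ij.1 - A ij.2) l)%:~R * y l.
  by rewrite -sumrB; apply: eq_bigr => l _; rewrite !ffunE rmorphB mulrBl.
have zE (z : 'I_k -> K) (ij : 'I_(m + n) * 'I_(m + n)) : (forall l, z l != 0) ->
    (\prod_l z l ^ A ij.1 l) / (\prod_l z l ^ A ij.2 l) = \prod_l z l ^ ((A ij.1 - A ij.2) l).
  move=> z0; rewrite -prodfV -big_split; apply: eq_bigr => l _ /=.
  by rewrite !ffunE expfzDr // -invr_expz.
exists k, (fun ij => A ij.1 - A ij.2); split.
- by move=> h /A1[y hy]; exists y => -[i j] _ _; rewrite /mx_weight !hy (wE y (i, j)).
- move=> y; exists (diag_mx (\row_i \sum_j (A i j)%:~R * y j)).
    rewrite memv_cap; apply/andP; split.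
      apply/(@block_superalgebraP K m n b E O false); split=> [|i j]; first exact: A2.
      by rewrite !mxE; case: (eqVneq i j) => [->|]; rewrite ?addbb // mulr0n eqxx.
    apply/diagonal_spaceP => i j; rewrite !mxE; case: (eqVneq i j) => // _.
    by rewrite mulr0n eqxx.
  by move=> [i j] _ _; rewrite /mx_weight !mxE !eqxx /= !mulr1n (wE y (i, j)).
- move=> phi [d [d0 /(A3 _ d0)[z z0 dE] phiE]]; exists z => // -[i j] X _ _.
  by rewrite /mx_coord /= phiE diag_conj // !dE (zE z (i, j)).
move=> z z0; exists (fun X => diag_mx (\row_i \prod_j z j ^ A i j) *m X *m
    invmx (diag_mx (\row_i \prod_j z j ^ A i j))).
  exists (\row_i \prod_j z j ^ A i j); split=> // [i|]; last exact: A4.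
  by rewrite mxE; apply/prodf_neq0 => l _; rewrite expfz_neq0.
move=> [i j] X _ _; rewrite /mx_coord /= diag_conj ?mxE ?(zE z (i, j)) // => l.
by rewrite mxE; apply/prodf_neq0 => l' _; rewrite expfz_neq0.
Qed.

Lemma matrix_triangular k (A : 'I_(m + n) -> {ffun 'I_k -> int}) :
  torus_param A -> triangular g.
Proof. by move=> /matrix_coordinates; apply: coordinates_triangular. Qed.

End MatrixTriangular.

(** * The supercommutator, also modulo scalars *)

Section Supercommutator.
Variables (K : fieldType) (m n : nat).
Notation V := 'M[K]_(m + n).
Hypothesis charK : forall k, k.+1%:R != 0 :> K.

Definition has_parity p (X : V) := forall i j, X i j != 0 -> in_dr i (+) in_dr j = p.

Lemma has_parityM p q X Y : has_parity p X -> has_parity q Y -> has_parity (p (+) q) (X *m Y).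
Proof.
move=> Xp Yq i j /mulmx_neq0[k [/Xp <- /Yq <-]].
by case: in_dr; case: in_dr; case: in_dr.
Qed.

Lemma has_parityD p X Y : has_parity p X -> has_parity p Y -> has_parity p (X + Y).
Proof. by move=> Xp Yp i j; rewrite mxE => /addr_neq0[/Xp|/Yp]. Qed.

Lemma has_parityN p X : has_parity p X -> has_parity p (- X).
Proof. by move=> Xp i j; rewrite mxE oppr_eq0 => /Xp. Qed.

Lemma has_parity_scalar (a : K) : has_parity false a%:M.
Proof.
by move=> i j; rewrite mxE; case: (eqVneq i j) => [->|_]; rewrite ?addbb // mulr0n eqxx.
Qed.

Lemma odd_block_parity p X : has_parity p X -> odd_block X = if p then X else 0.
Proof.
move=> Xp; apply/matrixP => i j; rewrite odd_blockE.
have [X0|/Xp->] := eqVneq (X i j) 0; last by case: (p) => //; rewrite mxE.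
by rewrite X0; case: (p); rewrite ?X0 ?mxE; case: ifP.
Qed.

Lemma supercommutatorE p q X Y : has_parity p X -> has_parity q Y ->
  supercommutator X Y = X *m Y - (-1) ^+ (p && q) *: (Y *m X).
Proof.
move=> Xp Yq; rewrite /supercommutator (odd_block_parity Xp) (odd_block_parity Yq).
case: p {Xp} => /=; last by rewrite mulmx0 scaler0 addr0 scale1r.
case: q {Yq} => /=; last by rewrite mul0mx scaler0 addr0 scale1r.
by rewrite expr1 scaleN1r opprK scaler_nat mulr2n addrA subrK.
Qed.

Lemma supercommutator_parity p q X Y : has_parity p X -> has_parity q Y ->
  has_parity (p (+) q) (supercommutator X Y).
Proof.
move=> Xp Yq; rewrite (supercommutatorE Xp Yq); apply: has_parityD; first exact: has_parityM.
apply: has_parityN => i j; rewrite mxE mulf_eq0 negb_or => /andP[_].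
by rewrite [p (+) q]addbC; apply: (has_parityM Yq Xp).
Qed.

Lemma supercommutator_linl Z : linear (fun X : V => supercommutator X Z).
Proof.
move=> a X Y; rewrite /supercommutator odd_block_linear !mulmxDl !mulmxDr.
rewrite -!scalemxAl -!scalemxAr; apply/matrixP => i j; rewrite !mxE; ring.
Qed.

Lemma supercommutator_linr Z : linear (supercommutator Z : V -> V).
Proof.
move=> a X Y; rewrite /supercommutator odd_block_linear !mulmxDl !mulmxDr.
rewrite -!scalemxAl -!scalemxAr; apply/matrixP => i j; rewrite !mxE; ring.
Qed.

Lemma modulo_scalars_linear : linear (@modulo_scalars K (m + n)).
Proof.
move=> a X Y; rewrite /modulo_scalars linearP; apply/matrixP => i j; rewrite !mxE.
by case: (i == j); rewrite ?mulr1n ?mulr0n; ring.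
Qed.

Lemma supercommutator_even X Y : has_parity false X ->
  supercommutator X Y = X *m Y - Y *m X.
Proof. by move=> X0; rewrite /supercommutator (odd_block_parity X0) mulmx0 scaler0 addr0. Qed.

Lemma modulo_supercommutator_even X Y : has_parity false X ->
  modulo_scalars (supercommutator X Y) = X *m Y - Y *m X.
Proof.
move=> X0; rewrite /modulo_scalars supercommutator_even // raddfB /= mxtrace_mulC subrr.
by rewrite mul0r raddf0 subr0.
Qed.

Lemma supercommutator_skew X Y : has_parity true X -> has_parity false Y ->
  supercommutator X Y = - supercommutator Y X.
Proof.
by move=> X1 Y0; rewrite (supercommutatorE X1 Y0) (supercommutatorE Y0 X1) /= !scale1r opprB.
Qed.

Lemma modulo_scalarsN (X : V) : modulo_scalars (- X) = - modulo_scalars X.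
Proof. by rewrite /modulo_scalars !raddfN /= mulNr raddfN /= opprD opprK. Qed.

Variables (E O : {vspace V}) (lv : 'I_(m + n) -> int).

Lemma spart_parity b p X : X \in spart (block_superalgebra b E O) p -> has_parity p X.
Proof. by case/block_superalgebraP. Qed.

Lemma super_algebra :
    (forall p q X Y, X \in spart (block_superalgebra (@supercommutator K m n) E O) p ->
      Y \in spart (block_superalgebra (@supercommutator K m n) E O) q ->
      supercommutator X Y \in (if p (+) q then O else E)) ->
    (forall i j, in_dr i = in_dr j -> lv i = lv j -> i = j) ->
    (exists2 H, H \in (spart (block_superalgebra (@supercommutator K m n) E O) false :&:
        diagonal_space K (m + n))%VS &
      forall i j, H i i - H j j = (lv i - lv j)%:~R) ->
  matrix_algebra (@supercommutator K m n) E O lv.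
Proof.
move=> cl inj hH; split=> //.
- exact: supercommutator_linl.
- exact: supercommutator_linr.
- by move=> X Y /spart_parity X0; apply: supercommutator_even.
- move=> X Y /spart_parity X1 /spart_parity Y1; exists 0.
  by rewrite (supercommutatorE X1 Y1) /= expr1 scaleN1r opprK raddf0 addr0.
- move=> X Y /spart_parity X1 /spart_parity Y0.
  exact: supercommutator_skew.
- move=> p q X Y Xp Yq; apply/block_superalgebraP; split; first exact: cl.
  exact: supercommutator_parity (spart_parity Xp) (spart_parity Yq).
Qed.

Notation b := (fun X Y : V => modulo_scalars (supercommutator X Y)).

(** Commutators are traceless, so reduction modulo scalars only changes the bracket of two odd
    elements, and there by a scalar matrix. *)
Lemma modulo_algebra :
    (forall p q X Y, X \in spart (block_superalgebra b E O) p ->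
      Y \in spart (block_superalgebra b E O) q ->
      modulo_scalars (supercommutator X Y) \in (if p (+) q then O else E)) ->
    (forall i j, in_dr i = in_dr j -> lv i = lv j -> i = j) ->
    (exists2 H, H \in (spart (block_superalgebra b E O) false :&:
        diagonal_space K (m + n))%VS &
      forall i j, H i i - H j j = (lv i - lv j)%:~R) ->
  matrix_algebra b E O lv.
Proof.
move=> cl inj hH; split=> //.
- by move=> Z a X Y; rewrite supercommutator_linl modulo_scalars_linear.
- by move=> Z a X Y; rewrite supercommutator_linr modulo_scalars_linear.
- by move=> X Y /spart_parity X0; apply: modulo_supercommutator_even.
- move=> X Y /spart_parity X1 /spart_parity Y1.
  exists (- (\tr (supercommutator X Y) / (m + n)%:R)); rewrite /modulo_scalars.
  by rewrite {1}(supercommutatorE X1 Y1) /= expr1 scaleN1r opprK raddfN.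
- move=> X Y /spart_parity X1 /spart_parity Y0.
  by rewrite (supercommutator_skew X1 Y0) modulo_scalarsN.
move=> p q X Y Xp Yq; apply/block_superalgebraP; split; first exact: cl.
have Spar := supercommutator_parity (spart_parity Xp) (spart_parity Yq).
case: p q Xp Yq Spar => [] [] Xp Yq Spar /=.
- by apply: has_parityD => //; apply/has_parityN/has_parity_scalar.
- rewrite supercommutator_skew ?modulo_scalarsN; try exact: spart_parity.
  rewrite (modulo_supercommutator_even _ (spart_parity Yq)); apply: has_parityN.
  rewrite -(supercommutator_even _ (spart_parity Yq)).
  exact: (supercommutator_parity (spart_parity Yq) (spart_parity Xp)).
- by rewrite (modulo_supercommutator_even _ (spart_parity Xp)) -(supercommutator_even _ (spart_parity Xp)).
by rewrite (modulo_supercommutator_even _ (spart_parity Xp)) -(supercommutator_even _ (spart_parity Xp)).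
Qed.

End Supercommutator.

(** * Tori defined by monomial relations *)

Section TorusRelations.
Variables (K : fieldType) (k : nat).
Implicit Types (y z : 'I_k -> K) (s : 'I_k -> int).

Definition delta_weight (i : 'I_k) : {ffun 'I_k -> int} := [ffun j => (i == j)%:Z].

Lemma sum_delta_weight i y : \sum_j (delta_weight i j)%:~R * y j = y i.
Proof.
rewrite (bigD1 i) //= ffunE eqxx mul1r big1 ?addr0 // => j /negPf ji.
by rewrite ffunE eq_sym ji mul0r.
Qed.

Lemma prod_delta_weight i z : \prod_j z j ^ delta_weight i j = z i.
Proof.
rewrite (bigD1 i) //= ffunE eqxx expr1z big1 ?mulr1 // => j /negPf ji.
by rewrite ffunE eq_sym ji expr0z.
Qed.

Lemma sum_weightN (a : {ffun 'I_k -> int}) y :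
  \sum_j ((- a) j)%:~R * y j = - \sum_j (a j)%:~R * y j.
Proof. by rewrite -sumrN; apply: eq_bigr => j _; rewrite ffunE rmorphN mulNr. Qed.

Lemma prod_weightN (a : {ffun 'I_k -> int}) z :
  \prod_j z j ^ (- a) j = (\prod_j z j ^ a j)^-1.
Proof. by rewrite -prodfV; apply: eq_bigr => j _; rewrite ffunE -invr_expz. Qed.

(* The torus defined by the relations prod z^s1 = 1 and prod z^s2 = 1, solved *)
(* for the coordinates i1 and i2: s1 i1 = s2 i2 = 1 and s1 i2 = s2 i1 = 0.    *)
Variables (s1 s2 : 'I_k -> int) (i1 i2 : 'I_k).

Definition relation_weight (i : 'I_k) : {ffun 'I_k -> int} :=
  [ffun j => (i == j)%:Z - (i == i1)%:Z * s1 j - (i == i2)%:Z * s2 j].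

Lemma sum_relation_weight i y : \sum_j (relation_weight i j)%:~R * y j =
  y i - (i == i1)%:R * (\sum_j (s1 j)%:~R * y j) - (i == i2)%:R * (\sum_j (s2 j)%:~R * y j).
Proof.
rewrite -[in RHS](sum_delta_weight i y) !mulr_sumr -!sumrB; apply: eq_bigr => j _.
by rewrite !ffunE !rmorphB !rmorphM /= !mulrBl !mulrA -!pmulrn.
Qed.

Lemma prod_relation_weight i z : (forall j, z j != 0) ->
  \prod_j z j ^ relation_weight i j =
  z i * (\prod_j z j ^ s1 j) ^ (- (i == i1)%:Z) * (\prod_j z j ^ s2 j) ^ (- (i == i2)%:Z).
Proof.
move=> z0; have zM (s : 'I_k -> int) (a : int) :
    (\prod_j z j ^ s j) ^ a = \prod_j z j ^ (s j * a).
  elim/big_rec2: _ => [|j x1 x2 _ <-]; first by rewrite exp1rz.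
  by rewrite expfzMl exprz_exp.
rewrite -[in RHS](prod_delta_weight i z) !zM -!big_split /=; apply: eq_bigr => j _.
by rewrite -!expfzDr // !ffunE; congr (_ ^ _); ring.
Qed.

(** [relation_weight] corrects the coordinates [i1] and [i2] by the defect of the relations:
    solutions are fixed, and [relation_weight_sum] computes the relations on the corrected vectors.
    Free parameters thus describe the whole torus. *)
Lemma relation_weight_param y :
  \sum_j (s1 j)%:~R * y j = 0 -> \sum_j (s2 j)%:~R * y j = 0 ->
  forall i, \sum_j (relation_weight i j)%:~R * y j = y i.
Proof. by move=> y1 y2 i; rewrite sum_relation_weight y1 y2 !mulr0 !subr0. Qed.

Lemma relation_weight_prod z : (forall j, z j != 0) ->
  \prod_j z j ^ s1 j = 1 -> \prod_j z j ^ s2 j = 1 ->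
  forall i, \prod_j z j ^ relation_weight i j = z i.
Proof. by move=> z0 z1 z2 i; rewrite prod_relation_weight // z1 z2 !exp1rz !mulr1. Qed.

Lemma relation_weight_sum (s : 'I_k -> int) y :
  \sum_i (s i)%:~R * (\sum_j (relation_weight i j)%:~R * y j) =
  \sum_i (s i)%:~R * y i - (s i1)%:~R * (\sum_j (s1 j)%:~R * y j)
    - (s i2)%:~R * (\sum_j (s2 j)%:~R * y j).
Proof.
under eq_bigr do rewrite sum_relation_weight !mulrBr.
rewrite !sumrB; congr (_ - _ - _).
  rewrite (bigD1 i1) //= eqxx mul1r [X in _ + X]big1 ?addr0 // => i /negPf->.
  by rewrite mul0r mulr0.
rewrite (bigD1 i2) //= eqxx mul1r [X in _ + X]big1 ?addr0 // => i /negPf->.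
by rewrite mul0r mulr0.
Qed.

Lemma relation_weight_prodr (s : 'I_k -> int) z : (forall j, z j != 0) ->
  \prod_i (\prod_j z j ^ relation_weight i j) ^ s i =
  (\prod_i z i ^ s i) * (\prod_j z j ^ s1 j) ^ (- s i1) * (\prod_j z j ^ s2 j) ^ (- s i2).
Proof.
move=> z0; under eq_bigr do rewrite prod_relation_weight // !expfzMl !exprz_exp.
rewrite !big_split /=; congr (_ * _ * _).
  rewrite (bigD1 i1) //= eqxx mulN1r [X in _ * X]big1 ?mulr1 // => i /negPf->.
  by rewrite mul0r expr0z.
rewrite (bigD1 i2) //= eqxx mulN1r [X in _ * X]big1 ?mulr1 // => i /negPf->.
by rewrite mul0r expr0z.
Qed.

End TorusRelations.

Section PartialTrace.
Variables (K : fieldType) (m n : nat).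
Notation V := 'M[K]_(m + n).

Definition ptrace (s : bool) (X : V) : K := \sum_(i | @in_dr m n i == s) X i i.

Lemma ptrace_ul X : \tr (ulsubmx X) = ptrace false X.
Proof.
rewrite /ptrace big_mkcond big_split_ord /= [X in _ + X]big1 ?addr0 => [|j _].
  by apply: eq_bigr => i _; rewrite in_dr_lshift eqxx !mxE.
by rewrite in_dr_rshift.
Qed.

Lemma ptrace_dr X : \tr (drsubmx X) = ptrace true X.
Proof.
rewrite /ptrace big_mkcond big_split_ord /= [X in X + _]big1 ?add0r => [|j _].
  by apply: eq_bigr => i _; rewrite in_dr_rshift eqxx !mxE.
by rewrite in_dr_lshift.
Qed.

(** An odd matrix exchanges the two blocks, so moving it around the trace also changes the block
    over which the trace is taken. *)
Lemma ptraceM p s (X Y : V) : has_parity p X ->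
  ptrace s (X *m Y) = ptrace (s (+) p) (Y *m X).
Proof.
move=> Xp; rewrite /ptrace.
under eq_bigr do rewrite mxE.
under [RHS]eq_bigr do rewrite mxE.
rewrite big_mkcond [RHS]big_mkcond /=.
transitivity (\sum_i \sum_j (if in_dr i == s then X i j * Y j i else 0)).
  by apply: eq_bigr => i _; case: ifP => // _; rewrite big1.
rewrite exchange_big; apply: eq_bigr => j _.
rewrite -big_mkcond /=; case: eqP => js.
  rewrite big_mkcond; apply: eq_bigr => i _; rewrite mulrC.
  case: eqP => // is_; have [->|/Xp ijp] := eqVneq (X i j) 0; first by rewrite mulr0.
  by case: is_; move: js ijp; case: in_dr; case: in_dr; case: (s); case: (p).
rewrite big1 // => i /eqP is_; have [->|/Xp ijp] := eqVneq (X i j) 0; first by rewrite mul0r.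
by case: js; move: is_ ijp; case: in_dr; case: in_dr; case: (s); case: (p).
Qed.

Lemma ptraceB s X Y : ptrace s (X - Y) = ptrace s X - ptrace s Y.
Proof. by rewrite /ptrace -sumrB; apply: eq_bigr => i _; rewrite !mxE. Qed.

Lemma ptraceD s X Y : ptrace s (X + Y) = ptrace s X + ptrace s Y.
Proof. by rewrite /ptrace -big_split; apply: eq_bigr => i _; rewrite !mxE. Qed.

Lemma ptrace_scalar a : ptrace false a%:M = a *+ m /\ ptrace true a%:M = a *+ n.
Proof.
rewrite -ptrace_ul -ptrace_dr; split.
  by rewrite /mxtrace (eq_bigr (fun=> a)) ?sumr_const ?card_ord // => i _; rewrite !mxE eqxx.
by rewrite /mxtrace (eq_bigr (fun=> a)) ?sumr_const ?card_ord // => i _; rewrite !mxE eqxx.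
Qed.

Lemma mxtrace_ptrace (X : V) : \tr X = ptrace false X + ptrace true X.
Proof.
rewrite -ptrace_ul -ptrace_dr /mxtrace big_split_ord /=.
by congr (_ + _); apply: eq_bigr => i _; rewrite !mxE.
Qed.

End PartialTrace.

Lemma fun_NDE (K : fieldType) (V : Type) (e f : V -> K) h : (- e + f)%R h = f h - e h.
Proof. exact: addrC. Qed.

(** * gl, sl and psl *)

Section TypeATriangular.
Variables (K : fieldType) (m n : nat).
Hypothesis charK : forall k, k.+1%:R != 0 :> K.
Notation V := 'M[K]_(m + n).

(** Levels decrease with the index and agree on epsilon_i and delta_i, so that epsilon_i - delta_i
    has level 0 and the listed roots of u_0 and u_1 are negative. *)
Definition levA (i : 'I_(m + n)) : int :=
  match fintype.split i with inl i' => - (i' : nat)%:Z | inr j => - (j : nat)%:Z end.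

Lemma levA_l i : levA (lshift n i) = - (i : nat)%:Z.
Proof. by rewrite /levA -[lshift n i]/(unsplit (inl i)) unsplitK. Qed.

Lemma levA_r j : levA (rshift m j) = - (j : nat)%:Z.
Proof. by rewrite /levA -[rshift m j]/(unsplit (inr j)) unsplitK. Qed.

Lemma levA_inj i j : in_dr i = in_dr j -> levA i = levA j -> i = j.
Proof.
case: (split_ordP i) => i' ->; case: (split_ordP j) => j' ->;
  rewrite ?levA_l ?levA_r ?in_dr_lshift ?in_dr_rshift // => _ /oppr_inj[] ij;
  by congr (_ _ _); apply: val_inj.
Qed.

Variables (b : V -> V -> V) (E : {vspace V}) (P : 'rV[K]_(m + n) -> Prop).
Hypothesis ma : matrix_algebra b E fullv levA.

(** Each of u_0, f_1 and u_1 is identified by two inclusions: every listed root has the right level,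
    and every matrix position of that level carries a listed root. The other matrix families follow
    the same pattern. *)
Lemma typeA_triangular k (A : 'I_(m + n) -> {ffun 'I_k -> int}) :
  torus_param b E fullv P A -> triangular (typeA b E P).
Proof.
move=> tA; apply: (matrix_triangular charK ma _ _ _ tA); apply/eqP; rewrite eqEsubv; apply/andP; split.
- rewrite subv_add; apply/andP; split; apply/subv_sumP => i _; apply/subv_sumP => j ij.
    apply: (mx_root_gr charK ma _ (i := lshift n j) (j := lshift n i)) => [h _|].
      exact: fun_NDE.
    by rewrite !levA_l; lia.
  apply: (mx_root_gr charK ma _ (i := rshift m j) (j := rshift m i)) => [h _|].
    exact: fun_NDE.
  by rewrite !levA_r; lia.
- apply: (mx_gr_root ma) => i0 j0.
  case: (split_ordP i0) => i ->; case: (split_ordP j0) => j ->;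
    rewrite ?in_dr_lshift ?in_dr_rshift ?levA_l ?levA_r // => _ ij _.
    exists (- eps j + eps i); split=> [h _|]; first exact: fun_NDE.
    apply: subv_trans (addvSl _ _); apply: (sumv_sup j) => //; apply: (sumv_sup i) => //; lia.
  exists (- del j + del i); split=> [h _|]; first exact: fun_NDE.
  apply: subv_trans (addvSr _ _); apply: (sumv_sup j) => //; apply: (sumv_sup i) => //; lia.
- apply/subv_sumP => i _; apply/subv_sumP => j /eqP ij; rewrite subv_add; apply/andP; split.
    apply: (mx_root_gr charK ma _ (i := lshift n i) (j := rshift m j)) => [h _|] //.
    by rewrite levA_l levA_r ij subrr.
  apply: (mx_root_gr charK ma _ (i := rshift m j) (j := lshift n i)) => [h _|].
    by rewrite -[RHS]opprB.
  by rewrite levA_l levA_r ij subrr.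
- apply: (mx_gr_root ma) => i0 j0.
  case: (split_ordP i0) => i ->; case: (split_ordP j0) => j ->;
    rewrite ?in_dr_lshift ?in_dr_rshift ?levA_l ?levA_r // => _ ij _.
    exists (eps i - del j); split=> [h _|] //.
    apply: (sumv_sup i) => //; apply: (sumv_sup j); last exact: addvSl.
    by move: ij; rewrite subr_eq0 eqr_opp.
  exists (- (eps j - del i)); split=> [h _|]; first by rewrite -[RHS]opprB.
  apply: (sumv_sup j) => //; apply: (sumv_sup i); last exact: addvSr.
  by move: ij; rewrite subr_eq0 eqr_opp eq_sym.
- rewrite subv_add; apply/andP; split; apply/subv_sumP => i _; apply/subv_sumP => j ij.
    apply: (mx_root_gr charK ma _ (i := rshift m j) (j := lshift n i)) => [h _|].
      exact: fun_NDE.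
    by rewrite levA_l levA_r; lia.
  apply: (mx_root_gr charK ma _ (i := lshift n j) (j := rshift m i)) => [h _|].
    exact: fun_NDE.
  by rewrite levA_l levA_r; lia.
apply: (mx_gr_root ma) => i0 j0.
case: (split_ordP i0) => i ->; case: (split_ordP j0) => j ->;
  rewrite ?in_dr_lshift ?in_dr_rshift ?levA_l ?levA_r // => _ ij _.
  exists (- del j + eps i); split=> [h _|]; first exact: fun_NDE.
  apply: subv_trans (addvSr _ _); apply: (sumv_sup j) => //; apply: (sumv_sup i) => //; lia.
exists (- eps j + del i); split=> [h _|]; first exact: fun_NDE.
apply: subv_trans (addvSl _ _); apply: (sumv_sup j) => //; apply: (sumv_sup i) => //; lia.
Qed.

End TypeATriangular.

(** * Cartan subalgebras and tori of gl and sl *)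

Lemma natr_inj_char (K : fieldType) (a b : nat) :
  (forall k, k.+1%:R != 0 :> K) -> a%:R = b%:R :> K -> a = b.
Proof.
move=> charK; wlog ab : a b / (a <= b)%N.
  by move=> H; case: (leqP a b) => [/H//|/ltnW/H{}H /esym/H].
move=> /eqP; rewrite eq_sym -subr_eq0 -natrB //.
case ba : (b - a)%N => [|k]; last by rewrite (negPf (charK k)).
by move=> _; apply/eqP; rewrite eqn_leq ab -subn_eq0 ba.
Qed.

Section BlockTori.
Variables (K : fieldType) (m n : nat).
Notation V := 'M[K]_(m + n).
Hypothesis charK : forall k, k.+1%:R != 0 :> K.

Definition block_sign (c1 c2 : int) (i : 'I_(m + n)) : int := if in_dr i then c2 else c1.

Lemma block_sign_sum c1 c2 (y : 'I_(m + n) -> K) :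
  \sum_i (block_sign c1 c2 i)%:~R * y i =
  c1%:~R * (\sum_i y (lshift n i)) + c2%:~R * (\sum_j y (rshift m j)).
Proof.
rewrite big_split_ord /= !mulr_sumr /block_sign.
congr (_ + _); apply: eq_bigr => i _; first by rewrite in_dr_lshift.
by rewrite in_dr_rshift.
Qed.

Lemma block_sign_prod c1 c2 (z : 'I_(m + n) -> K) :
  \prod_i z i ^ block_sign c1 c2 i =
  (\prod_i z (lshift n i)) ^ c1 * (\prod_j z (rshift m j)) ^ c2.
Proof.
have zM k (F : 'I_k -> K) (a : int) : (\prod_j F j) ^ a = \prod_j F j ^ a.
  elim/big_rec2: _ => [|j x1 x2 _ <-]; first by rewrite exp1rz.
  by rewrite expfzMl.
rewrite big_split_ord /= !zM /block_sign.
congr (_ * _); apply: eq_bigr => i _; first by rewrite in_dr_lshift.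
by rewrite in_dr_rshift.
Qed.

Lemma tr_ulE (X : V) : \tr (ulsubmx X) = \sum_i X (lshift n i) (lshift n i).
Proof. by apply: eq_bigr => i _; rewrite !mxE. Qed.

Lemma tr_drE (X : V) : \tr (drsubmx X) = \sum_j X (rshift m j) (rshift m j).
Proof. by apply: eq_bigr => j _; rewrite !mxE. Qed.

Lemma ul_trace_linear : linear (fun X : V => \tr (ulsubmx X) : K^o).
Proof.
move=> a X Y; rewrite !tr_ulE scaler_sumr -big_split; apply: eq_bigr => i _ /=.
by rewrite !mxE.
Qed.

Lemma dr_trace_linear : linear (fun X : V => \tr (drsubmx X) : K^o).
Proof.
move=> a X Y; rewrite !tr_drE scaler_sumr -big_split; apply: eq_bigr => i _ /=.
by rewrite !mxE.
Qed.

Lemma supertrace_linear : linear (fun X : V => \tr (ulsubmx X) - \tr (drsubmx X) : K^o).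
Proof. by move=> a X Y; rewrite ul_trace_linear dr_trace_linear scalerBr opprD addrACA. Qed.

Lemma diag_mx_t0 (b : V -> V -> V) (E O : {vspace V}) d : diag_mx d \in E ->
  diag_mx d \in (spart (block_superalgebra b E O) false :&: diagonal_space K (m + n))%VS.
Proof.
move=> dE; rewrite memv_cap; apply/andP; split.
  apply/block_superalgebraP; split=> // i j.
  by rewrite !mxE; case: (eqVneq i j) => [->|]; rewrite ?addbb // mulr0n eqxx.
apply/diagonal_spaceP => i j; rewrite !mxE; case: (eqVneq i j) => // _.
by rewrite mulr0n eqxx.
Qed.

(* Shifting by a scalar matrix does not change the differences of the levels. *)
Lemma level_element (b : V -> V -> V) (E O : {vspace V}) (lv : 'I_(m + n) -> int) c :
    diag_mx (\row_i ((lv i)%:~R + c)) \in E ->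
  exists2 H, H \in (spart (block_superalgebra b E O) false :&: diagonal_space K (m + n))%VS &
    forall i j, H i i - H j j = (lv i - lv j)%:~R.
Proof.
move=> dE; exists (diag_mx (\row_i ((lv i)%:~R + c))); first exact: diag_mx_t0.
by move=> i j; rewrite !mxE !eqxx !mulr1n rmorphB /=; ring.
Qed.

Lemma gl_triangular : triangular (gl_datum K m n).
Proof.
have ma : matrix_algebra (@supercommutator K m n) fullv fullv (@levA m n).
  apply: super_algebra; first by move=> p q X Y _ _; rewrite if_same memvf.
    exact: levA_inj.
  exact: (@level_element _ fullv fullv _ 0 (memvf _)).
apply: (typeA_triangular charK ma (A := @delta_weight (m + n))); split.
- by move=> h _; exists (fun i => h i i) => i; rewrite (sum_delta_weight i (fun i => h i i)).
- by move=> y; apply: memvf.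
- by move=> d d0 _; exists (fun j => d 0 j) => // i; rewrite (prod_delta_weight i (fun j => d 0 j)).
- by [].
Qed.

(** The supertrace of a supercommutator vanishes: [ptraceM] matches the two products, and for odd
    arguments it swaps the blocks with the sign of the supertrace. *)
Lemma sl_closed (E := kernel (fun X : V => \tr (ulsubmx X) - \tr (drsubmx X) : K^o)) p q X Y :
    has_parity p X -> has_parity q Y ->
  supercommutator X Y \in (if p (+) q then fullv else E).
Proof.
move=> Xp Yq; case pq: (p (+) q); first exact: memvf.
rewrite (memv_kernel _ supertrace_linear) ptrace_ul ptrace_dr.
have {pq} qp : q = p by move: pq; case: (p); case: (q).
subst q.
rewrite (supercommutatorE Xp Yq) -scaleNr; have trZ s a Z : ptrace s (a *: Z) = a * ptrace s Z.
  by rewrite /ptrace mulr_sumr; apply: eq_bigr => i _; rewrite mxE.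
rewrite !ptraceD !trZ !(ptraceM _ _ Xp) andbb.
by case: p {Xp Yq} => /=; rewrite ?expr1 ?expr0; apply/eqP; ring.
Qed.

End BlockTori.

Section SL.
Variables (K : fieldType) (m n : nat).
Hypothesis charK : forall k, k.+1%:R != 0 :> K.
Hypothesis m_gt0 : (0 < m)%N.
Notation V := 'M[K]_(m + n).

Lemma sl_triangular : triangular (sl_datum K m n).
Proof.
set E := kernel (fun X : V => \tr (ulsubmx X) - \tr (drsubmx X) : K^o).
have memE X : (X \in E) = (\tr (ulsubmx X) - \tr (drsubmx X) == 0).
  exact: (memv_kernel _ (@supertrace_linear K m n)).
have memEd (d : 'rV[K]_(m + n)) :
    (diag_mx d \in E) = (\sum_i (block_sign 1 (-1) i)%:~R * d 0 i == 0).
  rewrite memE tr_ulE tr_drE block_sign_sum mul1r mulN1r.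
  by congr (_ - _ == 0); apply: eq_bigr => i _; rewrite mxE eqxx.
have ma : matrix_algebra (@supercommutator K m n) E fullv (@levA m n).
  apply: super_algebra.
  - by move=> p q X Y /spart_parity Xp /spart_parity Yq; apply: sl_closed.
  - exact: levA_inj.
  pose S1 : K := \sum_(i < m) - (i : nat)%:R; pose S2 : K := \sum_(j < n) - (j : nat)%:R.
  (* For m different from n this scalar shift makes the supertrace vanish. For m = n scalars have
     supertrace 0 and the levels of the two blocks already cancel. *)
  apply: (@level_element _ _ _ _ _ _ _ ((S2 - S1) / (m%:R - n%:R))).
  rewrite memEd block_sign_sum mul1r mulN1r; under eq_bigr do rewrite mxE levA_l.
  under [X in _ - X]eq_bigr do rewrite mxE levA_r.
  rewrite !big_split /= !sumr_const !card_ord.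
  have S1E : \sum_(i < m) (- (i : nat)%:Z)%:~R = S1 by apply: eq_bigr => i _; rewrite rmorphN.
  have S2E : \sum_(i < n) (- (i : nat)%:Z)%:~R = S2 by apply: eq_bigr => i _; rewrite rmorphN.
  rewrite S1E S2E; have [mn|mn] := eqVneq m n.
    by rewrite /S1 mn subrr.
  have mn0 : m%:R - n%:R != 0 :> K.
    by rewrite subr_eq0; apply: contraNneq mn => /(natr_inj_char charK)->.
  rewrite -[_ *+ m]mulr_natr -[_ *+ n]mulr_natr; apply/eqP; field.
  exact: mn0.
(* The single relation, supertrace 0, is solved for the first epsilon; [block_sign 0 0] is the
   trivial relation. *)
pose i0 := lshift n (Ordinal m_gt0).
have s1_i0 : block_sign 1 (-1) i0 = 1 by rewrite /block_sign in_dr_lshift.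
have s0 (y : 'I_(m + n) -> K) : \sum_i (block_sign 0 0 i)%:~R * y i = 0.
  by rewrite block_sign_sum !mul0r addr0.
have p0 (z : 'I_(m + n) -> K) : \prod_i z i ^ block_sign 0 0 i = 1.
  by rewrite block_sign_prod !expr0z mulr1.
apply: (typeA_triangular charK ma (A := relation_weight (block_sign 1 (-1)) (block_sign 0 0) i0 i0)).
split.
- move=> h ht; exists (fun i => h i i) => i.
  rewrite (relation_weight_param _ _ (y := fun i => h i i)) //.
  rewrite block_sign_sum mul1r mulN1r -tr_ulE -tr_drE; apply/eqP; rewrite -memE.
  by have [/block_superalgebraP[]] := mx_t0P ht.
- move=> y; rewrite memEd; under eq_bigr do rewrite mxE.
  by rewrite relation_weight_sum s1_i0 s0 mul1r subrr mulr0 subrr.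
- move=> d d0 dP; exists (fun j => d 0 j) => // i.
  rewrite (relation_weight_prod _ _ _ (z := fun j => d 0 j)) //.
  rewrite block_sign_prod expr1z exprN1.
  have -> : \prod_i d 0 (lshift n i) = \prod_j d 0 (rshift m j).
    transitivity (\prod_i lsubmx d 0 i); first by apply: eq_bigr => l _; rewrite mxE.
    by rewrite dP; apply: eq_bigr => l _; rewrite mxE.
  by rewrite mulfV //; apply/prodf_neq0.
- move=> z z0; under eq_bigr do rewrite !mxE; under [RHS]eq_bigr do rewrite !mxE.
  have := relation_weight_prodr (block_sign 1 (-1)) (block_sign 0 0) i0 i0 (block_sign 1 (-1)) z0.
  rewrite s1_i0 p0 exp1rz mulr1 exprN1 mulfV; last first.
    by apply/prodf_neq0 => i _; rewrite expfz_neq0.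
  rewrite block_sign_prod expr1z exprN1 => /(congr1 (fun x => x *
    \prod_j \prod_l z l ^ relation_weight (block_sign 1 (-1)) (block_sign 0 0) i0 i0 (rshift m j) l)).
  rewrite mul1r -mulrA mulVf ?mulr1 //.
  by apply/prodf_neq0 => i _; apply/prodf_neq0 => j _; rewrite expfz_neq0.
Qed.

End SL.

(** * psl *)

Section PSL.
Variables (K : fieldType) (n : nat).
Hypothesis charK : forall k, k.+1%:R != 0 :> K.
Hypothesis n_gt0 : (0 < n)%N.
Notation V := 'M[K]_(n + n).
Notation b := (fun X Y : V => modulo_scalars (supercommutator X Y)).

Let n_neq0 : n%:R != 0 :> K.
Proof. by case: n n_gt0. Qed.

Let nn_neq0 : (n + n)%:R != 0 :> K.
Proof. by case: n n_gt0 => // k _; rewrite addSn. Qed.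

(** The supertrace of the supercommutator vanishes, so both diagonal blocks have the same trace and
    removing the average scalar kills both. *)
Lemma modulo_odd_trace s (X Y : V) : has_parity true X -> has_parity true Y ->
  ptrace s (modulo_scalars (supercommutator X Y)) = 0.
Proof.
move=> X1 Y1; rewrite /modulo_scalars; set M := supercommutator X Y.
have st : ptrace false M = ptrace true M.
  have := sl_closed X1 Y1; rewrite (memv_kernel _ (@supertrace_linear K n n)).
  by rewrite ptrace_ul ptrace_dr subr_eq0 => /eqP.
rewrite ptraceB mxtrace_ptrace -st; have [e0 e1] := ptrace_scalar n n ((ptrace false M + ptrace false M) / (n + n)%:R).
case: s; rewrite ?e0 ?e1 -?st -mulr_natr natrD; field; rewrite -natrD; exact: nn_neq0.
Qed.

Lemma modulo_even_trace s (X Y : V) : has_parity false X -> has_parity false Y ->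
  ptrace s (modulo_scalars (supercommutator X Y)) = 0.
Proof.
move=> X0 Y0; rewrite modulo_supercommutator_even // ptraceB.
by rewrite !(ptraceM _ _ X0) addbF subrr.
Qed.

Lemma psl_triangular : triangular (psl_datum K n).
Proof.
set E := (kernel (fun X : V => \tr (ulsubmx X) : K^o) :&:
          kernel (fun X : V => \tr (drsubmx X) : K^o))%VS.
have memE X : (X \in E) = (\tr (ulsubmx X) == 0) && (\tr (drsubmx X) == 0).
  rewrite memv_cap (memv_kernel _ (@ul_trace_linear K n n)).
  by rewrite (memv_kernel _ (@dr_trace_linear K n n)).
have memEd (d : 'rV[K]_(n + n)) : (diag_mx d \in E) =
    (\sum_i (block_sign 1 0 i)%:~R * d 0 i == 0) && (\sum_i (block_sign 0 1 i)%:~R * d 0 i == 0).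
  rewrite memE tr_ulE tr_drE !block_sign_sum !mul1r !mul0r addr0 add0r.
  by congr (_ && _); congr (_ == _); apply: eq_bigr => i _; rewrite mxE eqxx.
have ma : matrix_algebra b E fullv (@levA n n).
  apply: modulo_algebra.
  - move=> p q X Y /spart_parity Xp /spart_parity Yq; case pq: (p (+) q); first exact: memvf.
    rewrite memE ptrace_ul ptrace_dr; move: Xp Yq pq.
    case: p; case: q => // X1 Y1 _; first by rewrite !modulo_odd_trace ?eqxx.
    by rewrite !modulo_even_trace ?eqxx.
  - exact: levA_inj.
  pose S1 : K := \sum_(i < n) - (i : nat)%:R.
  have S1E : \sum_(i < n) (- (i : nat)%:Z)%:~R = S1 by apply: eq_bigr => i _; rewrite rmorphN.
  (* Both blocks have the same levels, so one shift makes both traces vanish. *)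
  apply: (@level_element _ _ _ _ _ _ _ (- S1 / n%:R)).
  rewrite memEd !block_sign_sum !mul1r !mul0r addr0 add0r.
  under eq_bigr do rewrite mxE levA_l.
  under [X in _ && (X == 0)]eq_bigr do rewrite mxE levA_r.
  rewrite !big_split /= !sumr_const !card_ord S1E -[(- S1 / n%:R) *+ n]mulr_natr.
  by rewrite mulfVK // subrr eqxx.
(* The relations of the two blocks are solved for the first coordinate of each block. *)
pose i1 := lshift n (Ordinal n_gt0); pose i2 := rshift n (Ordinal n_gt0).
have s11 : block_sign 1 0 i1 = 1 by rewrite /block_sign in_dr_lshift.
have s12 : block_sign 1 0 i2 = 0 by rewrite /block_sign in_dr_rshift.
have s21 : block_sign 0 1 i1 = 0 by rewrite /block_sign in_dr_lshift.
have s22 : block_sign 0 1 i2 = 1 by rewrite /block_sign in_dr_rshift.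
apply: (typeA_triangular charK ma (A := relation_weight (block_sign 1 0) (block_sign 0 1) i1 i2)).
split.
- move=> h ht; exists (fun i => h i i) => i.
  have [/block_superalgebraP[hE _] _] := mx_t0P ht.
  move: hE; rewrite memE tr_ulE tr_drE => /andP[/eqP h1 /eqP h2].
  rewrite (relation_weight_param _ _ (y := fun i => h i i)) //.
    by rewrite block_sign_sum h1 h2 !mulr0 addr0.
  by rewrite block_sign_sum h1 h2 !mulr0 addr0.
- move=> y; rewrite memEd; under eq_bigr do rewrite mxE.
  under [X in _ && (X == 0)]eq_bigr do rewrite mxE.
  rewrite !relation_weight_sum s11 s12 s21 s22 !mul1r !mul0r !subr0.
  by rewrite !subrr eqxx.
- move=> d d0 [dP1 dP2]; exists (fun j => d 0 j) => // i.
  have P1 : \prod_i d 0 (lshift n i) = 1 by rewrite -[RHS]dP1; apply: eq_bigr => l _; rewrite mxE.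
  have P2 : \prod_i d 0 (rshift n i) = 1 by rewrite -[RHS]dP2; apply: eq_bigr => l _; rewrite mxE.
  by rewrite (relation_weight_prod _ _ _ (z := fun j => d 0 j)) // block_sign_prod P1 P2 !exp1rz mulr1.
- move=> z z0; have z1 (s : 'I_(n + n) -> int) : \prod_j z j ^ s j != 0.
    by apply/prodf_neq0 => i _; rewrite expfz_neq0.
  have := relation_weight_prodr (block_sign 1 0) (block_sign 0 1) i1 i2 (block_sign 1 0) z0.
  have := relation_weight_prodr (block_sign 1 0) (block_sign 0 1) i1 i2 (block_sign 0 1) z0.
  rewrite s11 s12 s21 s22 !expr0z !mulr1 !exprN1 !mulfV //.
  rewrite !(block_sign_prod _ _ (fun i => \prod_j z j ^ _)) !expr0z !expr1z mulr1 mul1r => P2 P1.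
  split; [rewrite -[RHS]P1|rewrite -[RHS]P2]; by apply: eq_bigr => i _; rewrite !mxE.
Qed.

End PSL.

(** * osp *)

Section BlockClosure.
Variables (K : fieldType) (m n : nat).
Notation V := 'M[K]_(m + n).

Lemma even_blockK (X : V) : has_parity false X -> X = block_mx (ulsubmx X) 0 0 (drsubmx X).
Proof.
move=> X0; rewrite -[LHS]submxK; congr block_mx; apply/matrixP => i j; rewrite !mxE;
  apply/eqP; rewrite -[_ == 0]negbK; apply/negP => /X0;
  by rewrite in_dr_lshift in_dr_rshift.
Qed.

Lemma odd_blockK (X : V) : has_parity true X -> X = block_mx 0 (ursubmx X) (dlsubmx X) 0.
Proof.
move=> X0; rewrite -[LHS]submxK; congr block_mx; apply/matrixP => i j; rewrite !mxE;
  apply/eqP; rewrite -[_ == 0]negbK; apply/negP => /X0;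
  by rewrite ?in_dr_lshift ?in_dr_rshift.
Qed.

Lemma has_parity_even_block (A : 'M[K]_m) (D : 'M[K]_n) : has_parity false (block_mx A 0 0 D).
Proof.
move=> i j; case: (split_ordP i) => i' ->; case: (split_ordP j) => j' ->;
  rewrite ?in_dr_lshift ?in_dr_rshift //.
  by rewrite block_mxEur mxE eqxx.
by rewrite block_mxEdl mxE eqxx.
Qed.

Lemma has_parity_odd_block (B : 'M[K]_(m, n)) (C : 'M[K]_(n, m)) :
  has_parity true (block_mx 0 B C 0).
Proof.
move=> i j; case: (split_ordP i) => i' ->; case: (split_ordP j) => j' ->;
  rewrite ?in_dr_lshift ?in_dr_rshift //.
  by rewrite block_mxEul mxE eqxx.
by rewrite block_mxEdr mxE eqxx.
Qed.

Variables (E O : {vspace V}).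
Variables (PE : 'M[K]_m -> 'M[K]_n -> Prop) (PO : 'M[K]_(m, n) -> 'M[K]_(n, m) -> Prop).
Hypothesis memE : forall A D, block_mx A 0 0 D \in E <-> PE A D.
Hypothesis memO : forall B C, block_mx 0 B C 0 \in O <-> PO B C.
Hypothesis PE_comm : forall A D A' D', PE A D -> PE A' D' ->
  PE (A *m A' - A' *m A) (D *m D' - D' *m D).
Hypothesis PEO_comm : forall A D B C, PE A D -> PO B C ->
  PO (A *m B - B *m D) (D *m C - C *m A).
Hypothesis PO_comm : forall B C B' C', PO B C -> PO B' C' ->
  PE (B *m C' + B' *m C) (C *m B' + C' *m B).

(** Closure under the supercommutator is reduced to three identities between blocks; osp, q and p
    all go through it. *)
Lemma super_closed b p q (X Y : V) :
  X \in spart (block_superalgebra b E O) p -> Y \in spart (block_superalgebra b E O) q ->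
  supercommutator X Y \in (if p (+) q then O else E).
Proof.
move=> /block_superalgebraP[XE Xp] /block_superalgebraP[YE Yq].
have EO (X' Y' : V) : has_parity false X' -> has_parity true Y' -> X' \in E -> Y' \in O ->
    supercommutator X' Y' \in O.
  move=> X0 Y1; rewrite (even_blockK X0) (odd_blockK Y1) => /memE PX /memO PY.
  rewrite supercommutator_even ?mulmx_block; last exact: has_parity_even_block.
  rewrite !(mul0mx, mulmx0, addr0, add0r) opp_block_mx add_block_mx !(oppr0, addr0, subrr).
  exact/memO/PEO_comm.
case: p q XE Xp YE Yq => [] [] XE Xp YE Yq /=.
- move: XE YE; rewrite (odd_blockK Xp) (odd_blockK Yq) => /memO PX /memO PY.
  rewrite (supercommutatorE (p := true) (q := true)); try exact: has_parity_odd_block.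
  rewrite expr1 scaleN1r opprK !mulmx_block !(mul0mx, mulmx0, addr0, add0r).
  rewrite add_block_mx !addr0; exact/memE/PO_comm.
- by rewrite (supercommutator_skew Xp Yq) rpredN; apply: EO.
- exact: EO.
move: XE YE; rewrite (even_blockK Xp) (even_blockK Yq) => /memE PX /memE PY.
rewrite supercommutator_even ?mulmx_block; last exact: has_parity_even_block.
rewrite !(mul0mx, mulmx0, addr0, add0r) opp_block_mx add_block_mx !(oppr0, addr0).
exact/memE/PE_comm.
Qed.

End BlockClosure.

Section SubmatrixLinear.
Variables (K : fieldType) (m n : nat) (a : K) (X Y : 'M[K]_(m + n)).

Lemma ulsubmxP : ulsubmx (a *: X + Y) = a *: ulsubmx X + ulsubmx Y.
Proof. by apply/matrixP => i j; rewrite !mxE. Qed.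

Lemma ursubmxP : ursubmx (a *: X + Y) = a *: ursubmx X + ursubmx Y.
Proof. by apply/matrixP => i j; rewrite !mxE. Qed.

Lemma dlsubmxP : dlsubmx (a *: X + Y) = a *: dlsubmx X + dlsubmx Y.
Proof. by apply/matrixP => i j; rewrite !mxE. Qed.

Lemma drsubmxP : drsubmx (a *: X + Y) = a *: drsubmx X + drsubmx Y.
Proof. by apply/matrixP => i j; rewrite !mxE. Qed.

End SubmatrixLinear.

Section OSP.
Variables (K : fieldType) (m n : nat) (s : bool).
Hypothesis charK : forall k, k.+1%:R != 0 :> K.
Notation M := (m + m + s)%N.
Notation N := (M + (n + n))%N.
Notation V := 'M[K]_N.

Let ie (i : 'I_m) : 'I_N := lshift (n + n) (lshift s (lshift m i)).
Let ine (i : 'I_m) : 'I_N := lshift (n + n) (lshift s (rshift m i)).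
Let iz (k : 'I_s) : 'I_N := lshift (n + n) (rshift (m + m) k).
Let id (j : 'I_n) : 'I_N := rshift M (lshift n j).
Let ind (j : 'I_n) : 'I_N := rshift M (rshift n j).

Variant osp_index_spec : 'I_N -> Type :=
  | OspE i : osp_index_spec (ie i)
  | OspNE i : osp_index_spec (ine i)
  | OspZ k : osp_index_spec (iz k)
  | OspD j : osp_index_spec (id j)
  | OspND j : osp_index_spec (ind j).

Lemma osp_indexP i : osp_index_spec i.
Proof.
case: (split_ordP i) => [a ->|c ->]; last first.
  by case: (split_ordP c) => j ->; constructor.
case: (split_ordP a) => [a' ->|k ->]; last by constructor.
by case: (split_ordP a') => j ->; constructor.
Qed.

Definition osp_val T (fe fne : 'I_m -> T) (fz : T) (fd fnd : 'I_n -> T) (i : 'I_N) : T :=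
  match fintype.split i with
  | inl a => match fintype.split a with
    | inl a' => match fintype.split a' with inl i => fe i | inr i => fne i end
    | inr _ => fz
    end
  | inr c => match fintype.split c with inl j => fd j | inr j => fnd j end
  end.

Lemma osp_valE T (fe fne : 'I_m -> T) (fz : T) (fd fnd : 'I_n -> T)
    (f := osp_val fe fne fz fd fnd) :
  (forall i, f (ie i) = fe i) * (forall i, f (ine i) = fne i) * (forall k, f (iz k) = fz) *
  (forall j, f (id j) = fd j) * (forall j, f (ind j) = fnd j).
Proof.
have sl p q (i : 'I_p) : fintype.split (lshift q i) = inl i := unsplitK (inl i).
have sr p q (j : 'I_q) : fintype.split (rshift p j) = inr j := unsplitK (inr j).
by rewrite /f /osp_val; do ![split] => i; rewrite ?sl ?sr ?sl ?sr.
Qed.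

(** Opposite weights get opposite levels. The shift by m + n keeps the levels of all epsilon_i and
    delta_j positive, so that the roots -epsilon_k - delta_l and -delta_t are negative, while
    epsilon_i and delta_i still agree. *)
Definition lev_osp : 'I_N -> int := osp_val
  (fun i => (m + n)%:Z - (i : nat)%:Z) (fun i => (i : nat)%:Z - (m + n)%:Z) 0
  (fun j => (m + n)%:Z - (j : nat)%:Z) (fun j => (j : nat)%:Z - (m + n)%:Z).

Lemma lev_ospE : (forall i, lev_osp (ie i) = (m + n)%:Z - (i : nat)%:Z) *
  (forall i, lev_osp (ine i) = (i : nat)%:Z - (m + n)%:Z) * (forall k, lev_osp (iz k) = 0) *
  (forall j, lev_osp (id j) = (m + n)%:Z - (j : nat)%:Z) *
  (forall j, lev_osp (ind j) = (j : nat)%:Z - (m + n)%:Z).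
Proof. exact: osp_valE. Qed.

Lemma osp_dr : (forall i, in_dr (ie i) = false) * (forall i, in_dr (ine i) = false) *
  (forall k, in_dr (iz k) = false) * (forall j, in_dr (id j) = true) *
  (forall j, in_dr (ind j) = true).
Proof. by do ![split] => i; rewrite ?in_dr_lshift ?in_dr_rshift. Qed.

Lemma lev_osp_inj i j : in_dr i = in_dr j -> lev_osp i = lev_osp j -> i = j.
Proof.
have eqI p (x y : 'I_p) : x = y :> nat -> x = y by apply: val_inj.
case: (osp_indexP i) => a; case: (osp_indexP j) => c;
  rewrite ?osp_dr // ?lev_ospE => _ ac; have ha := ltn_ord a; have hc := ltn_ord c; try lia.
- by congr ie; apply: eqI; lia.
- by congr ine; apply: eqI; lia.
- by congr iz; apply: eqI; move: (leq_b1 s); lia.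
- by congr id; apply: eqI; lia.
- by congr ind; apply: eqI; lia.
Qed.

Notation S := (sym_form K m s).
Notation J := (alt_form K n).
Let E1 (X : V) := (ulsubmx X)^T *m S + S *m ulsubmx X.
Let E2 (X : V) := (drsubmx X)^T *m J + J *m drsubmx X.
Let O1 (X : V) := (dlsubmx X)^T *m J + S *m ursubmx X.

Let E1_linear : linear E1.
Proof.
move=> a X Y; rewrite /E1 ulsubmxP linearP /= mulmxDl mulmxDr -scalemxAl -scalemxAr.
by rewrite scalerDr addrACA.
Qed.

Let E2_linear : linear E2.
Proof.
move=> a X Y; rewrite /E2 drsubmxP linearP /= mulmxDl mulmxDr -scalemxAl -scalemxAr.
by rewrite scalerDr addrACA.
Qed.

Let O1_linear : linear O1.
Proof.
move=> a X Y; rewrite /O1 dlsubmxP ursubmxP linearP /= mulmxDl mulmxDr -scalemxAl -scalemxAr.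
by rewrite scalerDr addrACA.
Qed.

Notation E := (kernel E1 :&: kernel E2)%VS.
Notation O := (kernel O1).

Lemma mem_ospE X : (X \in E) = (E1 X == 0) && (E2 X == 0).
Proof. by rewrite memv_cap (memv_kernel _ E1_linear) (memv_kernel _ E2_linear). Qed.

Lemma sym_form_tr : S^T = S.
Proof. by rewrite /sym_form !(tr_block_mx, trmx0, trmx1). Qed.

Lemma alt_form_tr : J^T = - J.
Proof.
by rewrite /alt_form tr_block_mx !trmx0 trmx1 linearN /= trmx1 opp_block_mx !oppr0 opprK.
Qed.

(** The defining equations say that the two forms are preserved infinitesimally. For two odd
    elements the transposed equation [B^T *m S = J *m C] enters too; it follows from the symmetry of
    [S] and the skewness of [J]. *)
Lemma osp_closed p q X Y : X \in spart (osp K m n s) p -> Y \in spart (osp K m n s) q ->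
  supercommutator X Y \in (if p (+) q then O else E).
Proof.
apply: (super_closed (PE := fun A D => A^T *m S + S *m A = 0 /\ D^T *m J + J *m D = 0)
  (PO := fun B C => C^T *m J + S *m B = 0)).
- move=> A D; rewrite mem_ospE /E1 /E2 block_mxKul block_mxKdr.
  by split=> [/andP[/eqP-> /eqP->]|[-> ->]] //; rewrite !eqxx.
- move=> B C; rewrite (memv_kernel _ O1_linear) /O1 block_mxKur block_mxKdl.
  by split=> [/eqP|->].
- have comm N0 (F A A' : 'M[K]_N0) : A^T *m F + F *m A = 0 -> A'^T *m F + F *m A' = 0 ->
      (A *m A' - A' *m A)^T *m F + F *m (A *m A' - A' *m A) = 0.
    move=> /eqP; rewrite addr_eq0 => /eqP AF /eqP; rewrite addr_eq0 => /eqP A'F.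
    rewrite linearB /= !trmx_mul mulmxBl mulmxBr -!mulmxA AF A'F !mulmxN !mulmxA AF A'F.
    by rewrite !mulNmx !opprK addrC subrKA subrr.
  by move=> A D A' D' [A1 D1] [A'1 D'1]; split; apply: comm.
- move=> A D B C [/eqP]; rewrite addr_eq0 => /eqP AS /eqP; rewrite addr_eq0 => /eqP DJ.
  move=> /eqP; rewrite addr_eq0 => /eqP CJ.
  rewrite linearB /= !trmx_mul mulmxBl mulmxBr -!mulmxA DJ CJ !mulmxN !mulmxA CJ AS.
  by rewrite !mulNmx !opprK; apply/matrixP => i j; rewrite !mxE; ring.
move=> B C B' C' /eqP; rewrite addr_eq0 => /eqP CJ /eqP; rewrite addr_eq0 => /eqP CJ'.
have BS : B^T *m S = J *m C.
  apply: trmx_inj; rewrite !trmx_mul trmxK sym_form_tr alt_form_tr.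
  by rewrite mulmxN CJ opprK.
have BS' : B'^T *m S = J *m C'.
  apply: trmx_inj; rewrite !trmx_mul trmxK sym_form_tr alt_form_tr.
  by rewrite mulmxN CJ' opprK.
split.
  rewrite linearD /= !trmx_mul mulmxDl mulmxDr -!mulmxA BS BS' !mulmxA CJ CJ'.
  rewrite !mulNmx; apply/matrixP => i j; rewrite !mxE; ring.
rewrite linearD /= !trmx_mul mulmxDl mulmxDr -!mulmxA CJ CJ' !mulmxN !mulmxA BS BS'.
by apply/matrixP => i j; rewrite !mxE; ring.
Qed.

Lemma sym_rows (A : 'M[K]_M) b :
  (forall i, (S *m A) (lshift s (lshift m i)) b = A (lshift s (rshift m i)) b) *
  (forall i, (S *m A) (lshift s (rshift m i)) b = A (lshift s (lshift m i)) b) *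
  (forall k, (S *m A) (rshift (m + m) k) b = A (rshift (m + m) k) b).
Proof.
have SE Y : S *m col_mx (col_mx (usubmx (usubmx Y)) (dsubmx (usubmx Y))) (dsubmx Y)
  = col_mx (col_mx (dsubmx (usubmx Y)) (usubmx (usubmx Y))) (dsubmx Y) :> 'M[K]_M.
  by rewrite /sym_form !mul_block_col !(mul0mx, mul1mx, addr0, add0r).
have := SE A; rewrite !vsubmxK => ->.
by do ![split] => i; rewrite ?col_mxEd ?col_mxEu ?col_mxEd ?col_mxEu !mxE.
Qed.

Lemma alt_rows (D : 'M[K]_(n + n)) b :
  (forall j, (J *m D) (lshift n j) b = D (rshift n j) b) *
  (forall j, (J *m D) (rshift n j) b = - D (lshift n j) b).
Proof.
have JE Y : J *m col_mx (usubmx Y) (dsubmx Y) = col_mx (dsubmx Y) (- usubmx Y) :> 'M[K]_(n + n).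
  by rewrite /alt_form mul_block_col !(mul0mx, mul1mx, mulNmx, addr0, add0r).
have := JE D; rewrite vsubmxK => ->.
by split=> j; rewrite ?col_mxEd ?col_mxEu !mxE.
Qed.

Lemma osp_entries X : X \in E <->
  (forall a b, (S *m ulsubmx X) b a + (S *m ulsubmx X) a b = 0) /\
  (forall a b, (J *m drsubmx X) a b = (J *m drsubmx X) b a).
Proof.
rewrite mem_ospE /E1 /E2.
have -> : (ulsubmx X)^T *m S = (S *m ulsubmx X)^T by rewrite trmx_mul sym_form_tr.
have -> : (drsubmx X)^T *m J = - (J *m drsubmx X)^T.
  by rewrite trmx_mul alt_form_tr mulmxN opprK.
have addE p (P Q : 'M[K]_p) i j : (P + Q) i j = P i j + Q i j by rewrite mxE.
have oppE p (P : 'M[K]_p) i j : (- P) i j = - P i j by rewrite mxE.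
have trE p (P : 'M[K]_p) i j : P^T i j = P j i by rewrite mxE.
have zE p i j : (0 : 'M[K]_p) i j = 0 by rewrite mxE.
split=> [/andP[/eqP/matrixP X1 /eqP/matrixP X2]|[X1 X2]].
  split=> a b; first by have := X1 a b; rewrite addE trE zE.
  by have := X2 b a; rewrite addE oppE trE zE addrC => /eqP; rewrite subr_eq0 => /eqP.
apply/andP; split; apply/eqP/matrixP => a b; first by rewrite addE trE zE.
by rewrite addE oppE trE zE X2 addNr.
Qed.

(** Multiplication by the form turns the conditions into skewness on the orthogonal side and
    symmetry on the symplectic side. On the skew diagonal the entries of weight -2 epsilon_i vanish,
    whereas -2 delta_j remains a root. *)
Lemma osp_relations X : X \in E ->
  [/\ forall i k, X (ine i) (ine k) = - X (ie k) (ie i),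
      forall i, X (ine i) (ie i) = 0,
      forall k, X (iz k) (iz k) = 0 &
      forall j l, X (ind j) (ind l) = - X (id l) (id j)].
Proof.
have two0 (x : K) : x + x = 0 -> x = 0.
  by move=> /eqP; rewrite -mulr2n -mulr_natr mulf_eq0 (negPf (charK 1)) orbF => /eqP.
move=> /osp_entries[X1 X2]; split=> [i k|i|k|j l].
- have := X1 (lshift s (lshift m i)) (lshift s (rshift m k)); rewrite !sym_rows !mxE.
  by move/eqP; rewrite addrC addr_eq0 => /eqP.
- by have := X1 (lshift s (lshift m i)) (lshift s (lshift m i)); rewrite !sym_rows !mxE => /two0.
- by have := X1 (rshift (m + m) k) (rshift (m + m) k); rewrite !sym_rows !mxE => /two0.
by have := X2 (lshift n j) (rshift n l); rewrite !alt_rows !mxE.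
Qed.

Lemma osp_diag (x : 'rV[K]_N) :
  (forall i, x 0 (ine i) = - x 0 (ie i)) -> (forall k, x 0 (iz k) = 0) ->
  (forall j, x 0 (ind j) = - x 0 (id j)) -> diag_mx x \in E.
Proof.
move=> xe xz xd; apply/osp_entries; split=> a b.
  case: (split_ordP a) => [{}a ->|k ->]; [case: (split_ordP a) => i ->|];
  case: (split_ordP b) => [{}b ->|k' ->]; try (case: (split_ordP b) => i' ->);
  rewrite !sym_rows !mxE ?eq_shift ?mulr0n ?addr0 ?add0r //.
  - by rewrite xe eq_sym; case: eqP => [->|]; rewrite ?mulr0n ?addr0 // subrr.
  - by rewrite xe eq_sym; case: eqP => [->|]; rewrite ?mulr0n ?addr0 // addNr.
  - by rewrite !xz !mul0rn addr0.
case: (split_ordP a) => i ->; case: (split_ordP b) => j ->;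
  rewrite !alt_rows !mxE ?eq_shift ?mulr0n ?oppr0 //.
- by rewrite xd eq_sym; case: eqP => [->|]; rewrite ?mulr0n ?oppr0 // mulNrn.
- by rewrite xd eq_sym; case: eqP => [->|]; rewrite ?mulr0n ?oppr0 // mulNrn.
Qed.

Notation L := (osp K m n s).
Notation t0 := (spart L false :&: diagonal_space K N)%VS.

Lemma osp_t0 (h : V) : h \in t0 ->
  (forall i, h (ine i) (ine i) = - h (ie i) (ie i)) * (forall k, h (iz k) (iz k) = 0) *
  (forall j, h (ind j) (ind j) = - h (id j) (id j)).
Proof.
move=> /mx_t0P[/block_superalgebraP[/osp_relations[h1 _ h3 h4] _] _].
by do ![split] => i; rewrite ?h1 ?h3 ?h4.
Qed.

Lemma osp_matrix_algebra : matrix_algebra (@supercommutator K M (n + n)) E O lev_osp.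
Proof.
apply: super_algebra; first exact: osp_closed; first exact: lev_osp_inj.
apply: (@level_element _ _ _ _ _ _ _ 0); apply: osp_diag => i; rewrite !mxE !lev_ospE !addr0.
- by rewrite -rmorphN opprB.
- by [].
- by rewrite -rmorphN opprB.
Qed.

Let ma := osp_matrix_algebra.

Definition osp_weight : 'I_N -> {ffun 'I_(m + n) -> int} := osp_val
  (fun i => delta_weight (lshift n i)) (fun i => - delta_weight (lshift n i)) 0
  (fun j => delta_weight (rshift m j)) (fun j => - delta_weight (rshift m j)).

Lemma osp_torus_param : torus_param (@supercommutator K M (n + n)) E O (@osp_torus K m n s) osp_weight.
Proof.
have wE := osp_valE (fun i => delta_weight (lshift n i)) (fun i => - delta_weight (lshift n i)) 0
  (fun j => delta_weight (rshift m j)) (fun j => - delta_weight (rshift m j)).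
have s0 (y : 'I_(m + n) -> K) : \sum_j ((0 : {ffun 'I_(m + n) -> int}) j)%:~R * y j = 0.
  by rewrite big1 // => j _; rewrite ffunE mul0r.
have p0 (z : 'I_(m + n) -> K) : \prod_j z j ^ (0 : {ffun 'I_(m + n) -> int}) j = 1.
  by rewrite big1 // => j _; rewrite ffunE expr0z.
have sl p q (i : 'I_p) : fintype.split (lshift q i) = inl i := unsplitK (inl i).
have sr p q (j : 'I_q) : fintype.split (rshift p j) = inr j := unsplitK (inr j).
split.
- move=> h ht; have hE := osp_t0 ht.
  exists (fun l => match fintype.split l with inl i => h (ie i) (ie i) | inr j => h (id j) (id j) end).
  move=> a; case: (osp_indexP a) => i; rewrite /osp_weight ?wE ?hE ?s0 //
    ?sum_weightN ?sum_delta_weight ?sl ?sr //.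
- move=> y; apply: osp_diag => i; rewrite !mxE /osp_weight !wE ?s0 // sum_weightN //.
- move=> d d0 [a [c dE]].
  exists (fun l => match fintype.split l with inl i => d 0 (ie i) | inr j => d 0 (id j) end).
    by move=> l; case: fintype.split.
  move=> q; case: (osp_indexP q) => i; rewrite /osp_weight ?wE ?p0 // ?prod_weightN
    ?prod_delta_weight ?sl ?sr // dE;
    by rewrite !(row_mxEl, row_mxEr) !mxE.
move=> z z0; exists (\row_i z (lshift n i)), (\row_j z (rshift m j)).
apply/rowP => q; rewrite mxE; case: (osp_indexP q) => i; rewrite /osp_weight ?wE ?p0 //
  ?prod_weightN ?prod_delta_weight; by rewrite !(row_mxEl, row_mxEr) !mxE.
Qed.

Let e (i : 'I_m) : V -> K := eps (lshift s (lshift m i)).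
Let d (j : 'I_n) : V -> K := del (lshift n j).

Lemma osp_triangular : triangular (osp_datum K m n s).
Proof.
have lt_i (i : 'I_m) := ltn_ord i; have lt_j (j : 'I_n) := ltn_ord j.
apply: (matrix_triangular charK ma _ _ _ osp_torus_param); apply/eqP; rewrite eqEsubv;
  apply/andP; split.
- rewrite !subv_add -!andbA; apply/and4P; split.
  + apply/subv_sumP => i _; apply/subv_sumP => j ij; rewrite subv_add; apply/andP; split.
      apply: (mx_root_gr charK ma _ (i := ie j) (j := ie i)) => [h _|]; first exact: fun_NDE.
      by rewrite !lev_ospE; lia.
    apply: (mx_root_gr charK ma _ (i := ine i) (j := ie j)) => [h ht|].
      by rewrite (osp_t0 ht).
    by rewrite !lev_ospE; have := lt_i i; have := lt_i j; lia.
  + apply/subv_sumP => i hs; have s_gt0 : (0 < s)%N by rewrite hs.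
    apply: (mx_root_gr charK ma _ (i := iz (Ordinal s_gt0)) (j := ie i)) => [h ht|].
      by rewrite (osp_t0 ht) sub0r.
    by rewrite !lev_ospE; have := lt_i i; lia.
  + apply/subv_sumP => i _; apply/subv_sumP => j ij; rewrite subv_add; apply/andP; split.
      apply: (mx_root_gr charK ma _ (i := id j) (j := id i)) => [h _|]; first exact: fun_NDE.
      by rewrite !lev_ospE; lia.
    apply: (mx_root_gr charK ma _ (i := ind i) (j := id j)) => [h ht|].
      by rewrite (osp_t0 ht).
    by rewrite !lev_ospE; have := lt_j i; have := lt_j j; lia.
  apply/subv_sumP => i _.
  apply: (mx_root_gr charK ma _ (i := ind i) (j := id i)) => [h ht|].
    by rewrite (osp_t0 ht) -opprD -mulr2n.
  by rewrite !lev_ospE; have := lt_j i; lia.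
- apply: (mx_gr_root ma) => i0 j0.
  case: (osp_indexP i0) => i; case: (osp_indexP j0) => j; rewrite ?osp_dr // => _;
    have hi := ltn_ord i; have hj := ltn_ord j; rewrite !lev_ospE => ij hX; try lia.
  + exists (- e j + e i); split=> [h ht|]; first exact: fun_NDE.
    apply: subv_trans (addvSl _ _); apply: subv_trans (addvSl _ _); apply: subv_trans (addvSl _ _).
    by apply: (sumv_sup j) => //; apply: (sumv_sup i); [lia|apply: addvSl].
  + have [ji|ji|ji] := ltngtP i j.
    * exists (- e i - e j); split=> [h ht|]; first by rewrite (osp_t0 ht).
      apply: subv_trans (addvSl _ _); apply: subv_trans (addvSl _ _); apply: subv_trans (addvSl _ _).
      by apply: (sumv_sup i) => //; apply: (sumv_sup j) => //; apply: addvSr.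
    * exists (- e j - e i); split=> [h ht|]; first by rewrite (osp_t0 ht) [RHS]addrC.
      apply: subv_trans (addvSl _ _); apply: subv_trans (addvSl _ _); apply: subv_trans (addvSl _ _).
      by apply: (sumv_sup j) => //; apply: (sumv_sup i) => //; apply: addvSr.
    (* The remaining position has weight -2 epsilon_i and vanishes identically. *)
    have [X /block_superalgebraP[/osp_relations[_ X0 _ _] _]] := hX.
    by rewrite (val_inj ji : i = j) X0 eqxx.
  + exists (- e i + e j); split=> [h ht|].
      by rewrite fun_NDE !(osp_t0 ht) opprK addrC.
    apply: subv_trans (addvSl _ _); apply: subv_trans (addvSl _ _); apply: subv_trans (addvSl _ _).
    by apply: (sumv_sup i) => //; apply: (sumv_sup j); [lia|apply: addvSl].
  + exists (- e i); split=> [h ht|]; first by rewrite !(osp_t0 ht) subr0.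
    apply: subv_trans (addvSl _ _); apply: subv_trans (addvSl _ _); apply: subv_trans (addvSr _ _).
    by apply: (sumv_sup i) => //; have := leq_ltn_trans (leq0n j) hj; rewrite lt0b.
  + exists (- e j); split=> [h ht|]; first by rewrite !(osp_t0 ht) sub0r.
    apply: subv_trans (addvSl _ _); apply: subv_trans (addvSl _ _); apply: subv_trans (addvSr _ _).
    by apply: (sumv_sup j) => //; have := leq_ltn_trans (leq0n i) hi; rewrite lt0b.
  + exists (- d j + d i); split=> [h ht|]; first exact: fun_NDE.
    apply: subv_trans (addvSl _ _); apply: subv_trans (addvSr _ _).
    by apply: (sumv_sup j) => //; apply: (sumv_sup i); [lia|apply: addvSl].
  + have [ji|ji|/val_inj ij'] := ltngtP i j.
    * exists (- d i - d j); split=> [h ht|]; first by rewrite (osp_t0 ht).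
      apply: subv_trans (addvSl _ _); apply: subv_trans (addvSr _ _).
      by apply: (sumv_sup i) => //; apply: (sumv_sup j) => //; apply: addvSr.
    * exists (- d j - d i); split=> [h ht|]; first by rewrite (osp_t0 ht) [RHS]addrC.
      apply: subv_trans (addvSl _ _); apply: subv_trans (addvSr _ _).
      by apply: (sumv_sup j) => //; apply: (sumv_sup i) => //; apply: addvSr.
    exists (- (d i *+ 2)); split=> [h ht|].
      by rewrite -ij' (osp_t0 ht) -opprD -mulr2n.
    by apply: subv_trans (addvSr _ _); apply: (sumv_sup i).
  exists (- d i + d j); split=> [h ht|].
    by rewrite fun_NDE !(osp_t0 ht) opprK addrC.
  apply: subv_trans (addvSl _ _); apply: subv_trans (addvSr _ _).
  by apply: (sumv_sup i) => //; apply: (sumv_sup j); [lia|apply: addvSl].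
- apply/subv_sumP => i _; apply/subv_sumP => j /eqP ij; rewrite subv_add; apply/andP; split.
    apply: (mx_root_gr charK ma _ (i := ie i) (j := id j)) => [h _|] //.
    by rewrite !lev_ospE ij subrr.
  apply: (mx_root_gr charK ma _ (i := id j) (j := ie i)) => [h _|].
    by rewrite -[RHS]opprB.
  by rewrite !lev_ospE ij subrr.
- apply: (mx_gr_root ma) => i0 j0.
  case: (osp_indexP i0) => i; case: (osp_indexP j0) => j; rewrite ?osp_dr // => _;
    have hi := ltn_ord i; have hj := ltn_ord j; rewrite !lev_ospE => ij hX; try lia.
  + exists (e i - d j); split=> [h ht|] //.
    by apply: (sumv_sup i) => //; apply: (sumv_sup j); [lia|apply: addvSl].
  + exists (- (e i - d j)); split=> [h ht|].
      by rewrite !(osp_t0 ht) opprK -[LHS]/(- (_ - _)) opprB addrC.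
    by apply: (sumv_sup i) => //; apply: (sumv_sup j); [lia|apply: addvSr].
  + exists (- (e j - d i)); split=> [h ht|]; first by rewrite -[LHS]/(- (_ - _)) opprB.
    by apply: (sumv_sup j) => //; apply: (sumv_sup i); [lia|apply: addvSr].
  exists (e j - d i); split=> [h ht|]; first by rewrite !(osp_t0 ht) opprK addrC.
  by apply: (sumv_sup j) => //; apply: (sumv_sup i); [lia|apply: addvSl].
- rewrite !subv_add -!andbA; apply/and4P; split.
  + apply/subv_sumP => i _; apply/subv_sumP => j ij.
    apply: (mx_root_gr charK ma _ (i := id j) (j := ie i)) => [h _|]; first exact: fun_NDE.
    by rewrite !lev_ospE; lia.
  + apply/subv_sumP => i _; apply/subv_sumP => j ij.
    apply: (mx_root_gr charK ma _ (i := ie j) (j := id i)) => [h _|]; first exact: fun_NDE.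
    by rewrite !lev_ospE; lia.
  + apply/subv_sumP => i _; apply/subv_sumP => j _.
    apply: (mx_root_gr charK ma _ (i := ine i) (j := id j)) => [h ht|].
      by rewrite (osp_t0 ht).
    by rewrite !lev_ospE; have := lt_i i; have := lt_j j; lia.
  apply/subv_sumP => j hs; have s_gt0 : (0 < s)%N by rewrite hs.
  apply: (mx_root_gr charK ma _ (i := iz (Ordinal s_gt0)) (j := id j)) => [h ht|].
    by rewrite (osp_t0 ht) sub0r.
  by rewrite !lev_ospE; have := lt_j j; lia.
apply: (mx_gr_root ma) => i0 j0.
case: (osp_indexP i0) => i; case: (osp_indexP j0) => j; rewrite ?osp_dr // => _;
  have hi := ltn_ord i; have hj := ltn_ord j; rewrite !lev_ospE => ij hX; try lia.
- exists (- d j + e i); split=> [h ht|]; first exact: fun_NDE.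
  apply: subv_trans (addvSl _ _); apply: subv_trans (addvSl _ _); apply: subv_trans (addvSr _ _).
  by apply: (sumv_sup j) => //; apply: (sumv_sup i) => //; lia.
- exists (- e i - d j); split=> [h ht|]; first by rewrite (osp_t0 ht).
  apply: subv_trans (addvSl _ _); apply: subv_trans (addvSr _ _).
  by apply: (sumv_sup i) => //; apply: (sumv_sup j).
- exists (- e i + d j); split=> [h ht|]; first by rewrite fun_NDE !(osp_t0 ht) opprK addrC.
  apply: subv_trans (addvSl _ _); apply: subv_trans (addvSl _ _); apply: subv_trans (addvSl _ _).
  by apply: (sumv_sup i) => //; apply: (sumv_sup j) => //; lia.
- exists (- d j); split=> [h ht|]; first by rewrite (osp_t0 ht) sub0r.
  apply: subv_trans (addvSr _ _).
  by apply: (sumv_sup j) => //; have := leq_ltn_trans (leq0n i) hi; rewrite lt0b.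
- exists (- e j + d i); split=> [h ht|]; first exact: fun_NDE.
  apply: subv_trans (addvSl _ _); apply: subv_trans (addvSl _ _); apply: subv_trans (addvSl _ _).
  by apply: (sumv_sup j) => //; apply: (sumv_sup i) => //; lia.
- exists (- e j - d i); split=> [h ht|]; first by rewrite (osp_t0 ht) [RHS]addrC.
  apply: subv_trans (addvSl _ _); apply: subv_trans (addvSr _ _).
  by apply: (sumv_sup j) => //; apply: (sumv_sup i).
- exists (- d i + e j); split=> [h ht|]; first by rewrite fun_NDE !(osp_t0 ht) opprK addrC.
  apply: subv_trans (addvSl _ _); apply: subv_trans (addvSl _ _); apply: subv_trans (addvSr _ _).
  by apply: (sumv_sup i) => //; apply: (sumv_sup j) => //; lia.
exists (- d i); split=> [h ht|]; first by rewrite !(osp_t0 ht) subr0.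
apply: subv_trans (addvSr _ _).
by apply: (sumv_sup i) => //; have := leq_ltn_trans (leq0n j) hj; rewrite lt0b.
Qed.

End OSP.

(** * q and psq *)

Section TypeQTriangular.
Variables (K : fieldType) (n : nat).
Hypothesis charK : forall k, k.+1%:R != 0 :> K.
Notation V := 'M[K]_(n + n).
Let ker_even := kernel (fun X : V => ulsubmx X - drsubmx X).
Let ker_odd := kernel (fun X : V => ursubmx X - dlsubmx X).

Lemma ker_evenE (X : V) : (X \in ker_even) = (ulsubmx X == drsubmx X).
Proof.
rewrite memv_kernel ?subr_eq0 // => a Y Z; rewrite ulsubmxP drsubmxP.
by rewrite scalerBr opprD addrACA.
Qed.

Lemma ker_oddE (X : V) : (X \in ker_odd) = (ursubmx X == dlsubmx X).
Proof.
rewrite memv_kernel ?subr_eq0 // => a Y Z; rewrite ursubmxP dlsubmxP.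
by rewrite scalerBr opprD addrACA.
Qed.

Definition dup_val T (f : 'I_n -> T) (i : 'I_(n + n)) : T :=
  match fintype.split i with inl j | inr j => f j end.

Lemma dup_valE T (f : 'I_n -> T) :
  (forall i, dup_val f (lshift n i) = f i) * (forall i, dup_val f (rshift n i) = f i).
Proof.
have sl p q (i : 'I_p) : fintype.split (lshift q i) = inl i := unsplitK (inl i).
have sr p q (j : 'I_q) : fintype.split (rshift p j) = inr j := unsplitK (inr j).
by split=> i; rewrite /dup_val ?sl ?sr.
Qed.

Lemma ker_even_diag (x : 'rV[K]_(n + n)) :
  (forall i, x 0 (lshift n i) = x 0 (rshift n i)) -> diag_mx x \in ker_even.
Proof.
move=> xlr; rewrite ker_evenE; apply/eqP/matrixP => i j.
by rewrite !mxE xlr eq_lshift eq_rshift.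
Qed.

Variables (b : V -> V -> V) (E O : {vspace V}) (P : 'rV[K]_(n + n) -> Prop).
Hypothesis ma : matrix_algebra b (E :&: ker_even) (O :&: ker_odd) (@levA n n).

Lemma typeQ_t0 (h : V) : h \in (spart (block_superalgebra b (E :&: ker_even) (O :&: ker_odd)) false
    :&: diagonal_space K (n + n))%VS ->
  h \in E /\ forall i, h (rshift n i) (rshift n i) = h (lshift n i) (lshift n i).
Proof.
move=> /mx_t0P[/block_superalgebraP[hE _] _]; move: hE; rewrite memv_cap ker_evenE.
by move=> /andP[hE /eqP/matrixP hlr]; split=> // i; have := hlr i i; rewrite !mxE.
Qed.

(** On t_0 the two diagonal blocks coincide, so all four blocks carry the same weights. The odd
    diagonal matrices are exactly the odd part of level 0, a root space of weight 0 rather than a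
    sum over listed roots. *)
Lemma typeQ_triangular k (A : 'I_(n + n) -> {ffun 'I_k -> int}) :
  torus_param b (E :&: ker_even) (O :&: ker_odd) (fun d => lsubmx d = rsubmx d /\ P d) A ->
  triangular (typeQ b E O P).
Proof.
move=> tA; apply: (matrix_triangular charK ma _ _ _ tA); apply/eqP; rewrite eqEsubv; apply/andP; split.
- apply/subv_sumP => i _; apply/subv_sumP => j ij.
  apply: (mx_root_gr charK ma _ (i := lshift n j) (j := lshift n i)) => [h _|].
    exact: fun_NDE.
  by rewrite !levA_l; lia.
- apply: (mx_gr_root ma) => i0 j0.
  case: (split_ordP i0) => i ->; case: (split_ordP j0) => j ->;
    rewrite ?in_dr_lshift ?in_dr_rshift ?levA_l ?levA_r // => _ ij _;
    exists (- eps j + eps i); split=> [h ht|].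
  + exact: fun_NDE.
  + by apply: (sumv_sup j) => //; apply: (sumv_sup i) => //; lia.
  + by have [_ hr] := typeQ_t0 ht; rewrite fun_NDE !hr.
  by apply: (sumv_sup j) => //; apply: (sumv_sup i) => //; lia.
- apply/subvP => X; rewrite memv_cap => /andP[X1].
  rewrite memv_kernel => [/eqP/matrixP XD|]; last first.
    move=> a Y Z; apply/matrixP => i j; rewrite !mxE mulrnDl -mulrnAr; ring.
  have Xd i j : ursubmx X i j != 0 -> i = j.
    have := XD i j; rewrite !mxE; case: (eqVneq i j) => // _.
    by rewrite mulr0n subr0 => ->; rewrite eqxx.
  have [XO Xp] := block_superalgebraP _ _ _ _ _ X1.
  move: (XO); rewrite memv_cap ker_oddE => /andP[_ /eqP/matrixP Xud].
  apply/(mx_grP _ _ _ _); split=> // i0 j0.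
  case: (split_ordP i0) => i ->; case: (split_ordP j0) => j ->;
    rewrite ?levA_l ?levA_r => Xij.
  + by have := Xp _ _ Xij; rewrite !in_dr_lshift.
  + by rewrite (Xd i j) ?subrr // !mxE.
  + by rewrite (Xd i j) ?subrr // Xud !mxE.
  by have := Xp _ _ Xij; rewrite !in_dr_rshift.
- apply/subvP => X /(mx_grP _ _ _ _)[X1 Xl]; rewrite memv_cap X1 memv_kernel; last first.
    move=> a Y Z; apply/matrixP => i j; rewrite !mxE mulrnDl -mulrnAr; ring.
  apply/eqP/matrixP => i j; rewrite !mxE; case: (eqVneq i j) => [->|ij]; first by rewrite subrr.
  rewrite subr0; apply/eqP; rewrite -[_ == 0]negbK; apply: contra ij => /Xl.
  by rewrite levA_l levA_r subr_eq0 eqr_opp.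
- apply/subv_sumP => i _; apply/subv_sumP => j ij.
  apply: (mx_root_gr charK ma _ (i := lshift n j) (j := lshift n i)) => [h _|].
    exact: fun_NDE.
  by rewrite !levA_l; lia.
apply: (mx_gr_root ma) => i0 j0.
case: (split_ordP i0) => i ->; case: (split_ordP j0) => j ->;
  rewrite ?in_dr_lshift ?in_dr_rshift ?levA_l ?levA_r // => _ ij _;
  exists (- eps j + eps i); split=> [h ht|].
- by have [_ hr] := typeQ_t0 ht; rewrite fun_NDE !hr.
- by apply: (sumv_sup j) => //; apply: (sumv_sup i) => //; lia.
- by have [_ hr] := typeQ_t0 ht; rewrite fun_NDE !hr.
by apply: (sumv_sup j) => //; apply: (sumv_sup i) => //; lia.
Qed.

End TypeQTriangular.

(** * Closure and torus of q and psq *)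

Section QandPSQ.
Variables (K : fieldType) (n : nat).
Hypothesis charK : forall k, k.+1%:R != 0 :> K.
Notation V := 'M[K]_(n + n).
Notation ker_even := (kernel (fun X : V => ulsubmx X - drsubmx X)).
Notation ker_odd := (kernel (fun X : V => ursubmx X - dlsubmx X)).

Lemma typeQ_closed b (E O : {vspace V}) p q X Y :
    X \in spart (block_superalgebra b (E :&: ker_even) (O :&: ker_odd)) p ->
    Y \in spart (block_superalgebra b (E :&: ker_even) (O :&: ker_odd)) q ->
  supercommutator X Y \in (if p (+) q then ker_odd else ker_even).
Proof.
move=> Xp Yq.
have sub r Z : Z \in spart (block_superalgebra b (E :&: ker_even) (O :&: ker_odd)) r ->
    Z \in spart (block_superalgebra b ker_even ker_odd) r.
  move=> /block_superalgebraP[ZE Zr]; apply/block_superalgebraP; split=> //.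
  by case: r ZE {Zr}; rewrite memv_cap => /andP[].
apply: (super_closed (PE := fun A D => A = D) (PO := fun B C => B = C) _ _ _ _ _ (sub _ _ Xp) (sub _ _ Yq)).
- by move=> A D; rewrite ker_evenE block_mxKul block_mxKdr; split=> [/eqP|->].
- by move=> B C; rewrite ker_oddE block_mxKur block_mxKdl; split=> [/eqP|->].
- by move=> A D A' D' <- <-.
- by move=> A D B C <- <-.
by move=> B C B' C' <- <-.
Qed.

Lemma q_triangular : triangular (q_datum K n).
Proof.
have ma : matrix_algebra (@supercommutator K n n) (fullv :&: ker_even) (fullv :&: ker_odd) (@levA n n).
  apply: super_algebra; first by move=> p q X Y Xp Yq; rewrite !capfv; apply: (typeQ_closed Xp Yq).
    exact: levA_inj.
  apply: (@level_element _ _ _ _ _ _ _ 0); rewrite capfv; apply: ker_even_diag => i.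
  by rewrite !mxE levA_l levA_r.
apply: (typeQ_triangular charK ma (A := dup_val (@delta_weight n))); split.
- move=> h /typeQ_t0[_ hr]; exists (fun i => h (lshift n i) (lshift n i)) => i.
  by case: (split_ordP i) => j ->; rewrite dup_valE
    (sum_delta_weight j (fun i => h (lshift n i) (lshift n i))) ?hr.
- by move=> y; rewrite capfv; apply: ker_even_diag => i; rewrite !mxE !dup_valE.
- move=> d d0 [dlr _]; exists (fun i => d 0 (lshift n i)) => // i.
  case: (split_ordP i) => j ->; rewrite dup_valE
    (prod_delta_weight j (fun i => d 0 (lshift n i))) //.
  by have /rowP/(_ j) := dlr; rewrite !mxE.
by move=> z z0; split=> //; apply/rowP => i; rewrite !mxE !dup_valE.
Qed.

Lemma psq_triangular : (0 < n)%N -> triangular (psq_datum K n).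
Proof.
move=> n_gt0; set E := kernel (fun X : V => \tr (ulsubmx X) : K^o).
set O := kernel (fun X : V => \tr (ursubmx X) : K^o).
have memE X : (X \in E) = (\tr (ulsubmx X) == 0) by apply/memv_kernel/ul_trace_linear.
have memO X : (X \in O) = (\tr (ursubmx X) == 0).
  by apply: memv_kernel => a Y Z; rewrite ursubmxP linearP.
have memEd (d : 'rV[K]_(n + n)) : (diag_mx d \in E) = (\sum_i d 0 (lshift n i) == 0).
  by rewrite memE tr_ulE; congr (_ == _); apply: eq_bigr => i _; rewrite mxE eqxx.
pose b := fun X Y : V => modulo_scalars (supercommutator X Y).
have ma : matrix_algebra b (E :&: ker_even) (O :&: ker_odd) (@levA n n).
  apply: modulo_algebra.
  - have OE X Y : X \in spart (block_superalgebra b (E :&: ker_even) (O :&: ker_odd)) false ->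
        Y \in spart (block_superalgebra b (E :&: ker_even) (O :&: ker_odd)) true ->
        modulo_scalars (supercommutator X Y) \in (O :&: ker_odd)%VS.
      move=> X0 Y1; have XYo := typeQ_closed X0 Y1.
      rewrite memv_cap; move: XYo.
      rewrite (modulo_supercommutator_even _ (spart_parity X0)).
      rewrite -(supercommutator_even _ (spart_parity X0)) => -> /=; rewrite andbT memO.
      rewrite (supercommutator_even _ (spart_parity X0)).
      have [XE _] := block_superalgebraP _ _ _ _ _ X0; have [YO _] := block_superalgebraP _ _ _ _ _ Y1.
      move: XE YO; rewrite !memv_cap ker_evenE ker_oddE => /andP[_ /eqP Xlr] /andP[_ /eqP Yud].
      rewrite (even_blockK (spart_parity X0)) (odd_blockK (spart_parity Y1)) !mulmx_block.
      rewrite !(mul0mx, mulmx0, addr0, add0r) opp_block_mx add_block_mx block_mxKur Xlr.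
      by rewrite raddfB /= mxtrace_mulC subrr.
    move=> [] [] X Y Xp Yq /=.
    + have [X1 Y1] := (spart_parity Xp, spart_parity Yq).
      rewrite memv_cap; apply/andP; split.
        by rewrite memE ptrace_ul modulo_odd_trace.
      have := typeQ_closed Xp Yq; rewrite !ker_evenE => /eqP/matrixP ulr.
      apply/eqP/matrixP => i j; have := ulr i j.
      by rewrite /modulo_scalars; move: (supercommutator X Y) => Z; rewrite !mxE eq_lshift eq_rshift => ->.
    + rewrite supercommutator_skew ?modulo_scalarsN ?rpredN; try exact: spart_parity.
      exact: OE.
    + exact: OE.
    have [X0 Y0] := (spart_parity Xp, spart_parity Yq).
    rewrite memv_cap; apply/andP; split.
      by rewrite memE ptrace_ul modulo_even_trace.
    by rewrite modulo_supercommutator_even // -supercommutator_even //; apply: (typeQ_closed Xp Yq).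
  - exact: levA_inj.
  pose S1 : K := \sum_(i < n) - (i : nat)%:R.
  apply: (@level_element _ _ _ _ _ _ _ (- S1 / n%:R)).
  rewrite memv_cap memEd; apply/andP; split; last first.
    by apply: ker_even_diag => i; rewrite !mxE levA_l levA_r.
  have S1E : \sum_(i < n) (- (i : nat)%:Z)%:~R = S1 by apply: eq_bigr => i _; rewrite rmorphN.
  under eq_bigr do rewrite mxE levA_l.
  rewrite big_split /= sumr_const card_ord S1E -[(- S1 / n%:R) *+ n]mulr_natr.
  by rewrite mulfVK ?subrr //; case: (n) n_gt0.
pose i0 := Ordinal n_gt0.
have s1 (y : 'I_n -> K) : \sum_i (1 : int)%:~R * y i = \sum_i y i.
  by apply: eq_bigr => i _; rewrite mul1r.
have s0 (y : 'I_n -> K) : \sum_i (0 : int)%:~R * y i = 0.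
  by rewrite big1 // => i _; rewrite mul0r.
have p1 (z : 'I_n -> K) : \prod_i z i ^ (1 : int) = \prod_i z i.
  by apply: eq_bigr => i _; rewrite expr1z.
have p0 (z : 'I_n -> K) : \prod_i z i ^ (0 : int) = 1.
  by rewrite big1 // => i _; rewrite expr0z.
apply: (typeQ_triangular charK ma (A := dup_val (relation_weight (fun=> 1) (fun=> 0) i0 i0))).
split.
- move=> h /typeQ_t0[hE hr]; exists (fun i => h (lshift n i) (lshift n i)) => i.
  have hs : \sum_i h (lshift n i) (lshift n i) = 0.
    by apply/eqP; rewrite -tr_ulE -memE.
  by case: (split_ordP i) => j ->; rewrite dup_valE ?hr
    (relation_weight_param _ _ (y := fun i => h (lshift n i) (lshift n i))) ?s1 ?s0 ?hr.
- move=> y; rewrite memv_cap memEd; apply/andP; split; last first.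
    by apply: ker_even_diag => i; rewrite !mxE !dup_valE.
  under eq_bigr do rewrite mxE dup_valE.
  by rewrite -(s1 (fun i => _)) relation_weight_sum s1 s0 mul1r subrr mulr0 subrr.
- move=> d d0 [dlr dP]; exists (fun i => d 0 (lshift n i)) => // i.
  have dp : \prod_i d 0 (lshift n i) = 1 by rewrite -[RHS]dP; apply: eq_bigr => l _; rewrite mxE.
  case: (split_ordP i) => j ->; rewrite dup_valE
    (relation_weight_prod _ _ _ (z := fun i => d 0 (lshift n i))) ?p1
    ?(p0 (fun i => d 0 (lshift n i))) //.
  by have /rowP/(_ j) := dlr; rewrite !mxE.
move=> z z0; split; first by apply/rowP => i; rewrite !mxE !dup_valE.
under eq_bigr do rewrite !mxE dup_valE.
rewrite -(p1 (fun i => _)) relation_weight_prodr // p1 p0 exp1rz mulr1 exprN1 mulfV //.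
by apply/prodf_neq0.
Qed.

End QandPSQ.

(** * Type P *)

Section TypePTriangular.
Variables (K : fieldType) (n : nat).
Hypothesis charK : forall k, k.+1%:R != 0 :> K.
Notation V := 'M[K]_(n + n).
Let ker_even := kernel (fun X : V => drsubmx X + (ulsubmx X)^T).
Let ker_odd := (kernel (fun X : V => (ursubmx X)^T - ursubmx X)%R :&:
   kernel (fun X : V => (dlsubmx X)^T + dlsubmx X)%R)%VS.

Lemma kerP_evenE (X : V) : (X \in ker_even) = (drsubmx X == - (ulsubmx X)^T).
Proof.
rewrite memv_kernel ?addr_eq0 // => a Y Z; rewrite ulsubmxP drsubmxP linearP /=.
by rewrite scalerDr addrACA.
Qed.

Lemma kerP_oddE (X : V) : (X \in ker_odd) =
  ((ursubmx X)^T == ursubmx X) && ((dlsubmx X)^T == - dlsubmx X).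
Proof.
rewrite memv_cap memv_kernel ?memv_kernel ?subr_eq0 ?addr_eq0 //.
  by move=> a Y Z; rewrite dlsubmxP linearP /= scalerDr addrACA.
by move=> a Y Z; rewrite ursubmxP linearP /= scalerBr opprD addrACA.
Qed.

Lemma kerP_even_diag (x : 'rV[K]_(n + n)) :
  (forall i, x 0 (rshift n i) = - x 0 (lshift n i)) -> diag_mx x \in ker_even.
Proof.
move=> xlr; rewrite kerP_evenE; apply/eqP/matrixP => i j.
by rewrite !mxE xlr eq_lshift eq_rshift eq_sym; case: eqP => [->|]; rewrite ?mulr0n ?oppr0.
Qed.

(** With indices from 0, epsilon_j has level n - 1 - 2j, so epsilon_i + epsilon_j has level 2(n - 1
    - i - j), which is 0 exactly for i + j + 1 = n. The levels of the epsilon_j are symmetric about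
    0, hence the level matrix lies in p(n) without any shift. *)
Definition levP (i : 'I_(n + n)) : int :=
  match fintype.split i with
  | inl j => n%:Z - 1 - (j : nat)%:Z *+ 2
  | inr j => (j : nat)%:Z *+ 2 + 1 - n%:Z
  end.

Lemma levPE : (forall i, levP (lshift n i) = n%:Z - 1 - (i : nat)%:Z *+ 2) *
  (forall i, levP (rshift n i) = (i : nat)%:Z *+ 2 + 1 - n%:Z).
Proof.
have sl p q (i : 'I_p) : fintype.split (lshift q i) = inl i := unsplitK (inl i).
have sr p q (j : 'I_q) : fintype.split (rshift p j) = inr j := unsplitK (inr j).
by split=> i; rewrite /levP ?sl ?sr.
Qed.

Lemma levP_inj i j : in_dr i = in_dr j -> levP i = levP j -> i = j.
Proof.
case: (split_ordP i) => i' ->; case: (split_ordP j) => j' ->;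
  rewrite ?levPE ?in_dr_lshift ?in_dr_rshift // => _ ij;
  by congr (_ _ _); apply: val_inj => /=; lia.
Qed.

Lemma typeP_closed b (E : {vspace V}) p q X Y :
    X \in spart (block_superalgebra b (E :&: ker_even) ker_odd) p ->
    Y \in spart (block_superalgebra b (E :&: ker_even) ker_odd) q ->
  supercommutator X Y \in (if p (+) q then ker_odd else ker_even).
Proof.
move=> Xp Yq.
have sub r Z : Z \in spart (block_superalgebra b (E :&: ker_even) ker_odd) r ->
    Z \in spart (block_superalgebra b ker_even ker_odd) r.
  move=> /block_superalgebraP[ZE Zr]; apply/block_superalgebraP; split=> //.
  by case: r ZE {Zr} => //; rewrite memv_cap => /andP[].
apply: (super_closed (PE := fun A D => D = - A^T) (PO := fun B C => B^T = B /\ C^T = - C)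
  _ _ _ _ _ (sub _ _ Xp) (sub _ _ Yq)).
- by move=> A D; rewrite kerP_evenE block_mxKul block_mxKdr; split=> [/eqP|->].
- move=> B C; rewrite kerP_oddE block_mxKur block_mxKdl.
  by split=> [/andP[/eqP-> /eqP->]|[-> ->]]; rewrite ?eqxx.
- move=> A _ A' _ -> ->; rewrite linearB /= !trmx_mul !mulNmx !mulmxN !opprK opprB //.
- move=> A _ B C -> [BT CT]; rewrite !linearB /= !trmx_mul linearN /= trmxK BT CT.
  rewrite !mulNmx !mulmxN !opprK; split; first by rewrite addrC.
  by rewrite addrC.
- move=> B C B' C' [BT CT] [BT' CT']; rewrite linearD /= !trmx_mul BT CT BT' CT'.
  by rewrite !mulNmx opprD !opprK addrC.
Qed.

Variables (E : {vspace V}) (P : 'rV[K]_n -> Prop).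
Notation L := (block_superalgebra (@supercommutator K n n) (E :&: ker_even) ker_odd).
Hypothesis ma : matrix_algebra (@supercommutator K n n) (E :&: ker_even) ker_odd levP.

Lemma typeP_t0 (h : V) : h \in (spart L false :&: diagonal_space K (n + n))%VS ->
  h \in E /\ forall i, h (rshift n i) (rshift n i) = - h (lshift n i) (lshift n i).
Proof.
move=> /mx_t0P[/block_superalgebraP[hE _] _]; move: hE; rewrite memv_cap kerP_evenE.
by move=> /andP[hE /eqP/matrixP hlr]; split=> // i; have := hlr i i; rewrite !mxE.
Qed.

(** The lower left block is skew, so -2 epsilon_i is not an odd root, in contrast with 2
    epsilon_i. *)
Lemma typeP_skew0 X i : X \in spart L true -> X (rshift n i) (lshift n i) = 0.
Proof.
move=> /block_superalgebraP[XO _]; move: XO; rewrite kerP_oddE => /andP[_ /eqP/matrixP/(_ i i)].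
rewrite !mxE => /eqP; rewrite -addr_eq0 -mulr2n -mulr_natr mulf_eq0 (negPf (charK 1)) orbF.
by move/eqP.
Qed.

Let e (i : 'I_n) : V -> K := eps i.

Lemma typeP_triangular k (A : 'I_(n + n) -> {ffun 'I_k -> int}) :
  torus_param (@supercommutator K n n) (E :&: ker_even) ker_odd
    (fun d => exists2 a, d = row_mx a (map_mx GRing.inv a) & P a) A ->
  triangular (typeP E P).
Proof.
move=> tA; apply: (matrix_triangular charK ma _ _ _ tA); apply/eqP; rewrite eqEsubv; apply/andP; split.
- apply/subv_sumP => i _; apply/subv_sumP => j ij.
  apply: (mx_root_gr charK ma _ (i := lshift n j) (j := lshift n i)) => [h _|].
    exact: fun_NDE.
  by rewrite !levPE; lia.
- apply: (mx_gr_root ma) => i0 j0.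
  case: (split_ordP i0) => i ->; case: (split_ordP j0) => j ->;
    rewrite ?in_dr_lshift ?in_dr_rshift ?levPE // => _ ij _.
    exists (- e j + e i); split=> [h ht|]; first exact: fun_NDE.
    by apply: (sumv_sup j) => //; apply: (sumv_sup i) => //; lia.
  exists (- e i + e j); split=> [h ht|].
    by have [_ hr] := typeP_t0 ht; rewrite fun_NDE !hr opprK addrC.
  by apply: (sumv_sup i) => //; apply: (sumv_sup j) => //; lia.
- rewrite subv_add; apply/andP; split; last first.
    apply/subv_sumP => i ii.
    apply: (mx_root_gr charK ma _ (i := lshift n i) (j := rshift n i)) => [h ht|].
      by have [_ hr] := typeP_t0 ht; rewrite hr opprK -mulr2n.
    by rewrite !levPE; lia.
  apply/subv_sumP => i _; apply/subv_sumP => j ij; rewrite subv_add; apply/andP; split.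
    apply: (mx_root_gr charK ma _ (i := lshift n i) (j := rshift n j)) => [h ht|].
      by have [_ hr] := typeP_t0 ht; rewrite hr opprK.
    by rewrite !levPE; lia.
  apply: (mx_root_gr charK ma _ (i := rshift n i) (j := lshift n j)) => [h ht|].
    by have [_ hr] := typeP_t0 ht; rewrite hr -opprD.
  by rewrite !levPE; lia.
- apply: (mx_gr_root ma) => i0 j0.
  case: (split_ordP i0) => i ->; case: (split_ordP j0) => j ->;
    rewrite ?in_dr_lshift ?in_dr_rshift ?levPE // => _ ij hX.
    (* The positions (i, j) and (j, i) of the symmetric block carry the same root, listed once with
       ordered indices; the diagonal carries 2 epsilon_i. *)
    have [ltij|ltji|/val_inj eij] := ltngtP i j.
    + exists (e i + e j); split=> [h ht|]; first by have [_ hr] := typeP_t0 ht; rewrite hr opprK.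
      apply: subv_trans (addvSl _ _); apply: (sumv_sup i) => //; apply: (sumv_sup j); last exact: addvSl.
      by lia.
    + exists (e j + e i); split=> [h ht|]; first by have [_ hr] := typeP_t0 ht; rewrite hr opprK addrC.
      apply: subv_trans (addvSl _ _); apply: (sumv_sup j) => //; apply: (sumv_sup i); last exact: addvSl.
      by lia.
    exists (e i *+ 2); split=> [h ht|].
      by have [_ hr] := typeP_t0 ht; rewrite -eij hr opprK -mulr2n.
    by apply: subv_trans (addvSr _ _); apply: (sumv_sup i) => //; move: ij; rewrite -eij; lia.
  have [ltij|ltji|/val_inj eij] := ltngtP i j.
  + exists (- (e i + e j)); split=> [h ht|]; first by have [_ hr] := typeP_t0 ht; rewrite hr -opprD.
    apply: subv_trans (addvSl _ _); apply: (sumv_sup i) => //; apply: (sumv_sup j); last exact: addvSr.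
    by lia.
  + exists (- (e j + e i)); split=> [h ht|].
      by have [_ hr] := typeP_t0 ht; rewrite hr -opprD [h (lshift n i) _ + _]addrC.
    apply: subv_trans (addvSl _ _); apply: (sumv_sup j) => //; apply: (sumv_sup i); last exact: addvSr.
    by lia.
  by have [X /typeP_skew0 X0] := hX; rewrite -eij X0 eqxx.
- rewrite subv_add; apply/andP; split; apply/subv_sumP => i _; apply/subv_sumP => j ij.
    apply: (mx_root_gr charK ma _ (i := lshift n i) (j := rshift n j)) => [h ht|].
      by have [_ hr] := typeP_t0 ht; rewrite hr opprK.
    by rewrite !levPE; lia.
  apply: (mx_root_gr charK ma _ (i := rshift n i) (j := lshift n j)) => [h ht|].
    by have [_ hr] := typeP_t0 ht; rewrite hr.
  by rewrite !levPE; lia.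
apply: (mx_gr_root ma) => i0 j0.
case: (split_ordP i0) => i ->; case: (split_ordP j0) => j ->;
  rewrite ?in_dr_lshift ?in_dr_rshift ?levPE // => _ ij hX.
  have [leij|ltji] := leqP i j.
    exists (e i + e j); split=> [h ht|]; first by have [_ hr] := typeP_t0 ht; rewrite hr opprK.
    by apply: subv_trans (addvSl _ _); apply: (sumv_sup i) => //; apply: (sumv_sup j) => //; lia.
  exists (e j + e i); split=> [h ht|]; first by have [_ hr] := typeP_t0 ht; rewrite hr opprK addrC.
  by apply: subv_trans (addvSl _ _); apply: (sumv_sup j) => //; apply: (sumv_sup i) => //; lia.
have [ltij|ltji|/val_inj eij] := ltngtP i j.
- exists (- e i - e j); split=> [h ht|]; first by have [_ hr] := typeP_t0 ht; rewrite hr.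
  by apply: subv_trans (addvSr _ _); apply: (sumv_sup i) => //; apply: (sumv_sup j) => //; lia.
- exists (- e j - e i); split=> [h ht|]; first by have [_ hr] := typeP_t0 ht; rewrite hr [RHS]addrC.
  by apply: subv_trans (addvSr _ _); apply: (sumv_sup j) => //; apply: (sumv_sup i) => //; lia.
by have [X /typeP_skew0 X0] := hX; rewrite -eij X0 eqxx.
Qed.

Definition sign_val k (B : 'I_n -> {ffun 'I_k -> int}) (i : 'I_(n + n)) :=
  match fintype.split i with inl j => B j | inr j => - B j end.

Lemma sign_valE k (B : 'I_n -> {ffun 'I_k -> int}) :
  (forall i, sign_val B (lshift n i) = B i) * (forall i, sign_val B (rshift n i) = - B i).
Proof.
have sl p q (i : 'I_p) : fintype.split (lshift q i) = inl i := unsplitK (inl i).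
have sr p q (j : 'I_q) : fintype.split (rshift p j) = inr j := unsplitK (inr j).
by split=> i; rewrite /sign_val ?sl ?sr.
Qed.

Lemma typeP_torus_param (B : 'I_n -> {ffun 'I_n -> int}) :
    (forall y : 'I_n -> K, (exists2 h, h \in E & forall i, y i = h (lshift n i) (lshift n i)) ->
      forall i, \sum_j (B i j)%:~R * y j = y i) ->
    (forall y : 'I_n -> K, diag_mx (\row_i \sum_j (sign_val B i j)%:~R * y j) \in E) ->
    (forall z : 'I_n -> K, (forall j, z j != 0) -> P (\row_i z i) ->
      forall i, \prod_j z j ^ B i j = z i) ->
    (forall z : 'I_n -> K, (forall j, z j != 0) -> P (\row_i \prod_j z j ^ B i j)) ->
  torus_param (@supercommutator K n n) (E :&: ker_even) ker_odd
    (fun d => exists2 a, d = row_mx a (map_mx GRing.inv a) & P a) (sign_val B).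
Proof.
move=> B1 B2 B3 B4; split.
- move=> h /typeP_t0[hE hr]; exists (fun i => h (lshift n i) (lshift n i)) => i.
  have hB : forall i, \sum_j (B i j)%:~R * h (lshift n j) (lshift n j) = h (lshift n i) (lshift n i).
    by apply: (B1 (fun i => h (lshift n i) (lshift n i))); exists h.
  by case: (split_ordP i) => j ->; rewrite sign_valE ?sum_weightN hB ?hr.
- move=> y; rewrite memv_cap B2; apply: kerP_even_diag => i.
  by rewrite !mxE !sign_valE sum_weightN.
- move=> d d0 [a dE Pa]; exists (fun i => d 0 (lshift n i)) => // i.
  have aE : \row_i d 0 (lshift n i) = a by apply/rowP => j; rewrite mxE dE row_mxEl.
  have hB : forall i, \prod_j d 0 (lshift n j) ^ B i j = d 0 (lshift n i).
    by apply: (B3 (fun i => d 0 (lshift n i))) => //; rewrite aE.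
  case: (split_ordP i) => j ->; rewrite sign_valE ?prod_weightN hB //.
  by rewrite dE row_mxEr row_mxEl mxE.
move=> z z0; exists (\row_i \prod_j z j ^ B i j); last exact: B4.
apply/rowP => i; rewrite mxE; case: (split_ordP i) => j ->; rewrite sign_valE ?prod_weightN.
  by rewrite row_mxEl mxE.
by rewrite row_mxEr !mxE.
Qed.

End TypePTriangular.

(** * The two algebras of type P *)

Section PandPtilde.
Variables (K : fieldType) (n : nat).
Hypothesis charK : forall k, k.+1%:R != 0 :> K.
Notation V := 'M[K]_(n + n).
Notation ker_even := (kernel (fun X : V => drsubmx X + (ulsubmx X)^T)).
Notation ker_odd := (kernel (fun X : V => (ursubmx X)^T - ursubmx X)%R :&:
   kernel (fun X : V => (dlsubmx X)^T + dlsubmx X)%R)%VS.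

Lemma levP_even : diag_mx (\row_i ((@levP n i)%:~R + 0)) \in ker_even.
Proof.
by apply: kerP_even_diag => i; rewrite !mxE !levPE !addr0 -rmorphN; congr (_%:~R); lia.
Qed.

Lemma ptilde_triangular : triangular (ptilde_datum K n).
Proof.
have ma : matrix_algebra (@supercommutator K n n) (fullv :&: ker_even) ker_odd (@levP n).
  apply: super_algebra; last 2 first.
  - exact: levP_inj.
  - by apply: (@level_element _ _ _ _ _ _ _ 0); rewrite capfv; apply: levP_even.
  move=> p q X Y Xp Yq; have := typeP_closed Xp Yq.
  by case: (_ (+) _) => //; rewrite capfv.
apply: (typeP_triangular charK ma (A := sign_val (@delta_weight n))).
apply: typeP_torus_param => //.
- by move=> y _ i; apply: sum_delta_weight.
- by move=> y; apply: memvf.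
by move=> z _ _ i; apply: prod_delta_weight.
Qed.

Lemma p_triangular : (0 < n)%N -> triangular (p_datum K n).
Proof.
move=> n_gt0; set E := kernel (fun X : V => \tr (ulsubmx X) : K^o).
have memE X : (X \in E) = (\tr (ulsubmx X) == 0) by apply/memv_kernel/ul_trace_linear.
have memEd (d : 'rV[K]_(n + n)) : (diag_mx d \in E) = (\sum_i d 0 (lshift n i) == 0).
  by rewrite memE tr_ulE; congr (_ == _); apply: eq_bigr => i _; rewrite mxE eqxx.
have two0 (x : K) : x = - x -> x = 0.
  by move=> /eqP; rewrite -addr_eq0 -mulr2n -mulr_natr mulf_eq0 (negPf (charK 1)) orbF => /eqP.
have ma : matrix_algebra (@supercommutator K n n) (E :&: ker_even) ker_odd (@levP n).
  apply: super_algebra; last 2 first.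
  - exact: levP_inj.
  - apply: (@level_element _ _ _ _ _ _ _ 0); rewrite memv_cap levP_even andbT memEd.
    (* Reversing the indices negates the levels, so their sum is its own opposite. *)
    apply/eqP/two0; rewrite -sumrN (reindex_inj rev_ord_inj) /=; apply: eq_bigr => i _.
    rewrite !mxE !levPE !addr0 -rmorphN; congr (_%:~R) => /=; have := ltn_ord i; lia.
  move=> p q X Y Xp Yq; have := typeP_closed Xp Yq; case pq: (p (+) q) => // XY.
  rewrite memv_cap XY andbT memE ptrace_ul.
  move: Xp Yq pq {XY}; case: p; case: q => // X1 Y1 _; last first.
    have [X0 Y0] := (spart_parity X1, spart_parity Y1).
    by rewrite supercommutator_even // ptraceB !(ptraceM _ _ X0) subrr.
  have [XO _] := block_superalgebraP _ _ _ _ _ X1; have [YO _] := block_superalgebraP _ _ _ _ _ Y1.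
  (* The product of a symmetric and a skew matrix is traceless, which keeps the bracket of two odd
     elements inside p(n). *)
  have tr0 (B C : 'M[K]_n) : B^T = B -> C^T = - C -> \tr (B *m C) = 0.
    by move=> BT CT; apply: two0; rewrite -{1}mxtrace_tr trmx_mul BT CT mulNmx raddfN /= mxtrace_mulC.
  move: XO YO; rewrite !kerP_oddE => /andP[/eqP XB /eqP XC] /andP[/eqP YB /eqP YC].
  rewrite -ptrace_ul (supercommutatorE (spart_parity X1) (spart_parity Y1)) expr1 scaleN1r opprK.
  have ulM (Z W : V) : has_parity true Z -> has_parity true W ->
      ulsubmx (Z *m W) = ursubmx Z *m dlsubmx W.
    move=> Z1 W1; rewrite {1}(odd_blockK Z1) {1}(odd_blockK W1) mulmx_block block_mxKul.
    by rewrite mul0mx add0r.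
  have -> : ulsubmx (X *m Y + Y *m X) = ulsubmx (X *m Y) + ulsubmx (Y *m X).
    by rewrite -[X *m Y in LHS]scale1r ulsubmxP scale1r.
  rewrite !ulM; try exact: (spart_parity X1); try exact: (spart_parity Y1).
  by rewrite raddfD /= !tr0 ?addr0.
pose i0 := Ordinal n_gt0.
have s1 (y : 'I_n -> K) : \sum_i (1 : int)%:~R * y i = \sum_i y i.
  by apply: eq_bigr => i _; rewrite mul1r.
have s0 (y : 'I_n -> K) : \sum_i (0 : int)%:~R * y i = 0.
  by rewrite big1 // => i _; rewrite mul0r.
have p1 (z : 'I_n -> K) : \prod_i z i ^ (1 : int) = \prod_i z i.
  by apply: eq_bigr => i _; rewrite expr1z.
have p0 (z : 'I_n -> K) : \prod_i z i ^ (0 : int) = 1.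
  by rewrite big1 // => i _; rewrite expr0z.
apply: (typeP_triangular charK ma (A := sign_val (relation_weight (fun=> 1) (fun=> 0) i0 i0))).
apply: typeP_torus_param.
- move=> y [h hE hy]; apply: relation_weight_param; rewrite ?s0 // s1.
  by apply/eqP; move: hE; rewrite memE tr_ulE; congr (_ == _); apply: eq_bigr.
- move=> y; rewrite memEd; under eq_bigr do rewrite mxE sign_valE.
  by rewrite -(s1 (fun i => _)) relation_weight_sum s1 s0 mul1r subrr mulr0 subrr.
- move=> z z0 zP; apply: relation_weight_prod; rewrite ?p1 ?(p0 z) //.
  by rewrite -[RHS]zP; apply: eq_bigr => i _; rewrite mxE.
move=> z z0; under eq_bigr do rewrite !mxE.
rewrite -(p1 (fun i => _)) relation_weight_prodr // p1 p0 exp1rz mulr1 exprN1 mulfV //.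
by apply/prodf_neq0.
Qed.

End PandPtilde.

(** * Superalgebras of the form (s x sl_2) (+) (W (x) V) *)

Section ExcData.
Variables (K : fieldType) (N : nat).
Hypothesis charK : forall k, k.+1%:R != 0 :> K.
Notation V := ('M[K]_N * 'M[K]_2 * 'M[K]_(N, 2))%type.
Variables (s : {vspace 'M[K]_N}) (D : 'cV[K]_N -> 'cV[K]_N -> 'M[K]_N).
Variables (F : 'M[K]_N) (P : 'rV[K]_N -> Prop).
Variables (lv : 'I_N -> int) (cc : int) (p q : 'I_N).
Notation ev k := (delta_mx k 0 : 'cV[K]_N).

(** The indices [p] and [q] sit at the extreme levels [cc] and [- cc] of W; giving V the same two
    extreme levels, the odd part has level 0 exactly at (p, 1) and (q, 0). Conditions on [D] concern
    [D (ev q)], because the first column of an element of b_1 is a multiple of [ev q]. The values in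
    [ed_Dp] and [ed_Dq] normalise [D] against [F] so that [f_1, f_1] kills f_1. *)
Record exc_data : Prop := ExcData {
  ed_Dl : forall v, linear (D^~ v);
  ed_Dr : forall u, linear (D u);
  ed_s : forall A B, A \in s -> B \in s -> A *m B - B *m A \in s;
  ed_inj : injective lv;
  ed_p : lv p = cc;
  ed_q : lv q = - cc;
  ed_cc : 0 < cc;
  ed_bound : forall i, - cc <= lv i <= cc;
  ed_H : diag_mx (\row_i (lv i)%:~R) \in s;
  ed_Ds : forall k, D (ev q) (ev k) \in s;
  ed_Dskew : forall k, D (ev k) (ev q) = - D (ev q) (ev k);
  ed_Dlev : forall k i j, D (ev q) (ev k) i j != 0 -> lv i - lv j = lv k - cc;
  ed_F : forall i j, F i j != 0 -> lv i + lv j = 0;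
  ed_Fsym : F p q = F q p;
  ed_Dp : D (ev q) (ev p) p p = - F q p;
  ed_Dq : D (ev q) (ev p) q q = F q p;
  ed_rel : forall h, h \in s -> h \in diagonal_space K N -> h q q = - h p p;
  ed_P : forall d : 'rV[K]_N, (forall i, d 0 i != 0) -> P d -> d 0 q = (d 0 p)^-1;
  ed_Ponto : forall z, z != 0 -> exists2 d : 'rV[K]_N, (forall i, d 0 i != 0) & P d /\ d 0 p = z }.

Hypothesis ed : exc_data.

Notation I := ('I_N * 'I_N + 'I_2 * 'I_2 + 'I_N * 'I_2)%type.
Notation L := (exc s D F).
Notation t0 := (exc_t0 s).

Definition lv2 (a : 'I_2) : int := if a == 0 then cc else - cc.

Definition exc_coord (x : I) (X : V) : K :=
  match x with
  | inl (inl ij) => X.1.1 ij.1 ij.2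
  | inl (inr ij) => X.1.2 ij.1 ij.2
  | inr ij => X.2 ij.1 ij.2
  end.

Definition exc_par (x : I) : bool := if x is inr _ then true else false.

Definition exc_lev (x : I) : int :=
  match x with
  | inl (inl ij) => lv ij.1 - lv ij.2
  | inl (inr ij) => lv2 ij.1 - lv2 ij.2
  | inr ij => lv ij.1 + lv2 ij.2
  end.

Definition exc_weight (x : I) (h : V) : K :=
  match x with
  | inl (inl ij) => h.1.1 ij.1 ij.1 - h.1.1 ij.2 ij.2
  | inl (inr ij) => h.1.2 ij.1 ij.1 - h.1.2 ij.2 ij.2
  | inr ij => h.1.1 ij.1 ij.1 + h.1.2 ij.2 ij.2
  end.

Notation gr := (@grspace K L _ exc_coord exc_lev).

Lemma exc_coord_linear x : linear (exc_coord x : V -> K^o).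
Proof. by case: x => [[]|] [i j] a X Y /=; rewrite !mxE. Qed.

Lemma exc_weight_linear x : linear (exc_weight x : V -> K^o).
Proof. by case: x => [[]|] [i j] a X Y /=; rewrite !mxE /GRing.scale /=; ring. Qed.

Lemma exc_coord_sep (X : V) : (forall x, exc_coord x X = 0) -> X = 0.
Proof.
case: X => [[A B] x] H; congr (_, _, _); apply/matrixP => i j; rewrite mxE.
- exact: (H (inl (inl (i, j)))).
- exact: (H (inl (inr (i, j)))).
- exact: (H (inr (i, j))).
Qed.

Lemma exc_evenP (s1 : {vspace 'M[K]_N}) (s2 : {vspace 'M[K]_2}) (X : V) :
  (X \in exc_even s1 s2) = [&& X.1.1 \in s1, X.1.2 \in s2 & X.2 == 0].
Proof.
have l1 : linear (fun A : 'M[K]_N => (A, 0, 0) : V).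
  by move=> a A B; congr (_, _, _); rewrite /= scaler0 addr0.
have l2 : linear (fun A : 'M[K]_2 => (0, A, 0) : V).
  by move=> a A B; congr (_, _, _); rewrite /= scaler0 addr0.
apply/idP/idP.
  case/memv_addP => _ /memv_imgP[A As ->] [_ /memv_imgP[B Bs ->] ->].
  by rewrite !linfun_linear //= addr0 add0r addr0 As Bs eqxx.
case: X => [[A B] x] /= /and3P[As Bs /eqP->]; apply/memv_addP.
exists (A, 0, 0); first by apply/memv_imgP; exists A; rewrite ?linfun_linear.
exists (0, B, 0); first by apply/memv_imgP; exists B; rewrite ?linfun_linear.
by congr (_, _, _); rewrite /= ?addr0 ?add0r.
Qed.

Lemma exc_evenE (X : V) :
  (X \in spart L false) = [&& X.1.1 \in s, \tr X.1.2 == 0 & X.2 == 0].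
Proof.
rewrite /= exc_evenP memv_kernel // => a A B.
by rewrite linearP.
Qed.

Lemma exc_oddE (X : V) : (X \in spart L true) = (X.1 == 0).
Proof. by rewrite /= memv_kernel. Qed.

Lemma exc_t0E (h : V) : h \in t0 ->
  [/\ h.1.1 \in s, h.1.1 \in diagonal_space K N, \tr h.1.2 = 0,
      forall i j, h.1.2 i j != 0 -> i = j & h.2 = 0].
Proof.
rewrite /exc_t0 exc_evenP !memv_cap => /and3P[/andP[h1 h2] /andP[h3 /diagonal_spaceP h4] /eqP h5].
split=> //; move: h3; rewrite memv_kernel => [/eqP//|a A B]; by rewrite linearP.
Qed.

Lemma exc_t0_even h : h \in t0 -> h \in spart L false.
Proof. by move=> /exc_t0E[h1 _ h3 _ h5]; rewrite exc_evenE h1 h3 h5 !eqxx. Qed.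

Lemma exc_coord_par b (X : V) x : X \in spart L b -> exc_coord x X != 0 -> exc_par x = b.
Proof.
case: b; rewrite ?exc_oddE ?exc_evenE.
  move=> /eqP X1; case: x => // [[[i j]|[i j]]] /=; by rewrite X1 mxE eqxx.
by move=> /and3P[_ _ /eqP X2]; case: x => // -[i j] /=; rewrite X2 mxE eqxx.
Qed.

Lemma D0l v : D 0 v = 0.
Proof. by have := ed_Dl ed v (-1) 0 0; rewrite scaler0 addr0 scaleN1r addNr. Qed.
Lemma D0r v : D v 0 = 0.
Proof. by have := ed_Dr ed v (-1) 0 0; rewrite scaler0 addr0 scaleN1r addNr. Qed.

Lemma exc_even_odd (X Y : V) : X.2 = 0 -> Y.1 = 0 ->
  exc_bracket D F X Y = (0, 0, X.1.1 *m Y.2 + Y.2 *m X.1.2^T).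
Proof.
case: X Y => [[A B] x] [[A' B'] y] /= -> [-> ->].
rewrite /exc_bracket /= !col0 !D0l !(mulmx0, mul0mx, trmx0, subrr, subr0, oppr0, addr0, add0r).
by [].
Qed.

Lemma exc_even_even (X Y : V) : X.2 = 0 -> Y.2 = 0 ->
  exc_bracket D F X Y = (X.1.1 *m Y.1.1 - Y.1.1 *m X.1.1, X.1.2 *m Y.1.2 - Y.1.2 *m X.1.2, 0).
Proof.
case: X Y => [[A B] x] [[A' B'] y] /= -> ->.
rewrite /exc_bracket /= !col0 !D0l !(mulmx0, mul0mx, trmx0, subrr, subr0, oppr0, addr0, add0r).
by [].
Qed.

Lemma exc_odd_odd (X Y : V) (G := X.2^T *m F *m Y.2) : X.1 = 0 -> Y.1 = 0 ->
  exc_bracket D F X Y = (D (col 0 X.2) (col 1 Y.2) - D (col 1 X.2) (col 0 Y.2),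
    (G + G^T) *m symp2 K, 0).
Proof.
rewrite {}/G; case: X Y => [[A B] x] [[A' B'] y] /= [-> ->] [-> ->].
rewrite /exc_bracket /= !(mulmx0, mul0mx, trmx0, subrr, subr0, oppr0, addr0, add0r).
by [].
Qed.

Lemma exc_linl Z : linear (fun X => exc_bracket D F X Z).
Proof.
case: Z => [[A2 B2] z] a [[A B] x] [[A' B'] y].
have colP i : col i (a *: x + y) = a *: col i x + col i y.
  by apply/matrixP => k l; rewrite !mxE.
rewrite /exc_bracket /=; congr (_, _, _) => /=.
- rewrite !colP !(ed_Dl ed) !mulmxDl !mulmxDr -!scalemxAl -!scalemxAr.
  by move: (D _ _) (D _ _) (D _ _) (D _ _) => *; apply/matrixP => i j; rewrite !mxE; ring.
- have trP (p1 p2 : nat) (Z W : 'M[K]_(p1, p2)) : (a *: Z + W)^T = a *: Z^T + W^T by rewrite linearP.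
  rewrite !trP !mulmxDl !mulmxDr -!scalemxAl -!scalemxAr trP !mulmxDl -!scalemxAl.
  by apply/matrixP => i j; rewrite !mxE; ring.
rewrite linearP /= !mulmxDl !mulmxDr -!scalemxAl -!scalemxAr.
by apply/matrixP => i j; rewrite !mxE; ring.
Qed.

Lemma exc_linr Z : linear (exc_bracket D F Z).
Proof.
case: Z => [[A2 B2] z] a [[A B] x] [[A' B'] y].
have colP i : col i (a *: x + y) = a *: col i x + col i y.
  by apply/matrixP => k l; rewrite !mxE.
rewrite /exc_bracket /=; congr (_, _, _) => /=.
- rewrite !colP !(ed_Dr ed) !mulmxDl !mulmxDr -!scalemxAl -!scalemxAr.
  by move: (D _ _) (D _ _) (D _ _) (D _ _) => *; apply/matrixP => i j; rewrite !mxE; ring.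
- have trP (p1 p2 : nat) (Z W : 'M[K]_(p1, p2)) : (a *: Z + W)^T = a *: Z^T + W^T by rewrite linearP.
  rewrite !mulmxDr !mulmxDl -!scalemxAr -!scalemxAl trP !mulmxDl -?scalemxAl.
  by apply/matrixP => i j; rewrite !mxE; ring.
have trP (p1 p2 : nat) (Z W : 'M[K]_(p1, p2)) : (a *: Z + W)^T = a *: Z^T + W^T by rewrite linearP.
rewrite trP !mulmxDl !mulmxDr -!scalemxAl -!scalemxAr.
by apply/matrixP => i j; rewrite !mxE; ring.
Qed.

Lemma exc_odd_even (X Y : V) : X.1 = 0 -> Y.2 = 0 ->
  exc_bracket D F X Y = - exc_bracket D F Y X.
Proof.
move=> X1 Y2; rewrite (exc_even_odd Y2 X1); case: X Y X1 Y2 => [[A B] x] [[A' B'] y] /= [-> ->] ->.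
rewrite /exc_bracket /= !col0 !D0r !(mulmx0, mul0mx, trmx0, subrr, subr0, oppr0, addr0, add0r).
by congr (_, _, _); rewrite /= oppr0.
Qed.

Lemma exc_grP b (Z : pred int) (X : V) : reflect
  [/\ X \in spart L b, forall i j, X.1.1 i j != 0 -> Z (lv i - lv j),
      forall i j, X.1.2 i j != 0 -> Z (lv2 i - lv2 j) &
      forall i j, X.2 i j != 0 -> Z (lv i + lv2 j)]
  (X \in gr b Z).
Proof.
apply: (iffP (@grspaceP K L _ exc_coord exc_lev exc_coord_linear b Z X)) => [[Xb XZ]|[Xb X1 X2 X3]].
  by split=> // i j; [apply: (XZ (inl (inl (i, j))))|apply: (XZ (inl (inr (i, j))))|apply: (XZ (inr (i, j)))].
by split=> // -[[[i j]|[i j]]|[i j]]; [apply: X1|apply: X2|apply: X3].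
Qed.

Lemma exc_closed_even X Y : X \in spart L false -> Y \in spart L false ->
  exc_bracket D F X Y \in spart L false.
Proof.
rewrite !exc_evenE => /and3P[X1 X2 /eqP X3] /and3P[Y1 Y2 /eqP Y3].
rewrite exc_even_even //= (ed_s ed) // eqxx andbT /=.
by rewrite raddfB /= mxtrace_mulC subrr.
Qed.

Lemma exc_closed_even_odd X Y : X \in spart L false -> Y \in spart L true ->
  exc_bracket D F X Y \in spart L true.
Proof.
rewrite exc_evenE !exc_oddE => /and3P[_ _ /eqP X3] /eqP Y1.
by rewrite exc_even_odd.
Qed.

Lemma exc_act b (h X : ambient L) : h \in t0 -> X \in spart L b ->
  sbr h X \in spart L b /\ forall x, exc_coord x (sbr h X) = exc_weight x h * exc_coord x X.
Proof.
move=> ht; have [h1 /diagonal_spaceP h2 h3 h4 h5] := exc_t0E ht; have h0 := exc_t0_even ht.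
case: b => Xb; split.
- exact: exc_closed_even_odd.
- have X1 : X.1 = 0 by apply/eqP; rewrite -exc_oddE.
  rewrite /= (exc_even_odd h5 X1).
  case=> [[[i j]|[i j]]|[i j]] /=; rewrite ?X1 !mxE ?mulr0 //.
  have := diag_mxM X.2 i j h2; rewrite mxE mulrDl => ->; congr (_ + _).
  have h4' k l : h.1.2^T k l != 0 -> k = l by rewrite mxE => /h4.
  by have := mx_diagM X.2 i j h4'; rewrite !mxE mulrC => ->.
- exact: exc_closed_even.
have X2 : X.2 = 0 by move: Xb; rewrite exc_evenE => /and3P[_ _ /eqP].
rewrite /= (exc_even_even h5 X2).
case=> [[[i j]|[i j]]|[i j]] /=; rewrite ?X2 !mxE ?mulr0 //.
  have := diag_mxM X.1.1 i j h2; have := mx_diagM X.1.1 i j h2; rewrite !mxE => -> ->; ring.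
have := diag_mxM X.1.2 i j h4; have := mx_diagM X.1.2 i j h4; rewrite !mxE => -> ->; ring.
Qed.

Lemma exc_t0_mem A B : A \in s -> A \in diagonal_space K N -> \tr B = 0 ->
  (forall i j, B i j != 0 -> i = j) -> (A, B, 0) \in t0.
Proof.
move=> As Ad B0 Bd; rewrite /exc_t0 exc_evenP !memv_cap As Ad eqxx /= andbT.
apply/andP; split; last exact/diagonal_spaceP.
by rewrite memv_kernel ?B0 // => a A' B'; rewrite linearP.
Qed.

Lemma diag_mx_diagonal n (d : 'rV[K]_n) i j : diag_mx d i j != 0 -> i = j.
Proof. by rewrite mxE; case: (eqVneq i j) => // _; rewrite mulr0n eqxx. Qed.

Lemma exc_H : exists2 H : ambient L, H \in t0 & forall x, exc_weight x H = (exc_lev x)%:~R.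
Proof.
exists (diag_mx (\row_i (lv i)%:~R), diag_mx (\row_i (lv2 i)%:~R), 0).
  apply: exc_t0_mem; first exact: (ed_H ed).
  - by apply/diagonal_spaceP => i j; apply: diag_mx_diagonal.
  - rewrite mxtrace_diag !big_ord_recl big_ord0 addr0 !mxE -rmorphD /=.
    by rewrite /lv2 /= addrN.
  - by move=> i j; apply: diag_mx_diagonal.
by case=> [[[i j]|[i j]]|[i j]] /=; rewrite !mxE !eqxx !mulr1n ?rmorphB ?rmorphD.
Qed.

Lemma lv2_inj : injective lv2.
Proof.
have cc0 := ed_cc ed; have lv_eq (i j : 'I_2) : (i == 0) = (j == 0) -> i = j.
  by case: i j => [[|[|i]] hi] [[|[|j]] hj] // _; apply: val_inj.
move=> i j; rewrite /lv2; case: ifP => i0; case: ifP => j0 // ij; try lia; by apply: lv_eq; rewrite i0 j0.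
Qed.

Lemma exc_gr_t0 : t0 = gr false (fun n => n == 0).
Proof.
apply/eqP; rewrite eqEsubv; apply/andP; split; apply/subvP => X.
  move=> /[dup] /exc_t0_even X0 /exc_t0E[_ /diagonal_spaceP X2 _ X4 X5]; apply/exc_grP; split=> // i j.
  - by move/X2->; rewrite subrr.
  - by move/X4->; rewrite subrr.
  by rewrite X5 mxE eqxx.
case: X => [[A B] x] /exc_grP[]; rewrite exc_evenE /= => /and3P[A1 /eqP B1 /eqP->] A2 B2 _.
apply: exc_t0_mem => //.
  by apply/diagonal_spaceP => i j /A2; rewrite subr_eq0 => /eqP/(ed_inj ed).
by move=> i j /B2; rewrite subr_eq0 => /eqP/lv2_inj.
Qed.

Lemma comm_lev n (A B : 'M[K]_n) (l : 'I_n -> int) (Z Z1 Z2 : pred int) :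
    (forall x y, Z1 x -> Z2 y -> Z (x + y)) ->
    (forall i j, A i j != 0 -> Z1 (l i - l j)) -> (forall i j, B i j != 0 -> Z2 (l i - l j)) ->
  forall i j, (A *m B - B *m A) i j != 0 -> Z (l i - l j).
Proof.
move=> ZZ AZ BZ i j; have -> : (A *m B - B *m A) i j = (A *m B) i j + - (B *m A) i j by rewrite mxE [X in _ + X]mxE.
case/addr_neq0; rewrite ?oppr_eq0 => /mulmx_neq0[k [h1 h2]].
  have -> : l i - l j = (l i - l k) + (l k - l j) by ring.
  by apply: ZZ; [apply: AZ|apply: BZ].
have -> : l i - l j = (l k - l j) + (l i - l k) by ring.
by apply: ZZ; [apply: AZ|apply: BZ].
Qed.

Lemma exc_br_even (Z Z1 Z2 : pred int) X Y : (forall x y, Z1 x -> Z2 y -> Z (x + y)) ->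
  X \in gr false Z1 -> Y \in gr false Z2 -> exc_bracket D F X Y \in gr false Z.
Proof.
move=> ZZ /exc_grP[X0 X1 X2 X3] /exc_grP[Y0 Y1 Y2 Y3]; apply/exc_grP.
have /and3P[_ _ /eqP X30] : [&& X.1.1 \in s, \tr X.1.2 == 0 & X.2 == 0] by rewrite -exc_evenE.
have /and3P[_ _ /eqP Y30] : [&& Y.1.1 \in s, \tr Y.1.2 == 0 & Y.2 == 0] by rewrite -exc_evenE.
split; [exact: exc_closed_even| | |]; rewrite (exc_even_even X30 Y30) /=.
- exact: comm_lev ZZ X1 Y1.
- exact: comm_lev ZZ X2 Y2.
by move=> i j; rewrite mxE eqxx.
Qed.

Lemma exc_br_even_odd (Z Z1 Z2 : pred int) X Y : (forall x y, Z1 x -> Z2 y -> Z (x + y)) ->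
  X \in gr false Z1 -> Y \in gr true Z2 -> exc_bracket D F X Y \in gr true Z.
Proof.
move=> ZZ /exc_grP[X0 X1 X2 X3] /exc_grP[Y0 Y1 Y2 Y3]; apply/exc_grP.
have /and3P[_ _ /eqP X30] : [&& X.1.1 \in s, \tr X.1.2 == 0 & X.2 == 0] by rewrite -exc_evenE.
have /eqP Y10 : Y.1 == 0 by rewrite -exc_oddE.
split; [exact: exc_closed_even_odd| | |]; rewrite (exc_even_odd X30 Y10) /= => i j.
- by rewrite mxE eqxx.
- by rewrite mxE eqxx.
have -> : (X.1.1 *m Y.2 + Y.2 *m X.1.2^T) i j = (X.1.1 *m Y.2) i j + (Y.2 *m X.1.2^T) i j.
  by rewrite mxE.
case/addr_neq0 => /mulmx_neq0[k [h1 h2]].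
  have -> : lv i + lv2 j = (lv i - lv k) + (lv k + lv2 j) by ring.
  by apply: ZZ; [apply: X1|apply: Y3].
rewrite mxE in h2; have -> : lv i + lv2 j = (lv2 j - lv2 k) + (lv i + lv2 k) by ring.
by apply: ZZ; [apply: X2|apply: Y3].
Qed.

Lemma col_ev (v : 'cV[K]_N) : v = \sum_k v k 0 *: ev k.
Proof.
apply/matrixP => i j; rewrite ord1 summxE (bigD1 i) //= !mxE eqxx mulr1 big1 ?addr0 // => k /negPf ki.
by rewrite !mxE eq_sym ki mulr0.
Qed.

Lemma Dq_sum v : D (ev q) v = \sum_k v k 0 *: D (ev q) (ev k).
Proof.
have DrD x y : D (ev q) (x + y) = D (ev q) x + D (ev q) y.
  by have := ed_Dr ed (ev q) 1 x y; rewrite !scale1r.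
have DrZ a x : D (ev q) (a *: x) = a *: D (ev q) x.
  by have := ed_Dr ed (ev q) a x 0; rewrite !addr0 D0r addr0.
rewrite {1}[v]col_ev (big_morph (D (ev q)) DrD (D0r _)).
by apply: eq_bigr => k _; rewrite DrZ.
Qed.

Lemma D_skewq v : D v (ev q) = - D (ev q) v.
Proof.
have DlD x y : D (x + y) (ev q) = D x (ev q) + D y (ev q).
  by have := ed_Dl ed (ev q) 1 x y; rewrite !scale1r.
have DlZ a x : D (a *: x) (ev q) = a *: D x (ev q).
  by have := ed_Dl ed (ev q) a x 0; rewrite !addr0 D0l addr0.
rewrite {1}[v]col_ev (big_morph (D^~ (ev q)) DlD (D0l _)) Dq_sum -sumrN.
by apply: eq_bigr => k _; rewrite DlZ (ed_Dskew ed) scalerN.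
Qed.

Lemma DlZq a v : D (a *: ev q) v = a *: D (ev q) v.
Proof. by have := ed_Dl ed v a (ev q) 0; rewrite !addr0 D0l addr0. Qed.

Lemma DrZq a v : D v (a *: ev q) = a *: D v (ev q).
Proof. by have := ed_Dr ed v a (ev q) 0; rewrite !addr0 D0r addr0. Qed.

(** The first vector of V has the maximal level [cc], so a total level at most 0 leaves only the
    lowest weight vector of W. *)
Lemma exc_b1_col0 X : X \in gr true (fun n => n <= 0) -> col 0 X.2 = X.2 q 0 *: ev q.
Proof.
move=> /exc_grP[_ _ _ X3]; apply/matrixP => i j; rewrite !mxE ord1 andbT.
have [->|iq] := eqVneq i q; first by rewrite mulr1.
rewrite mulr0; apply/eqP; rewrite -[_ == 0]negbK; apply: contra iq => /X3.
rewrite /lv2 eqxx => li; have := ed_bound ed i; have := ed_q ed => lq hb.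
by apply/eqP/(ed_inj ed); lia.
Qed.

Lemma exc_odd_D X Y : X \in gr true (fun n => n <= 0) -> Y \in gr true (fun n => n <= 0) ->
  D (col 0 X.2) (col 1 Y.2) - D (col 1 X.2) (col 0 Y.2) =
  \sum_k (X.2 q 0 * Y.2 k 1 + Y.2 q 0 * X.2 k 1) *: D (ev q) (ev k).
Proof.
move=> Xb Yb; rewrite (exc_b1_col0 Xb) (exc_b1_col0 Yb) DlZq DrZq D_skewq scalerN opprK !Dq_sum.
rewrite !scaler_sumr -big_split; apply: eq_bigr => k _ /=.
by rewrite !mxE !scalerA scalerDl.
Qed.

(** By [exc_odd_D] the first component is a combination of the matrices [D (ev q) (ev k)], whose
    entries have the level of (k, 1); the sl_2 component is controlled by the form, which pairs
    opposite levels. *)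
Lemma exc_br_odd (Z : pred int) X Y : (forall x y, Z x -> Z y -> Z (x + y)) ->
    (forall n, Z n -> n <= 0) ->
    X \in gr true Z -> Y \in gr true Z -> exc_bracket D F X Y \in gr false Z.
Proof.
move=> ZZ Z0 Xg Yg.
have sub : (gr true Z <= gr true (fun n => n <= 0)%R)%VS.
  by apply/subvP => W /exc_grP[W0 W1 W2 W3]; apply/exc_grP; split=> // i j h; apply: Z0; [apply: W1|apply: W2|apply: W3].
have [Xb Yb] := (subvP sub _ Xg, subvP sub _ Yg).
move: (Xg) (Yg) => /exc_grP[X0 _ _ X3] /exc_grP[Y0 _ _ Y3].
have /eqP X10 : X.1 == 0 by rewrite -exc_oddE.
have /eqP Y10 : Y.1 == 0 by rewrite -exc_oddE.
rewrite (exc_odd_odd X10 Y10) (exc_odd_D Xb Yb); set G := X.2^T *m F *m Y.2.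
apply/exc_grP; split=> /=.
- rewrite exc_evenE /= eqxx andbT; apply/andP; split.
    by apply: memv_suml => k _; rewrite memvZ // (ed_Ds ed).
  rewrite /mxtrace !big_ord_recl big_ord0 !mxE !big_ord_recl !big_ord0 !mxE /=.
  by apply/eqP; ring.
- move=> i j; rewrite summxE => /eqP h; have [k hk] : exists k,
      (X.2 q 0 * Y.2 k 1 + Y.2 q 0 * X.2 k 1) * D (ev q) (ev k) i j != 0.
    have [/existsP[k hk]|] := boolP [exists k, (X.2 q 0 * Y.2 k 1 + Y.2 q 0 * X.2 k 1) * D (ev q) (ev k) i j != 0].
      by exists k.
    rewrite negb_exists => /forallP h0; case: h; apply: big1 => k _; rewrite mxE.
    by apply/eqP; have := h0 k; rewrite negbK.
  move: hk; rewrite mulf_eq0 negb_or => /andP[hk /(ed_Dlev ed) ->].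
  have l1 : lv2 1 = - cc by [].
  by case/addr_neq0: hk; rewrite mulf_eq0 negb_or => /andP[_ h1]; rewrite -l1; [apply: Y3|apply: X3].
- move=> a b /mulmx_neq0[b' [hG hJ]].
  have -> : lv2 a - lv2 b = lv2 a + lv2 b'.
    move: hJ; rewrite mxE; case: b b' {hG} => [[|[|?]] ?] [[|[|?]] ?] //=; rewrite ?subrr ?eqxx // /lv2 /=;
      by rewrite ?opprK.
  have GZ a1 a2 : G a1 a2 != 0 -> Z (lv2 a1 + lv2 a2).
    case/mulmx_neq0 => j [/mulmx_neq0[i [h1 h2]] h3]; rewrite mxE in h1.
    have lij := ed_F ed h2.
    have -> : lv2 a1 + lv2 a2 = (lv i + lv2 a1) + (lv j + lv2 a2).
      by rewrite addrACA lij add0r.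
    by apply: ZZ; [apply: X3|apply: Y3].
  have : (G + G^T) a b' = G a b' + G b' a by rewrite mxE [X in _ + X]mxE.
  move=> GE; rewrite GE in hG; case/addr_neq0: hG => /GZ //.
  by rewrite addrC.
by move=> i j; rewrite mxE eqxx.
Qed.

Lemma exc_f1_col1 X : X \in gr true (fun n => n == 0) -> forall k, k != p -> X.2 k 1 = 0.
Proof.
move=> /exc_grP[_ _ _ X3] k kp; apply/eqP; rewrite -[_ == 0]negbK; apply: contra kp => /X3.
rewrite /lv2 /= subr_eq0 -(ed_p ed) => /eqP/(ed_inj ed)->; exact: eqxx.
Qed.

Lemma exc_f1_col0 X : X \in gr true (fun n => n == 0) -> forall k, k != q -> X.2 k 0 = 0.
Proof.
move=> /exc_grP[_ _ _ X3] k kq; apply/eqP; rewrite -[_ == 0]negbK; apply: contra kq => /X3.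
rewrite /lv2 eqxx addr_eq0 -(ed_q ed) => /eqP/(ed_inj ed)->; exact: eqxx.
Qed.

(** The bracket of [X] and [Y] is diagonal and governed by one scalar [t]. On (p, 1) and on (q, 0)
    its weight is the sum of a contribution of [D] and one of the sl_2 part, equal to [t * F q p] up
    to opposite signs. *)
Lemma exc_fff X Y W : X \in gr true (fun n => n == 0) -> Y \in gr true (fun n => n == 0) ->
  W \in gr true (fun n => n == 0) -> exc_bracket D F (exc_bracket D F X Y) W = 0.
Proof.
move=> Xf Yf Wf.
have sub U : U \in gr true (fun n => n == 0) -> U \in gr true (fun n => n <= 0).
  by move=> /exc_grP[U0 U1 U2 U3]; apply/exc_grP; split=> // i j h; rewrite le_eqVlt ?U1 ?U2 ?U3.
have /eqP X10 : X.1 == 0 by rewrite -exc_oddE; case/exc_grP: Xf.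
have /eqP Y10 : Y.1 == 0 by rewrite -exc_oddE; case/exc_grP: Yf.
have W1 : W \in spart L true by case/exc_grP: Wf.
have ht : exc_bracket D F X Y \in t0.
  rewrite exc_gr_t0; apply: exc_br_odd Xf Yf => [x y /eqP-> /eqP->|n /eqP->] //.
have [_ hE] := exc_act ht W1; apply: exc_coord_sep => x; rewrite hE.
have [->|Wx] := eqVneq (exc_coord x W) 0; first by rewrite mulr0.
suff -> : exc_weight x (exc_bracket D F X Y) = 0 by rewrite mul0r.
have px := exc_coord_par W1 Wx; case: x px Wx {hE} => // -[i j] _ /= Wij.
set t := X.2 q 0 * Y.2 p 1 + Y.2 q 0 * X.2 p 1.
have h1 k : (exc_bracket D F X Y).1.1 k k = t * D (ev q) (ev p) k k.
  rewrite (exc_odd_odd X10 Y10) /= exc_odd_D ?sub // summxE (bigD1 p) //= mxE big1 ?addr0 //.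
  by move=> l lp; rewrite mxE !(exc_f1_col1 _ lp) // !mulr0 addr0 mul0r.
pose G := X.2^T *m F *m Y.2.
have G01 : G 0 1 = X.2 q 0 * F q p * Y.2 p 1.
  rewrite mxE (bigD1 p) //= big1 ?addr0 => [|l lp]; last by rewrite (exc_f1_col1 Yf lp) mulr0.
  rewrite mxE (bigD1 q) //= big1 ?addr0 => [|l lq]; first by rewrite mxE.
  by rewrite mxE (exc_f1_col0 Xf lq) mul0r.
have G10 : G 1 0 = X.2 p 1 * F p q * Y.2 q 0.
  rewrite mxE (bigD1 q) //= big1 ?addr0 => [|l lq]; last by rewrite (exc_f1_col0 Yf lq) mulr0.
  rewrite mxE (bigD1 p) //= big1 ?addr0 => [|l lp]; first by rewrite mxE.
  by rewrite mxE (exc_f1_col1 Xf lp) mul0r.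
have h2 : (exc_bracket D F X Y).1.2 = (G + G^T) *m symp2 K by rewrite (exc_odd_odd X10 Y10).
have GT a1 a2 : (G + G^T) a1 a2 = G a1 a2 + G a2 a1 by rewrite mxE [X in _ + X]mxE.
have h20 : (exc_bracket D F X Y).1.2 0 0 = - (t * F q p).
  rewrite h2 mxE !big_ord_recl big_ord0 !GT [symp2 K _ _]mxE [X in _ + (_ * X + _)]mxE /=.
  rewrite (_ : lift ord0 ord0 = 1); last exact: val_inj.
  by rewrite G01 G10 (ed_Fsym ed) /t; ring.
have h21 : (exc_bracket D F X Y).1.2 1 1 = t * F q p.
  rewrite h2 mxE !big_ord_recl big_ord0 !GT [symp2 K _ _]mxE [X in _ + (_ * X + _)]mxE /=.
  rewrite (_ : lift ord0 ord0 = 1); last exact: val_inj.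
  by rewrite G01 G10 (ed_Fsym ed) /t; ring.
have j01 : j = 0 \/ j = 1.
  by case: j {Wij} => [[|[|j]] hj] //; [left|right]; apply: val_inj.
case: j01 Wij => -> Wij.
  have [->|iq] := eqVneq i q; last by rewrite (exc_f1_col0 Wf iq) eqxx in Wij.
  by rewrite h1 h20 (ed_Dq ed) subrr.
have [->|ip] := eqVneq i p; last by rewrite (exc_f1_col1 Wf ip) eqxx in Wij.
by rewrite h1 h21 (ed_Dp ed) mulrN addNr.
Qed.

Lemma exc_odd_lev0 x : exc_par x -> exc_lev x = 0 -> x = inr (p, 1) \/ x = inr (q, 0).
Proof.
case: x => // -[i j] _ /=; rewrite /lv2; have [->|j0] := eqVneq j 0.
  by move/eqP; rewrite addr_eq0 -(ed_q ed) => /eqP/(ed_inj ed)->; right.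
move/eqP; rewrite subr_eq0 -(ed_p ed) => /eqP/(ed_inj ed)->; left; congr (inr (_, _)).
by case: j j0 => [[|[|j]] hj] // _; apply: val_inj.
Qed.

Lemma exc_root_gr b (lm : V -> K) x (Z : pred int) :
    {in t0, forall h, lm h = exc_weight x h} -> Z (exc_lev x) ->
  (@exc_root K N s D F b lm <= gr b Z)%VS.
Proof.
move=> lmE Zx; apply: (@root_space_gr K L t0 _ exc_coord exc_lev exc_weight _ _ _ _ _ _ _ b lm x) => //.
- exact: exc_coord_linear.
- exact: exc_linl.
- exact: exc_linr.
- exact: exc_act.
- exact: exc_H.
- exact: exc_weight_linear.
Qed.

Lemma exc_gr_root b (Z : pred int) U :
    (forall x, exc_par x = b -> Z (exc_lev x) ->
      (exists2 X, X \in spart L b & exc_coord x X != 0) ->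
      exists lm : V -> K, {in t0, forall h, lm h = exc_weight x h} /\
        (@exc_root K N s D F b lm <= U)%VS) ->
  (gr b Z <= U)%VS.
Proof.
move=> hU; apply: (@gr_root_space K L t0 _ exc_coord exc_par exc_lev exc_weight).
- exact: exc_coord_linear.
- exact: exc_coord_sep.
- exact: exc_coord_par.
- exact: exc_linr.
- exact: exc_act.
- exact: hU.
Qed.

Notation mu i := (@exc_mu K N i).
Notation eps2 := (@exc_eps K N).

Lemma exc_t0_sl2 h : h \in t0 -> h.1.2 1 1 = - h.1.2 0 0.
Proof.
move=> /exc_t0E[_ _ trh _ _]; apply/eqP; rewrite -addr_eq0 addrC -trh.
by rewrite /mxtrace !big_ord_recl big_ord0 addr0; apply/eqP; congr (_ + h.1.2 _ _); apply: val_inj.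
Qed.

Lemma exc_t0_pq h : h \in t0 -> h.1.1 q q = - h.1.1 p p.
Proof. by move=> /exc_t0E[h1 h2 _ _ _]; apply: (ed_rel ed). Qed.

Lemma exc_f1E : (@exc_root K N s D F true (mu p - eps2)%R + @exc_root K N s D F true (- (mu p - eps2))%R)%VS =
  gr true (fun n => n == 0).
Proof.
have lm1 : {in t0, forall h, (mu p - eps2)%R h = exc_weight (inr (p, 1)) h}.
  by move=> h ht; rewrite /= exc_t0_sl2.
have lm2 : {in t0, forall h, (- (mu p - eps2))%R h = exc_weight (inr (q, 0)) h}.
  by move=> h ht /=; rewrite -[LHS]/(- ((mu p - eps2) h)) lm1 //= exc_t0_sl2 // exc_t0_pq // opprB addrC.
apply/eqP; rewrite eqEsubv subv_add; apply/andP; split.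
  apply/andP; split; [apply: (exc_root_gr _ lm1)|apply: (exc_root_gr _ lm2)].
    by rewrite /= /lv2 /= (ed_p ed) addrN.
  by rewrite /= /lv2 /= (ed_q ed) addNr.
apply: exc_gr_root => x px /eqP/(exc_odd_lev0 px)[]-> _.
  by exists (mu p - eps2)%R; split=> //; apply: addvSl.
by exists (- (mu p - eps2))%R; split=> //; apply: addvSr.
Qed.

Lemma exc_u1E : (\sum_(i < N | i != p) @exc_root K N s D F true (mu i - eps2)%R)%VS =
  gr true (fun n => n < 0).
Proof.
have lm1 i : {in t0, forall h, (mu i - eps2)%R h = exc_weight (inr (i, 1)) h}.
  by move=> h ht; rewrite /= exc_t0_sl2.
apply/eqP; rewrite eqEsubv; apply/andP; split.
  apply/subv_sumP => i ip; apply: (exc_root_gr _ (lm1 i)) => /=; rewrite /lv2 /= subr_lt0.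
  rewrite lt_neqAle; have /andP[_ ->] := ed_bound ed i; rewrite andbT -(ed_p ed).
  by rewrite (inj_eq (ed_inj ed)).
apply: exc_gr_root => -[] // [i j] _ /= hij _.
have hi := ed_bound ed i; have lp := ed_p ed; have c0 := ed_cc ed.
have [j0|j1] := eqVneq j 0; first by move: hij; rewrite /lv2 j0 eqxx; lia.
have j1' : j = 1 by case: j j1 {hij} => [[|[|j]] hj] // _; apply: val_inj.
have ip : i != p by apply/eqP => ip; move: hij; rewrite j1' ip /lv2 /=; lia.
exists (mu i - eps2)%R; split; first by rewrite j1'; apply: lm1.
by rewrite (sumv_sup i).
Qed.

Lemma exc_u0E (U : {vspace V}) : (U <= gr false (fun n => (n < 0)%R))%VS ->
    (forall i j A, A \in s -> A i j != 0 -> lv i < lv j -> exists lm : V -> K,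
      {in t0, forall h, lm h = h.1.1 i i - h.1.1 j j} /\ (@exc_root K N s D F false lm <= U)%VS) ->
  (U + @exc_root K N s D F false (- (eps2 *+ 2))%R)%VS = gr false (fun n => n < 0).
Proof.
have lm1 : {in t0, forall h, (- (eps2 *+ 2))%R h = exc_weight (inl (inr (1, 0))) h}.
  by move=> h ht /=; rewrite exc_t0_sl2 // -opprD -mulr2n -[LHS]/(- ((eps2 *+ 2) h)) !mulr2n.
move=> U1 U2; apply/eqP; rewrite eqEsubv subv_add; apply/andP; split.
  rewrite U1 (exc_root_gr _ lm1) //= /lv2 /=; have := ed_cc ed; lia.
apply: exc_gr_root => -[[[i j]|[a b]]|] //= _ hl [X]; rewrite exc_evenE => /and3P[Xs _ _] hX.
  have [lm [lmE lmU]] := U2 i j _ Xs hX ltac:(by move: hl; rewrite subr_lt0).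
  by exists lm; split=> //; apply: subv_trans lmU (addvSl _ _).
exists (- (eps2 *+ 2))%R; split; last exact: addvSr.
have c0 := ed_cc ed; suff [-> ->] : a = 1 /\ b = 0 by [].
move: hl {hX}; rewrite /lv2; case: a b => [[|[|a]] ha] [[|[|b]] hb] //=;
  by [lia | move=> _; split; apply: val_inj].
Qed.

Section Triangular.
Variables (u0 f1 u1 : {vspace V}).
Hypothesis u0E : u0 = gr false (fun n => n < 0).
Hypothesis f1E : f1 = gr true (fun n => n == 0).
Hypothesis u1E : u1 = gr true (fun n => n < 0).
Notation g := (@ClassicalDatum K L t0 u0 f1 u1 (exc_torus P)).

Lemma exc_br a b X Y : X \in gr a (fun n => n <= 0) -> Y \in gr b (fun n => n <= 0) ->
  exc_bracket D F X Y \in gr (a (+) b) (fun n => n <= 0).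
Proof.
have ZZ x y : x <= 0 -> y <= 0 -> x + y <= 0 :> int by lia.
case: a b => -[] Xg Yg.
- exact: exc_br_odd ZZ _ Xg Yg.
- have /eqP X1 : X.1 == 0 by rewrite -exc_oddE; case/exc_grP: Xg.
  have /eqP Y2 : Y.2 == 0.
    by case/exc_grP: Yg => + _ _ _; rewrite exc_evenE => /and3P[].
  by rewrite (exc_odd_even X1 Y2) memvN; apply: exc_br_even_odd ZZ Yg Xg.
- exact: exc_br_even_odd ZZ Xg Yg.
- exact: exc_br_even ZZ Xg Yg.
Qed.

Lemma exc_torusE phi : exc_torus P phi -> exists (d : 'rV[K]_N) (a : K),
  [/\ forall i, d 0 i != 0, P d, a != 0 & let r (j : 'I_2) := if j == 0 then a else a^-1 in
   forall X, [/\ forall i j, (phi X).1.1 i j = d 0 i / d 0 j * X.1.1 i j,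
                 forall i j, (phi X).1.2 i j = r i / r j * X.1.2 i j &
                 forall i j, (phi X).2 i j = d 0 i * r j * X.2 i j]].
Proof.
move=> [d [a [d0 Pd a0 phiE]]]; exists d, a; split=> // r X; rewrite phiE; split=> i j /=.
- exact: diag_conj.
- rewrite diag_conj ?mxE // => k; rewrite mxE; case: ifP => // _; exact: invr_neq0.
by rewrite mul_mx_diag mul_diag_mx !mxE; rewrite mulrAC.
Qed.

(** The two odd weights of level 0 are opposite, so one parameter is enough. *)
Definition exc_char (x : I) : {ffun 'I_1 -> int} :=
  if x is inr (_, j) then [ffun=> if j == 0 then -1 else 1] else 0.

Lemma exc_coordinates : @coordinates K g I exc_coord exc_par exc_lev exc_weight.
Proof.
split.
- exact: exc_coord_linear.
- exact: exc_coord_sep.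
- by move=> b X x; apply: exc_coord_par.
- exact: exc_linl.
- exact: exc_linr.
- move=> X Y; rewrite exc_oddE exc_evenE => /and3P[_ _ /eqP X2] /eqP Y1; exact: exc_odd_even.
- exact: exc_act.
- exact: exc_H.
- case=> [[[i j]|[i j]]|] //= h _ /eqP; rewrite subr_eq0 => /eqP.
    by move=> /(ed_inj ed)-> _; rewrite subrr.
  by move=> /lv2_inj-> _; rewrite subrr.
- exact: exc_weight_linear.
- exact: exc_gr_t0.
- exact: u0E.
- exact: f1E.
- exact: u1E.
- move=> a b; exact: exc_br.
- move=> X Y; apply: exc_br_even_odd => x y; lia.
- move=> X Y; rewrite f1E => Xf Yf; rewrite /= exc_gr_t0.
  by apply: exc_br_odd Xf Yf => [x y /eqP-> /eqP->|n /eqP->].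
- by move=> X Y Z; rewrite f1E; apply: exc_fff.
- move=> phi /exc_torusE[d [a [_ _ _ phiE]]] k X Y; apply: (coord_inj exc_coord_linear exc_coord_sep) => x.
  rewrite (coordD exc_coord_linear) (coordZ exc_coord_linear).
  have [X1 X2 X3] := phiE X; have [Y1 Y2 Y3] := phiE Y; have [Z1 Z2 Z3] := phiE (k *: X + Y).
  by case: x => [[[i j]|[i j]]|[i j]] /=; rewrite ?X1 ?X2 ?X3 ?Y1 ?Y2 ?Y3 ?Z1 ?Z2 ?Z3 /= !mxE; ring.
- move=> phi h /exc_torusE[d [a [d0 _ a0 phiE]]] /exc_t0E[_ /diagonal_spaceP h2 _ h4 h5].
  have [X1 X2 X3] := phiE h; have r0 (j : 'I_2) : (if j == 0 then a else a^-1) != 0.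
    by case: ifP => // _; apply: invr_neq0.
  apply: (coord_inj exc_coord_linear exc_coord_sep).
  case=> [[[i j]|[i j]]|[i j]] /=; rewrite ?X1 ?X2 ?X3.
  + by have [->|/h2->] := eqVneq (h.1.1 i j) 0; rewrite ?mulr0 // mulfV // mul1r.
  + by have [->|/h4->] := eqVneq (h.1.2 i j) 0; rewrite ?mulr0 // mulfV // mul1r.
  by rewrite h5 mxE mulr0.
- move=> phi X x /exc_torusE[d [a [_ _ _ phiE]]]; have [X1 X2 X3] := phiE X.
  by case: x => [[[i j]|[i j]]|[i j]] /=; rewrite ?X1 ?X2 ?X3 => ->; rewrite mulr0.
exists 1%N, exc_char; split.
- move=> h ht; exists (fun=> h.1.1 p p + h.1.2 1 1) => x px lx; rewrite big_ord1.
  case: (exc_odd_lev0 px lx) => ->; rewrite /= ffunE /= ?mul1r //.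
  by rewrite exc_t0_pq // exc_t0_sl2 // mulN1r opprD opprK.
- move=> y; have ccK : cc%:~R != 0 :> K.
    by apply/eqP => /(intr_eq0_char charK) c0; have := ed_cc ed; rewrite c0 ltxx.
  (* The W-part of H, rescaled so that its value at [p] is the prescribed parameter. *)
  exists ((y 0 / cc%:~R) *: diag_mx (\row_i (lv i)%:~R), 0, 0).
    apply: exc_t0_mem; first by rewrite memvZ ?(ed_H ed).
    - by apply: memvZ; apply/diagonal_spaceP => i j; apply: diag_mx_diagonal.
    - exact: mxtrace0.
    by move=> i j; rewrite mxE eqxx.
  move=> x px lx; rewrite big_ord1 ord1.
  case: (exc_odd_lev0 px lx) => ->; rewrite /= ffunE /= !mxE eqxx !mulr1n addr0.
    by rewrite (ed_p ed) mul1r divfK.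
  by rewrite (ed_q ed) rmorphN mulrN divfK ?mulN1r.
- move=> phi /exc_torusE[d [a [d0 Pd a0 phiE]]]; exists (fun=> d 0 p / a).
    by move=> _; rewrite mulf_neq0 ?invr_neq0.
  move=> x X px lx; rewrite big_ord1; have [_ _ X3] := phiE X.
  case: (exc_odd_lev0 px lx) => ->; rewrite /= ffunE /= X3 //=.
  by rewrite exprN1 invf_div (ed_P ed) // [a / _]mulrC.
move=> z z0; have [d d0 [Pd dp]] := ed_Ponto ed (z0 0).
pose r := diag_mx (\row_(i < 2) (if i == 0 then 1 else 1^-1 : K)).
exists (fun X => (diag_mx d *m X.1.1 *m invmx (diag_mx d), r *m X.1.2 *m invmx r, diag_mx d *m X.2 *m r)).
  by exists d, 1; split; rewrite ?oner_eq0.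
move=> x X px lx; rewrite big_ord1.
case: (exc_odd_lev0 px lx) => ->; rewrite /= ffunE /= mul_mx_diag mul_diag_mx !mxE /=.
  by rewrite invr1 mulr1 dp.
by rewrite mulr1 (ed_P ed) // dp exprN1.
Qed.

Lemma exc_triangular : triangular g.
Proof. exact: coordinates_triangular exc_coordinates. Qed.
End Triangular.

End ExcData.

(** * G(3) *)

Section OctonionCoordinates.
Variable K : fieldType.
Hypothesis charK : forall k, k.+1%:R != 0 :> K.
Notation W := 'cV[K]_(1 + (3 + 3)).

Definition iz : 'I_(1 + (3 + 3)) := lshift (3 + 3) 0.
Definition ix (k : 'I_3) : 'I_(1 + (3 + 3)) := rshift 1 (lshift 3 k).
Definition iy (k : 'I_3) : 'I_(1 + (3 + 3)) := rshift 1 (rshift 3 k).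

Variant octo_index_spec : 'I_(1 + (3 + 3)) -> Prop :=
  | OctoZ : octo_index_spec iz
  | OctoX k : octo_index_spec (ix k)
  | OctoY k : octo_index_spec (iy k).

Lemma octo_indexP i : octo_index_spec i.
Proof.
case: (split_ordP i) => [j ->|j ->]; first by rewrite ord1; constructor.
by case: (split_ordP j) => k ->; constructor.
Qed.

Lemma big_ord3 (V : nmodType) (F : 'I_3 -> V) : \sum_i F i = F 0 + F 1 + F 2.
Proof.
rewrite !big_ord_recl big_ord0 addr0 -addrA; by congr (F _ + (F _ + F _)); apply: val_inj.
Qed.

Lemma ord3P (P : 'I_3 -> Prop) : P 0 -> P 1 -> P 2 -> forall k, P k.
Proof.
move=> P0 P1 P2 [[|[|[|k]]] hk] //.
- by rewrite (_ : Ordinal hk = 0) //; apply: val_inj.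
- by rewrite (_ : Ordinal hk = 1) //; apply: val_inj.
by rewrite (_ : Ordinal hk = 2) //; apply: val_inj.
Qed.

Lemma octo_crossZ (u v : W) : octo_cross u v iz 0 =
  (\sum_k (u (ix k) 0 * v (iy k) 0 - u (iy k) 0 * v (ix k) 0)) / 2.
Proof.
rewrite /octo_cross /iz col_mxEu mxE eqxx mulr1n /dot3 -sumrB; congr (_ / _).
by apply: eq_bigr => k _; rewrite /ox /oy !mxE.
Qed.

Lemma octo_crossX (u v : W) k : octo_cross u v (ix k) 0 =
  u iz 0 * v (ix k) 0 - v iz 0 * u (ix k) 0 -
  (u (iy (k + 1)) 0 * v (iy (k + 2)) 0 - u (iy (k + 2)) 0 * v (iy (k + 1)) 0).
Proof.
have z0 : (0 : 'I_(1 + (3 + 3))) = iz by apply: val_inj.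
by rewrite /octo_cross /ix col_mxEd col_mxEu !mxE /oz z0.
Qed.

Lemma octo_crossY (u v : W) k : octo_cross u v (iy k) 0 =
  v iz 0 * u (iy k) 0 - u iz 0 * v (iy k) 0 +
  (u (ix (k + 1)) 0 * v (ix (k + 2)) 0 - u (ix (k + 2)) 0 * v (ix (k + 1)) 0).
Proof.
have z0 : (0 : 'I_(1 + (3 + 3))) = iz by apply: val_inj.
by rewrite /octo_cross /iy col_mxEd col_mxEd !mxE /oz z0.
Qed.

Lemma octo_dotE (u v : W) : octo_dot u v =
  u iz 0 * v iz 0 + (\sum_k (u (ix k) 0 * v (iy k) 0 + u (iy k) 0 * v (ix k) 0)) / 2.
Proof.
have z0 : (0 : 'I_(1 + (3 + 3))) = iz by apply: val_inj.
rewrite /octo_dot /oz z0 /dot3 -big_split; congr (_ + _ / _).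
by apply: eq_bigr => k _; rewrite /ox /oy !mxE.
Qed.

Lemma mxDE p1 p2 (A B : 'M[K]_(p1, p2)) i j : (A + B) i j = A i j + B i j.
Proof. by rewrite mxE. Qed.
Lemma mxNE p1 p2 (A : 'M[K]_(p1, p2)) i j : (- A) i j = - A i j.
Proof. by rewrite mxE. Qed.
Lemma mxZE p1 p2 a (A : 'M[K]_(p1, p2)) i j : (a *: A) i j = a * A i j.
Proof. by rewrite mxE. Qed.

Definition mx_linE := (mxDE, mxNE, mxZE).

Definition octo_entries := (octo_crossZ, octo_crossX, octo_crossY, octo_dotE).

Lemma octo_vecP (u v : W) : u iz 0 = v iz 0 -> (forall k, u (ix k) 0 = v (ix k) 0) ->
  (forall k, u (iy k) 0 = v (iy k) 0) -> u = v.
Proof. by move=> h1 h2 h3; apply/matrixP => i j; rewrite ord1; case: (octo_indexP i). Qed.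

Lemma octo_cross_linl v : linear (fun u : W => octo_cross u v).
Proof.
move=> a u u'; apply: octo_vecP => [|k|k].
- by rewrite !mx_linE !octo_entries !big_ord3 !mx_linE; ring.
- by rewrite !mx_linE !octo_entries !mx_linE; ring.
by rewrite !mx_linE !octo_entries !mx_linE; ring.
Qed.

Lemma octo_cross_linr u : linear (octo_cross u : W -> W).
Proof.
move=> a v v'; apply: octo_vecP => [|k|k].
- by rewrite !mx_linE !octo_entries !big_ord3 !mx_linE; ring.
- by rewrite !mx_linE !octo_entries !mx_linE; ring.
by rewrite !mx_linE !octo_entries !mx_linE; ring.
Qed.

Lemma octo_dot_linl v : linear (fun u : W => octo_dot u v : K^o).
Proof. by move=> a u u'; rewrite !octo_entries !big_ord3 !mx_linE /GRing.scale /=; ring. Qed.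

Lemma octo_dotC u v : octo_dot u v = octo_dot v u :> K.
Proof. by rewrite !octo_entries !big_ord3; ring. Qed.

Lemma octo_dot_linr u : linear (octo_dot u : W -> K^o).
Proof. by move=> a v v'; rewrite !(octo_dotC u) octo_dot_linl. Qed.

Definition octo_T (u v w : W) : W := octo_cross u (octo_cross v w) - octo_cross v (octo_cross u w)
     + 3 *: (octo_dot v w *: u - octo_dot u w *: v).

Lemma octo_T_lin u v : linear (octo_T u v).
Proof.
move=> a w w'; rewrite /octo_T !octo_cross_linr !octo_dot_linr.
move: (octo_cross _ _) (octo_cross _ _) (octo_cross _ _) (octo_cross _ _) => c1 c2 c3 c4.
move: (octo_dot _ _) (octo_dot _ _) (octo_dot _ _) (octo_dot _ _) => d1 d2 d3 d4.
by apply/matrixP => i j; rewrite /GRing.scale /= !mx_linE; ring.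
Qed.

Lemma ord3_add : [/\ 0 + 1 = 1 :> 'I_3, 0 + 2 = 2 :> 'I_3, 1 + 1 = 2 :> 'I_3, 1 + 2 = 0 :> 'I_3 & 2 + 1 = 0 :> 'I_3 /\ 2 + 2 = 1 :> 'I_3].
Proof. by do 4?split; apply: val_inj. Qed.

Definition der (A : W -> W) := forall u v,
  A (octo_cross u v) = octo_cross (A u) v + octo_cross u (A v).

(* The coordinates e u 0, ..., e u 6 are those of K (+) K^3 (+) (K^3)^*. *)
Lemma octo_der_identity (V : lmodType K) (e : V -> nat -> K) (c : V -> V -> V) (d : V -> V -> K) :
    (forall u v i, e (u + v) i = e u i + e v i) -> (forall u i, e (- u) i = - e u i) ->
    (forall a u i, e (a *: u) i = a * e u i) ->
    (forall u v, e (c u v) 0%N = (e u 1%N * e v 4 + e u 2 * e v 5 + e u 3 * e v 6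
       - (e u 4 * e v 1%N + e u 5 * e v 2 + e u 6 * e v 3)) / 2) ->
    (forall u v, e (c u v) 1%N = e u 0%N * e v 1%N - e v 0%N * e u 1%N - (e u 5 * e v 6 - e u 6 * e v 5)) ->
    (forall u v, e (c u v) 2 = e u 0%N * e v 2 - e v 0%N * e u 2 - (e u 6 * e v 4 - e u 4 * e v 6)) ->
    (forall u v, e (c u v) 3 = e u 0%N * e v 3 - e v 0%N * e u 3 - (e u 4 * e v 5 - e u 5 * e v 4)) ->
    (forall u v, e (c u v) 4 = e v 0%N * e u 4 - e u 0%N * e v 4 + (e u 2 * e v 3 - e u 3 * e v 2)) ->
    (forall u v, e (c u v) 5 = e v 0%N * e u 5 - e u 0%N * e v 5 + (e u 3 * e v 1%N - e u 1%N * e v 3)) ->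
    (forall u v, e (c u v) 6 = e v 0%N * e u 6 - e u 0%N * e v 6 + (e u 1%N * e v 2 - e u 2 * e v 1%N)) ->
    (forall u v, d u v = e u 0%N * e v 0%N + (e u 1%N * e v 4 + e u 2 * e v 5 + e u 3 * e v 6
       + (e u 4 * e v 1%N + e u 5 * e v 2 + e u 6 * e v 3)) / 2) ->
  let T u v w := c u (c v w) - c v (c u w) + 3 *: (d v w *: u - d u w *: v) in
  forall u v w w' i, e u 0%N = 0 -> e u 1%N = 0 -> e u 2 = 0 -> e u 3 = 0 -> e u 4 = 1 -> e u 5 = 0 -> e u 6 = 0 ->
  (i < 7)%N ->
  e (T u v (c w w')) i = e (c (T u v w) w' + c w (T u v w')) i.
Proof.
move=> eD eN eZ c0 c1 c2 c3 c4 c5 c6 dE T u v w w' i u0 u1 u2 u3 u4 u5 u6.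
have two0 : 2 != 0 :> K by apply: (charK 1).
have u' := (u0, u1, u2, u3, u4, u5, u6).
have cu0 x : e (c u x) 0%N = - (e x 1%N / 2) by rewrite c0 !u'; field.
have cu1 x : e (c u x) 1%N = 0 by rewrite c1 !u'; ring.
have cu2 x : e (c u x) 2 = e x 6 by rewrite c2 !u'; ring.
have cu3 x : e (c u x) 3 = - e x 5 by rewrite c3 !u'; ring.
have cu4 x : e (c u x) 4 = e x 0%N by rewrite c4 !u'; ring.
have cu5 x : e (c u x) 5 = 0 by rewrite c5 !u'; ring.
have cu6 x : e (c u x) 6 = 0 by rewrite c6 !u'; ring.
have cu := (cu0, cu1, cu2, cu3, cu4, cu5, cu6).
have du x : d u x = e x 1%N / 2 by rewrite dE !u'; field.
have TE x j : e (T u v x) j = e (c u (c v x)) j - e (c v (c u x)) j + 3 * (d v x * e u j - e x 1%N / 2 * e v j).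
  by rewrite /T du !(eD, eN, eZ).
have T0 x : e (T u v x) 0%N = - 2 * e v 0%N * e x 1%N + e v 5 * e x 6 - e v 6 * e x 5.
  by rewrite TE cu0 !c0 c1 !cu u0; field.
have T1 x : e (T u v x) 1%N = - 2 * e v 1%N * e x 1%N by rewrite TE cu1 c1 !cu u1; field.
have T2 x : e (T u v x) 2 = 2 * e x 0%N * e v 6 - 2 * e v 0%N * e x 6 + e v 1%N * e x 2 - 3 * e v 2 * e x 1%N.
  by rewrite TE cu2 c6 c2 !cu u2; field.
have T3 x : e (T u v x) 3 = - 2 * e x 0%N * e v 5 + 2 * e v 0%N * e x 5 + e v 1%N * e x 3 - 3 * e v 3 * e x 1%N.
  by rewrite TE cu3 c5 c3 !cu u3; field.
have T4 x : e (T u v x) 4 = 4 * e v 0%N * e x 0%N + 2 * e v 1%N * e x 4 + 3 * e v 2 * e x 5 + 3 * e v 3 * e x 6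
    + e v 5 * e x 2 + e v 6 * e x 3.
  by rewrite TE cu4 c0 c4 dE !cu u4; field.
have T5 x : e (T u v x) 5 = - e v 5 * e x 1%N - e v 1%N * e x 5 by rewrite TE cu5 c5 !cu u5; field.
have T6 x : e (T u v x) 6 = - e v 6 * e x 1%N - e v 1%N * e x 6 by rewrite TE cu6 c6 !cu u6; field.
have T' := (T0, T1, T2, T3, T4, T5, T6).
(* From here on [T u v] is known only through [T0] to [T6], the formulas for [u] the lowest weight
   vector, so each coordinate is a polynomial identity of moderate size. *)
clearbody T; case: i => [|[|[|[|[|[|[|i]]]]]]] // _; rewrite !eD.
- by rewrite T0 c1 c5 c6 !c0 !T'; field.
- by rewrite T1 !c1 !T'; ring.
- by rewrite T2 c0 c1 c2 c6 !c2 !T'; field.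
- by rewrite T3 c0 c1 c3 c5 !c3 !T'; field.
- by rewrite T4 c0 c2 c3 c4 c5 c6 !c4 !T'; field.
- by rewrite T5 c1 !c5 !T'; ring.
by rewrite T6 c1 !c6 !T'; ring.
Qed.

Lemma octo_T_der v : der (octo_T (delta_mx (iy 0) 0) v).
Proof.
have [e01 e02 e11 e12 [e21 e22]] := ord3_add.
pose ix7 := [:: iz; ix 0; ix 1; ix 2; iy 0; iy 1; iy 2].
pose e (u : W) i := u (nth iz ix7 i) 0.
move=> w w'; suff H i : (i < 7)%N -> e (octo_T (delta_mx (iy 0) 0) v (octo_cross w w')) i =
    e (octo_cross (octo_T (delta_mx (iy 0) 0) v w) w' + octo_cross w (octo_T (delta_mx (iy 0) 0) v w')) i.
  apply: octo_vecP; first exact: (H 0%N); apply: ord3P.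
  - exact: (H 1%N).
  - exact: (H 2).
  - exact: (H 3).
  - exact: (H 4).
  - exact: (H 5).
  - exact: (H 6).
apply: (octo_der_identity (e := e)); rewrite /e /=.
- by move=> u u' j; rewrite mxDE.
- by move=> u j; rewrite mxNE.
- by move=> a u j; rewrite mxZE.
- by move=> u u'; rewrite octo_crossZ big_ord3; congr (_ / _); ring.
- by move=> u u'; rewrite octo_crossX e01 e02.
- by move=> u u'; rewrite octo_crossX e11 e12.
- by move=> u u'; rewrite octo_crossX e21 e22.
- by move=> u u'; rewrite octo_crossY e01 e02.
- by move=> u u'; rewrite octo_crossY e11 e12.
- by move=> u u'; rewrite octo_crossY e21 e22.
- by move=> u u'; rewrite octo_dotE big_ord3; congr (_ + _ / _); ring.
all: by rewrite mxE.
Qed.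

Lemma mul_matrix_lin n (f : 'cV[K]_n -> 'cV[K]_n) w : linear f ->
  (\matrix_(i, j) f (delta_mx j 0) i 0) *m w = f w.
Proof.
move=> lf; have f0 : f 0 = 0 by have := lf (-1) 0 0; rewrite scaler0 addr0 scaleN1r addNr.
have fD x y : f (x + y) = f x + f y by have := lf 1 x y; rewrite !scale1r.
have fZ a x : f (a *: x) = a *: f x by have := lf a x 0; rewrite !addr0 f0 addr0.
rewrite {2}[w]col_ev (big_morph f fD f0); apply/matrixP => i j; rewrite ord1 mxE summxE.
by apply: eq_bigr => k _; rewrite !mxE fZ mxE mulrC.
Qed.

Lemma octo_derE u v w : octo_der u v *m w = octo_T u v w.
Proof. by rewrite -(mul_matrix_lin w (octo_T_lin u v)). Qed.

Lemma lin_eq0 n (f : 'cV[K]_n -> 'cV[K]_n) w : linear f -> (forall i, f (delta_mx i 0) = 0) -> f w = 0.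
Proof.
move=> lf f0; rewrite -(mul_matrix_lin w lf); apply/matrixP => i j; rewrite !mxE.
by apply: big1 => k _; rewrite mxE f0 mxE mul0r.
Qed.

Definition der_defect (A : 'M[K]_(1 + (3 + 3))) (u v : W) :=
  A *m octo_cross u v - octo_cross (A *m u) v - octo_cross u (A *m v).

Lemma addr_subC (V : lmodType K) a (x1 x2 y1 y2 z1 z2 : V) :
  (a *: x1 + x2) - (a *: y1 + y2) - (a *: z1 + z2) = a *: (x1 - y1 - z1) + (x2 - y2 - z2).
Proof. by rewrite !scalerBr !opprD ![_ - _ + (_ - _)]addrACA. Qed.

Lemma der_defect_lin u v : linear (der_defect^~ u ^~ v).
Proof.
by move=> a B C; rewrite /der_defect !mulmxDl -!scalemxAl octo_cross_linl octo_cross_linr addr_subC.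
Qed.

Lemma der_defect_linl A v : linear (der_defect A ^~ v).
Proof.
move=> a u u'; rewrite /der_defect mulmxDr -scalemxAr !octo_cross_linl mulmxDr -scalemxAr.
exact: addr_subC.
Qed.

Lemma der_defect_linr A u : linear (der_defect A u).
Proof.
move=> a v v'; rewrite /der_defect mulmxDr -scalemxAr !octo_cross_linr mulmxDr -scalemxAr.
exact: addr_subC.
Qed.

(** [G2] tests the derivation rule on basis vectors only; the defect is linear in each vector, so it
    vanishes everywhere. *)
Lemma G2P (A : 'M[K]_(1 + (3 + 3))) : reflect (der (mulmx A)) (A \in G2 K).
Proof.
have der0 u v : (der_defect A u v == 0) = (A *m octo_cross u v == octo_cross (A *m u) v + octo_cross u (A *m v)).
  by rewrite /der_defect -addrA -opprD subr_eq0.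
apply: (iffP idP) => [hA u v|hA].
  apply/eqP; rewrite -der0; apply/eqP; apply: (lin_eq0 v (der_defect_linr A u)) => j.
  apply: (lin_eq0 u (der_defect_linl A _)) => i.
  move: hA; rewrite memvE => /subv_bigcapP/(_ i isT); rewrite -memvE => hA.
  move: hA; rewrite memvE => /subv_bigcapP/(_ j isT); rewrite -memvE memv_kernel; last exact: der_defect_lin.
  by move/eqP.
rewrite memvE; apply/subv_bigcapP => i _; apply/subv_bigcapP => j _; rewrite -memvE.
rewrite memv_kernel; last exact: der_defect_lin.
by rewrite -/(der_defect A _ _) der0 hA.
Qed.

Lemma G2_comm A B : A \in G2 K -> B \in G2 K -> A *m B - B *m A \in G2 K.
Proof.
move=> /G2P hA /G2P hB; apply/G2P => u v.
have cDl x y z : octo_cross (x + y) z = octo_cross x z + octo_cross y z :> W.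
  by have := octo_cross_linl z 1 x y; rewrite !scale1r.
have cDr x y z : octo_cross z (x + y) = octo_cross z x + octo_cross z y :> W.
  by have := octo_cross_linr z 1 x y; rewrite !scale1r.
have cNl x z : octo_cross (- x) z = - octo_cross x z :> W.
  by apply/eqP; rewrite -addr_eq0 -cDl addNr; apply/eqP; have := octo_cross_linl z (-1) 0 0; rewrite scaler0 addr0 scaleN1r addNr.
have cNr x z : octo_cross z (- x) = - octo_cross z x :> W.
  by apply/eqP; rewrite -addr_eq0 -cDr addNr; apply/eqP; have := octo_cross_linr z (-1) 0 0; rewrite scaler0 addr0 scaleN1r addNr.
rewrite !mulmxBl -!mulmxA (hA u v) (hB u v) !mulmxDr hA hA hB hB !(cDl, cDr, cNl, cNr).
by apply/matrixP => i j; rewrite !mx_linE; ring.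
Qed.

End OctonionCoordinates.

(** * Weights of G_2 on the imaginary octonions *)

Section G3Data.
Variable K : fieldType.
Hypothesis charK : forall k, k.+1%:R != 0 :> K.
Notation W := 'cV[K]_(1 + (3 + 3)).
Notation ev k := (delta_mx k 0 : W).

(** The values of e_0, e_1, e_2 at H. They add up to 0, e_0 is the highest weight, and the six roots
    listed in u_0 become negative. *)
Definition lv3 (k : 'I_3) : int := nth 0 [:: 3; -1; -2] k.
Definition lvO (i : 'I_(1 + (3 + 3))) : int := nth 0 [:: 0; 3; -1; -2; -3; 1; 2] i.

Lemma lvOz : lvO iz = 0. Proof. by []. Qed.
Lemma lvOx k : lvO (ix k) = lv3 k. Proof. by move: k; apply: ord3P. Qed.
Lemma lvOy k : lvO (iy k) = - lv3 k. Proof. by move: k; apply: ord3P. Qed.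
Definition lvOE := (lvOz, lvOx, lvOy).

Lemma lv3_sum k : lv3 k + lv3 (k + 1) + lv3 (k + 2) = 0.
Proof. by move: k; apply: ord3P. Qed.

Lemma sum_neq0 (I : finType) (F : I -> K) : \sum_i F i != 0 -> exists i, F i != 0.
Proof.
move=> h; have [/existsP//|] := boolP [exists i, F i != 0].
rewrite negb_exists => /forallP F0; case/eqP: h; apply: big1 => i _; exact/eqP/negbNE/F0.
Qed.

Lemma mulr_neq0 (x y : K) : x * y != 0 -> x != 0 /\ y != 0.
Proof. by rewrite mulf_eq0 negb_or => /andP. Qed.

Lemma subr_neq0P (x y : K) : x - y != 0 -> x != 0 \/ y != 0.
Proof. by case/addr_neq0; rewrite ?oppr_eq0; [left|right]. Qed.

(** The product of octonions adds levels; for the two cross products of Zorn's matrices this is the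
    relation e_0 + e_1 + e_2 = 0. *)
Lemma octo_cross_lev (u v : W) i : octo_cross u v i 0 != 0 ->
  exists j k, [/\ u j 0 != 0, v k 0 != 0 & lvO i = lvO j + lvO k].
Proof.
have W2 j k : u j 0 * v k 0 != 0 -> lvO i = lvO j + lvO k ->
    exists j k, [/\ u j 0 != 0, v k 0 != 0 & lvO i = lvO j + lvO k].
  by move=> /mulr_neq0[h1 h2] h; exists j, k.
case: (octo_indexP i) W2 => [|k|k] W2; rewrite ?octo_entries.
- move=> /mulr_neq0[/sum_neq0[k]] /subr_neq0P[] h _; apply: (W2 _ _ h); rewrite !lvOE; ring.
- have e := lv3_sum k; case/subr_neq0P => /subr_neq0P[] h; try rewrite mulrC in h.
  + by rewrite mulrC in h; apply: (W2 _ _ h); rewrite !lvOE add0r.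
  + by apply: (W2 _ _ h); rewrite !lvOE addr0.
  + by rewrite mulrC in h; apply: (W2 _ _ h); rewrite !lvOE; lia.
  + by rewrite mulrC in h; apply: (W2 _ _ h); rewrite !lvOE; lia.
have e := lv3_sum k; case/addr_neq0 => /subr_neq0P[] h.
+ by rewrite mulrC in h; apply: (W2 _ _ h); rewrite !lvOE addr0.
+ by apply: (W2 _ _ h); rewrite !lvOE add0r.
+ by apply: (W2 _ _ h); rewrite !lvOE; lia.
+ by apply: (W2 _ _ h); rewrite !lvOE; lia.
Qed.

Lemma octo_dot_lev (u v : W) : octo_dot u v != 0 ->
  exists j k, [/\ u j 0 != 0, v k 0 != 0 & lvO j + lvO k = 0].
Proof.
rewrite octo_dotE => /addr_neq0[/mulr_neq0[hu hv]|].
  by exists iz, iz.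
move=> /mulr_neq0[/sum_neq0[k /addr_neq0[]/mulr_neq0[hu hv]] _].
  by exists (ix k), (iy k); rewrite !lvOE addrN.
by exists (iy k), (ix k); rewrite !lvOE addNr.
Qed.

Lemma ev_neq0 (i j : 'I_(1 + (3 + 3))) : ev i j 0 != 0 -> j = i.
Proof. by rewrite mxE andbT; case: (eqVneq j i) => // _; rewrite eqxx. Qed.

Lemma octo_der_entry (u v : W) i j : octo_der u v i j = octo_T u v (ev j) i 0.
Proof. by rewrite /octo_der mxE. Qed.

Lemma octo_der_lev a b i j : octo_der (ev a) (ev b) i j != 0 ->
  lvO i = lvO a + lvO b + lvO j.
Proof.
rewrite octo_der_entry /octo_T mxDE.
case/addr_neq0; last first.
  rewrite mxZE => /mulr_neq0[_]; rewrite mxDE mxNE !mxZE => /subr_neq0P[]/mulr_neq0[];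
  by move=> /octo_dot_lev[j1 [j2 [/ev_neq0-> /ev_neq0-> e]]] /ev_neq0->; lia.
rewrite mxDE mxNE => /subr_neq0P[]/octo_cross_lev[j1 [j2 [/ev_neq0-> + ->]]];
  by move=> /octo_cross_lev[k1 [k2 [/ev_neq0-> /ev_neq0-> ->]]]; ring.
Qed.

Lemma octo_der_skew (u v : W) : octo_der v u = - octo_der u v.
Proof.
apply/matrixP => i j; rewrite mxNE !octo_der_entry /octo_T.
move: (octo_cross _ _) (octo_cross _ _) => c1 c2; rewrite !mx_linE; ring.
Qed.

Lemma octo_der_linr (u : W) : linear (octo_der u).
Proof.
move=> a v v'; apply/matrixP => i j; rewrite mxDE mxZE !octo_der_entry /octo_T.
rewrite !octo_cross_linl octo_cross_linr octo_dot_linl.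
move: (octo_cross _ _) (octo_cross _ _) (octo_cross _ _) (octo_cross _ _) => c1 c2 c3 c4.
by rewrite /GRing.scale /= !mx_linE; ring.
Qed.

Lemma octo_der_linl (v : W) : linear (fun u : W => octo_der u v).
Proof.
move=> a u u'; rewrite (octo_der_skew v) octo_der_linr opprD (octo_der_skew v u).
by rewrite (octo_der_skew v u') scalerN.
Qed.

Lemma diag_mulE (d : 'rV[K]_(1 + (3 + 3))) (u : W) i : (diag_mx d *m u) i 0 = d 0 i * u i 0.
Proof. by rewrite mul_diag_mx mxE. Qed.

Lemma G2_weights : diag_mx (\row_i (lvO i)%:~R) \in G2 K.
Proof.
apply/G2P => u v.
have dE (w : W) i : (diag_mx (\row_i (lvO i)%:~R) *m w) i 0 = (lvO i)%:~R * w i 0.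
  by rewrite diag_mulE mxE.
have l3 k : (lv3 k)%:~R = - (lv3 (k + 1))%:~R - (lv3 (k + 2))%:~R :> K.
  by rewrite -opprD -rmorphD -rmorphN /=; congr (_%:~R); have := lv3_sum k; lia.
move: (diag_mx _) dE => A dE; apply: octo_vecP => [|k|k]; rewrite mxDE dE !octo_entries.
- rewrite mulrA -mulrDl -big_split mulr_sumr; congr (_ / _); apply: eq_bigr => k _ /=.
  by rewrite !dE !lvOE rmorphN /=; ring.
- by rewrite !dE !lvOE !rmorphN /= l3; ring.
by rewrite !dE !lvOE !rmorphN /= l3; ring.
Qed.

Lemma octo_index_eq : [/\ forall k, (iz == ix k) = false, forall k, (iz == iy k) = false,
  forall k, (ix k == iz) = false, forall k, (iy k == iz) = false &
  [/\ forall k l, (ix k == iy l) = false, forall k l, (iy k == ix l) = false,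
      forall k l, (ix k == ix l) = (k == l) & forall k l, (iy k == iy l) = (k == l)]].
Proof.
by split=> [k|k|k|k|]; last split=> k l; rewrite /ix /iy /iz ?eq_rshift ?eq_lshift ?eq_rlshift ?eq_lrshift ?eq_rshift.
Qed.

Lemma evE k i : ev k i 0 = (i == k)%:R.
Proof. by rewrite mxE andbT. Qed.

(** The derivation rule applied to the products of [iz] with [ix 0], of [ix k] with [iy k], and of
    [ix 1] with [ix 2] gives the three relations in turn. *)
Lemma G2_diag h : h \in G2 K -> h \in diagonal_space K 7 ->
  [/\ h iz iz = 0, forall k, h (iy k) (iy k) = - h (ix k) (ix k) &
      h (ix 0) (ix 0) = - h (ix 1) (ix 1) - h (ix 2) (ix 2)].
Proof.
move=> /G2P hG /diagonal_spaceP hd.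
have two0 : 2 != 0 :> K by apply: (charK 1).
have hE (w : W) i : (h *m w) i 0 = h i i * w i 0 by apply: diag_mxM.
have [zx zy xz yz [xy yx xx yy]] := octo_index_eq.
have E := (oppr0, evE, zx, zy, xz, yz, xy, yx, xx, yy, eqxx, mulr0, mul0r, mulr1, mul1r, subr0, sub0r, addr0, add0r).
have [e01 e02 e11 e12 [e21 e22]] := ord3_add.
have h0 : h iz iz = 0.
  have := congr1 (fun w : W => w (ix 0) 0) (hG (ev iz) (ev (ix 0))).
  rewrite mxDE hE !octo_crossX !hE !E /= ?E.
  by move/eqP; rewrite addrC -[X in X == _]addr0 (inj_eq (addrI _)) eq_sym => /eqP.
have hy k : h (iy k) (iy k) = - h (ix k) (ix k).
  have := congr1 (fun w : W => w iz 0) (hG (ev (ix k)) (ev (iy k))).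
  rewrite mxDE hE h0 mul0r !octo_crossZ -mulrDl -big_split => /esym/eqP.
  rewrite mulf_eq0 invr_eq0 (negPf two0) orbF (bigD1 k) //= big1 => [|l /negPf lk].
    by rewrite !hE !E /= ?E addrC addr_eq0 => /eqP.
  by rewrite !hE !E lk !E.
split=> //; have := congr1 (fun w : W => w (iy 0) 0) (hG (ev (ix 1)) (ev (ix 2))).
rewrite mxDE hE !octo_crossY e01 e02 !hE !E /= ?E hy => h12.
by rewrite -opprD -h12 opprK.
Qed.

(** These positions have weight twice a short root, which is not a root. Multiplication by the basis
    vector [iz] acts on [ix k] and [iy k] with opposite signs, and the derivation rule then makes
    the entry equal to its opposite. *)
Lemma G2_xy0 A k : A \in G2 K -> A (ix k) (iy k) = 0 /\ A (iy k) (ix k) = 0.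
Proof.
move=> /G2P hA.
have two0 : 2 != 0 :> K by apply: (charK 1).
have [zx zy xz yz [xy yx xx yy]] := octo_index_eq.
have E := (oppr0, evE, zx, zy, xz, yz, xy, yx, xx, yy, eqxx, mulr0, mul0r, mulr1, mul1r, subr0, sub0r, addr0, add0r).
have [e01 e02 e11 e12 [e21 e22]] := ord3_add.
have AE j i : (A *m ev j) i 0 = A i j by rewrite -colE mxE.
have zX : octo_cross (ev iz) (ev (ix k)) = ev (ix k).
  by apply: octo_vecP => [|l|l]; rewrite octo_entries ?big_ord3 ?E.
have zY : octo_cross (ev iz) (ev (iy k)) = - ev (iy k).
  by apply: octo_vecP => [|l|l]; rewrite mxNE octo_entries ?big_ord3 ?E.
have k1 : (k + 1 == k) = false by move: k {zX zY}; apply: ord3P.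
have k2 : (k + 2 == k) = false by move: k {zX zY k1}; apply: ord3P.
have fin x : x = - x -> x = 0 :> K.
  by move/eqP; rewrite -addr_eq0 -mulr2n -mulr_natl mulf_eq0 (negPf two0) => /eqP.
split.
  have := congr1 (fun w : W => w (ix k) 0) (hA (ev iz) (ev (iy k))).
  rewrite zY mulmxN mxNE mxDE !octo_crossX !AE !E k1 k2 !E => e; apply: fin; by rewrite -{1}e.
have := congr1 (fun w : W => w (iy k) 0) (hA (ev iz) (ev (ix k))).
by rewrite zX mxDE !octo_crossY !AE !E k1 k2 !E => /fin.
Qed.

End G3Data.

Section G3Triangular.
Variable K : fieldType.
Hypothesis charK : forall k, k.+1%:R != 0 :> K.
Notation W := 'cV[K]_(1 + (3 + 3)).
Notation ev k := (delta_mx k 0 : W).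

Lemma G3_form_dot i j : G3_form K i j = 4 * octo_dot (ev i) (ev j).
Proof. by rewrite /G3_form mxE. Qed.

Lemma lvO_inj : injective lvO.
Proof.
move=> i j h; apply/val_inj/eqP; move: h; rewrite /lvO.
by case: i j => [[|[|[|[|[|[|[|i]]]]]]] hi] [[|[|[|[|[|[|[|j]]]]]]] hj].
Qed.

Definition G2_torus_elt (a : 'rV[K]_3) : 'rV[K]_(1 + (3 + 3)) :=
  row_mx (const_mx 1) (row_mx a (map_mx GRing.inv a)).

Lemma G2_torusE a (d := G2_torus_elt a) :
  [/\ d 0 iz = 1, forall k, d 0 (ix k) = a 0 k & forall k, d 0 (iy k) = (a 0 k)^-1].
Proof.
by rewrite /d /G2_torus_elt /iz /ix /iy; split=> [|k|k]; rewrite ?row_mxEl ?row_mxEr ?row_mxEl ?row_mxEr ?mxE.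
Qed.

(** The factor 4 in [G3_form] makes [F q p] equal to 2, matching the diagonal entries -2 and 2 of
    [octo_der (ev q) (ev p)] at [p] and [q]. *)
Lemma G3_exc : @exc_data K 7 (G2 K) (@octo_der K) (G3_form K) (@G2_torus K) lvO 3 (ix 0) (iy 0).
Proof.
have two0 : 2 != 0 :> K by apply: (charK 1).
have [zx zy xz yz [xy yx xx yy]] := octo_index_eq.
have E := (oppr0, evE, zx, zy, xz, yz, xy, yx, xx, yy, eqxx, mulr0, mul0r, mulr1, mul1r, subr0, sub0r, addr0, add0r).
have [e01 e02 e11 e12 [e21 e22]] := ord3_add.
have form_qp : G3_form K (iy 0) (ix 0) = 2.
  by rewrite G3_form_dot octo_dotE big_ord3 !E /= ?E; field.
have pq : octo_dot (ev (iy 0)) (ev (ix 0)) = 2^-1 :> K by rewrite octo_dotE big_ord3 !E /= ?E; field.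
have pp : octo_dot (ev (ix 0)) (ev (ix 0)) = 0 :> K by rewrite octo_dotE big_ord3 !E /= ?E.
have qq : octo_dot (ev (iy 0)) (ev (iy 0)) = 0 :> K by rewrite octo_dotE big_ord3 !E /= ?E.
have cpp k : octo_cross (ev (ix 0)) (ev (ix 0)) (iy k) 0 = 0.
  by rewrite octo_crossY !E; ring.
have cqq k : octo_cross (ev (iy 0)) (ev (iy 0)) (ix k) 0 = 0.
  by rewrite octo_crossX !E; ring.
have cppz : octo_cross (ev (ix 0)) (ev (ix 0)) iz 0 = 0 by rewrite octo_crossZ big_ord3 !E /= ?E.
have cqqz : octo_cross (ev (iy 0)) (ev (iy 0)) iz 0 = 0 by rewrite octo_crossZ big_ord3 !E /= ?E.
have cppx : octo_cross (ev (ix 0)) (ev (ix 0)) (ix 0) 0 = 0 by rewrite octo_crossX !E.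
have cqqy : octo_cross (ev (iy 0)) (ev (iy 0)) (iy 0) 0 = 0 by rewrite octo_crossY !E.
have cqp k : octo_cross (ev (iy 0)) (ev (ix 0)) (iy k) 0 = 0 by rewrite octo_crossY !E.
have cqpz : octo_cross (ev (iy 0)) (ev (ix 0)) iz 0 = - 2^-1.
  by rewrite octo_crossZ big_ord3 !E /= ?E; field.
have cqpx k : octo_cross (ev (iy 0)) (ev (ix 0)) (ix k) 0 = 0 by rewrite octo_crossX !E.
have cpqx k : octo_cross (ev (ix 0)) (ev (iy 0)) (ix k) 0 = 0 by rewrite octo_crossX !E.
have cpqz : octo_cross (ev (ix 0)) (ev (iy 0)) iz 0 = 2^-1.
  by rewrite octo_crossZ big_ord3 !E /= ?E; field.
have cpqy k : octo_cross (ev (ix 0)) (ev (iy 0)) (iy k) 0 = 0 by rewrite octo_crossY !E.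
have T_qp : octo_T (ev (iy 0)) (ev (ix 0)) (ev (ix 0)) (ix 0) 0 = - 2.
  rewrite /octo_T pq pp; move: (octo_cross _ _) (octo_cross _ _) cpp cppz cppx cqp cqpz cqpx => w1 w2 h1 h2 h3 h4 h5 h6.
  by rewrite !mx_linE !octo_crossX !(h1, h2, h3, h4, h5, h6, E) /= ?E; field.
have T_qq : octo_T (ev (iy 0)) (ev (ix 0)) (ev (iy 0)) (iy 0) 0 = 2.
  rewrite /octo_T octo_dotC pq qq; move: (octo_cross _ _) (octo_cross _ _) cqq cqqz cqqy cpqx cpqz cpqy => w1 w2 h1 h2 h3 h4 h5 h6.
  by rewrite !mx_linE !octo_crossY !(h1, h2, h3, h4, h5, h6, E) /= ?E; field.
split.
- exact: octo_der_linl.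
- exact: octo_der_linr.
- exact: G2_comm.
- exact: lvO_inj.
- by rewrite lvOx.
- by rewrite lvOy.
- by [].
- by case=> [[|[|[|[|[|[|[|i]]]]]]] hi].
- exact: G2_weights.
- by move=> k; apply/G2P => u v; rewrite !octo_derE; apply: octo_T_der.
- by move=> k; rewrite octo_der_skew.
- by move=> k i j /octo_der_lev->; rewrite lvOy; ring.
- move=> i j; rewrite G3_form_dot => /mulr_neq0[_ /octo_dot_lev[j1 [j2 [/ev_neq0-> /ev_neq0->]]]] //.
- by rewrite !G3_form_dot octo_dotC.
- by rewrite octo_der_entry form_qp T_qp.
- by rewrite octo_der_entry form_qp T_qq.
- by move=> h hG hd; have [_ -> _] := G2_diag charK hG hd.
- by move=> d d0 [a _ ->]; have [_ -> ->] := G2_torusE a.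
(* The diagonal element (z, 1/z, 1) of SL_3 takes the value [z] at [p]. *)
move=> z z0; pose a := \row_(k < 3) nth 1 [:: z; z^-1] k.
have [dz dx dy] := G2_torusE a; exists (G2_torus_elt a).
  have a0 k : a 0 k != 0 by rewrite mxE; move: k; apply: ord3P; rewrite /= ?invr_eq0 ?oner_eq0.
  move=> i; case: (octo_indexP i) => [|k|k].
  - by rewrite dz oner_eq0.
  - by rewrite dx.
  by rewrite dy invr_eq0.
split; last by rewrite dx mxE.
exists a => //; by rewrite !big_ord_recl big_ord0 !mxE /= !mulr1 mulfV.
Qed.

Notation V := ('M[K]_7 * 'M[K]_2 * 'M[K]_(7, 2))%type.
Notation g0_ lam := (@exc_root K 7 (G2 K) (@octo_der K) (G3_form K) false lam%R).
Notation mu i := (@exc_mu K 7 i).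
Notation gr := (@grspace K (exc (G2 K) (@octo_der K) (G3_form K)) _ (@exc_coord K 7) (exc_lev lvO 3)).

(** Modulo the relations of [G2_diag], each position of negative level carries one of the six listed
    roots, except the pairs [ix k], [iy k], where [G2_xy0] shows that the entry is 0. The finitely
    many positions are tested against the roots in turn. *)
Lemma G3_u0 (U : {vspace V}) : U = (g0_ (- mu (ix 0)) + g0_ (mu (ix 1)) + g0_ (mu (ix 2)) +
   g0_ (- mu (ix 0) + mu (ix 1)) + g0_ (- mu (ix 0) + mu (ix 2)) + g0_ (- mu (ix 1) + mu (ix 2)))%VS ->
  (U + g0_ (- (@exc_eps K 7 *+ 2)))%VS = gr false (fun n => n < 0).
Proof.
move=> UE.
have t0E (h : V) : h \in @exc_t0 K 7 (G2 K) -> [/\ h.1.1 iz iz = 0,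
    forall k, h.1.1 (iy k) (iy k) = - h.1.1 (ix k) (ix k) &
    h.1.1 (ix 0) (ix 0) = - h.1.1 (ix 1) (ix 1) - h.1.1 (ix 2) (ix 2)].
  by move=> /exc_t0E[h1 h2 _ _ _]; apply: G2_diag.
have subU (i j : 'I_7) (lm : V -> K) : {in @exc_t0 K 7 (G2 K), forall h, lm h = h.1.1 i i - h.1.1 j j} -> lvO i < lvO j ->
    (g0_ lm <= gr false (fun n => (n < 0)%R))%VS.
  move=> lmE lt; apply: (exc_root_gr charK G3_exc (x := inl (inl (i, j))) _ lmE); by rewrite /= subr_lt0.
apply: (exc_u0E charK G3_exc).
  rewrite UE !subv_add -!andbA; do 5?[apply/andP; split].
  - by apply: (@subU iz (ix 0)) => // h /t0E[/= -> _ _]; rewrite sub0r.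
  - by apply: (@subU (ix 1) iz) => // h /t0E[/= -> _ _]; rewrite subr0.
  - by apply: (@subU (ix 2) iz) => // h /t0E[/= -> _ _]; rewrite subr0.
  - by apply: (@subU (ix 1) (ix 0)) => // h _; rewrite addrC.
  - by apply: (@subU (ix 2) (ix 0)) => // h _; rewrite addrC.
  by apply: (@subU (ix 2) (ix 1)) => // h _; rewrite addrC.
have [U1 U2 U3 [U4 U5 U6]] : [/\ (g0_ (- mu (ix 0)) <= U)%VS, (g0_ (mu (ix 1)) <= U)%VS,
    (g0_ (mu (ix 2)) <= U)%VS & [/\ (g0_ (- mu (ix 0) + mu (ix 1)) <= U)%VS,
    (g0_ (- mu (ix 0) + mu (ix 2)) <= U)%VS & (g0_ (- mu (ix 1) + mu (ix 2)) <= U)%VS]].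
  have := subvv U; rewrite {1}UE !subv_add -!andbA => /andP[V1 /and5P[V2 V3 V4 V5 V6]].
  exact: (And4 V1 V2 V3 (And3 V4 V5 V6)).
pose good (i j : 'I_7) := exists lm : V -> K, {in @exc_t0 K 7 (G2 K), forall h, lm h = h.1.1 i i - h.1.1 j j} /\
  (g0_ lm <= U)%VS.
have R (lm : V -> K) (i j : 'I_7) (f : V -> K) : (g0_ lm <= U)%VS -> lm =1 f ->
    (forall h : V, h.1.1 iz iz = 0 -> (forall k, h.1.1 (iy k) (iy k) = - h.1.1 (ix k) (ix k)) ->
      h.1.1 (ix 0) (ix 0) = - h.1.1 (ix 1) (ix 1) - h.1.1 (ix 2) (ix 2) ->
      f h = h.1.1 i i - h.1.1 j j) -> good i j.
  by move=> lmU lmE lmR; exists lm; split=> // h /t0E[hz hy hx]; rewrite lmE lmR.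
have R1 i j := R _ i j (fun h => - h.1.1 (ix 0) (ix 0)) U1 (fun h => erefl).
have R2 i j := R _ i j (fun h => h.1.1 (ix 1) (ix 1)) U2 (fun h => erefl).
have R3 i j := R _ i j (fun h => h.1.1 (ix 2) (ix 2)) U3 (fun h => erefl).
have R4 i j := R _ i j (fun h => - h.1.1 (ix 0) (ix 0) + h.1.1 (ix 1) (ix 1)) U4 (fun h => erefl).
have R5 i j := R _ i j (fun h => - h.1.1 (ix 0) (ix 0) + h.1.1 (ix 2) (ix 2)) U5 (fun h => erefl).
have R6 i j := R _ i j (fun h => - h.1.1 (ix 1) (ix 1) + h.1.1 (ix 2) (ix 2)) U6 (fun h => erefl).
have cases (i j : 'I_7) : lvO i < lvO j -> (exists k, (i, j) = (ix k, iy k) \/ (i, j) = (iy k, ix k)) \/ good i j.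
  case: (octo_indexP i) => [|k|k]; case: (octo_indexP j) => [|l|l]; rewrite !lvOE //;
    try elim/ord3P: k; try elim/ord3P: l; try done; move=> _;
    try (left; first [exists 0; solve [by left|by right] | exists 1; solve [by left|by right]
      | exists 2; solve [by left|by right]]);
    right; let solve_by R := (apply (R _ _); move=> h hz hy hx; rewrite ?hz ?hy ?hx; solve [ring]) in
    first [solve_by R1 | solve_by R2 | solve_by R3 | solve_by R4 | solve_by R5 | solve_by R6].
move=> i j A AG Aij ij; have [[k [[ik jk]|[ik jk]]]|//] := cases _ _ ij; have [A1 A2] := G2_xy0 charK k AG.
  by rewrite ik jk A1 eqxx in Aij.
by rewrite ik jk A2 eqxx in Aij.
Qed.

Lemma G3_triangular : triangular (G3_datum K).
Proof.
have i0 : inord 1 = ix 0 :> 'I_7 by apply: val_inj; rewrite /= inordK.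
have i1 : inord 2 = ix 1 :> 'I_7 by apply: val_inj; rewrite /= inordK.
have i2 : inord 3 = ix 2 :> 'I_7 by apply: val_inj; rewrite /= inordK.
have one : (1 : 'I_7) = ix 0 by apply: val_inj.
apply: (exc_triangular charK G3_exc).
- by rewrite i0 i1 i2; apply: G3_u0.
- by rewrite i0; apply: (exc_f1E charK G3_exc).
by rewrite one; apply: (exc_u1E charK G3_exc).
Qed.

End G3Triangular.

(** * F(4) *)

(* Every product of gamma matrices is a signed permutation matrix, sending    *)
(* e_j to +/- e_(j xor m); it is encoded by the mask m and the list of signs, *)
(* so that the identities between such products are decided by computation.   *)
Definition xr (i j : nat) : nat :=
  ((bit 0 i (+) bit 0 j) + 2 * (bit 1 i (+) bit 1 j) + 4 * (bit 2 i (+) bit 2 j))%N.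
Definition scode := (nat * seq bool)%type.
Definition smul (x y : scode) : scode :=
  (xr x.1 y.1, mkseq (fun j => nth false y.2 j (+) nth false x.2 (xr y.1 j)) 8).
Definition sneg (x : scode) : scode := (x.1, mkseq (fun j => ~~ nth false x.2 j) 8).
Definition sgn (b : bool) : int := if b then -1 else 1.
Definition sent (x : scode) (i j : nat) : int :=
  if i == xr x.1 j then sgn (nth false x.2 j) else 0.

Definition gcode (k : nat) : scode := if (k == 6)%N then
    (0, mkseq (fun j => odd (bit 0 j + bit 1 j + bit 2 j)) 8)%N
  else (2 ^ (k %% 3), mkseq (fun j => odd (sumn (mkseq (fun r => bit r j : nat) (k %% 3)) + ((3 <= k) && bit (k %% 3) j))) 8)%N.

Definition gcode2 a b := smul (gcode a) (gcode b).
Definition pairs7 := [seq (a, b) | a <- iota 0 7, b <- [seq b <- iota 0 7 | (a < b)%N]].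

Lemma all_iota n (P : pred nat) : all P (iota 0 n) -> forall i, (i < n)%N -> P i.
Proof. by move=> /allP h i hi; apply: h; rewrite mem_iota. Qed.

Lemma pairs7_mem a b : (a < b)%N -> (b < 7)%N -> (a, b) \in pairs7.
Proof.
move=> ab b7; apply/allpairsPdep; exists a, b; rewrite mem_filter !mem_iota /= ab b7.
by rewrite (ltn_trans ab b7).
Qed.

Lemma xr_lt i j : (xr i j < 8)%N.
Proof. by rewrite /xr; do 3!case: (_ (+) _). Qed.

Lemma xr_check : all (fun i => all (fun j => all (fun k =>
  [&& xr (xr i j) k == xr i (xr j k), xr 0 k == k, xr i k == xr k i & xr i i == 0]%N) (iota 0 8)) (iota 0 8)) (iota 0 8).
Proof. by vm_compute. Qed.

Lemma xrP i j k : (i < 8)%N -> (j < 8)%N -> (k < 8)%N ->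
  [/\ xr (xr i j) k = xr i (xr j k), xr 0 k = k, xr i k = xr k i & xr i i = 0]%N.
Proof.
move=> hi hj hk; have /and4P[] := all_iota (all_iota (all_iota xr_check hi) hj) hk.
by do 4?move/eqP => ?.
Qed.

(** * Gamma matrices as signed permutations *)

Section SignedPermutations.
Variable K : fieldType.

Definition smx (x : scode) : 'M[K]_8 := \matrix_(i, j) (sent x i j)%:~R.

Lemma smxE x (i j : 'I_8) : smx x i j = (sent x i j)%:~R.
Proof. by rewrite mxE. Qed.

Lemma smx_mul x y : (x.1 < 8)%N -> (y.1 < 8)%N -> smx x *m smx y = smx (smul x y).
Proof.
move=> hx hy; apply/matrixP => i j; rewrite smxE mxE (bigD1 (Ordinal (xr_lt y.1 j))) //= big1 ?addr0.
  rewrite !smxE /sent /= eqxx nth_mkseq //; have [-> _ _ _] := xrP hx hy (ltn_ord j).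
  by case: eqP => _; rewrite ?mul0r // /sgn -rmorphM /=; case: nth; case: nth.
move=> k; rewrite smxE [smx y _ _]smxE /sent -(inj_eq val_inj) /= => /negPf->.
by rewrite mulr0.
Qed.

Lemma smx_neg x : smx (sneg x) = - smx x.
Proof.
apply/matrixP => i j; rewrite [RHS]mxE !smxE /sent /= nth_mkseq //.
by case: eqP => _; rewrite ?rmorph0 ?oppr0 // /sgn -rmorphN; case: nth.
Qed.

Lemma gcode_lt k : (k < 7)%N -> ((gcode k).1 < 8)%N.
Proof. by case: k => [|[|[|[|[|[|[|]]]]]]]. Qed.

Lemma gamma_check : all (fun l => all (fun i => all (fun j =>
  ([&& bit 0 i == bit 0 j (+) (0 == l), bit 1 i == bit 1 j (+) (1 == l) & bit 2 i == bit 2 j (+) (2 == l)])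
    == (i == xr (2 ^ l) j))%N (iota 0 8)) (iota 0 8)) (iota 0 3).
Proof. by vm_compute. Qed.

Lemma gammaE (k : 'I_7) : gamma K k = smx (gcode k).
Proof.
apply/matrixP => i j; rewrite smxE !mxE /sent /gcode; case: ifP => _ /=.
  have [_ -> _ _] := xrP (ltn_ord i) (ltn_ord i) (ltn_ord j).
  rewrite nth_mkseq // -signr_odd (inj_eq val_inj); case: eqP => _; rewrite ?mul0r // mul1r.
  by rewrite /sgn; case: odd; rewrite ?rmorphN.
have l3 : (k %% 3 < 3)%N by rewrite ltn_mod.
have /eqP <- := all_iota (all_iota (all_iota gamma_check l3) (ltn_ord i)) (ltn_ord j).
have -> : [forall r : 'I_3, bit r i == bit r j (+) (r == (k %% 3)%N :> nat)] =
    [&& bit 0 i == bit 0 j (+) (0 == k %% 3)%N, bit 1 i == bit 1 j (+) (1 == k %% 3)%N &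
        bit 2 i == bit 2 j (+) (2 == k %% 3)%N].
  apply/forallP/and3P => [h|[h0 h1 h2]]; last exact: ord3P.
  by split; [apply: (h 0)|apply: (h 1)|apply: (h 2)].
case: ifP => _; rewrite ?mul0r // mul1r nth_mkseq // -signr_odd.
have -> : (\sum_(r < (k %% 3)%N) bit r j)%N = sumn (mkseq (fun r => bit r j : nat) (k %% 3)).
  by rewrite sumnE big_map -(big_mkord xpredT (fun r => bit r j : nat)) /index_iota subn0.
by rewrite /sgn; case: odd; rewrite ?rmorphN.
Qed.

Lemma gamma2E (a b : 'I_7) : gamma K a *m gamma K b = smx (gcode2 a b).
Proof. by rewrite !gammaE smx_mul ?gcode_lt. Qed.

Lemma gcode2_lt a b : ((gcode2 a b).1 < 8)%N.
Proof. exact: xr_lt. Qed.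

Lemma spin7_ind (P : 'M[K]_8 -> Prop) : (forall A B, P A -> P B -> P (A + B)) -> P 0 ->
  (forall c A, P A -> P (c *: A)) ->
  (forall a b, (a < b)%N -> (b < 7)%N -> P (smx (gcode2 a b))) -> forall A, A \in spin7 K -> P A.
Proof.
move=> PD P0 PZ Pg A /memv_sumP[f hf ->]; apply: (big_ind P) => // i _.
have /memv_sumP[f' hf' ->] := hf i isT; apply: (big_ind P) => // j ij.
by have /vlineP[c ->] := hf' j ij; apply: PZ; rewrite gamma2E; apply: Pg.
Qed.

Lemma gcode2_spin7 a b : (a < b)%N -> (b < 7)%N -> smx (gcode2 a b) \in spin7 K.
Proof.
move=> ab b7; have a7 := ltn_trans ab b7.
rewrite -[a]/(nat_of_ord (Ordinal a7)) -[b]/(nat_of_ord (Ordinal b7)) -gamma2E memvE.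
by rewrite (sumv_sup (Ordinal a7)) // (sumv_sup (Ordinal b7)).
Qed.

(** Two products of pairs of gamma matrices either commute, or their two orders of multiplication
    are opposite and equal up to sign to another such product. So their span is closed under
    commutators. *)
Lemma comm_check : all (fun p => all (fun p' =>
  let x := smul (gcode2 p.1 p.2) (gcode2 p'.1 p'.2) in
  let y := smul (gcode2 p'.1 p'.2) (gcode2 p.1 p.2) in
  (x == y) || has (fun e => let z := gcode2 e.1 e.2 in
    ((x == z) && (y == sneg z)) || ((x == sneg z) && (y == z))) pairs7) pairs7) pairs7.
Proof. by vm_compute. Qed.

Lemma pairs7P e : e \in pairs7 -> (e.1 < e.2)%N /\ (e.2 < 7)%N.
Proof.
case/allpairsPdep => a [b [_ + ->]]; by rewrite mem_filter mem_iota => /andP[].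
Qed.

Lemma spin7_comm A B : A \in spin7 K -> B \in spin7 K -> A *m B - B *m A \in spin7 K.
Proof.
move=> hA hB; move: A hA; apply: spin7_ind.
- by move=> A A' h h'; rewrite mulmxDl mulmxDr opprD addrACA rpredD.
- by rewrite mul0mx mulmx0 subrr mem0v.
- by move=> c A h; rewrite -scalemxAl -scalemxAr -scalerBr memvZ.
move=> a b ab b7; move: B hB; apply: spin7_ind.
- by move=> A A' h h'; rewrite mulmxDl mulmxDr opprD addrACA rpredD.
- by rewrite mul0mx mulmx0 subrr mem0v.
- by move=> c A h; rewrite -scalemxAl -scalemxAr -scalerBr memvZ.
move=> c d cd d7; rewrite !smx_mul ?gcode2_lt //.
have /orP[/eqP-> |/hasP[e /pairs7P[e1 e2]]] := allP (allP comm_check _ (pairs7_mem ab b7)) _ (pairs7_mem cd d7).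
  by rewrite subrr mem0v.
by case/orP => /andP[/eqP /= -> /eqP ->]; rewrite smx_neg ?opprK ?rpredD ?rpredN ?gcode2_spin7.
Qed.

End SignedPermutations.

(** * Form, derivations and weights of the spin module *)

Section SpinData.
Variable K : fieldType.
Notation ev k := (delta_mx k 0 : 'cV[K]_8).

(** The values of the weights [mu i] at H when e_0, e_1, e_2 take the values 8, 4, 2 and omega_3 the
    value 7; powers of 2 make the eight levels distinct. *)
Definition lvS (i : nat) : int := nth 0 [:: 7; -1; 3; -5; 5; -3; 1; -7] i.
Definition form_code : scode := smul (smul (gcode 3) (gcode 4)) (gcode 5).
Definition gsign (k : nat) : int := if (3 <= k < 6)%N then -1 else 1.

Definition der_term (k i j a b : nat) : int :=
  gsign a * gsign b * sent (smul form_code (gcode2 a b)) 7 k * sent (gcode2 a b) i j.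
(** The integer computed by the entry (i, j) of [spin_der (ev iq8) (ev k)]. It is written with
    nested folds over lists so that the properties of [D] can be decided by evaluation. *)
Definition der_entry (k i j : nat) : int :=
  foldr (fun a s => foldr (fun b t => if (a < b)%N then der_term k i j a b + t else t) 0 (iota 0 7) + s)
    0 (iota 0 7).

Lemma spin_formE : spin_form K = smx K form_code.
Proof. by rewrite /spin_form !gammaE !inordK // !smx_mul ?xr_lt // gcode_lt. Qed.

Definition trc (x : scode) : scode := (x.1, mkseq (fun j => nth false x.2 (xr x.1 j)) 8).

Lemma smx_tr x : (x.1 < 8)%N -> (smx K x)^T = smx K (trc x).
Proof.
move=> hx; apply/matrixP => i j; rewrite mxE !smxE /sent /=.
have xx k l : (k < 8)%N -> k = xr x.1 l -> (l < 8)%N -> xr x.1 k = l.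
  move=> _ -> hl; have [<- _ _ _] := xrP hx hx hl; have [_ h0 _ hxx] := xrP hx hx hl.
  by rewrite hxx h0.
case: (eqVneq (j : nat) (xr x.1 i)) => h.
  by have := xx _ _ (ltn_ord j) h (ltn_ord i) => e; rewrite e eqxx nth_mkseq // e.
by case: eqP => // /(xx _ _ (ltn_ord i))/(_ (ltn_ord j)) e; rewrite e eqxx in h.
Qed.

Lemma skew_check : all (fun p => let x := smul form_code (gcode2 p.1 p.2) in trc x == sneg x) pairs7.
Proof. by vm_compute. Qed.

Lemma spin_coefE (i j : 'I_7) (x y : 'cV[K]_8) :
  x^T *m spin_form K *m gamma K i *m gamma K j *m y =
  x^T *m smx K (smul form_code (gcode2 i j)) *m y.
Proof.
rewrite -[_ *m gamma K i *m _]mulmxA -[_ *m spin_form K *m _]mulmxA gamma2E spin_formE smx_mul //.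
exact: xr_lt.
Qed.

Lemma spin_der_skew (x y : 'cV[K]_8) : spin_der y x = - spin_der x y.
Proof.
rewrite /spin_der -sumrN; apply: eq_bigr => i _; rewrite -sumrN; apply: eq_bigr => j ij.
rewrite -scaleNr -mulrN; congr (_ * _ *: _); rewrite !spin_coefE.
have /eqP h := allP skew_check _ (pairs7_mem ij (ltn_ord j)).
rewrite -[LHS]trace_mx11 -mxtrace_tr !trmx_mul trmxK smx_tr ?xr_lt // h smx_neg.
by rewrite mulmxA mulmxN mulNmx linearN /= trace_mx11.
Qed.

Lemma spin_der_linr (x : 'cV[K]_8) : linear (spin_der x).
Proof.
move=> a y y'; rewrite /spin_der scaler_sumr -big_split; apply: eq_bigr => i _ /=.
rewrite scaler_sumr -big_split; apply: eq_bigr => j ij /=.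
rewrite scalerA -scalerDl; congr (_ *: _); rewrite mulmxDr -scalemxAr mxDE mxZE; ring.
Qed.

Lemma spin_der_linl (y : 'cV[K]_8) : linear (fun x : 'cV[K]_8 => spin_der x y).
Proof.
move=> a u u'; rewrite (spin_der_skew y) spin_der_linr opprD (spin_der_skew y u).
by rewrite (spin_der_skew y u') scalerN.
Qed.

Lemma spin_der_spin7 (x y : 'cV[K]_8) : spin_der x y \in spin7 K.
Proof.
apply: memv_suml => i _; apply: memv_suml => j ij; rewrite memvZ // gamma2E gcode2_spin7 //.
Qed.

Definition iq8 : 'I_8 := ord_max.

Lemma row_mul_col (M : 'M[K]_8) i j : ((ev i)^T *m M *m ev j) 0 0 = M i j.
Proof. by rewrite trmx_delta -rowE -colE !mxE. Qed.

Lemma gamma_signE (k : 'I_7) : gamma_sign K k = (gsign k)%:~R.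
Proof. by rewrite /gamma_sign /gsign; case: ifP; rewrite ?rmorphN. Qed.

Lemma spin_der_entry (k i j : 'I_8) : spin_der (ev iq8) (ev k) i j = (der_entry k i j)%:~R.
Proof.
have -> : der_entry k i j = \sum_(a < 7) \sum_(b < 7 | (a < b)%N) der_term k i j a b.
  pose in_sum a := foldr (fun b t => if (a < b)%N then der_term k i j a b + t else t) 0 (iota 0 7).
  have inE (a : 'I_7) : \sum_(b < 7 | (a < b)%N) der_term k i j a b = in_sum a.
    by rewrite -(big_mkord (fun b => (a < b)%N) (fun b : nat => der_term k i j a b)) unlock.
  by rewrite (eq_bigr _ (fun a _ => inE a)) -(big_mkord xpredT in_sum) unlock.
rewrite /spin_der summxE rmorph_sum; apply: eq_bigr => a _ /=.
rewrite summxE rmorph_sum; apply: eq_bigr => b ab /=.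
rewrite mxZE spin_coefE row_mul_col gamma2E !smxE !gamma_signE /der_term !rmorphM /=; congr (_ * _ * _ * _).
Qed.

Lemma der_check : all (fun k => all (fun i => all (fun j =>
  (der_entry k i j == 0) || (lvS i - lvS j == lvS k - 7)) (iota 0 8)) (iota 0 8)) (iota 0 8).
Proof. by vm_compute. Qed.

(** These two values dictate the factor 3 in front of [spin_form]. *)
Lemma der_values : (der_entry 0 0 0 == -3 * sent form_code 7 0) && (der_entry 0 7 7 == 3 * sent form_code 7 0).
Proof. by vm_compute. Qed.

Lemma form_check : all (fun i => all (fun j => (sent form_code i j == 0) || (lvS i + lvS j == 0)) (iota 0 8)) (iota 0 8).
Proof. by vm_compute. Qed.

(** H is a combination of the diagonal products of the gamma matrices k and k + 3, with coefficients
    4, 2, 1, the halves of the values of the e_k; the search settles their signs. *)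
Lemma weight_check : has (fun s => all (fun i => lvS i ==
   s.1.1 * sent (gcode2 0 3) i i + s.1.2 * sent (gcode2 1 4) i i + s.2 * sent (gcode2 2 5) i i) (iota 0 8)
  && all (fun i => all (fun j => (i == j) || [&& sent (gcode2 0 3) i j == 0, sent (gcode2 1 4) i j == 0 & sent (gcode2 2 5) i j == 0]) (iota 0 8)) (iota 0 8))
  [seq (a, c) | a <- [seq (x, y) | x <- [:: 4; -4] : seq int, y <- [:: 2; -2] : seq int], c <- [:: 1; -1] : seq int].
Proof. by vm_compute. Qed.

(** All weights are expressed through [mu 0], [mu 1], [mu 2], those at i and 7 - i being opposite.
    The antidiagonal vanishes because twice a weight of the spin module is not a root. *)
Definition spin_relations (V : zmodType) (d : nat -> nat -> V) : Prop :=
  [/\ d 4 4 = d 0%N 0%N - d 1%N 1%N - d 2 2, d 3 3 = - d 4 4, d 5 5 = - d 2 2, d 6 6 = - d 1%N 1%N &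
      d 7 7 = - d 0%N 0%N /\ forall i, (i < 8)%N -> d i (7 - i)%N = 0].

Lemma diag_check : all (fun p => let d := sent (gcode2 p.1 p.2) in
  [&& d 4 4 == d 0%N 0%N - d 1%N 1%N - d 2 2, d 3 3 == - d 4 4, d 5 5 == - d 2 2, d 6 6 == - d 1%N 1%N,
      d 7 7 == - d 0%N 0%N & all (fun i => d i (7 - i)%N == 0) (iota 0 8)]) pairs7.
Proof. by vm_compute. Qed.

Lemma spin7_relations A : A \in spin7 K -> spin_relations (fun i j => A (inord i) (inord j)).
Proof.
move: A; apply: spin7_ind.
- move=> A B [A1 A2 A3 A4 [A5 A6]] [B1 B2 B3 B4 [B5 B6]]; split; [..|split=> [|i hi]]; rewrite !mxDE.
  + by rewrite A1 B1; ring.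
  + by rewrite A2 B2; ring.
  + by rewrite A3 B3; ring.
  + by rewrite A4 B4; ring.
  + by rewrite A5 B5; ring.
  by rewrite A6 // B6 // addr0.
- by split; [..|split=> [|i hi]]; rewrite !mxE ?subr0 ?oppr0.
- move=> c A [A1 A2 A3 A4 [A5 A6]]; split; [..|split=> [|i hi]]; rewrite !mxZE.
  + by rewrite A1; ring.
  + by rewrite A2; ring.
  + by rewrite A3; ring.
  + by rewrite A4; ring.
  + by rewrite A5; ring.
  by rewrite A6 // mulr0.
move=> a b ab b7; have := allP diag_check _ (pairs7_mem ab b7).
case/and5P => /eqP h1 /eqP h2 /eqP h3 /eqP h4 /andP[/eqP h5 h6].
split; [..|split=> [|i hi]]; rewrite !smxE !inordK //.
- by rewrite h1 !rmorphB.
- by rewrite h2 rmorphN.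
- by rewrite h3 rmorphN.
- by rewrite h4 rmorphN.
- by rewrite h5 rmorphN.
- by have /eqP-> := all_iota h6 hi.
by rewrite ltnS leq_subr.
Qed.

End SpinData.

(** * Triangular decomposition of F(4) *)

Section F4Triangular.
Variable K : fieldType.
Hypothesis charK : forall k, k.+1%:R != 0 :> K.
Notation ev k := (delta_mx k 0 : 'cV[K]_8).
Notation V := ('M[K]_8 * 'M[K]_2 * 'M[K]_(8, 2))%type.

Lemma lvS_check : all (fun i => (- 7 <= lvS i <= 7) && all (fun j => (lvS i == lvS j) ==> (i == j)) (iota 0 8)) (iota 0 8).
Proof. by vm_compute. Qed.

Lemma spin_weights : diag_mx (\row_(i < 8) (lvS i)%:~R) \in spin7 K.
Proof.
have /hasP[[[a b] c] _ /andP[h1 h2]] := weight_check.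
rewrite (_ : diag_mx _ = a%:~R *: smx K (gcode2 0 3) + b%:~R *: smx K (gcode2 1 4) + c%:~R *: smx K (gcode2 2 5)).
  by clear h1 h2; rewrite !rpredD // memvZ // gcode2_spin7.
apply/matrixP => i j; rewrite 2!mxDE !mxZE !smxE !mxE -!rmorphM -!rmorphD.
have [<-|ij] := eqVneq i j.
  by rewrite mulr1n; congr (_%:~R); exact/eqP/(all_iota h1 (ltn_ord i)).
have := all_iota (all_iota h2 (ltn_ord i)) (ltn_ord j); rewrite -(inj_eq val_inj) /= in ij.
by rewrite (negPf ij) mulr0n /= => /and3P[/eqP-> /eqP-> /eqP->]; rewrite !mulr0.
Qed.

Lemma bit0 k : bit k 0 = false. Proof. by rewrite /bit div0n. Qed.
Lemma bit7 (k : 'I_3) : bit k 7. Proof. by elim/ord3P: k. Qed.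

Lemma F4_exc : @exc_data K 8 (spin7 K) (@spin_der K) (3 *: spin_form K) (@spin_torus K)
  (fun i => lvS i) 7 0 iq8.
Proof.
have lvP (i : 'I_8) := all_iota lvS_check (ltn_ord i).
have [v1 v2] := andP der_values.
have qp : (3 *: spin_form K) iq8 0 = (3 * sent form_code 7 0)%:~R.
  by rewrite mxZE spin_formE smxE rmorphM.
split.
- exact: spin_der_linl.
- exact: spin_der_linr.
- exact: spin7_comm.
- move=> i j lij; have /andP[_ h] := lvP i; have /implyP := all_iota h (ltn_ord j).
  by rewrite lij eqxx => /(_ isT)/eqP/val_inj.
- by [].
- by [].
- by [].
- by move=> i; have /andP[] := lvP i.
- exact: spin_weights.
- by move=> k; apply: spin_der_spin7.
- by move=> k; rewrite spin_der_skew.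
- move=> k i j; rewrite spin_der_entry => h.
  have /orP[/eqP h0|/eqP-> //] := all_iota (all_iota (all_iota der_check (ltn_ord k)) (ltn_ord i)) (ltn_ord j).
  by rewrite h0 eqxx in h.
- move=> i j; rewrite mxZE spin_formE smxE => /mulr_neq0[_ h].
  have /orP[/eqP h0|/eqP-> //] := all_iota (all_iota form_check (ltn_ord i)) (ltn_ord j).
  by rewrite h0 eqxx in h.
- by rewrite qp mxZE spin_formE smxE -rmorphM.
- by rewrite spin_der_entry qp -rmorphN (eqP v1); congr (_%:~R).
- by rewrite spin_der_entry qp (eqP v2).
- move=> h /spin7_relations[_ _ _ _ [h7 _]] _; move: h7.
  have -> : inord 7 = iq8 :> 'I_8 by apply: val_inj; rewrite /= inordK.
  by have -> : inord 0 = 0 :> 'I_8 by apply: val_inj; rewrite /= inordK.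
- clear v1 v2 qp lvP; move=> d d0 [t [r [rt dE]]]; have := d0 0; rewrite !dE big_pred0 => [|k]; last by rewrite bit0.
  rewrite divr1 => r0; rewrite (eq_bigl xpredT) => [|k]; last by rewrite bit7.
  by rewrite -rt expr2 invfM mulrA mulfV // mul1r.
(* The torus element with t = (z^2, 1, 1) and r = z gives omega_3 the value [z]. *)
clear v1 v2 qp lvP; move=> z z0; pose t (k : 'I_3) : K := if k == 0 then z ^+ 2 else 1.
have t0 k : t k != 0 by rewrite /t; case: ifP; rewrite ?expf_neq0 ?oner_eq0.
exists (\row_(i < 8) (z / \prod_(k < 3 | bit k i) t k)) => [i|].
  by rewrite mxE mulf_neq0 // invr_neq0 //; apply/prodf_neq0.
split; last by rewrite mxE big_pred0 ?divr1 // => k; rewrite bit0.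
exists t, z; split=> [|i]; last by rewrite mxE.
by rewrite !big_ord_recl big_ord0 /t /= !mulr1.
Qed.

Notation g0_ lam := (@exc_root K 8 (spin7 K) (@spin_der K) (3 *: spin_form K) false lam%R).
Notation mu i := (@exc_mu K 8 i).
Notation e k := (mu 0 - mu (inord (2 ^ k))).
Notation gr := (@grspace K (exc (spin7 K) (@spin_der K) (3 *: spin_form K)) _ (@exc_coord K 8)
  (exc_lev (fun i : 'I_8 => lvS i) 7)).

(** Modulo [spin_relations], every position of negative level off the antidiagonal i + j = 7 carries
    one of the listed roots of so_7; antidiagonal entries vanish. *)
Lemma F4_u0 (U : {vspace V}) : U = (\sum_(k < 3) g0_ (- e k) +
   \sum_(i < 3) \sum_(j < 3 | (i < j)%N) (g0_ (- e i + e j) + g0_ (- e i - e j)))%VS ->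
  (U + g0_ (- (@exc_eps K 8 *+ 2)))%VS = gr false (fun n => n < 0).
Proof.
move=> UE; pose d (h : V) (k : nat) := h.1.1 (inord k) (inord k).
have io0 : inord 0 = 0 :> 'I_8 by apply: val_inj; rewrite /= inordK.
have t0E (h : V) : h \in @exc_t0 K 8 (spin7 K) -> [/\ d h 3 = - d h 4, d h 5 = - d h 2, d h 6 = - d h 1%N,
    d h 7 = - d h 0%N & d h 4 = d h 0%N - d h 1%N - d h 2].
  by move=> /exc_t0E[/spin7_relations[h1 h2 h3 h4 [h5 _]] _ _ _ _]; split.
pose good i j := exists lm : V -> K, {in @exc_t0 K 8 (spin7 K), forall h : V, lm h = d h i - d h j} /\
  (g0_ lm <= U)%VS.
have subU (i j : nat) (lm : V -> K) : (i < 8)%N -> (j < 8)%N -> lvS i < lvS j ->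
    {in @exc_t0 K 8 (spin7 K), forall h : V, lm h = d h i - d h j} ->
    (g0_ lm <= gr false (fun n => (n < 0)%R))%VS.
  move=> hi hj lt lmE; apply: (exc_root_gr charK F4_exc (x := inl (inl (inord i, inord j))) _ lmE).
  by rewrite /= !inordK // subr_lt0.
apply: (exc_u0E charK F4_exc).
  rewrite UE subv_add; apply/andP; split.
    apply/subv_sumP => k _; apply: (subU (2 ^ k)%N 0%N) => // [||h _].
    - by elim/ord3P: k.
    - by elim/ord3P: k.
    by rewrite -[LHS]/(- (h.1.1 0 0 - _)) /d io0 opprB.
  apply/subv_sumP => i _; apply/subv_sumP => j ij; rewrite subv_add; apply/andP; split.
    apply: (subU (2 ^ i)%N (2 ^ j)%N) => [|||h _].
    - by elim/ord3P: i {ij}.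
    - by elim/ord3P: j {ij}.
    - by move: ij; elim/ord3P: i; elim/ord3P: j.
    by rewrite -[LHS]/(- (h.1.1 0 0 - d h _) + (h.1.1 0 0 - d h _)); ring.
  apply: (subU (2 ^ i + 2 ^ j)%N 0%N) => [|||h /t0E[h3 h5 h6 h7 h4]] //.
  - by move: ij; elim/ord3P: i; elim/ord3P: j.
  - by move: ij; elim/ord3P: i; elim/ord3P: j.
  rewrite -[LHS]/(- (h.1.1 0 0 - d h _) - (h.1.1 0 0 - d h _)) -io0 -/(d h 0%N).
  by move: ij; elim/ord3P: i; elim/ord3P: j => // _; rewrite /= ?h3 ?h5 ?h6 h4; ring.
have /andP[U1 U2] : (\sum_(k < 3) g0_ (- e k) <= U)%VS && (\sum_(i < 3) \sum_(j < 3 | (i < j)%N)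
    (g0_ (- e i + e j) + g0_ (- e i - e j)) <= U)%VS by rewrite -subv_add -UE.
have R (lm : V -> K) (f : V -> K) i j : (g0_ lm <= U)%VS -> lm =1 f ->
    (forall h : V, d h 3 = - d h 4 -> d h 5 = - d h 2 -> d h 6 = - d h 1%N -> d h 7 = - d h 0%N ->
      d h 4 = d h 0%N - d h 1%N - d h 2 -> f h = d h i - d h j) -> good i j.
  by move=> lmU lmE lmR; exists lm; split=> // h /t0E[h3 h5 h6 h7 h4]; rewrite lmE lmR.
have d0 (h : V) : h.1.1 0 0 = d h 0%N by rewrite /d io0.
have V1 (k : 'I_3) : (g0_ (- e k) <= U)%VS.
  by apply: subv_trans U1; rewrite (sumv_sup k).
have V23 (i j : 'I_3) : (i < j)%N -> (g0_ (- e i + e j) + g0_ (- e i - e j) <= U)%VS.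
  by move=> ij; apply: subv_trans U2; rewrite (sumv_sup i) // (sumv_sup j).
have R1 (k : 'I_3) i j := R _ (fun h => - (h.1.1 0 0 - d h (2 ^ k)%N)) i j (V1 k) (fun h => erefl).
have R2 (k l : 'I_3) (kl : (k < l)%N) i j := R _
  (fun h => - (h.1.1 0 0 - d h (2 ^ k)%N) + (h.1.1 0 0 - d h (2 ^ l)%N)) i j
  (subv_trans (addvSl _ _) (V23 k l kl)) (fun h => erefl).
have R3 (k l : 'I_3) (kl : (k < l)%N) i j := R _
  (fun h => - (h.1.1 0 0 - d h (2 ^ k)%N) - (h.1.1 0 0 - d h (2 ^ l)%N)) i j
  (subv_trans (addvSr _ _) (V23 k l kl)) (fun h => erefl).
have lt3 (k l : 'I_3) : (k < l)%N -> (k < l)%N by [].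
have k01 := lt3 0 1 isT; have k02 := lt3 0 2 isT; have k12 := lt3 1 2 isT.
have R10 := R1 0; have R11 := R1 1; have R12 := R1 2.
have R201 := R2 _ _ k01; have R202 := R2 _ _ k02; have R212 := R2 _ _ k12.
have R301 := R3 _ _ k01; have R302 := R3 _ _ k02; have R312 := R3 _ _ k12.
rewrite /= in R10 R11 R12 R201 R202 R212 R301 R302 R312.
clear R R1 R2 R3 V1 V23 U1 U2 subU.
have cases i j : (i < 8)%N -> (j < 8)%N -> lvS i < lvS j -> (i + j = 7)%N \/ good i j.
  do 8?[case: i => [|i] //]; do 8?[case: j => [|j] //]; move=> _ _ //=; try (by left); move=> _; right;
    let solve_by R := (apply (R _ _); move=> h h3 h5 h6 h7 h4; rewrite ?d0 ?h3 ?h5 ?h6 ?h7 ?h4; solve [ring]) in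
    first [solve_by R10 | solve_by R11 | solve_by R12 | solve_by R201 | solve_by R202 | solve_by R212 |
      solve_by R301 | solve_by R302 | solve_by R312].
move=> i j A /spin7_relations[_ _ _ _ [_ A7]] Aij ij.
have [ij7|] := cases _ _ (ltn_ord i) (ltn_ord j) ij; last by rewrite /good /d !inord_val.
have e7 : (7 - i)%N = j by lia.
by have := A7 i (ltn_ord i); rewrite e7 !inord_val => A0; rewrite A0 eqxx in Aij.
Qed.

Lemma F4_triangular : triangular (F4_datum K).
Proof.
apply: (exc_triangular charK F4_exc).
- exact: F4_u0.
- exact: (exc_f1E charK F4_exc).
exact: (exc_u1E charK F4_exc).
Qed.

End F4Triangular.

(** * D(2,1,alpha) *)

Section D21Data.
Variables (K : fieldType) (alpha : K).
Hypothesis charK : forall k, k.+1%:R != 0 :> K.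
Notation I := {ffun 'I_3 -> 'I_2}.
Notation T := {ffun I -> K^o}.
Notation V := ({ffun 'I_3 -> 'M[K]_2} * T)%type.
Notation L := (D21 alpha).
Notation J := ('I_3 * 'I_2 * 'I_2 + I)%type.
Notation t0 := (ct0 (D21_datum alpha)).

(** The three weights take the values 1, 2, 1 at H, so that epsilon_0 - epsilon_1 + epsilon_2 has
    level 0 and the listed odd roots of u_1 are negative. *)
Definition lvD (k : 'I_3) (a : 'I_2) : int :=
  if a == 0 then nth 0 [:: 1; 2; 1] k else - nth 0 [:: 1; 2; 1] k.
Definition lvT (s : I) : int := \sum_k lvD k (s k).

Definition d21_coord (x : J) (X : V) : K :=
  match x with inl (k, a, b) => X.1 k a b | inr s => X.2 s end.
Definition d21_par (x : J) : bool := if x is inr _ then true else false.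
Definition d21_lev (x : J) : int :=
  match x with inl (k, a, b) => lvD k a - lvD k b | inr s => lvT s end.
Definition d21_weight (x : J) (h : V) : K :=
  match x with
  | inl (k, a, b) => h.1 k a a - h.1 k b b
  | inr s => \sum_k h.1 k (s k) (s k)
  end.

Notation gr := (@grspace K L _ d21_coord d21_lev).

Lemma ord2P (P : 'I_2 -> Prop) : P 0 -> P 1 -> forall a, P a.
Proof.
move=> P0 P1 [[|[|a]] ha] //.
- by rewrite (_ : Ordinal ha = 0) //; apply: val_inj.
by rewrite (_ : Ordinal ha = 1) //; apply: val_inj.
Qed.

Lemma big_ord2 (U : nmodType) (F : 'I_2 -> U) : \sum_i F i = F 0 + F 1.
Proof. rewrite !big_ord_recl big_ord0 addr0; by congr (F _ + F _); apply: val_inj. Qed.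

Lemma ffDE (J : finType) (U : zmodType) (f g : {ffun J -> U}) k : (f + g) k = f k + g k.
Proof. by rewrite ffunE. Qed.
Lemma ffZE (J : finType) (U : lmodType K) a (f : {ffun J -> U}) k : (a *: f) k = a *: f k.
Proof. by rewrite ffunE. Qed.

Lemma d21_coord_linear x : linear (d21_coord x : V -> K^o).
Proof. by case: x => [[[k a] b]|s] c X Y; rewrite /= ffDE ffZE ?mxDE ?mxZE. Qed.

Lemma d21_weight_linear x : linear (d21_weight x : V -> K^o).
Proof.
case: x => [[[k a] b]|s] c X Y /=; first by rewrite ffDE ffZE !mxDE !mxZE /GRing.scale /=; ring.
rewrite /GRing.scale /= mulr_sumr -big_split; apply: eq_bigr => k _ /=.
by rewrite ffDE ffZE !mxDE !mxZE.
Qed.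

Lemma d21_coord_sep (X : V) : (forall x, d21_coord x X = 0) -> X = 0.
Proof.
case: X => [A x] H; congr (_, _); apply/ffunP => k; rewrite [RHS]ffunE.
  by apply/matrixP => a b; rewrite mxE; apply: (H (inl (k, a, b))).
exact: (H (inr k)).
Qed.

Lemma d21_evenE (X : V) : reflect (X.2 = 0 /\ forall k, \tr (X.1 k) = 0) (X \in spart L false).
Proof.
have l2 : linear (fun X : V => [ffun k => \tr (X.1 k) : K^o]).
  by move=> c Y Z; apply/ffunP => k; rewrite ffDE ffZE !ffunE /= linearP.
rewrite /= memv_cap !memv_kernel //; apply: (iffP andP) => [[/eqP-> /eqP/ffunP h]|[-> h]].
  by split=> // k; have := h k; rewrite !ffunE.
by split=> //; apply/eqP/ffunP => k; rewrite !ffunE.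
Qed.

Lemma d21_oddE (X : V) : (X \in spart L true) = (X.1 == 0).
Proof. by rewrite /= memv_kernel. Qed.

Lemma d21_t0E (h : V) : reflect
  [/\ h.2 = 0, forall k, \tr (h.1 k) = 0 & forall k a b, h.1 k a b != 0 -> a = b] (h \in t0).
Proof.
have l2 : linear (fun X : V => [ffun k => X.1 k - diag_mx (\row_i X.1 k i i)]).
  move=> c Y Z; apply/ffunP => k; rewrite ffDE ffZE !ffunE; apply/matrixP => a b.
  by rewrite !mxE mulrnDl -mulrnAr; ring.
rewrite memv_cap memv_kernel //; apply: (iffP andP) => [[/d21_evenE[h1 h2] /eqP/ffunP h3]|[h1 h2 h3]].
  split=> // k a b; apply: contra_neq_eq => ab.
  have := congr1 (fun M : 'M_2 => M a b) (h3 k); rewrite !ffunE !mxE (negPf ab) mulr0n subr0; exact.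
split; first exact/d21_evenE.
apply/eqP/ffunP => k; rewrite !ffunE; apply/matrixP => a b; rewrite !mxE.
case: (eqVneq a b) => [->|ab]; first by rewrite mulr1n subrr.
by rewrite mulr0n subr0; apply/eqP; rewrite -[_ == 0]negbK; apply: contra ab => /h3->.
Qed.

Lemma t0_even h : h \in t0 -> h \in spart L false.
Proof. by move/d21_t0E => [h1 h2 _]; apply/d21_evenE. Qed.

Lemma d21_coord_par b (X : V) x : X \in spart L b -> d21_coord x X != 0 -> d21_par x = b.
Proof.
case: b => [|/d21_evenE[X2 _]]; rewrite ?d21_oddE.
  by move=> /eqP X1; case: x => // -[[k a] b] /=; rewrite X1 ffunE mxE eqxx.
by case: x => // s /=; rewrite X2 ffunE eqxx.
Qed.

Lemma tensor_act0 A : tensor_act A (0 : T) = 0.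
Proof. by apply/ffunP => s; rewrite !ffunE big1 // => k _; rewrite big1 // => c _; rewrite ffunE mulr0. Qed.

Lemma tensor_act0l x : tensor_act 0 (x : T) = 0.
Proof. by apply/ffunP => s; rewrite !ffunE big1 // => k _; rewrite big1 // => c _; rewrite ffunE mxE mul0r. Qed.

Lemma contract0l k (y : T) : contract k 0 y = 0.
Proof.
apply/matrixP => a b; rewrite !mxE big1 // => s _; rewrite big1 // => r _.
by rewrite ffunE mulr0 mul0r.
Qed.

Lemma contract0r k (x : T) : contract k x 0 = 0.
Proof.
apply/matrixP => a b; rewrite !mxE big1 // => s _; rewrite big1 // => r _.
by rewrite ffunE mulr0.
Qed.

Lemma d21_even_even X Y : X.2 = 0 -> Y.2 = 0 ->
  D21_bracket alpha X Y = ([ffun k => X.1 k *m Y.1 k - Y.1 k *m X.1 k], 0).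
Proof.
case: X Y => [A x] [B y] /= -> ->; rewrite /D21_bracket /= !tensor_act0 subr0; congr (_, _).
by apply/ffunP => k; rewrite !ffunE contract0l trmx0 addr0 mul0mx scaler0 addr0.
Qed.

Lemma d21_even_odd X Y : X.2 = 0 -> Y.1 = 0 -> D21_bracket alpha X Y = (0, tensor_act X.1 Y.2).
Proof.
case: X Y => [A x] [B y] /= -> ->; rewrite /D21_bracket /= tensor_act0 subr0; congr (_, _).
by apply/ffunP => k; rewrite !ffunE !(contract0l, trmx0, addr0, mul0mx, mulmx0, scaler0, subrr).
Qed.

Lemma d21_odd_even X Y : X.1 = 0 -> Y.2 = 0 ->
  D21_bracket alpha X Y = - D21_bracket alpha Y X.
Proof.
move=> X1 Y2; rewrite (d21_even_odd Y2 X1); case: X Y X1 Y2 => [A x] [B y] /= -> ->.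
rewrite /D21_bracket /= tensor_act0 sub0r; congr (_, _); rewrite /= ?oppr0.
by apply/ffunP => k; rewrite !ffunE !(contract0r, trmx0, addr0, mul0mx, mulmx0, scaler0, subrr).
Qed.

Definition cbr k (x y : T) : 'M[K]_2 :=
  sigma alpha k *: ((contract k x y + (contract k x y)^T) *m symp2 K).

Lemma d21_odd_odd X Y : X.1 = 0 -> Y.1 = 0 ->
  D21_bracket alpha X Y = ([ffun k => cbr k X.2 Y.2], 0).
Proof.
case: X Y => [A x] [B y] /= -> ->; rewrite /D21_bracket /= !tensor_act0l subr0; congr (_, _).
by apply/ffunP => k; rewrite !ffunE mulmx0 subrr add0r.
Qed.

Lemma tensor_act_linl x : linear (fun A => tensor_act A (x : T)).
Proof.
move=> c A B; apply/ffunP => s; rewrite ffDE ffZE !ffunE /GRing.scale /= mulr_sumr -big_split.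
apply: eq_bigr => k _ /=; rewrite mulr_sumr -big_split; apply: eq_bigr => d _ /=.
by rewrite ffDE ffZE mxDE mxZE; ring.
Qed.

Lemma tensor_act_linr A : linear (tensor_act A : T -> T).
Proof.
move=> c x y; apply/ffunP => s; rewrite ffDE ffZE !ffunE /GRing.scale /= mulr_sumr -big_split.
apply: eq_bigr => k _ /=; rewrite mulr_sumr -big_split; apply: eq_bigr => d _ /=.
by rewrite ffDE ffZE /GRing.scale /=; ring.
Qed.

Lemma contract_linl k (y : T) : linear (fun x : T => contract k x y).
Proof.
move=> c x x'; apply/matrixP => a b; rewrite mxDE mxZE !mxE mulr_sumr -big_split.
apply: eq_bigr => s _ /=; rewrite mulr_sumr -big_split; apply: eq_bigr => r _ /=.
by rewrite ffDE ffZE /GRing.scale /=; ring.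
Qed.

Lemma contract_linr k (x : T) : linear (contract k x).
Proof.
move=> c y y'; apply/matrixP => a b; rewrite mxDE mxZE !mxE mulr_sumr -big_split.
apply: eq_bigr => s _ /=; rewrite mulr_sumr -big_split; apply: eq_bigr => r _ /=.
by rewrite ffDE ffZE /GRing.scale /=; ring.
Qed.

Lemma d21_linl Z : linear (fun X => D21_bracket alpha X Z).
Proof.
case: Z => [C z] c [A x] [B y]; rewrite /D21_bracket /=; congr (_, _) => /=.
  apply/ffunP => k; rewrite ffDE ffZE !ffunE contract_linl.
  have trP (M N : 'M[K]_2) : (c *: M + N)^T = c *: M^T + N^T by rewrite linearP.
  rewrite trP !mulmxDl !mulmxDr -!scalemxAl -!scalemxAr.
  by move: (contract _ _ _) (contract _ _ _) => M N; apply/matrixP => i j; rewrite !mx_linE; ring.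
rewrite tensor_act_linl tensor_act_linr.
by apply/ffunP => s; rewrite !ffunE /GRing.scale /=; ring.
Qed.

Lemma d21_linr Z : linear (D21_bracket alpha Z).
Proof.
case: Z => [C z] c [A x] [B y]; rewrite /D21_bracket /=; congr (_, _) => /=.
  apply/ffunP => k; rewrite ffDE ffZE !ffunE contract_linr.
  have trP (M N : 'M[K]_2) : (c *: M + N)^T = c *: M^T + N^T by rewrite linearP.
  rewrite trP !mulmxDl !mulmxDr -!scalemxAl -!scalemxAr.
  by move: (contract _ _ _) (contract _ _ _) => M N; apply/matrixP => i j; rewrite !mx_linE; ring.
rewrite tensor_act_linl tensor_act_linr.
by apply/ffunP => s; rewrite !ffunE /GRing.scale /=; ring.
Qed.

End D21Data.

(** * Brackets and levels in D(2,1,alpha) *)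

Section D21Triangular.
Variables (K : fieldType) (alpha : K).
Hypothesis charK : forall k, k.+1%:R != 0 :> K.
Notation I := {ffun 'I_3 -> 'I_2}.
Notation T := {ffun I -> K^o}.
Notation V := ({ffun 'I_3 -> 'M[K]_2} * T)%type.
Notation L := (D21 alpha).
Notation t0 := (ct0 (D21_datum alpha)).
Notation gr := (@grspace K L _ (@d21_coord K) d21_lev).
Notation even_odd := (@d21_even_odd K alpha).
Notation even_even := (@d21_even_even K alpha).
Notation odd_odd := (@d21_odd_odd K alpha).

Lemma d21_grP b (Z : pred int) (X : V) : reflect
  [/\ X \in spart L b, forall k i j, X.1 k i j != 0 -> Z (lvD k i - lvD k j) &
      forall s, X.2 s != 0 -> Z (lvT s)] (X \in gr b Z).
Proof.
apply: (iffP (@grspaceP K L _ _ d21_lev (@d21_coord_linear K) b Z X)) => [[Xb XZ]|[Xb X1 X2]].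
  by split=> // [k i j|s]; [apply: (XZ (inl (k, i, j)))|apply: (XZ (inr s))].
by split=> // -[[[k i] j]|s]; [apply: X1|apply: X2].
Qed.

Lemma d21_closed_even X Y : X \in spart L false -> Y \in spart L false ->
  D21_bracket alpha X Y \in spart L false.
Proof.
move=> /d21_evenE[X2 Xt] /d21_evenE[Y2 Yt]; apply/d21_evenE; rewrite even_even //; split=> // k.
by rewrite ffunE raddfB /= mxtrace_mulC subrr.
Qed.

Lemma d21_closed_even_odd X Y : X \in spart L false -> Y \in spart L true ->
  D21_bracket alpha X Y \in spart L true.
Proof. by move=> /d21_evenE[X2 _]; rewrite !d21_oddE => /eqP Y1; rewrite even_odd. Qed.

Lemma reset_id (s : I) k : reset s k (s k) = s.
Proof. by apply/ffunP => l; rewrite ffunE; case: eqP => [->|]. Qed.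

Lemma d21_act b h X : h \in t0 -> X \in spart L b ->
  @sbr K L h X \in spart L b /\ forall x, d21_coord x (@sbr K L h X) = d21_weight x h * d21_coord x X.
Proof.
move=> ht; have [h2 hT hd] := d21_t0E _ _ ht; have h0 := t0_even ht.
case: b => Xb; split.
- exact: d21_closed_even_odd.
- have X1 : X.1 = 0 by apply/eqP; rewrite -(d21_oddE alpha).
  rewrite /= even_odd //; case=> [[[k i] j]|s] /=.
    by rewrite X1 !ffunE !mxE mulr0.
  rewrite ffunE mulr_suml; apply: eq_bigr => k _.
  rewrite (bigD1 (s k)) //= reset_id big1 ?addr0 // => c cs.
  by have [->|/hd sc] := eqVneq (h.1 k (s k) c) 0; [rewrite mul0r|rewrite sc eqxx in cs].
- exact: d21_closed_even.
have X2 : X.2 = 0 by have [] := d21_evenE _ _ Xb.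
rewrite /= even_even //; case=> [[[k i] j]|s] /=; last by rewrite X2 !ffunE mulr0.
rewrite ffunE mxDE mxNE (diag_mxM _ _ _ (hd k)) (mx_diagM _ _ _ (hd k)); ring.
Qed.

Lemma symp2_neq0 k (i j : 'I_2) : symp2 K i j != 0 -> lvD k i = - lvD k j.
Proof.
rewrite mxE; elim/ord2P: i; elim/ord2P: j; rewrite /lvD /= ?subrr ?eqxx ?opprK //.
Qed.

Lemma lvT_reset s k c : lvT s = lvD k (s k) - lvD k c + lvT (reset s k c).
Proof.
rewrite /lvT (bigD1 k) //= [in RHS](bigD1 k) //= ffunE eqxx addrA subrK; congr (_ + _).
by apply: eq_bigr => l lk; rewrite ffunE (negPf lk).
Qed.

Lemma sum_cond_neq0 (J : finType) (Q : pred J) (F : J -> K) : \sum_(i | Q i) F i != 0 ->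
  exists2 i, Q i & F i != 0.
Proof.
by rewrite big_mkcond => /sum_neq0[j]; case: ifP => [Qj Fj|]; [exists j|rewrite eqxx].
Qed.

Lemma contract_lev k (x y : T) i j : contract k x y i j != 0 -> exists (s r : I),
  [/\ s k = i, r k = j, x s != 0, y r != 0 & lvT s + lvT r = lvD k i + lvD k j].
Proof.
rewrite mxE => /sum_cond_neq0[s /eqP si] /sum_cond_neq0[r /eqP rj].
move=> /mulr_neq0[/mulr_neq0[/prodf_neq0 h xs] yr]; exists s, r; split=> //.
rewrite /lvT -big_split (bigD1 k) //= si rj big1 ?addr0 // => l lk.
by rewrite (symp2_neq0 l (h l lk)) addNr.
Qed.

Lemma cbr_lev k (x y : T) i j : cbr alpha k x y i j != 0 -> exists (s r : I),
  [/\ x s != 0, y r != 0 & lvT s + lvT r = lvD k i - lvD k j].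
Proof.
rewrite mxZE => /mulr_neq0[_ /mulmx_neq0[l [h /(symp2_neq0 k) lj]]].
rewrite mxDE [X in _ + X]mxE in h; have -> : lvD k i - lvD k j = lvD k i + lvD k l by rewrite lj; ring.
case/addr_neq0: h => /contract_lev[s [r [_ _ xs yr e]]]; exists s, r; rewrite ?e //.
by rewrite addrC.
Qed.

Lemma d21_br_even (Z Z1 Z2 : pred int) X Y : (forall x y, Z1 x -> Z2 y -> Z (x + y)) ->
  X \in gr false Z1 -> Y \in gr false Z2 -> D21_bracket alpha X Y \in gr false Z.
Proof.
move=> ZZ /d21_grP[X0 X1 X2] /d21_grP[Y0 Y1 Y2]; apply/d21_grP.
have [[X20 _] [Y20 _]] := (d21_evenE _ _ X0, d21_evenE _ _ Y0).
split; [exact: d21_closed_even|move=> k i j|move=> s]; rewrite even_even //=.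
  by rewrite ffunE; apply: (comm_lev ZZ (X1 k) (Y1 k)).
by rewrite ffunE eqxx.
Qed.

Lemma d21_br_even_odd (Z Z1 Z2 : pred int) X Y : (forall x y, Z1 x -> Z2 y -> Z (x + y)) ->
  X \in gr false Z1 -> Y \in gr true Z2 -> D21_bracket alpha X Y \in gr true Z.
Proof.
move=> ZZ /d21_grP[X0 X1 X2] /d21_grP[Y0 Y1 Y2]; apply/d21_grP.
have [X20 _] := d21_evenE _ _ X0; have /eqP Y10 : Y.1 == 0 by rewrite -(d21_oddE alpha).
split; [exact: d21_closed_even_odd|move=> k i j|move=> s]; rewrite even_odd //=.
  by rewrite ffunE mxE eqxx.
rewrite ffunE => /sum_neq0[k /sum_neq0[c /mulr_neq0[hA hy]]].
by rewrite (lvT_reset s k c); apply: ZZ; [apply: X1|apply: Y2].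
Qed.

Lemma d21_br_odd (Z Z1 Z2 : pred int) X Y : (forall x y, Z1 x -> Z2 y -> Z (x + y)) ->
  X \in gr true Z1 -> Y \in gr true Z2 -> D21_bracket alpha X Y \in gr false Z.
Proof.
move=> ZZ /d21_grP[X0 X1 X2] /d21_grP[Y0 Y1 Y2]; apply/d21_grP.
have /eqP X10 : X.1 == 0 by rewrite -(d21_oddE alpha).
have /eqP Y10 : Y.1 == 0 by rewrite -(d21_oddE alpha).
split; [|move=> k i j|move=> s]; rewrite odd_odd //.
- apply/d21_evenE; split=> // k; rewrite /= ffunE /cbr linearZ /= /mxtrace big_ord2.
  move: (contract _ _ _) => C.
  by rewrite ![(_ *m _) _ _]mxE !big_ord2 !mx_linE ![_^T _ _]mxE ![symp2 _ _ _]mxE /=; ring.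
- by rewrite /= ffunE => /cbr_lev[s [r [xs yr <-]]]; apply: ZZ; [apply: X2|apply: Y2].
by rewrite /= ffunE eqxx.
Qed.

Lemma d21_H : exists2 H : V, H \in t0 & forall x, d21_weight x H = (d21_lev x)%:~R.
Proof.
exists ([ffun k => diag_mx (\row_i (lvD k i)%:~R)], 0).
  apply/d21_t0E; split=> [//|k|k i j]; rewrite /= ffunE; last exact: diag_mx_diagonal.
  by rewrite mxtrace_diag big_ord2 !mxE -rmorphD /lvD /= addrN.
case=> [[[k i] j]|s] /=; first by rewrite ffunE !mxE !eqxx !mulr1n rmorphB.
by rewrite /lvT rmorph_sum; apply: eq_bigr => k _; rewrite ffunE !mxE eqxx mulr1n.
Qed.

Lemma lvD_inj k : injective (lvD k).
Proof. by move=> i j; elim/ord3P: k; elim/ord2P: i; elim/ord2P: j. Qed.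

Lemma d21_gr_t0 : t0 = gr false (fun n => n == 0).
Proof.
apply/eqP; rewrite eqEsubv; apply/andP; split; apply/subvP => X.
  move=> /[dup] /t0_even X0 /d21_t0E[X2 _ Xd]; apply/d21_grP; split=> // [k i j /Xd->|s].
    by rewrite subrr.
  by rewrite X2 ffunE eqxx.
move=> /d21_grP[/d21_evenE[X2 Xt] X1 _]; apply/d21_t0E; split=> // k i j /X1.
by rewrite subr_eq0 => /eqP/lvD_inj.
Qed.

Definition triple (a b c : 'I_2) : I := [ffun k : 'I_3 => nth 0 [:: a; b; c] k].

Lemma tripleE (s : I) : s = triple (s 0) (s 1) (s 2).
Proof. by apply/ffunP; apply: ord3P; rewrite ffunE. Qed.

Notation s0 := (triple 0 1 0).
Notation s1 := (triple 1 0 1).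

Lemma lvT0 s : lvT s = 0 -> s = s0 \/ s = s1.
Proof.
rewrite (tripleE s) /lvT big_ord3 /triple !ffunE /=.
elim/ord2P: (s 0); elim/ord2P: (s 1); elim/ord2P: (s 2) => //=; by [left|right].
Qed.

Lemma d21_f1_supp (X : V) : X \in gr true (fun n => n == 0) -> forall s, X.2 s != 0 -> s = s0 \/ s = s1.
Proof. by move=> /d21_grP[_ _ h] s /h/eqP/lvT0. Qed.

Lemma s0E k : s0 k = if k == 1 then 1 else 0.
Proof. by elim/ord3P: k; rewrite ffunE. Qed.

Lemma s1E k : s1 k = if k == 1 then 0 else 1.
Proof. by elim/ord3P: k; rewrite ffunE. Qed.

(** The tensors [s0] and [s1] differ in every factor, so the symplectic form on the factors other
    than [k] pairs only [s0] with [s1]. The signs from these two factors depend on whether [k] is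
    the middle factor. *)
Lemma cbr_f1 (x y : T) k : (forall s, x s != 0 -> s = s0 \/ s = s1) ->
    (forall s, y s != 0 -> s = s0 \/ s = s1) ->
  cbr alpha k x y 0 0 = (if k == 1 then -1 else 1) * sigma alpha k * (x s0 * y s1 + x s1 * y s0).
Proof.
move=> hx hy.
have s01 k' : s0 k' != s1 k' by rewrite s0E s1E; case: ifP.
have sum_x (z : T) (g : I -> K) a (s : I) : s = s0 \/ s = s1 -> s k = a ->
    (forall s, z s != 0 -> s = s0 \/ s = s1) -> \sum_(r : I | r k == a) g r * z r = g s * z s.
  move=> ss sk hz; rewrite (bigD1 s) ?sk //= big1 ?addr0 // => r /andP[/eqP rk rs].
  have [->|/hz rr] := eqVneq (z r) 0; first by rewrite mulr0.
  have s01k := s01 k; case: ss rr rs sk rk => -> [] ->; rewrite ?eqxx // => _ e1 e2;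
    by rewrite e1 e2 eqxx in s01k.
have C a b (s r : I) : s = s0 \/ s = s1 -> r = s0 \/ r = s1 -> s k = a -> r k = b ->
    contract k x y a b = (\prod_(l < 3 | l != k) symp2 K (s l) (r l)) * x s * y r.
  move=> ss rr sa rb; rewrite mxE.
  rewrite (eq_bigr (fun s' : I => ((\prod_(l < 3 | l != k) symp2 K (s' l) (r l)) * y r) * x s')) => [|s' _].
    by rewrite (sum_x _ _ _ s) // mulrAC.
  by rewrite (sum_x _ _ _ r) // mulrAC.
rewrite /cbr mxZE [(_ *m _) 0 0]mxE big_ord2 !mxDE ![_^T _ _]mxE ![symp2 K _ 0]mxE /=.
have prodE (s r : I) : \prod_(l < 3 | l != k) symp2 K (s l) (r l) =
    (if 0 != k then symp2 K (s 0) (r 0) else 1) * (if 1 != k then symp2 K (s 1) (r 1) else 1) *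
    (if 2 != k then symp2 K (s 2) (r 2) else 1).
  rewrite big_mkcond !big_ord_recl big_ord0 /= mulr1 mulrA.
  have -> : lift ord0 ord0 = 1 :> 'I_3 by apply: val_inj.
  by have -> : lift ord0 (lift ord0 ord0) = 2 :> 'I_3 by apply: val_inj.
have [k1|k1] := eqVneq k 1.
  have C01 := C 0 1 s1 s0 (or_intror erefl) (or_introl erefl).
  have C10 := C 1 0 s0 s1 (or_introl erefl) (or_intror erefl).
  rewrite C01 ?C10 ?prodE; try by rewrite ?s0E ?s1E k1.
  by rewrite k1 /= !s0E !s1E /= !mxE /=; ring.
have k0 (a b : 'I_2) : (if k == 1 then a else b) = b by rewrite (negPf k1).
have C01 := C 0 1 s0 s1 (or_introl erefl) (or_intror erefl).
have C10 := C 1 0 s1 s0 (or_intror erefl) (or_introl erefl).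
rewrite C01 ?C10 ?prodE; try by rewrite ?s0E ?s1E k0.
rewrite !s0E !s1E /= !mxE /=.
by elim/ord3P: k k1 {k0 C prodE sum_x C01 C10} => //= _; ring.
Qed.

Lemma d21_weight_s1 h : h \in t0 -> d21_weight (inr s1) h = - d21_weight (inr s0) h.
Proof.
move=> /d21_t0E[_ hT _]; have hk k : h.1 k 1 1 = - h.1 k 0 0.
  by apply/eqP; rewrite -addr_eq0 addrC; have := hT k; rewrite /mxtrace big_ord2 => /eqP.
by rewrite /= !big_ord3 !s0E !s1E /= !hk; ring.
Qed.

Lemma d21_weight_s0 h : h \in t0 -> d21_weight (inr s0) h = h.1 0 0 0 - h.1 1 0 0 + h.1 2 0 0.
Proof.
move=> /d21_t0E[_ hT _]; have hk k : h.1 k 1 1 = - h.1 k 0 0.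
  by apply/eqP; rewrite -addr_eq0 addrC; have := hT k; rewrite /mxtrace big_ord2 => /eqP.
by rewrite /= !big_ord3 !s0E /= !hk.
Qed.

(** By [cbr_f1] the value of epsilon_0 - epsilon_1 + epsilon_2 on the bracket of [X] and [Y] is a
    common factor times the sum of the three [sigma], which is 0. *)
Lemma d21_fff X Y W : X \in gr true (fun n => n == 0) -> Y \in gr true (fun n => n == 0) ->
  W \in gr true (fun n => n == 0) -> D21_bracket alpha (D21_bracket alpha X Y) W = 0.
Proof.
move=> Xf Yf Wf; have W1 : W \in spart L true by case/d21_grP: Wf.
have /eqP X10 : X.1 == 0 by rewrite -(d21_oddE alpha); case/d21_grP: Xf.
have /eqP Y10 : Y.1 == 0 by rewrite -(d21_oddE alpha); case/d21_grP: Yf.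
have ht : D21_bracket alpha X Y \in t0.
  by rewrite d21_gr_t0; apply: d21_br_odd Xf Yf => x y /eqP-> /eqP->.
have [_ hE] := d21_act ht W1; apply: d21_coord_sep => x; rewrite hE.
have [->|Wx] := eqVneq (d21_coord x W) 0; first by rewrite mulr0.
suff h0 : d21_weight (inr s0) (D21_bracket alpha X Y) = 0.
  have px := d21_coord_par W1 Wx; case: x px Wx {hE} => // s _ /= /(d21_f1_supp Wf)[]->.
    by rewrite [X in X * _]h0 mul0r.
  by rewrite [X in X * _](d21_weight_s1 ht) h0 oppr0 mul0r.
rewrite d21_weight_s0 // odd_odd //= !ffunE !cbr_f1; try exact: d21_f1_supp.
by rewrite /sigma /=; ring.
Qed.

Lemma d21_root_gr b (lm : V -> K) x (Z : pred int) :
    {in t0, forall h, lm h = d21_weight x h} -> Z (d21_lev x) ->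
  (@root_space K L t0 b lm <= gr b Z)%VS.
Proof.
move=> lmE Zx; apply: (@root_space_gr K L t0 _ (@d21_coord K) d21_lev (@d21_weight K) _ _ _ _ _ _ _ b lm x) => //.
- exact: d21_coord_linear.
- exact: d21_linl.
- exact: d21_linr.
- exact: d21_act.
- exact: d21_H.
- exact: d21_weight_linear.
Qed.

Lemma d21_gr_root b (Z : pred int) U :
    (forall x, d21_par x = b -> Z (d21_lev x) ->
      exists lm : V -> K, {in t0, forall h, lm h = d21_weight x h} /\
        (@root_space K L t0 b lm <= U)%VS) ->
  (gr b Z <= U)%VS.
Proof.
move=> hU; apply: (@gr_root_space K L t0 _ (@d21_coord K) d21_par d21_lev (@d21_weight K)).
- exact: d21_coord_linear.
- exact: d21_coord_sep.
- by move=> b' X x; apply: d21_coord_par.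
- exact: d21_linr.
- exact: d21_act.
- by move=> x px Zx _; apply: hU.
Qed.

End D21Triangular.

(** * Triangular decomposition of D(2,1,alpha) *)

Section D21Final.
Variables (K : fieldType) (alpha : K).
Hypothesis charK : forall k, k.+1%:R != 0 :> K.
Notation I := {ffun 'I_3 -> 'I_2}.
Notation T := {ffun I -> K^o}.
Notation V := ({ffun 'I_3 -> 'M[K]_2} * T)%type.
Notation L := (D21 alpha).
Notation g := (D21_datum alpha).
Notation t0 := (ct0 g).
Notation gr := (@grspace K L _ (@d21_coord K) d21_lev).
Notation s0 := (triple 0 1 0).
Notation s1 := (triple 1 0 1).
Notation e k := ((fun h : V => h.1 k 0 0) : V -> K).

Lemma d21_weight_triple a b c h : h \in t0 -> d21_weight (inr (triple a b c)) h =
  (if a == 0 then 1 else -1) * h.1 0 0 0 + (if b == 0 then 1 else -1) * h.1 1 0 0 +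
  (if c == 0 then 1 else -1) * h.1 2 0 0.
Proof.
move=> /d21_t0E[_ hT _]; have hk k : h.1 k 1 1 = - h.1 k 0 0.
  by apply/eqP; rewrite -addr_eq0 addrC; have := hT k; rewrite /mxtrace big_ord2 => /eqP.
rewrite /= big_ord3 !ffunE /=.
by elim/ord2P: a; elim/ord2P: b; elim/ord2P: c; rewrite /= ?hk ?mul1r ?mulN1r.
Qed.

Lemma ord3_inord : [/\ inord 0 = 0 :> 'I_3, inord 1 = 1 :> 'I_3 & inord 2 = 2 :> 'I_3].
Proof. by split; apply: val_inj; rewrite /= inordK. Qed.

Lemma d21_f1 : cf1 g = gr true (fun n => n == 0).
Proof.
have [i0 i1 i2] := ord3_inord; rewrite /= i0 i1 i2.
have lm0 : {in t0, forall h, (e 0 - e 1 + e 2)%R h = d21_weight (inr s0) h}.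
  by move=> h ht; rewrite d21_weight_s0.
have lm1 : {in t0, forall h, (- (e 0 - e 1 + e 2))%R h = d21_weight (inr s1) h}.
  by move=> h ht; rewrite d21_weight_s1 // -lm0.
have l0 : lvT s0 = 0 by rewrite /lvT big_ord3 !ffunE.
have l1 : lvT s1 = 0 by rewrite /lvT big_ord3 !ffunE.
apply/eqP; rewrite eqEsubv subv_add; apply/andP; split.
  by apply/andP; split; [apply: (d21_root_gr charK _ lm0)|apply: (d21_root_gr charK _ lm1)];
    rewrite /= ?l0 ?l1.
apply: d21_gr_root => -[] // s _ /eqP/lvT0[]->.
  by exists (e 0 - e 1 + e 2)%R; split=> //; apply: addvSl.
by exists (- (e 0 - e 1 + e 2))%R; split=> //; apply: addvSr.
Qed.

Lemma d21_u1 : cu1 g = gr true (fun n => n < 0).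
Proof.
have [i0 i1 i2] := ord3_inord; rewrite /= i0 i1 i2.
have lm1 : {in t0, forall h, (- e 0 - e 1 - e 2)%R h = d21_weight (inr (triple 1 1 1)) h}.
  by move=> h ht; rewrite d21_weight_triple //= !mulN1r.
have lm2 : {in t0, forall h, (- e 0 - e 1 + e 2)%R h = d21_weight (inr (triple 1 1 0)) h}.
  by move=> h ht; rewrite d21_weight_triple //= !mulN1r mul1r.
have lm3 : {in t0, forall h, (e 0 - e 1 - e 2)%R h = d21_weight (inr (triple 0 1 1)) h}.
  by move=> h ht; rewrite d21_weight_triple //= !mulN1r mul1r.
apply/eqP; rewrite eqEsubv !subv_add; apply/andP; split.
  apply/andP; split; [apply/andP; split|].
  - by apply: (d21_root_gr charK _ lm1); rewrite /= /lvT big_ord3 !ffunE.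
  - by apply: (d21_root_gr charK _ lm2); rewrite /= /lvT big_ord3 !ffunE.
  by apply: (d21_root_gr charK _ lm3); rewrite /= /lvT big_ord3 !ffunE.
apply: d21_gr_root => -[] // s _.
rewrite (tripleE s) /= /lvT big_ord3 !ffunE /=.
elim/ord2P: (s 0); elim/ord2P: (s 1); elim/ord2P: (s 2) => // _.
- by exists (e 0 - e 1 - e 2)%R; split=> //; apply: addvSr.
- by exists (- e 0 - e 1 + e 2)%R; split=> //; apply: subv_trans (addvSr _ _) (addvSl _ _).
by exists (- e 0 - e 1 - e 2)%R; split=> //; apply: subv_trans (addvSl _ _) (addvSl _ _).
Qed.

Lemma d21_u0 : cu0 g = gr false (fun n => n < 0).
Proof.
have lm k : {in t0, forall h, (- (e k *+ 2))%R h = d21_weight (inl (k, 1, 0)) h}.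
  move=> h /d21_t0E[_ hT _]; have hk : h.1 k 1 1 = - h.1 k 0 0.
    by apply/eqP; rewrite -addr_eq0 addrC; have := hT k; rewrite /mxtrace big_ord2 => /eqP.
  by rewrite /= hk -opprD.
rewrite /=; under eq_bigr => k _ do rewrite inord_val.
apply/eqP; rewrite eqEsubv; apply/andP; split.
  by apply/subv_sumP => k _; apply: (d21_root_gr charK _ (lm k)); elim/ord3P: k.
apply: d21_gr_root => -[[[k i] j]|//] _ /= hl.
have [-> ->] : i = 1 /\ j = 0 by move: hl; elim/ord3P: k; elim/ord2P: i; elim/ord2P: j.
by exists (- (e k *+ 2))%R; split; [apply: lm|rewrite (sumv_sup k)].
Qed.

Lemma d21_torusE phi : D21_torus phi -> exists a : 'I_3 -> K, (forall k, a k != 0) /\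
  let d k (i : 'I_2) := if i == 0 then a k else (a k)^-1 in
  forall X, (forall k i j, (phi X).1 k i j = d k i / d k j * X.1 k i j) /\
    forall s, (phi X).2 s = (\prod_k d k (s k)) * X.2 s.
Proof.
move=> [a [a0 phiE]]; exists a; split=> // d X; rewrite phiE; split=> [k i j|s] /=.
  rewrite ffunE diag_conj ?mxE // => l; rewrite mxE; case: ifP => // _; exact: invr_neq0.
by rewrite ffunE; congr (_ * _); apply: eq_bigr => k _; rewrite mxE.
Qed.

Definition d21_char (x : 'I_3 * 'I_2 * 'I_2 + I) : {ffun 'I_1 -> int} :=
  if x is inr s then [ffun=> if s == s0 then 1 else -1] else 0.

Lemma d21_odd_lev0 x : d21_par x -> d21_lev x = 0 -> x = inr s0 \/ x = inr s1.
Proof. by case: x => // s _ /= /lvT0[]->; [left|right]. Qed.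

Lemma d21_coordinates : @coordinates K g _ (@d21_coord K) d21_par d21_lev (@d21_weight K).
Proof.
have s10 : (s1 == s0) = false.
  by apply/negbTE/eqP => /ffunP/(_ 0); rewrite !ffunE.
split.
- exact: d21_coord_linear.
- exact: d21_coord_sep.
- by move=> b X x; apply: d21_coord_par.
- exact: d21_linl.
- exact: d21_linr.
- by move=> X Y /d21_evenE[X2 _]; rewrite d21_oddE => /eqP Y1; apply: d21_odd_even.
- exact: d21_act.
- exact: d21_H.
- case=> [[[k i] j]|] //= h _ /eqP; rewrite subr_eq0 => /eqP/lvD_inj-> _; exact: subrr.
- exact: d21_weight_linear.
- exact: d21_gr_t0.
- exact: d21_u0.
- exact: d21_f1.
- exact: d21_u1.
- have ZZ x y : x <= 0 -> y <= 0 -> x + y <= 0 :> int by lia.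
  case=> -[] X Y Xg Yg.
  + exact: d21_br_odd ZZ Xg Yg.
  + have /eqP X1 : X.1 == 0 by rewrite -(d21_oddE alpha); case/d21_grP: Xg.
    have Y2 : Y.2 = 0 by case/d21_grP: Yg => /d21_evenE[].
    by rewrite /= d21_odd_even // memvN; apply: d21_br_even_odd ZZ Yg Xg.
  + exact: d21_br_even_odd ZZ Xg Yg.
  exact: d21_br_even ZZ Xg Yg.
- by move=> X Y; apply: d21_br_even_odd => x y; lia.
- by move=> X Y; rewrite d21_f1 d21_gr_t0; apply: d21_br_odd => x y /eqP-> /eqP->.
- by move=> X Y Z; rewrite d21_f1; apply: d21_fff.
- move=> phi /d21_torusE[a [_ phiE]] k X Y.
  apply: (coord_inj (@d21_coord_linear K) (@d21_coord_sep K)) => x.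
  rewrite (coordD (@d21_coord_linear K)) (coordZ (@d21_coord_linear K)).
  have [X1 X2] := phiE X; have [Y1 Y2] := phiE Y; have [Z1 Z2] := phiE (k *: X + Y).
  case: x => [[[l i] j]|s] /=; rewrite ?X1 ?X2 ?Y1 ?Y2 ?Z1 ?Z2 /= ffDE ffZE ?mxDE ?mxZE; first ring.
  by rewrite /GRing.scale /=; ring.
- move=> phi h /d21_torusE[a [a0 phiE]] /d21_t0E[h2 _ hd]; have [X1 X2] := phiE h.
  apply: (coord_inj (@d21_coord_linear K) (@d21_coord_sep K)) => -[[[k i] j]|s] /=.
    rewrite X1; have [->|/hd->] := eqVneq (h.1 k i j) 0; first by rewrite mulr0.
    by rewrite mulfV ?mul1r //; case: ifP; rewrite ?invr_neq0.
  by rewrite X2 h2 ffunE mulr0.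
- move=> phi X x /d21_torusE[a [_ phiE]]; have [X1 X2] := phiE X.
  by case: x => [[[k i] j]|s] /=; rewrite ?X1 ?X2 => ->; rewrite mulr0.
have prod3 (F : 'I_3 -> K) : \prod_k F k = F 0 * F 1 * F 2.
  by rewrite !big_ord_recl big_ord0 mulr1 -mulrA; congr (F _ * (F _ * F _)); apply: val_inj.
exists 1%N, d21_char; split.
- move=> h ht; exists (fun=> d21_weight (inr s0) h) => x px lx; rewrite big_ord1.
  case: (d21_odd_lev0 px lx) => ->; rewrite [d21_char _]/= ffunE ?eqxx ?mul1r //.
  by rewrite s10 mulN1r d21_weight_s1.
(* The Cartan element of the first sl_2 factor alone realises any value of the weight of [s0]. *)
- move=> y; pose h : V := ([ffun k => if k == 0 then diag_mx (\row_i (if i == 0 then y 0 else - y 0)) else 0], 0).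
  have ht : h \in t0.
    apply/d21_t0E; split=> [//|k|k i j]; rewrite /= ffunE; case: ifP => _.
    - by rewrite mxtrace_diag big_ord2 !mxE addrN.
    - exact: mxtrace0.
    - exact: diag_mx_diagonal.
    by rewrite mxE eqxx.
  have h0 : d21_weight (inr s0) h = y 0.
    by rewrite (d21_weight_s0 ht) /= !ffunE !mxE /= mulr1n subr0 addr0.
  exists h => // x px lx; rewrite big_ord1 ord1.
  case: (d21_odd_lev0 px lx) => ->; rewrite [d21_char _]/= ffunE ?eqxx ?mul1r //.
  by rewrite s10 mulN1r (d21_weight_s1 ht) h0.
- move=> phi /d21_torusE[a [a0 phiE]]; exists (fun=> a 0 / a 1 * a 2).
    by move=> _; rewrite !mulf_neq0 ?invr_neq0.
  move=> x X px lx; rewrite big_ord1; have [_ X2] := phiE X.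
  case: (d21_odd_lev0 px lx) => ->; rewrite [d21_char _]/= ffunE ?eqxx [LHS]X2 prod3 !ffunE //=.
  by rewrite s10 exprN1 !invfM invrK.
move=> z z0; pose a (k : 'I_3) := if k == 0 then z 0 else 1.
have a0 k : a k != 0 by rewrite /a; case: ifP; rewrite ?oner_eq0.
pose d k := \row_(i < 2) (if i == 0 then a k else (a k)^-1).
exists (fun X : V => ([ffun k => diag_mx (d k) *m X.1 k *m invmx (diag_mx (d k))],
  [ffun s : I => (\prod_k d k 0 (s k)) * X.2 s]) : V); first by exists a.
move=> x X px lx; rewrite big_ord1.
case: (d21_odd_lev0 px lx) => ->; rewrite [d21_char _]/= ffunE ?eqxx /= ffunE prod3 !mxE !ffunE /= /a /=.
  by rewrite invr1 !mulr1.
by rewrite s10 exprN1 invr1 !mulr1.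
Qed.

Lemma D21_triangular : triangular g.
Proof. exact: coordinates_triangular charK d21_coordinates. Qed.

End D21Final.

(** * Conclusion for all types *)

Lemma classical_triangular (K : fieldType) (X : classical_type K) :
  (forall k, k.+1%:R != 0 :> K) -> admissible X -> triangular (classical X).
Proof.
move=> charK; case: X => [m n|m n|n|m n|m n|alpha|||n|n|n|n] /=.
- by move=> _; apply: gl_triangular.
- by case/andP => m0 _; apply: sl_triangular.
- by move=> n0; apply: psl_triangular.
- by move=> _; apply: osp_triangular.
- by move=> _; apply: osp_triangular.
- by move=> _; apply: D21_triangular.
- by move=> _; apply: G3_triangular.
- by move=> _; apply: F4_triangular.
- by move=> _; apply: q_triangular.
- by move=> n0; apply: psq_triangular.
- by move=> n1; apply: p_triangular => //; apply: ltnW.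
- by move=> _; apply: ptilde_triangular.
Qed.

Theorem theorem3p4p1 (R : realType) (X : classical_type R[i]) (hX : admissible X) :
  let g := classical X in
  (* (a) *)
  graded_isomorphic (cohomology (f_alg g)) (sym_dual R[i] (\dim (cf1 g))) /\
  (* (b) *)
  graded_iso (A := cohomology (b_alg g))
    (B := invariant_cohomology (f_alg g) (ctorus g)) (restriction_b_f g) /\
  graded_isomorphic (invariant_cohomology (f_alg g) (ctorus g))
    (cohomology (t_alg g)).
Proof.
have charK k : k.+1%:R != 0 :> R[i] by rewrite pnatr_eq0.
have trg := classical_triangular charK hX.
split; first exact: triangular_sym charK trg.
split; [exact: triangular_restriction charK trg | exact: triangular_invariant charK trg].
Qed.
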